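(* Let $H_{\mathbb R}$ be a real Hilbert space and $q\in(-1,1)$. The $C^*$-algebra $C^*_q(H_{\mathbb R})$ generated by all $q$-Gaussian operators is QWEP.
   Context: QWEP: a $C^*$-algebra $B$ has the weak expectation property (WEP) if the canonical inclusion $B\to B^{**}$ factorizes completely contractively through some $B(K)$, $K$ a Hilbert space. A $C^*$-algebra is QWEP if it is a quotient, by a closed (two-sided) ideal, of a $C^*$-algebra with the WEP. Let $H_{\mathbb C}$ be the complexification of $H_{\mathbb R}$. The $q$-Fock space $\mathcal F_q(H_{\mathbb C})=\mathbb C\Omega\oplus\bigoplus_{n\ge1}H_{\mathbb C}^{\otimes n}$ is the Hilbert space completion of the algebraic direct sum of algebraic tensor powers for the inner product $\langle h_1\otimes\dots\otimes h_n,g_1\otimes\dots\otimes g_m\rangle_q=\delta_{n,m}\sum_{\pi\in S_n}q^{\mathrm{inv}(\pi)}\prod_{i=1}^n\langle h_i,g_{\pi(i)}\rangle$, where $\mathrm{inv}(\pi)$ is the number of inversions of $\pi$. For $h\in H_{\mathbb C}$, $a^*(h)$ is the bounded operator with $a^*(h)\Omega=h$, $a^*(h)(h_1\otimes\dots\otimes h_n)=h\otimes h_1\otimes\dots\otimes h_n$, and $a(h)$ is its adjoint. For $f\in H_{\mathbb R}$, $G(f)=a^*(f)+a(f)$. $C_q^*(H_{\mathbb R})$ is the $C^*$-algebra generated by $\{G(f):f\in H_{\mathbb R}\}$ in $B(\mathcal F_q(H_{\mathbb C}))$. *)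

(* Defs.v *)
From HB Require Import structures.
From mathcomp Require Import all_boot all_order all_fingroup all_algebra.
From mathcomp Require Import all_classical all_reals all_analysis.
From mathcomp Require Import complex ring lra.

Set Implicit Arguments.
Unset Strict Implicit.
Unset Printing Implicit Defensive.
Import Order.TTheory GRing.Theory Num.Theory.
Import numFieldNormedType.Exports.

Local Open Scope classical_set_scope.
Local Open Scope ring_scope.
Local Open Scope complex_scope.

Section real_norm.
Variable R : realType.

Lemma RCM (x y : R) : (x * y)%:C = x%:C * y%:C.
Proof. exact: (rmorphM (real_complex R)). Qed.

Lemma RCD (x y : R) : (x + y)%:C = x%:C + y%:C.
Proof. exact: (rmorphD (real_complex R)). Qed.

Lemma RCV (x : R) : (x^-1)%:C = x%:C^-1.
Proof. exact: (fmorphV (real_complex R)). Qed.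

Lemma RCN1 : (-1 : R)%:C = -1.
Proof. exact: (rmorphN1 (real_complex R)). Qed.

(* The norm of a normed module over R[i] takes its values in R[i]. *)
Definition nrm (V : normedZmodType R[i]) (x : V) : R := complex.Re `|x|.

Lemma nrmE (V : normedZmodType R[i]) (x : V) : `|x| = (nrm x)%:C.
Proof. by rewrite /nrm RRe_real. Qed.

Lemma nrm_ge0 (V : normedZmodType R[i]) (x : V) : 0 <= nrm x.
Proof. by have := normr_ge0 x; rewrite nrmE lecR. Qed.

Lemma nrm0 (V : normedZmodType R[i]) : nrm (0 : V) = 0.
Proof. by rewrite /nrm normr0. Qed.

Lemma nrm_eq0 (V : normedZmodType R[i]) (x : V) : nrm x = 0 -> x = 0.
Proof. by move=> h; apply/eqP; rewrite -normr_eq0 nrmE h. Qed.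

Lemma nrmD (V : normedZmodType R[i]) (x y : V) : nrm (x + y) <= nrm x + nrm y.
Proof. by have := ler_normD x y; rewrite !nrmE -RCD lecR. Qed.

Lemma nrmB (V : normedZmodType R[i]) (x y : V) : nrm (x - y) = nrm (y - x).
Proof. by rewrite /nrm distrC. Qed.

Lemma nrmZ (V : normedModType R[i]) (a : R[i]) (x : V) :
  nrm (a *: x) = nrm a * nrm x.
Proof. by apply: (@complexI R); rewrite RCM -!nrmE normrZ. Qed.

End real_norm.

Section bounded_operators.
Variable R : realType.

Definition bounded_linear (U V : normedModType R[i]) : pred (U -> V) :=
  fun f => `[< linear f /\ exists M : R, forall x, nrm (f x) <= M * nrm x >].

Record bop (U V : normedModType R[i]) := Bop {
  bop_fun :> U -> V;
  bopP : bop_fun \in @bounded_linear U V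
}.

Section lmodule.
Variables U V : normedModType R[i].

HB.instance Definition _ := [isSub for @bop_fun U V].
HB.instance Definition _ := [Choice of bop U V by <:].

Lemma bounded_linear_submod : submod_closed (@bounded_linear U V).
Proof.
split.
  apply/asboolP; split; first by move=> a x y /=; rewrite scaler0 addr0.
  by exists 0 => x; rewrite nrm0 mul0r.
move=> a f g /asboolP[lf [M hM]] /asboolP[lg [N hN]].
apply/asboolP; split.
  move=> b x y; rewrite !fctE /= lf lg !scalerDr !scalerA.
  by rewrite [b * a]mulrC !addrA; congr (_ + _); rewrite addrAC.
exists (nrm a * M + N) => x.
apply: (le_trans (nrmD _ _)); rewrite mulrDl lerD//.
by rewrite nrmZ -mulrA ler_wpM2l ?nrm_ge0.
Qed.

HB.instance Definition _ :=
  GRing.isSubmodClosed.Build _ _ (@bounded_linear U V) bounded_linear_submod.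
HB.instance Definition _ := [SubChoice_isSubLmodule of bop U V by <:].

Lemma bop_linear (f : bop U V) : linear f.
Proof. by case: f => f /= /asboolP[]. Qed.

HB.instance Definition _ (f : bop U V) :=
  GRing.isLinear.Build _ _ _ _ (bop_fun f) (@bop_linear f).

Lemma bop_bounded (f : bop U V) : exists M : R, forall x, nrm (f x) <= M * nrm x.
Proof. by case: f => f /= /asboolP[]. Qed.

Lemma bopE (f g : bop U V) : f =1 g -> f = g.
Proof. by move=> fg; apply/val_inj/funext. Qed.

Definition opnorm (f : bop U V) : R :=
  sup [set nrm (f x) | x in [set x | nrm x <= 1]].

Lemma opnorm_has_sup (f : bop U V) :
  has_sup [set nrm (f x) | x in [set x | nrm x <= 1]].
Proof.
split; first by exists (nrm (f 0)); exists 0 => //=; rewrite nrm0.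
have [M hM] := bop_bounded f; exists `|M| => _ [x /= x1 <-].
apply: (le_trans (hM x)).
apply: (@le_trans _ _ (`|M| * nrm x)); first by rewrite ler_wpM2r ?nrm_ge0 ?ler_norm.
by rewrite ler_piMr.
Qed.

Lemma opnorm_ge0 (f : bop U V) : 0 <= opnorm f.
Proof.
apply: (ub_le_sup (opnorm_has_sup f).2); exists 0; rewrite /= ?nrm0//.
by rewrite linear0 nrm0.
Qed.

Lemma opnorm_le (f : bop U V) (x : U) : nrm (f x) <= opnorm f * nrm x.
Proof.
have [->|x0] := eqVneq x 0; first by rewrite linear0 !nrm0 mulr0.
have nx : 0 < nrm x.
  by rewrite lt_def nrm_ge0 andbT; apply: contra x0 => /eqP/nrm_eq0 ->.
rewrite -ler_pdivrMr// mulrC.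
have nv : nrm ((nrm x)^-1%:C : R[i]) = (nrm x)^-1.
  by rewrite /nrm ger0_norm ?lecR ?invr_ge0 ?ltW.
have -> : (nrm x)^-1 * nrm (f x) = nrm (f ((nrm x)^-1%:C *: x)).
  by rewrite linearZ nrmZ nv.
apply: (ub_le_sup (opnorm_has_sup f).2).
exists ((nrm x)^-1%:C *: x) => //=.
by rewrite nrmZ nv mulVf ?gt_eqF.
Qed.

Lemma opnorm_lub (f : bop U V) (M : R) : 0 <= M ->
  (forall x, nrm (f x) <= M * nrm x) -> opnorm f <= M.
Proof.
move=> M0 hM; apply: ge_sup; first exact: (opnorm_has_sup f).1.
move=> _ [x /= x1 <-]; apply: (le_trans (hM x)).
by rewrite ler_piMr.
Qed.

Let norm (f : bop U V) : R[i] := (opnorm f)%:C.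

Let normD f g : norm (f + g) <= norm f + norm g.
Proof.
rewrite /norm -RCD lecR; apply: opnorm_lub; first by rewrite addr_ge0 ?opnorm_ge0.
by move=> x; apply: (le_trans (nrmD _ _)); rewrite mulrDl lerD ?opnorm_le.
Qed.

Let opnormZ_le (a : R[i]) f : opnorm (a *: f) <= nrm a * opnorm f.
Proof.
apply: opnorm_lub; first by rewrite mulr_ge0 ?opnorm_ge0 ?nrm_ge0.
by move=> x; rewrite /= nrmZ -mulrA ler_wpM2l ?nrm_ge0 ?opnorm_le.
Qed.

Let normZ (a : R[i]) f : norm (a *: f) = `|a| * norm f.
Proof.
rewrite nrmE /norm -RCM; congr (_ %:C); apply/eqP; rewrite eq_le opnormZ_le/=.
have [->|a0] := eqVneq a 0; first by rewrite nrm0 mul0r opnorm_ge0.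
have na : 0 < nrm a.
  by rewrite lt_def nrm_ge0 andbT; apply: contra a0 => /eqP/nrm_eq0 ->.
have nV : nrm a^-1 = (nrm a)^-1.
  by apply: complexI; rewrite -nrmE normfV nrmE RCV.
rewrite -ler_pdivlMl// -nV; apply: le_trans (opnormZ_le _ _).
by rewrite scalerA mulVf// scale1r.
Qed.

Let norm0_eq0 f : norm f = 0 -> f = 0.
Proof.
move=> /complexI h; apply: bopE => x /=; apply: nrm_eq0.
by apply/eqP; rewrite eq_le nrm_ge0 andbT; have := opnorm_le f x; rewrite h mul0r.
Qed.

HB.instance Definition _ :=
  Lmodule_isNormed.Build R[i] (bop U V) normD normZ norm0_eq0.

Lemma nrm_bop (f : bop U V) : nrm f = opnorm f. Proof. by []. Qed.

End lmodule.
End bounded_operators.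

Section complete_operators.
Variable R : realType.

Lemma cvg_nrmP (T : Type) (F : set_system T) (FF : Filter F)
    (V : normedModType R[i]) (f : T -> V) (l : V) :
  f @ F --> l <-> forall e : R, 0 < e -> F [set t | nrm (l - f t) < e].
Proof.
split=> [/cvgrPdist_lt h e e0|h].
  have := h e%:C; rewrite ltcR => /(_ e0); apply: filterS => t /=.
  by rewrite nrmE ltcR.
apply/cvgrPdist_lt => e e0; have er : e = (complex.Re e)%:C.
  by rewrite RRe_real// gtr0_real.
have e0' : 0 < complex.Re e by rewrite er ltcR in e0.
have := h _ e0'; apply: filterS => t /=.
by rewrite nrmE er ltcR.
Qed.

Lemma cvg_nrm_le (T : Type) (F : set_system T) (FF : ProperFilter F)
    (V : normedModType R[i]) (f : T -> V) (l y : V) (c : R) :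
  f @ F --> l -> F [set t | nrm (y - f t) <= c] -> nrm (y - l) <= c.
Proof.
move=> /cvg_nrmP h hF; apply/ler_addgt0Pr => e e0.
have [t [/= h1 h2]] := filter_ex (filterI (h e e0) hF).
have -> : y - l = (y - f t) + (f t - l) by rewrite addrA subrK.
by apply: (le_trans (nrmD _ _)); rewrite lerD// nrmB ltW.
Qed.

Lemma cauchy_nrmP (V : normedModType R[i]) (F : set_system V) (FF : ProperFilter F) :
  cauchy F <-> forall e : R, 0 < e -> exists y, F [set x | nrm (y - x) < e].
Proof.
split=> [/cauchyP h e e0|h].
  have := h e%:C; rewrite ltcR => /(_ e0)[y hy]; exists y.
  apply: filterS hy => x; rewrite -ball_normE /=.
  by rewrite nrmE ltcR.
apply/cauchyP => e e0; have er : e = (complex.Re e)%:C.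
  by rewrite RRe_real// gtr0_real.
have e0' : 0 < complex.Re e by rewrite er ltcR in e0.
have [y hy] := h _ e0'; exists y; apply: filterS hy => x.
by rewrite -ball_normE /= nrmE er ltcR.
Qed.

Variables (U : normedModType R[i]) (V : completeNormedModType R[i]).

Lemma bop_complete (F : set_system (bop U V)) :
  ProperFilter F -> cauchy F -> cvg F.
Proof.
move=> FF /cauchy_nrmP cF.
have cx x : cvg ((fun f : bop U V => f x) @ F).
  apply: cauchy_cvg; apply/cauchy_nrmP => e e0.
  have d0 : 0 < e / (nrm x + 1) by rewrite divr_gt0// ltr_wpDl ?nrm_ge0.
  have [g hg] := cF _ d0; exists (g x); apply: (@filterS _ F _ _ _ _ hg) => f /= fg.
  have -> : g x - f x = (g - f) x by [].
  apply: (le_lt_trans (opnorm_le _ _)).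
  apply: (@le_lt_trans _ _ (e / (nrm x + 1) * nrm x)).
    by rewrite ler_wpM2r ?nrm_ge0// ltW.
  by rewrite mulrAC ltr_pdivrMr ?ltr_pM2l ?ltrDl ?ltr_wpDl ?nrm_ge0.
pose T x : V := lim ((fun f : bop U V => f x) @ F).
have TP x : (fun f : bop U V => f x) @ F --> T x by exact: cx.
have key (g : bop U V) (c : R) : F [set f | nrm (g - f) < c] ->
    forall x, nrm (g x - T x) <= c * nrm x.
  move=> hg x; apply: (cvg_nrm_le _ (TP x)); apply: filterS hg => f /= fg.
  have -> : g x - f x = (g - f) x by [].
  apply: (le_trans (opnorm_le _ _)).
  by rewrite ler_wpM2r ?nrm_ge0// ltW.
have Tb : T \in @bounded_linear R U V.
  apply/asboolP; split.
    move=> a x y; have h : (fun f : bop U V => a *: f x + f y) @ F -->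
        a *: T x + T y by apply: cvgD (TP y); apply: cvgZr; exact: TP.
    apply: (cvg_unique _ _ h) => //.
    have -> : (fun f : bop U V => a *: f x + f y) =
       (fun f : bop U V => f (a *: x + y)).
      by apply/funext => f; rewrite linearP.
    exact: TP.
  have [g hg] := cF 1 ltr01; exists (1 + opnorm g) => x.
  have -> : T x = (T x - g x) + g x by rewrite subrK.
  apply: (le_trans (nrmD _ _)); rewrite mulrDl lerD ?opnorm_le//.
  by rewrite nrmB; exact: key.
apply/cvg_ex; exists (Bop Tb); apply/cvg_nrmP => e e0.
have e20 : 0 < e / 2 by rewrite divr_gt0.
have [g hg] := cF _ e20; apply: filterS (hg) => f /= fg.
have -> : Bop Tb - f = (Bop Tb - g) + (g - f) by rewrite addrA subrK.
apply: (le_lt_trans (nrmD _ _)).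
rewrite [ltRHS](splitr e) ler_ltD//; apply: opnorm_lub; first exact: ltW.
by move=> x /=; rewrite nrmB; exact: key.
Qed.

HB.instance Definition _ := Uniform_isComplete.Build (bop U V) bop_complete.

End complete_operators.

HB.mixin Record isHilbert (K : numFieldType) (theta : K -> K) V
    & CompleteNormedModule K V := {
  inner : {dot V for theta};
  inner_norm : forall x : V, `|x| ^+ 2 = inner x x
}.
HB.structure Definition Hilbert (K : numFieldType) (theta : K -> K) :=
  {V of isHilbert K theta V & CompleteNormedModule K V}.

Notation realHilbertType R := (@Hilbert.type R idfun).
Notation complexHilbertType R := (@Hilbert.type R[i] Num.conj).

Section riesz.
Variables (R : realType) (H : complexHilbertType R).
Implicit Types x y z : H.

Let r x y : R := complex.Re (inner x y).

Let ReD (a b : R[i]) : complex.Re (a + b) = complex.Re a + complex.Re b.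
Proof. by case: a b => [? ?] [? ?]. Qed.

Let ReN (a : R[i]) : complex.Re (- a) = - complex.Re a.
Proof. by case: a. Qed.

Let ReM (t : R) (a : R[i]) : complex.Re (t%:C * a) = t * complex.Re a.
Proof. by case: a => a b /=; rewrite mul0r subr0. Qed.

Let inner_sym x y : inner x y = (inner y x)^*%R.
Proof. by rewrite (hermC (@inner _ _ H)) expr0 mul1r. Qed.

Let ReC (a : R[i]) : complex.Re (a^*%R) = complex.Re a.
Proof. by case: a. Qed.

Let r_sym x y : r x y = r y x.
Proof. by rewrite /r inner_sym ReC. Qed.

Let rDl x y z : r (x + y) z = r x z + r y z.
Proof. by rewrite /r linearDl ReD. Qed.

Let rZl (t : R) x y : r (t%:C *: x) y = t * r x y.
Proof. by rewrite /r linearZl_LR ReM. Qed.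

Let rDr x y z : r z (x + y) = r z x + r z y.
Proof. by rewrite r_sym rDl !(r_sym z). Qed.

Let rZr (t : R) x y : r x (t%:C *: y) = t * r x y.
Proof. by rewrite r_sym rZl r_sym. Qed.

Let r_nrm x : r x x = nrm x ^+ 2.
Proof. by rewrite /r -inner_norm nrmE -(rmorphXn (real_complex R)). Qed.

Let nrmDsq x y : nrm (x + y) ^+ 2 = nrm x ^+ 2 + 2 * r x y + nrm y ^+ 2.
Proof. by rewrite -!r_nrm rDl !rDr (r_sym y x); ring. Qed.

Let nrmZr (t : R) x : nrm (t%:C *: x) ^+ 2 = t ^+ 2 * nrm x ^+ 2.
Proof. by rewrite -!r_nrm rZl rZr mulrA. Qed.

Let r_le x y : r x y <= nrm x * nrm y.
Proof.
have := nrmD x y; rewrite -(@ler_pXn2r _ 2)// ?nnegrE ?addr_ge0 ?nrm_ge0//.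
by rewrite nrmDsq sqrrD; lra.
Qed.

Lemma re_inner_le x y : complex.Re (inner x y) <= nrm x * nrm y.
Proof. exact: r_le. Qed.

Lemma inner_bounded x y : nrm (inner x y) <= 2 * (nrm x * nrm y).
Proof.
have rN : - r x y <= nrm x * nrm y.
  have -> : - r x y = r (- x) y.
    by rewrite (_ : - x = (-1)%:C *: x) ?rZl ?mulN1r// RCN1 scaleN1r.
  by apply: (le_trans (r_le _ _)); rewrite /nrm normrN.
have i1 : nrm ('i : R[i]) = 1 by rewrite /nrm normc_def /= expr0n expr1n add0r sqrtr1.
have iE (a : R[i]) : complex.Re ('i * a) = - complex.Im a.
  by case: a => a b /=; rewrite mul0r mul1r add0r.
have iI : `|complex.Im (inner x y)| <= nrm x * nrm y.
  rewrite ler_norml; apply/andP; split.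
    rewrite -[leRHS]opprK -iE -linearZl_LR lerN2.
    by apply: (le_trans (r_le _ _)); rewrite nrmZ i1 mul1r.
  rewrite -[leLHS]opprK -iE -linearZl_LR -ReN -linearNl.
  by apply: (le_trans (r_le _ _)); rewrite -scalerN nrmZ i1 mul1r /nrm normrN.
have iR : `|complex.Re (inner x y)| <= nrm x * nrm y.
  by rewrite ler_norml lerNl rN r_le.
have : nrm (inner x y) <= `|complex.Re (inner x y)| + `|complex.Im (inner x y)|.
  case: (inner x y) => a b; rewrite /nrm normc_def /=.
  rewrite -[leRHS]ger0_norm ?addr_ge0 ?normr_ge0// -sqrtr_sqr ler_sqrt ?sqr_ge0//.
  rewrite sqrrD !real_normK ?num_real// lerD2r lerDl.
  by rewrite mulrn_wge0// mulr_ge0.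
lra.
Qed.

Theorem riesz (phi : H -> R[i]) (M : R) :
  (forall (a : R[i]) x y, phi (a *: x + y) = a * phi x + phi y) ->
  (forall x, nrm (phi x) <= M * nrm x) ->
  exists y, forall x, phi x = inner x y.
Proof.
move=> lphi bphi.
have phi0 : phi 0 = 0.
  by have := lphi (-1) 0 0; rewrite scaler0 add0r mulN1r addNr.
have phiZ (a : R[i]) x : phi (a *: x) = a * phi x.
  by have := lphi a x 0; rewrite phi0 !addr0.
have phiD x y : phi (x + y) = phi x + phi y.
  by have := lphi 1 x y; rewrite scale1r mul1r.
pose J x : R := nrm x ^+ 2 - 2 * complex.Re (phi x).
have Rephi x : complex.Re (phi x) <= M * nrm x.
  apply: le_trans (bphi x); apply: (le_trans (ler_norm _)).
  by have := normc_ge_Re (phi x); rewrite nrmE lecR.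
have Jlb x : - M ^+ 2 <= J x.
  by have := Rephi x; have := sqr_ge0 (nrm x - M); rewrite /J sqrrB; lra.
have hJ : has_inf (range J).
  by split; [exists (J 0), 0|exists (- M ^+ 2) => _ [x _ <-]].
pose m := inf (range J).
have mJ x : m <= J x by apply: (ge_inf hJ.2); exists x.
have JD (t : R) x y : J (y + t%:C *: x) =
    J y + t ^+ 2 * nrm x ^+ 2 + 2 * t * (r x y - complex.Re (phi x)).
  rewrite /J nrmDsq rZr nrmZr phiD phiZ ReD ReM (r_sym y x); ring.
have JB x y : nrm (x - y) ^+ 2 <= 2 * (J x - m) + 2 * (J y - m).
  have -> : x - y = x + (-1)%:C *: y by rewrite RCN1 scaleN1r.
  rewrite nrmDsq nrmZr rZr.
  have := mJ (2^-1%:C *: (x + y)).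
  rewrite {1}/J nrmZr nrmDsq phiZ ReM phiD ReD /J => h.
  have e : (2^-1 : R) ^+ 2 = 4^-1 by rewrite exprVn; congr (_^-1); ring.
  rewrite e in h; move: h; lra.
have near_inf (e : R) : 0 < e -> exists x, J x < m + e.
  by move=> e0; have [_ [x _ <-] h] := inf_adherent e0 hJ; exists x.
have inv_gt0 (n : nat) : 0 < n.+1%:R^-1 :> R by rewrite invr_gt0.
have [u hu] := boolp.choice (fun n : nat =>
  near_inf n.+1%:R^-1 (inv_gt0 n)).
have cu : cvg (u @ \oo).
  apply: cauchy_cvg; apply/cauchy_nrmP => e e0.
  have d0 : 0 < e ^+ 2 / 4 by rewrite divr_gt0 ?exprn_gt0.
  have [N _ hN] : \forall n \near \oo, n.+1%:R^-1 < e ^+ 2 / 4 :> R.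
    exact: near_infty_natSinv_lt (PosNum d0).
  exists (u N); exists N => // n /= Nn.
  rewrite -(@ltr_pXn2r _ 2)// ?nnegrE ?nrm_ge0 ?ltW//.
  apply: (le_lt_trans (JB _ _)).
  have := hN N (leqnn N); have := hN n Nn; have := hu N; have := hu n => /=.
  move: (J (u n)) (J (u N)) (n.+1%:R^-1) (N.+1%:R^-1) => a b c d; lra.
pose y := lim (u @ \oo).
have key x (t d : R) : 0 < d ->
    - d <= t ^+ 2 * nrm x ^+ 2 + 2 * t * (r x y - complex.Re (phi x)).
  move=> d0.
  pose c := 1 + 2 * `|t| * nrm x.
  have c0 : 0 < c by rewrite ltr_wpDr// !mulr_ge0 ?nrm_ge0.
  have e0 : 0 < d / (2 * c) by rewrite divr_gt0// mulr_gt0.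
  have d20 : 0 < d / 2 by rewrite divr_gt0.
  have /cvg_nrmP/(_ _ e0)[N1 _ hN1] : u @ \oo --> y by exact: cu.
  have [N2 _ hN2] : \forall n \near \oo, n.+1%:R^-1 < d / 2 :> R.
    exact: near_infty_natSinv_lt (PosNum d20).
  pose n := maxn N1 N2.
  have h1 := hN1 n (leq_maxl _ _); have h2 := hN2 n (leq_maxr _ _).
  have := mJ (u n + t%:C *: x); rewrite JD; have := hu n.
  have {}h2 : n.+1%:R^-1 < d / 2 by exact: h2.
  have h3 : - (2 * t * (r x y - r x (u n))) <= d / 2.
    have -> : - (2 * t * (r x y - r x (u n))) = r ((- 2 * t)%:C *: x) (y + (-1)%:C *: u n).
      by rewrite rZl rDr rZr; ring.
    apply: (le_trans (r_le _ _)); rewrite nrmZ.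
    have -> : nrm ((- 2 * t)%:C : R[i]) = 2 * `|t|.
      rewrite /nrm normc_def /= expr0n addr0 sqrtr_sqr normrM normrN.
      by rewrite (ger0_norm (ler0n _ 2)).
    have -> : y + (-1)%:C *: u n = y - u n by rewrite RCN1 scaleN1r.
    apply: (@le_trans _ _ (2 * `|t| * nrm x * (d / (2 * c)))).
      by rewrite ler_wpM2l ?mulr_ge0 ?nrm_ge0// ltW.
    rewrite (_ : d / 2 = c * (d / (2 * c))); last by field; rewrite gt_eqF.
    by apply: ler_wpM2r; [exact: ltW | rewrite /c lerDr].
  move: h2 h3; move: (J (u n)) (n.+1%:R^-1) (r x y) (r x (u n)) => a0 b0 z0 z1.
  move: (complex.Re _) (nrm x ^+ 2) => p0 n0; lra.
have re_eq x : complex.Re (phi x) = r x y.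
  pose b := r x y - complex.Re (phi x).
  suff : b = 0 by move/eqP; rewrite subr_eq0 => /eqP.
  pose A := nrm x ^+ 2.
  have A0 : 0 <= A by rewrite sqr_ge0.
  have h (t : R) : 0 <= t ^+ 2 * A + 2 * t * b.
    apply/ler_addgt0Pr => e e0; have := key x t e e0; rewrite -/A -/b; lra.
  have A1 : 0 < A + 1 by rewrite ltr_wpDl.
  have := h (- b / (A + 1)).
  have -> : (- b / (A + 1)) ^+ 2 * A + 2 * (- b / (A + 1)) * b =
      - (b ^+ 2 * ((A + 2) / (A + 1) ^+ 2)) by field; rewrite gt_eqF.
  rewrite oppr_ge0 pmulr_lle0 => [|]; last by rewrite divr_gt0 ?exprn_gt0 ?ltr_wpDl.
  by move=> hb; apply/eqP; rewrite -sqrf_eq0 eq_le hb sqr_ge0.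
exists y => x.
have iE (a : R[i]) : complex.Re ('i * a) = - complex.Im a.
  by case: a => a b /=; rewrite mul0r mul1r add0r.
have im_eq : complex.Im (phi x) = complex.Im (inner x y).
  by apply: oppr_inj; rewrite -!iE -phiZ re_eq /r linearZl_LR.
have := re_eq x; rewrite /r; move: im_eq.
by case: (phi x) => a b; case: (inner x y) => a' b' /= -> ->.
Qed.

End riesz.

HB.mixin Record isStarAlgebra (R : realType) A & GRing.Lmodule R[i] A := {
  smul : A -> A -> A;
  star : A -> A;
  smulA : associative smul;
  smulDl : left_distributive smul +%R;
  smulDr : right_distributive smul +%R;
  smulZl : forall (a : R[i]) (x y : A), smul (a *: x) y = a *: smul x y;
  smulZr : forall (a : R[i]) (x y : A), smul x (a *: y) = a *: smul x y;
  starK : involutive star;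
  starD : forall x y : A, star (x + y) = star x + star y;
  starZ : forall (a : R[i]) (x : A), star (a *: x) = a^* *: star x;
  starM : forall x y : A, star (smul x y) = smul (star y) (star x)
}.
(* Not necessarily unital complex *-algebras. *)
#[short(type="starAlgType")]
HB.structure Definition StarAlgebra (R : realType) :=
  {A of isStarAlgebra R A & GRing.Lmodule R[i] A}.

HB.mixin Record StarAlgebra_isCstar (R : realType) A
    & StarAlgebra R A & CompleteNormedModule R[i] A := {
  norm_smul : forall x y : A, `|smul x y| <= `|x| * `|y|;
  norm_starM : forall x : A, `|smul (star x) x| = `|x| ^+ 2
}.
#[short(type="cstarAlgType")]
HB.structure Definition CstarAlgebra (R : realType) :=
  {A of StarAlgebra_isCstar R A & StarAlgebra R A
      & CompleteNormedModule R[i] A}.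

Section scalars.
Variable R : realType.

HB.instance Definition _ := @isStarAlgebra.Build R R[i]^o
  *%R (@conjc R) (@mulrA _) (@mulrDl _) (@mulrDr _)
  (fun a x y => esym (mulrA a x y)) (fun a x y => mulrCA x a y)
  (@conjcK R) (rmorphD (@conjc R)) (rmorphM (@conjc R))
  (fun x y => etrans (rmorphM (@conjc R) x y) (mulrC _ _)).

End scalars.

Section bounded_operators_on_a_hilbert_space.
Variables (R : realType) (H : complexHilbertType R).

Definition bounded_op := bop H H.

HB.instance Definition _ := CompleteNormedModule.on bounded_op.

Implicit Types T S : bounded_op.

Fact comp_bounded T S : T \o S \in @bounded_linear R H H.
Proof.
apply/asboolP; split; first by move=> a x y /=; rewrite !linearP.
exists (opnorm T * opnorm S) => x /=; apply: (le_trans (opnorm_le _ _)).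
by rewrite -mulrA ler_wpM2l ?opnorm_ge0 ?opnorm_le.
Qed.

Definition comp_op T S : bounded_op := Bop (comp_bounded T S).

Fact ex_adjoint T : exists S : bounded_op, forall x y, inner (T x) y = inner x (S y).
Proof.
have hz (y : H) : exists z : H, forall x : H, inner (T x) y = inner x z.
  apply: (@riesz R H (fun x => inner (T x) y) (2 * (opnorm T * nrm y))).
    by move=> a x z; rewrite linearP linearDl linearZl_LR.
  move=> x; apply: (le_trans (inner_bounded _ _)).
  rewrite -mulrA ler_wpM2l// [leRHS]mulrAC ler_wpM2r ?nrm_ge0//.
  exact: opnorm_le.
have [S hS] := boolp.choice hz.
have innerI (x y : H) : (forall z : H, inner z x = inner z y) -> x = y.
  move=> h; apply/eqP; rewrite -subr_eq0 -normr_eq0 -sqrf_eq0 inner_norm.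
  by rewrite linearBr /= h subrr.
suff Sb : S \in @bounded_linear R H H by exists (Bop Sb).
apply/asboolP; split.
  move=> a x y; apply: innerI => z.
  by rewrite [RHS]linearDr linearZr /= -!hS linearDr linearZr /=.
exists (2 * opnorm T) => y.
have [->|y0] := eqVneq (nrm (S y)) 0; first by rewrite !mulr_ge0 ?opnorm_ge0 ?nrm_ge0.
have p : 0 < nrm (S y) by rewrite lt_def y0 nrm_ge0.
rewrite -(ler_pM2l p) -expr2.
have -> : nrm (S y) ^+ 2 = nrm (inner (T (S y)) y).
  rewrite hS -inner_norm nrmE /nrm.
  by rewrite -(rmorphXn (real_complex R)) ger0_norm ?lecR ?sqr_ge0.
apply: (le_trans (inner_bounded _ _)).
have := opnorm_le T (S y); have := nrm_ge0 y.
nra.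
Qed.

Definition adjoint T : bounded_op := projT1 (cid (ex_adjoint T)).

Lemma adjointP T (x y : H) : inner (T x) y = inner x (adjoint T y).
Proof. by rewrite /adjoint; case: cid. Qed.

Let innerI (x y : H) : (forall z : H, inner z x = inner z y) -> x = y.
Proof.
move=> h; apply/eqP; rewrite -subr_eq0 -normr_eq0 -sqrf_eq0 inner_norm.
by rewrite linearBr /= h subrr.
Qed.

Let inner_sym (x y : H) : inner x y = (inner y x)^*%R.
Proof. by rewrite (hermC (@inner _ _ H)) expr0 mul1r. Qed.

Lemma adjoint_unique T S :
  (forall x y, inner (T x) y = inner x (S y)) -> adjoint T = S.
Proof. by move=> h; apply: bopE => y; apply: innerI => x; rewrite -adjointP h. Qed.

Let compDl : left_distributive comp_op +%R.
Proof. by move=> T S U; apply: bopE. Qed.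

Let compDr : right_distributive comp_op +%R.
Proof. by move=> T S U; apply: bopE => x /=; rewrite linearD. Qed.

Let compZl (a : R[i]) T S : comp_op (a *: T) S = a *: comp_op T S.
Proof. exact: bopE. Qed.

Let compZr (a : R[i]) T S : comp_op T (a *: S) = a *: comp_op T S.
Proof. by apply: bopE => x /=; rewrite linearZ. Qed.

Let compA : associative comp_op.
Proof. by move=> T S U; apply: bopE. Qed.

Let adjointK : involutive adjoint.
Proof.
move=> T; apply: adjoint_unique => x y.
by rewrite inner_sym -adjointP -inner_sym.
Qed.

Let adjointD T S : adjoint (T + S) = adjoint T + adjoint S.
Proof.
by apply: adjoint_unique => x y; rewrite /= linearDl /= !adjointP linearDr.
Qed.

Let adjointZ (a : R[i]) T : adjoint (a *: T) = a^* *: adjoint T.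
Proof.
apply: adjoint_unique => x y /=.
by rewrite linearZl_LR /= adjointP linearZr /= [_^*%R](conjcK a).
Qed.

Let adjointM T S : adjoint (comp_op T S) = comp_op (adjoint S) (adjoint T).
Proof. by apply: adjoint_unique => x y /=; rewrite !adjointP. Qed.

HB.instance Definition _ := @isStarAlgebra.Build R bounded_op comp_op adjoint
  compA compDl compDr compZl compZr adjointK adjointD adjointZ adjointM.

Let comp_norm T S : `|comp_op T S| <= `|T| * `|S|.
Proof.
rewrite !nrmE -RCM lecR; apply: opnorm_lub; first by rewrite mulr_ge0 ?nrm_ge0.
move=> x /=; apply: (le_trans (opnorm_le T (S x))).
by rewrite -mulrA ler_wpM2l ?opnorm_ge0 ?opnorm_le.
Qed.

Let nrm2E (x : H) : nrm x ^+ 2 = complex.Re (inner x x).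
Proof. by rewrite -inner_norm nrmE -(rmorphXn (real_complex R)). Qed.

Let nrm_adjoint T : nrm (adjoint T) <= nrm T.
Proof.
apply: opnorm_lub; first exact: nrm_ge0.
move=> x; have [->|y0] := eqVneq (nrm (adjoint T x)) 0.
  by rewrite mulr_ge0 ?nrm_ge0.
have p : 0 < nrm (adjoint T x) by rewrite lt_def y0 nrm_ge0.
rewrite -(ler_pM2l p) -expr2 nrm2E -adjointP.
apply: (le_trans (re_inner_le _ _)).
by rewrite mulrCA mulrA ler_wpM2r ?nrm_ge0 ?opnorm_le.
Qed.

Let comp_normS T : `|comp_op (adjoint T) T| = `|T| ^+ 2.
Proof.
rewrite !nrmE -(rmorphXn (real_complex R)); congr (_%:C).
apply/eqP; rewrite eq_le; apply/andP; split.
  have := comp_norm (adjoint T) T; rewrite !nrmE -RCM lecR => /le_trans; apply.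
  by rewrite expr2 ler_wpM2r ?nrm_ge0 ?nrm_adjoint.
set c := nrm (comp_op _ _).
have c0 : 0 <= c by exact: nrm_ge0.
rewrite -[leRHS]sqr_sqrtr// ler_pXn2r ?nnegrE ?nrm_ge0 ?sqrtr_ge0//.
apply: opnorm_lub; first exact: sqrtr_ge0.
move=> x; rewrite -(@ler_pXn2r _ 2) ?nnegrE ?mulr_ge0 ?nrm_ge0 ?sqrtr_ge0//.
rewrite exprMn sqr_sqrtr// nrm2E adjointP.
apply: (le_trans (re_inner_le _ _)).
by rewrite mulrC expr2 mulrA ler_wpM2r ?nrm_ge0// (opnorm_le (comp_op _ _)).
Qed.

HB.instance Definition _ :=
  StarAlgebra_isCstar.Build R bounded_op comp_norm comp_normS.

End bounded_operators_on_a_hilbert_space.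

Section subalgebras.
Variables (R : realType) (A : cstarAlgType R).

(* The unit is not required, so cstar_gen X below is the smallest norm-closed
   *-subalgebra containing X, unital or not. *)
Definition cstar_subalgebra (B : set A) :=
  [/\ B 0, forall (a : R[i]) x y, B x -> B y -> B (a *: x + y),
      forall x y, B x -> B y -> B (smul x y),
      forall x, B x -> B (star x) & closed B].

Definition in_cstar_gen (X : set A) : pred A :=
  fun x => `[< smallest cstar_subalgebra X x >].

Record cstar_gen (X : set A) := CstarGen {
  cstar_gen_val : A;
  cstar_gen_valP : cstar_gen_val \in in_cstar_gen X
}.

Variable X : set A.

HB.instance Definition _ := [isSub for @cstar_gen_val X].
HB.instance Definition _ := [Choice of cstar_gen X by <:].

Fact cstar_gen_submod : submod_closed (in_cstar_gen X).
Proof.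
split; first by apply/asboolP => B [[]].
move=> a x y /asboolP hx /asboolP hy; apply/asboolP => B PB; have [[B0 BD BM BS BC] XB] := PB.
by apply: BD; [exact: hx|exact: hy].
Qed.

HB.instance Definition _ :=
  GRing.isSubmodClosed.Build _ _ (in_cstar_gen X) cstar_gen_submod.
HB.instance Definition _ := [SubChoice_isSubLmodule of cstar_gen X by <:].

Fact cstar_gen_smul (x y : cstar_gen X) :
  smul (val x) (val y) \in in_cstar_gen X.
Proof.
apply/asboolP => B PB; have [[B0 BD BM BS BC] XB] := PB.
by apply: BM; [have /asboolP/(_ B PB) := valP x|have /asboolP/(_ B PB) := valP y].
Qed.

Fact cstar_gen_star (x : cstar_gen X) : star (val x) \in in_cstar_gen X.
Proof.
apply/asboolP => B PB; have [[B0 BD BM BS BC] XB] := PB.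
by apply: BS; have /asboolP/(_ B PB) := valP x.
Qed.

Let mul (x y : cstar_gen X) : cstar_gen X := CstarGen (cstar_gen_smul x y).
Let st (x : cstar_gen X) : cstar_gen X := CstarGen (cstar_gen_star x).

Let mulA : associative mul.
Proof. by move=> x y z; apply: val_inj; exact: smulA. Qed.
Let mulDl : left_distributive mul +%R.
Proof. by move=> x y z; apply: val_inj; exact: smulDl. Qed.
Let mulDr : right_distributive mul +%R.
Proof. by move=> x y z; apply: val_inj; exact: smulDr. Qed.
Let mulZl (a : R[i]) x y : mul (a *: x) y = a *: mul x y.
Proof. by apply: val_inj; exact: smulZl. Qed.
Let mulZr (a : R[i]) x y : mul x (a *: y) = a *: mul x y.
Proof. by apply: val_inj; exact: smulZr. Qed.
Let stK : involutive st.
Proof. by move=> x; apply: val_inj; exact: starK. Qed.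
Let stD x y : st (x + y) = st x + st y.
Proof. by apply: val_inj; exact: starD. Qed.
Let stZ (a : R[i]) x : st (a *: x) = a^* *: st x.
Proof. by apply: val_inj; exact: starZ. Qed.
Let stM x y : st (mul x y) = mul (st y) (st x).
Proof. by apply: val_inj; exact: starM. Qed.

HB.instance Definition _ := @isStarAlgebra.Build R (cstar_gen X)
  mul st mulA mulDl mulDr mulZl mulZr stK stD stZ stM.

Let norm (x : cstar_gen X) : R[i] := `|val x|.

Let normD x y : norm (x + y) <= norm x + norm y.
Proof. exact: ler_normD. Qed.
Let normZ (a : R[i]) x : norm (a *: x) = `|a| * norm x.
Proof. exact: normrZ. Qed.
Let norm0_eq0 x : norm x = 0 -> x = 0.
Proof. by move/normr0_eq0 => h; apply: val_inj. Qed.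

HB.instance Definition _ :=
  Lmodule_isNormed.Build R[i] (cstar_gen X) normD normZ norm0_eq0.

Let gen_complete (F : set_system (cstar_gen X)) :
  ProperFilter F -> cauchy F -> cvg F.
Proof.
move=> FF /cauchy_nrmP cF.
have : cvg ((val : cstar_gen X -> A) @ F).
  apply: cauchy_cvg; apply/cauchy_nrmP => e e0.
  by have [y hy] := cF e e0; exists (val y).
move=> /cvg_ex[l hl].
have lX : l \in in_cstar_gen X.
  apply/asboolP => B BX; have [[B0 BD BM BS BC] XB] := BX.
  apply: (@closed_cvg _ _ F _ val B BC _ l hl); apply: nearW => x.
  by have /asboolP/(_ B BX) := valP x.
apply/cvg_ex; exists (CstarGen lX); apply/cvg_nrmP => e e0.
by have /cvg_nrmP/(_ e e0) := hl.
Qed.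

HB.instance Definition _ := Uniform_isComplete.Build (cstar_gen X) gen_complete.

Let normM (x y : cstar_gen X) : `|smul x y| <= `|x| * `|y|.
Proof. exact: (norm_smul (val x) (val y)). Qed.
Let normS (x : cstar_gen X) : `|smul (star x) x| = `|x| ^+ 2.
Proof. exact: (norm_starM (val x)). Qed.

HB.instance Definition _ :=
  StarAlgebra_isCstar.Build R (cstar_gen X) normM normS.

End subalgebras.

Section matrix_norms.
Variable R : realType.

Definition mx_smul (A : starAlgType R) n (x y : 'M[A]_n) : 'M[A]_n :=
  \matrix_(i, k) \sum_j smul (x i j) (y j k).

Definition mx_star (A : starAlgType R) n (x : 'M[A]_n) : 'M[A]_n :=
  \matrix_(i, j) star (x j i).

Definition is_cstar_mxnorm (A : starAlgType R) n (N : 'M[A]_n -> R) :=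
  [/\ forall x, N x = 0 -> x = 0,
      forall x y, N (x + y) <= N x + N y,
      forall (a : R[i]) x, N (map_mx ( *:%R a) x) = nrm a * N x,
      forall x y, N (mx_smul x y) <= N x * N y
    & forall x, N (mx_smul (mx_star x) x) = N x ^+ 2].

(* When A is a C*-algebra, the *-algebra M_n(A) carries exactly one C*-norm;
   it is automatically complete. *)
Definition cstar_mxnorm (A : starAlgType R) n : 'M[A]_n -> R :=
  get (@is_cstar_mxnorm A n).

(* A family of norms on the spaces M_n(X), as in an operator space. *)
Definition mxnorms (X : Type) := forall n, 'M[X]_n -> \bar R.

Definition cstar_mxnorms (A : starAlgType R) : mxnorms A :=
  fun n x => (cstar_mxnorm x)%:E.

Definition completely_contractive (X Y : Type)
    (NX : mxnorms X) (NY : mxnorms Y) (f : X -> Y) :=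
  forall n (x : 'M[X]_n), (NY n (map_mx f x) <= NX n x)%E.

Definition dual_space (X : normedModType R[i]) := bop X R[i]^o.

HB.instance Definition _ (X : normedModType R[i]) :=
  NormedModule.on (dual_space X).

(* The operator space dual: M_n(X^* ) is identified with the completely bounded
   maps X -> M_n(C), with the completely bounded norm; the scalar matrices
   M_n(M_m(C)) = M_(nm)(C) carry their C*-norm. *)
Definition dual_mxnorms (X : normedModType R[i]) (NX : mxnorms X) :
    mxnorms (dual_space X) :=
  fun n f => ereal_sup
    [set t | exists m (x : 'M[X]_m), (NX m x <= 1)%E /\
       t = (cstar_mxnorm (\mxblock_(i < n, j < n) map_mx (f i j) x
                          : 'M[R[i]^o]_(\sum_(i < n) m)))%:E].

Definition bidual_space (X : normedModType R[i]) := dual_space (dual_space X).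

HB.instance Definition _ (X : normedModType R[i]) :=
  NormedModule.on (bidual_space X).

Fact eval_bounded (X : normedModType R[i]) (x : X) :
  (fun f : dual_space X => f x : R[i]^o) \in @bounded_linear R (dual_space X) R[i]^o.
Proof.
apply/asboolP; split=> //; exists (nrm x) => f.
by rewrite mulrC; exact: opnorm_le.
Qed.

Definition to_bidual (X : normedModType R[i]) (x : X) : bidual_space X :=
  Bop (eval_bounded x).

End matrix_norms.

Section qwep.
Variable R : realType.

Definition WEP (B : cstarAlgType R) :=
  exists (K : complexHilbertType R) (u : {linear B -> bounded_op K})
         (v : {linear bounded_op K -> bidual_space B}),
    [/\ completely_contractive (@cstar_mxnorms R B)
          (@cstar_mxnorms R (bounded_op K)) u,
        completely_contractive (@cstar_mxnorms R (bounded_op K))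
          (dual_mxnorms (dual_mxnorms (@cstar_mxnorms R B))) v
      & forall b, v (u b) = to_bidual b].

Definition closed_ideal (B : cstarAlgType R) (J : set B) :=
  [/\ J 0, forall (a : R[i]) x y, J x -> J y -> J (a *: x + y),
      forall b x, J x -> J (smul b x) /\ J (smul x b) & closed J].

(* A is the quotient of B by J, up to *-isomorphism, with quotient map p. *)
Definition quotient_map (B A : cstarAlgType R) (J : set B)
    (p : {linear B -> A}) :=
  [/\ {morph p : x y / smul x y >-> smul x y}, {morph p : x / star x >-> star x},
      set_surj setT setT p & p @^-1` [set 0] = J].

Definition QWEP (A : cstarAlgType R) :=
  exists (B : cstarAlgType R) (J : set B) (p : {linear B -> A}),
    [/\ WEP B, closed_ideal J & quotient_map J p].

End qwep.

Section complexification.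
Variables (R : realType) (H : realHilbertType R).

(* The pair (x, y) stands for x + iy. *)
Definition complexification : Type := (H * H)%type.

HB.instance Definition _ := GRing.Zmodule.copy complexification (H * H)%type.

Let scale (a : R[i]) (u : complexification) : complexification :=
  (complex.Re a *: u.1 - complex.Im a *: u.2,
   complex.Re a *: u.2 + complex.Im a *: u.1).

Let scaleA a b u : scale a (scale b u) = scale (a * b) u.
Proof.
case: a b u => [a a'] [b b'] [x y]; congr (_, _) => /=.
  rewrite scalerBr scalerDr scalerBl scalerDl !scalerA !opprD !addrA.
  by rewrite [LHS]addrAC; congr (_ + _); rewrite addrAC.
rewrite scalerBr scalerDr scalerBl scalerDl !scalerA !addrA.
by rewrite [LHS]addrAC; congr (_ + _); rewrite addrAC.
Qed.

Let scale1 : left_id 1 scale.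
Proof.
by case=> x y; rewrite /scale /= !scale1r !scale0r subr0 addr0.
Qed.

Let scaleDr : right_distributive scale +%R.
Proof.
move=> a [x y] [z t]; congr (_, _) => /=.
  by rewrite !scalerDr opprD addrACA.
by rewrite !scalerDr addrACA.
Qed.

Let scaleDl u : {morph scale^~ u : a b / a + b}.
Proof.
case: u => x y [a a'] [b b']; congr (_, _) => /=.
  by rewrite !scalerDl opprD addrACA.
by rewrite !scalerDl addrACA.
Qed.

HB.instance Definition _ := GRing.Zmodule_isLmodule.Build R[i]
  complexification scaleA scale1 scaleDr scaleDl.

(* Linear in the first variable, conjugate linear in the second. *)
Definition cinner (u v : complexification) : R[i] :=
  (inner u.1 v.1 + inner u.2 v.2) +i* (inner u.2 v.1 - inner u.1 v.2).

Definition real_vec (x : H) : complexification := (x, 0).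

End complexification.

Section q_gaussian.
Variables (R : realType) (H : realHilbertType R) (q : R).

Definition inversions n (p : 'S_n) : nat :=
  #|[pred ij : 'I_n * 'I_n | (ij.1 < ij.2)%N && (p ij.2 < p ij.1)%N]|.

(* Words h_1 ... h_n over H_C stand for the elementary tensors, the empty word
   for the vacuum. *)
Definition qinner (s t : seq (complexification H)) : R[i] :=
  if size s == size t then
    \sum_(p : 'S_(size s)) (q ^+ inversions p)%:C *
      \prod_(i < size s) cinner s`_i t`_(p i)
  else 0.

(* A Hilbert space completion of the algebraic direct sum of the algebraic
   tensor powers of H_C, for qinner. It is determined up to a unique unitary
   preserving the elementary tensors. The multilinearity of tens in each letter
   follows from tens_inner. *)
Record qFock := QFock {
  fock :> complexHilbertType R;
  tens : seq (complexification H) -> fock;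
  tens_inner : forall s t, inner (tens s) (tens t) = qinner s t;
  tens_dense : dense [set x : fock |
    exists n (c : 'I_n -> R[i]) (s : 'I_n -> seq (complexification H)),
      x = \sum_i c i *: tens (s i)]
}.

Variable F : qFock.

(* The bounded operator T with T(h_1 ... h_n) = h h_1 ... h_n; it is unique by
   tens_dense, and exists when -1 < q < 1. *)
Definition creation (h : complexification H) : bounded_op F :=
  get [set T : bounded_op F | forall s, T (tens F s) = tens F (h :: s)].

Definition annihilation (h : complexification H) : bounded_op F :=
  star (creation h).

Definition gaussian (f : H) : bounded_op F :=
  creation (real_vec f) + annihilation (real_vec f).

Definition q_gaussian_cstar : cstarAlgType R := cstar_gen (range gaussian).

End q_gaussian.

(* Main.v *)
(* The q-Gaussians are limits in moments of normalised sums of spins which commute or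
   anticommute in pairs, with independent random signs of mean q (Speicher). On a Hilbert
   space K carrying all these finite models, let D be the C*-algebra of the bounded
   operators x that have a limit p x in C_q^*(H_R), tested along an ultrafilter on the
   vectors given by words in the spin sums. Then p maps D onto C_q^*(H_R), since the
   bounded functions G / (1 + G^2 / t) of the spin sums approximate the Gaussians, and the
   kernel of p is hereditary in B(K). The claim follows once D has the WEP.

   Rotate the letters of the test vectors by arccos r towards fresh independent
   directions and compress: this gives completely contractive maps Phi_r on B(K) with
   values in B(F). The models are tracial, so that Phi_r x commutes with the right
   multiplications by Gaussians and is determined by its vacuum vector, whose n-particle
   component is r^n times that of Phi_1 x. For x in D, Phi_r x is therefore the second
   quantisation of r applied to p x, and it tends to p x when r -> 1. For every x in B(K),
   the Haagerup-Bozejko inequality (the norm of a Wick word of length n is at most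
   O(n) times the norm of its vector, up to constants of subexponential growth) makes
   Phi_r x a multiplier of C_q^*(H_R) when r < 1. Cutting Phi_r down by a quasi-unit of
   C_q^*(H_R), we obtain completely contractive maps from B(K) to C_q^*(H_R) that
   converge to p pointwise on D.

   To get from there to the bidual of D, average e_k x e_k + (1 - e_k) y (1 - e_k) over a
   long chain of quasi-units e_k of the kernel of p, each almost absorbing the previous
   ones, with y in D a lift of the image of x. The first term lies in the kernel because
   the latter is hereditary, and when x = y is in D, the cross terms e_k x (1 - e_k) are
   almost orthogonal, so that their average is small. *)
From HB Require Import structures.
Require Import Defs.
From mathcomp Require Import all_boot all_order all_fingroup all_algebra.
From mathcomp Require Import all_classical all_reals all_analysis.
From mathcomp Require Import complex ring lra zify.
Set Implicit Arguments.
Unset Strict Implicit.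
Unset Printing Implicit Defensive.
Import Order.TTheory GRing.Theory Num.Theory.
Import numFieldNormedType.Exports.
Local Open Scope classical_set_scope.
Local Open Scope ring_scope.
Local Open Scope complex_scope.

(** The norms of the spin sums grow with the number of sites, so together they define no bounded
    operator on K. Only their moments converge, which forces bounded functions of them, and limits
    tested on vectors rather than in norm. All of this takes place in one B(K): the finite models
    are the coordinates of an l2 sum, and an average over signs, configurations and rotations
    becomes a vector state of a finite amplification of B(K), with the square roots of the weights
    as coefficients. Summed over all configurations, the vector states are tracial against arbitrary
    bounded operators, not only against spins; this is why Phi_r is under control on the whole of
    B(K) and not merely on D. Averaging over a chain stands in for a quasicentral approximate unit,
    which would come from a separation argument. The matrix norms in the definition of the WEP are
    specified only by the C*-axioms, so the uniqueness of C*-norms is part of the proof. It is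
    obtained, like the lifting theorems, from square roots and inverses constructed by iteration, in
    algebras that may lack a unit. *)

Section complex_modulus.
Variable R : realType.

(* Monomorphic copies of the projections: their argument type mentions only the
   realType, so that rewriting does not depend on the inferred structure. *)
Definition Cre (a : R[i]) : R := complex.Re a.
Definition Cim (a : R[i]) : R := complex.Im a.
Implicit Types a b : R[i].

Lemma nrmM a b : nrm (a * b) = nrm a * nrm b.
Proof. by apply: (@complexI R); rewrite RCM -!nrmE normrM. Qed.

Lemma nrm1 : nrm (1 : R[i]) = 1.
Proof. by apply: (@complexI R); rewrite -nrmE normr1. Qed.

Lemma nrmC (x : R) : nrm x%:C = `|x|.
Proof. by rewrite /nrm normc_def /= expr0n addr0 sqrtr_sqr. Qed.

Lemma nrm_conj a : nrm (a^*)%R = nrm a.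
Proof. by rewrite /nrm norm_conjC. Qed.

Lemma nrm_sqr a : nrm a ^+ 2 = Cre a ^+ 2 + Cim a ^+ 2.
Proof. by case: a => x y; rewrite /nrm /Cre /Cim normc_def /= sqr_sqrtr ?addr_ge0 ?sqr_ge0. Qed.

Lemma nrm_sqrE a : a * (a^*)%R = (nrm a ^+ 2)%:C.
Proof. by rewrite -normCK nrmE (rmorphXn (real_complex R)). Qed.

Lemma Cre_le_nrm a : `|Cre a| <= nrm a.
Proof.
rewrite -(@ler_pXn2r _ 2) ?nnegrE ?normr_ge0 ?nrm_ge0// nrm_sqr real_normK ?num_real//.
by rewrite lerDl sqr_ge0.
Qed.

Lemma Cim_le_nrm a : `|Cim a| <= nrm a.
Proof.
rewrite -(@ler_pXn2r _ 2) ?nnegrE ?normr_ge0 ?nrm_ge0// nrm_sqr real_normK ?num_real//.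
by rewrite lerDr sqr_ge0.
Qed.

Lemma nrm_le_ReIm a : nrm a <= `|Cre a| + `|Cim a|.
Proof.
rewrite -(@ler_pXn2r _ 2) ?nnegrE ?addr_ge0 ?normr_ge0 ?nrm_ge0// nrm_sqr sqrrD.
by rewrite !real_normK ?num_real// lerD2r lerDl mulrn_wge0 ?mulr_ge0.
Qed.

Lemma RCB (x y : R) : (x - y)%:C = x%:C - y%:C.
Proof. exact: (rmorphB (real_complex R)). Qed.

Lemma RCX (x : R) n : (x ^+ n)%:C = x%:C ^+ n.
Proof. exact: (rmorphXn (real_complex R)). Qed.

Lemma RC_sum (I : Type) (r : seq I) (P : pred I) (F : I -> R) :
  (\sum_(i <- r | P i) F i)%:C = \sum_(i <- r | P i) (F i)%:C.
Proof. exact: (rmorph_sum (real_complex R)). Qed.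

Lemma conj_RC (x : R) : ((x%:C)^*)%R = x%:C.
Proof. by apply/eqP; rewrite eq_complex /= oppr0 !eqxx. Qed.

Lemma CreD a b : Cre (a + b) = Cre a + Cre b.
Proof. by case: a b => [? ?] [? ?]. Qed.

Lemma CreN a : Cre (- a) = - Cre a.
Proof. by case: a. Qed.

Lemma CreB a b : Cre (a - b) = Cre a - Cre b.
Proof. by rewrite CreD CreN. Qed.

Lemma conjM a b : ((a * b)^*)%R = (a^*)%R * (b^*)%R.
Proof. exact: rmorphM. Qed.
Lemma conjD a b : ((a + b)^*)%R = (a^*)%R + (b^*)%R.
Proof. exact: rmorphD. Qed.
Lemma conjB a b : ((a - b)^*)%R = (a^*)%R - (b^*)%R.
Proof. exact: rmorphB. Qed.
Lemma conj_sum (I : Type) (r : seq I) (P : pred I) (F : I -> R[i]) :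
  ((\sum_(i <- r | P i) F i)^*)%R = \sum_(i <- r | P i) ((F i)^*)%R.
Proof. exact: rmorph_sum. Qed.
Lemma cjK a : ((a^*)^*)%R = a.
Proof. exact: conjCK. Qed.

Lemma Cre_conj a : Cre (a^*)%R = Cre a.
Proof. by case: a. Qed.

Lemma CreZ (t : R) a : Cre (t%:C * a) = t * Cre a.
Proof. by case: a => x y /=; rewrite /Cre /= mul0r subr0. Qed.

Lemma Cre_sum (I : Type) (r : seq I) (P : pred I) (F : I -> R[i]) :
  Cre (\sum_(i <- r | P i) F i) = \sum_(i <- r | P i) Cre (F i).
Proof. by rewrite (big_morph _ CreD (erefl : Cre 0 = 0)). Qed.

End complex_modulus.

Section normed.
Variables (R : realType) (V : normedZmodType R[i]).
Implicit Types x y : V.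

Lemma nrmN x : nrm (- x) = nrm x.
Proof. by rewrite /nrm normrN. Qed.

Lemma nrmBD x y : nrm (x - y) <= nrm x + nrm y.
Proof. by rewrite -(nrmN y) nrmD. Qed.

Lemma nrm_dist x y z : nrm (x - z) <= nrm (x - y) + nrm (y - z).
Proof. by have := nrmD (x - y) (y - z); rewrite addrA subrK. Qed.

Lemma nrm_sum (I : Type) (r : seq I) (P : pred I) (F : I -> V) :
  nrm (\sum_(i <- r | P i) F i) <= \sum_(i <- r | P i) nrm (F i).
Proof.
elim/big_rec2: _ => [|i y1 y2 _ h]; first by rewrite nrm0.
by apply: (le_trans (nrmD _ _)); rewrite lerD2l.
Qed.

Lemma nrm_sub_le x y : nrm x <= nrm y + nrm (x - y).
Proof. by have := nrmD y (x - y); rewrite addrC subrK. Qed.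

Lemma nrm_small x : (forall e : R, 0 < e -> nrm x <= e) -> x = 0.
Proof.
move=> h; apply: nrm_eq0; apply/eqP; rewrite eq_le nrm_ge0 andbT.
by apply/ler_addgt0Pr => e e0; rewrite add0r; exact: h.
Qed.

End normed.

Section hilbert_space.
Variables (R : realType) (H : complexHilbertType R).
Implicit Types x y z : H.

Lemma inner_sym x y : inner x y = (inner y x)^*%R.
Proof. by rewrite (hermC (@inner _ _ H)) expr0 mul1r. Qed.

Lemma innerDl x y z : inner (x + y) z = inner x z + inner y z.
Proof. exact: linearDl. Qed.
Lemma innerZl (a : R[i]) x y : inner (a *: x) y = a * inner x y.
Proof. exact: linearZl_LR. Qed.
Lemma innerDr x y z : inner x (y + z) = inner x y + inner x z.
Proof. exact: linearDr. Qed.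
Lemma innerZr (a : R[i]) x y : inner x (a *: y) = a^*%R * inner x y.
Proof. by rewrite linearZr. Qed.
Lemma inner0l x : inner 0 x = 0.
Proof. by rewrite -(scale0r (0:H)) innerZl mul0r. Qed.
Lemma inner0r x : inner x 0 = 0.
Proof. by rewrite inner_sym inner0l conjC0. Qed.
Lemma innerNl x y : inner (- x) y = - inner x y.
Proof. by rewrite -scaleN1r innerZl mulN1r. Qed.
Lemma innerNr x y : inner x (- y) = - inner x y.
Proof. by rewrite -scaleN1r innerZr rmorphN1 mulN1r. Qed.
Lemma innerBl x y z : inner (x - y) z = inner x z - inner y z.
Proof. by rewrite innerDl innerNl. Qed.
Lemma innerBr x y z : inner x (y - z) = inner x y - inner x z.
Proof. by rewrite innerDr innerNr. Qed.
Lemma inner_suml (I : Type) (r : seq I) (P : pred I) (F : I -> H) y :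
  inner (\sum_(i <- r | P i) F i) y = \sum_(i <- r | P i) inner (F i) y.
Proof.
by apply: (big_morph (fun x => inner x y)) => [u v|]; rewrite ?innerDl ?inner0l.
Qed.
Lemma inner_sumr (I : Type) (r : seq I) (P : pred I) (F : I -> H) y :
  inner y (\sum_(i <- r | P i) F i) = \sum_(i <- r | P i) inner y (F i).
Proof.
by apply: (big_morph (fun x => inner y x)) => [u v|]; rewrite ?innerDr ?inner0r.
Qed.

Lemma inner_nrm x : inner x x = (nrm x ^+ 2)%:C.
Proof. by rewrite -inner_norm nrmE RCX. Qed.

Lemma Cre_inner_nrm x : Cre (inner x x) = nrm x ^+ 2.
Proof. by rewrite inner_nrm. Qed.

Lemma inner_le x y : nrm (inner x y) <= nrm x * nrm y.
Proof.
set z := inner x y.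
have [z0|z0] := eqVneq z 0; first by rewrite z0 nrm0 mulr_ge0 ?nrm_ge0.
have nz : nrm z != 0 by apply: contra z0 => /eqP/nrm_eq0 ->.
pose a := (nrm z)^-1%:C * z^*%R.
have na : nrm a = 1.
  by rewrite nrmM nrmC nrm_conj ger0_norm ?invr_ge0 ?nrm_ge0// mulVf.
have <- : Cre (inner (a *: x) y) = nrm z.
  rewrite innerZl -/z /a -mulrA [_^*%R * _]mulrC nrm_sqrE -RCM /Cre /=.
  by rewrite expr2 mulKf.
by apply: (le_trans (re_inner_le _ _)); rewrite nrmZ na mul1r.
Qed.

Lemma inner_extr x y : (forall z, inner z x = inner z y) -> x = y.
Proof.
move=> h; apply/eqP; rewrite -subr_eq0 -normr_eq0 -sqrf_eq0 inner_norm.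
by rewrite innerBr h subrr.
Qed.

Lemma inner_extl x y : (forall z, inner x z = inner y z) -> x = y.
Proof. by move=> h; apply: inner_extr => z; rewrite !(inner_sym z) h. Qed.

Lemma nrm_le_inner x (M : R) :
  0 <= M -> (forall y, nrm (inner x y) <= M * nrm y) -> nrm x <= M.
Proof.
move=> M0 h; have [->//|n0] := eqVneq (nrm x) 0.
have n1 : 0 < nrm x by rewrite lt_def n0 nrm_ge0.
rewrite -(ler_pM2r n1) -expr2; apply: le_trans (h x).
by rewrite inner_nrm nrmC ger0_norm ?sqr_ge0.
Qed.

Lemma nrmD_sqr x y :
  nrm (x + y) ^+ 2 = nrm x ^+ 2 + nrm y ^+ 2 + 2 * Cre (inner x y).
Proof.
rewrite -!Cre_inner_nrm innerDl !innerDr !CreD (inner_sym y x) Cre_conj; ring.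
Qed.

Lemma nrmB_sqr x y :
  nrm (x - y) ^+ 2 = nrm x ^+ 2 + nrm y ^+ 2 - 2 * Cre (inner x y).
Proof. by rewrite nrmD_sqr nrmN innerNr CreN mulrN. Qed.

End hilbert_space.

(** * Limits along filters and ultrafilters *)

Section limits.
Variable R : realType.

(** Tolerances are real although norms take values in [R[i]], and the target only needs a norm, no
    topology. Most uses have an ultrafilter for [U]. *)
Definition ucvg (T : Type) (U : set_system T) (V : normedZmodType R[i])
  (f : T -> V) (l : V) := forall e : R, 0 < e -> U [set t | nrm (f t - l) < e].

Section filter.
Context {T : Type} {U : set_system T} {FU : Filter U}.

Lemma ucvg_near (V : normedZmodType R[i]) (f g : T -> V) l :
  U [set t | f t = g t] -> ucvg U f l -> ucvg U g l.
Proof. by move=> h c e e0; have := c e e0; apply: filterS2 h => t /= ->. Qed.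

Lemma ucvg_cst (V : normedZmodType R[i]) (l : V) : ucvg U (fun=> l) l.
Proof. by move=> e e0; apply: filterE => t /=; rewrite subrr nrm0. Qed.

Lemma ucvgD (V : normedZmodType R[i]) (f g : T -> V) l m :
  ucvg U f l -> ucvg U g m -> ucvg U (fun t => f t + g t) (l + m).
Proof.
move=> cf cg e e0; have e2 : 0 < e / 2 by rewrite divr_gt0.
apply: filterS2 (cf _ e2) (cg _ e2) => t /= h1 h2.
rewrite opprD addrACA; apply: (le_lt_trans (nrmD _ _)).
by rewrite [e](splitr e) ltrD.
Qed.

Lemma ucvgN (V : normedZmodType R[i]) (f : T -> V) l :
  ucvg U f l -> ucvg U (fun t => - f t) (- l).
Proof. by move=> cf e e0; apply: filterS (cf e e0) => t /=; rewrite -opprD nrmN. Qed.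

Lemma ucvgB (V : normedZmodType R[i]) (f g : T -> V) l m :
  ucvg U f l -> ucvg U g m -> ucvg U (fun t => f t - g t) (l - m).
Proof. by move=> cf /ucvgN; apply: ucvgD. Qed.

Lemma ucvg_sum (V : normedZmodType R[i]) (I : Type) (r : seq I) (f : I -> T -> V)
    (l : I -> V) : (forall i, ucvg U (f i) (l i)) ->
  ucvg U (fun t => \sum_(i <- r) f i t) (\sum_(i <- r) l i).
Proof.
move=> h; elim: r => [|i r IH].
  by rewrite big_nil; apply: (ucvg_near _ (ucvg_cst _)); apply: filterE => t /=; rewrite big_nil.
rewrite big_cons; apply: (ucvg_near _ (ucvgD (h i) IH)).
by apply: filterE => t /=; rewrite big_cons.
Qed.

Lemma ucvg_dom (V W : normedZmodType R[i]) (f : T -> V) (g : T -> W) l m (c : R) :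
  U [set t | nrm (g t - m) <= c * nrm (f t - l)] -> ucvg U f l -> ucvg U g m.
Proof.
move=> h cf e e0; have c1 : 0 < `|c| + 1 by rewrite ltr_wpDl.
have d0 : 0 < e / (`|c| + 1) by rewrite divr_gt0.
apply: filterS2 h (cf _ d0) => t /= h1 h2; apply: (le_lt_trans h1).
apply: (@le_lt_trans _ _ ((`|c| + 1) * nrm (f t - l))).
  by rewrite ler_wpM2r ?nrm_ge0// (le_trans (ler_norm _))// lerDl.
by rewrite -ltr_pdivlMl// mulrC.
Qed.

Lemma ucvgMl (a : R[i]) (f : T -> R[i]) l :
  ucvg U f l -> ucvg U (fun t => a * f t) (a * l).
Proof.
apply: (ucvg_dom (c := nrm a)); apply: filterE => t /=.
by rewrite -mulrBr nrmM.
Qed.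

Lemma ucvg_conj (f : T -> R[i]) l :
  ucvg U f l -> ucvg U (fun t => (f t)^*%R) (l^*%R).
Proof.
apply: (ucvg_dom (c := 1)); apply: filterE => t /=.
by rewrite -rmorphB nrm_conj mul1r.
Qed.

Lemma ucvg_Re (f : T -> R[i]) l :
  ucvg U f l -> ucvg U (fun t => (Cre (f t))%:C) (Cre l)%:C.
Proof.
apply: (ucvg_dom (c := 1)); apply: filterE => t /=.
by rewrite -RCB nrmC -CreB mul1r Cre_le_nrm.
Qed.

End filter.

Section proper.
Context {T : Type} {U : set_system T} {FU : ProperFilter U}.

Lemma ucvg_uniq (V : normedZmodType R[i]) (f : T -> V) l m :
  ucvg U f l -> ucvg U f m -> l = m.
Proof.
move=> cl cm; apply/eqP; rewrite -subr_eq0; apply/eqP/nrm_small => e e0.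
have e2 : 0 < e / 2 by rewrite divr_gt0.
have [t [/= h1 h2]] := filter_ex (filterI (cl _ e2) (cm _ e2)).
apply: (le_trans (nrm_dist _ (f t) _)).
by rewrite [nrm (l - _)]nrmB (splitr e) lerD// ltW.
Qed.

Lemma ucvg_le (V : normedZmodType R[i]) (f : T -> V) l (c : R) :
  ucvg U f l -> (forall e, 0 < e -> U [set t | nrm (f t) <= c + e]) -> nrm l <= c.
Proof.
move=> cl h; apply/ler_addgt0Pr => e e0; have e2 : 0 < e / 2 by rewrite divr_gt0.
have [t [/= h1 h2]] := filter_ex (filterI (cl _ e2) (h _ e2)).
apply: (le_trans (nrm_sub_le _ (f t))).
by rewrite nrmB (splitr e) addrA lerD// ltW.
Qed.

Lemma ucvg_leW (V : normedZmodType R[i]) (f : T -> V) l (c : R) :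
  ucvg U f l -> U [set t | nrm (f t) <= c] -> nrm l <= c.
Proof.
move=> cl h; apply: (ucvg_le cl) => e e0; apply: filterS h => t /= ht.
by apply: (le_trans ht); rewrite lerDl ltW.
Qed.

End proper.

Section ultra.
Context {T : Type} {U : set_system T} {UU : UltraFilter U}.

(** The limit is the supremum of the levels that f exceeds on a set of U. A level just above the
    supremum fails, and maximality of U then puts the complementary set in U. *)
Let ex_ulimR (f : T -> R) (M : R) : U [set t | `|f t| <= M] ->
  exists l : R, forall e, 0 < e -> U [set t | `|f t - l| < e].
Proof.
move=> hM; have FU : ProperFilter U := @ultra_proper _ _ UU.
pose S := [set a : R | U [set t | a <= f t]].
have hS : has_sup S.
  split; first by exists (- M); apply: filterS hM => t /=; rewrite ler_norml => /andP[].
  exists M => a /= ha; have [t [/= h1 h2]] := filter_ex (filterI ha hM).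
  by apply: (le_trans h1); rewrite (le_trans (ler_norm _)).
exists (sup S) => e e0.
have [a aS ha] := sup_adherent e0 hS.
have nb : ~ S (sup S + e).
  move=> /(ub_le_sup hS.2); rewrite leNgt => /negP; apply.
  by rewrite ltrDl.
have := in_ultra_setVsetC [set t | sup S + e <= f t] UU.
case=> // nbC; apply: filterS2 aS nbC => t /= h1 /negP; rewrite -ltNge => h2.
rewrite ltr_norml; apply/andP; split; last by rewrite ltrBlDl.
by rewrite ltrBrDl (lt_le_trans ha h1).
Qed.

Lemma ex_ulim (f : T -> R[i]) (M : R) : U [set t | nrm (f t) <= M] ->
  exists l, ucvg U f l.
Proof.
move=> hM; have FU : ProperFilter U := @ultra_proper _ _ UU.
have [|r hr] := @ex_ulimR (fun t => Cre (f t)) M.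
  by apply: filterS hM => t /=; apply: le_trans; exact: Cre_le_nrm.
have [|s hs] := @ex_ulimR (fun t => Cim (f t)) M.
  by apply: filterS hM => t /=; apply: le_trans; exact: Cim_le_nrm.
exists (r +i* s) => e e0; have e2 : 0 < e / 2 by rewrite divr_gt0.
apply: filterS2 (hr _ e2) (hs _ e2) => t /=; case: (f t) => a b /= h1 h2.
apply: (le_lt_trans (nrm_le_ReIm _)) => /=.
by rewrite (splitr e) ltrD.
Qed.

Definition ulim (f : T -> R[i]) : R[i] := xget 0 [set l | ucvg U f l].

Lemma ulimP (f : T -> R[i]) (M : R) :
  U [set t | nrm (f t) <= M] -> ucvg U f (ulim f).
Proof. by move=> /ex_ulim h; rewrite /ulim; case: xgetP => // n; case: h => l /n. Qed.

Lemma ulim_eq (f : T -> R[i]) l : ucvg U f l -> ulim f = l.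
Proof.
move=> h; have FU : ProperFilter U := @ultra_proper _ _ UU.
by rewrite /ulim; case: xgetP => [x -> hx|/(_ l)//]; exact: (ucvg_uniq hx h).
Qed.

End ultra.

Section tails.
Variables (T : Type) (le : T -> T -> Prop).
Definition tails : set_system T := [set P | exists a, forall b, le a b -> P b].

Lemma tails_proper (t0 : T) : (forall a, exists b, le a b) ->
  (forall a b, exists c, forall d, le c d -> le a d /\ le b d) ->
  ProperFilter tails.
Proof.
move=> hex hdir; apply: Build_ProperFilter => [[a ha]|].
  by have [b ab] := hex a; exact: (ha b).
split; first by exists t0.
  move=> P Q [a ha] [b hb]; have [c hc] := hdir a b.
  by exists c => d /hc[ad bd]; split; [exact: ha|exact: hb].
by move=> P Q PQ [a ha]; exists a => b /ha /PQ.
Qed.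

End tails.

Definition ultra_ext (T : Type) (F : set_system T) : set_system T :=
  xget setT [set G | UltraFilter G /\ F `<=` G].

Lemma ultra_extP (T : Type) (F : set_system T) : ProperFilter F ->
  UltraFilter (ultra_ext F) /\ F `<=` ultra_ext F.
Proof.
move=> /ultraFilterLemma[G hG]; rewrite /ultra_ext.
by case: xgetP => [x _ //|/(_ G)].
Qed.

End limits.
Arguments ulim {R T} U f.

Section limits_of_products.
Context {R : realType} {T : Type} {U : set_system T}.

Lemma ucvgM {FU : Filter U} (f g : T -> R[i]) l m :
  ucvg U f l -> ucvg U g m -> ucvg U (fun t => f t * g t) (l * m).
Proof.
move=> cf cg e e0.
pose c := nrm l + nrm m + 1.
have c0 : 0 < c by rewrite ltr_wpDl ?addr_ge0 ?nrm_ge0.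
have d0 : 0 < Num.min 1 (e / c) by rewrite lt_min ltr01 divr_gt0.
apply: filterS2 (cf _ d0) (cg _ d0) => t /=.
rewrite !lt_min => /andP[f1 f2] /andP[g1 g2].
have -> : f t * g t - l * m = (f t - l) * (g t - m) + (l * (g t - m) + (f t - l) * m).
  by ring.
apply: (le_lt_trans (nrmD _ _)).
have := nrmD (l * (g t - m)) ((f t - l) * m); rewrite !nrmM => h.
have h1 : nrm (f t - l) * nrm (g t - m) <= nrm (f t - l) by rewrite ler_piMr ?nrm_ge0// ltW.
have h2 : nrm l * nrm (g t - m) <= nrm l * (e / c) by rewrite ler_wpM2l ?nrm_ge0// ltW.
have h3 : nrm (f t - l) * nrm m <= e / c * nrm m by rewrite ler_wpM2r ?nrm_ge0// ltW.
have -> : e = e / c + (nrm l * (e / c) + e / c * nrm m).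
  have c1 : c != 0 by rewrite gt_eqF.
  by rewrite -[LHS](divfK c1) {2}/c; ring.
lra.
Qed.

Lemma ucvg_nrm {FU : Filter U} (V : normedZmodType R[i]) (f : T -> V) l :
  ucvg U f l -> ucvg U (fun t => (nrm (f t))%:C) (nrm l)%:C.
Proof.
apply: (ucvg_dom (c := 1)); apply: filterE => t /=.
rewrite -RCB nrmC mul1r ler_norml; apply/andP; split.
  by have := nrm_sub_le l (f t); rewrite nrmB; lra.
by have := nrm_sub_le (f t) l; lra.
Qed.

Lemma ucvg_real_le {FU : ProperFilter U} (f : T -> R) (l c : R) :
  ucvg U (fun t => (f t)%:C) l%:C -> U [set t | f t <= c] -> l <= c.
Proof.
move=> cl h; apply/ler_addgt0Pr => e e0.
have [t [/= h1 h2]] := filter_ex (filterI (cl e e0) h).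
by move: h1; rewrite -RCB nrmC ltr_norml => /andP[h1 _]; lra.
Qed.

Lemma ucvg_real_ge {FU : ProperFilter U} (f : T -> R) (l c : R) :
  ucvg U (fun t => (f t)%:C) l%:C -> U [set t | c <= f t] -> c <= l.
Proof.
move=> /ucvgN cl h; rewrite -lerN2; apply: (ucvg_real_le (f := fun t => - f t)).
  move=> e e0; have := cl e e0; apply: filterS => t /=.
  by rewrite !(rmorphN (real_complex R)).
by apply: filterS h => t /=; rewrite lerN2.
Qed.

End limits_of_products.

(** * The scalars and the square-summable families as Hilbert spaces *)

Section scalar_hilbert_space.
Variable R : realType.
Definition cplx : Type := R[i]^o.
HB.instance Definition _ := NormedModule.copy cplx R[i]^o.

(** A Cauchy filter is bounded on one of its sets, so an ultrafilter refining it has a limit by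
    [ex_ulim]; the Cauchy property brings the filter itself to that limit. *)
Let cplx_complete (F : set_system cplx) : ProperFilter F -> cauchy F -> cvg F.
Proof.
move=> FF /cauchy_nrmP cF.
have [UU FU] := ultra_extP FF; set U := ultra_ext F in UU FU.
have PU : ProperFilter U := @ultra_proper _ _ UU.
have [y0 h0] := cF 1 ltr01.
have [|l hl] := @ex_ulim R _ U UU (fun x : cplx => x : R[i]) (nrm y0 + 1).
  apply: FU; apply: filterS h0 => x /= h.
  by apply: (le_trans (nrm_sub_le _ y0)); rewrite nrmB lerD2l ltW.
apply/cvg_ex; exists (l : cplx); apply/cvg_nrmP => e e0.
have e2 : 0 < e / 2 by rewrite divr_gt0.
have [y hy] := cF _ e2.
have ly : nrm ((y : R[i]) - l) <= e / 2.
  apply: (ucvg_leW (U := U) (f := fun x : cplx => (y : R[i]) - x)).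
    by apply: ucvgB hl; apply: ucvg_cst.
  by apply: FU; apply: filterS hy => x /= /ltW.
apply: filterS hy => x /= h; apply: (le_lt_trans (nrm_dist _ (y : cplx) _)).
by rewrite (splitr e) ler_ltD// nrmB.
Qed.

HB.instance Definition _ := Uniform_isComplete.Build cplx cplx_complete.

Definition cplx_inner (x y : cplx) : R[i] := (x : R[i]) * (y : R[i])^*%R.

Let bil : bilinear_for *%R (Num.conj \; *%R) cplx_inner.
Proof.
split=> y a x z; rewrite /cplx_inner /=; first by rewrite mulrDl -mulrA.
by rewrite conjD conjM mulrDr mulrCA.
Qed.
HB.instance Definition _ := @bilinear_isBilinear.Build R[i] cplx cplx R[i] *%R (Num.conj \; *%R) cplx_inner bil.
Let herm x y : cplx_inner x y = (-1) ^+ false * (cplx_inner y x)^*%R.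
Proof. by rewrite expr0 mul1r /cplx_inner conjM mulrC; congr (_ * _); rewrite [RHS]cjK. Qed.
HB.instance Definition _ := @isHermitianSesquilinear.Build R[i] cplx false Num.conj cplx_inner herm.
Let pos (u : cplx) : u != 0 -> 0 < cplx_inner u u.
Proof. by move=> u0; rewrite /cplx_inner mulrC -normCKC exprn_gt0// normr_gt0. Qed.
HB.instance Definition _ := @isDotProduct.Build R[i] cplx cplx_inner pos.
Let inner_normE (x : cplx) : `|x| ^+ 2 = cplx_inner x x.
Proof. by rewrite /cplx_inner -normCK. Qed.
HB.instance Definition _ := isHilbert.Build R[i] Num.conj cplx inner_normE.

Lemma cplx_innerE (x y : cplx) : inner x y = (x : R[i]) * (y : R[i])^*%R.
Proof. by []. Qed.
End scalar_hilbert_space.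

Section square_summable.
Variables (R : realType) (I : choiceType) (V : complexHilbertType R).
Implicit Types (s : seq I).

(** With [undup], lists serve as finite subsets of I, and inclusion of lists makes the partial sums
    monotone. *)
Definition psum (f : I -> V) s : R := \sum_(i <- undup s) nrm (f i) ^+ 2.

Definition sqsummable : pred (I -> V) := fun f => `[< exists M, forall s, psum f s <= M >].

Record l2 := L2 { l2_fun :> I -> V; l2P : l2_fun \in sqsummable }.
HB.instance Definition _ := [isSub for l2_fun].
HB.instance Definition _ := [Choice of l2 by <:].

Lemma psum_ge0 (f : I -> V) s : 0 <= psum f s.
Proof. by apply: sumr_ge0 => i _; rewrite sqr_ge0. Qed.

Lemma psum_sub (f : I -> V) s s' : {subset s <= s'} -> psum f s <= psum f s'.
Proof.
move=> ss'; rewrite /psum (perm_big ([seq i <- undup s' | i \in s])) /=; last first.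
  apply: uniq_perm; rewrite ?filter_uniq ?undup_uniq// => i.
  rewrite mem_filter !mem_undup; case: (boolP (i \in s)) => //= /ss' ->//.
rewrite big_filter [leRHS](bigID (fun i => i \in s)) /= lerDl.
by apply: sumr_ge0 => i _; rewrite sqr_ge0.
Qed.

Lemma sqsummable_submod : submod_closed sqsummable.
Proof.
split; first by apply/asboolP; exists 0 => s; rewrite /psum big1// => i _; rewrite nrm0 expr0n.
move=> a f g /asboolP[M hM] /asboolP[N hN]; apply/asboolP.
exists (2 * nrm a ^+ 2 * M + 2 * N) => s.
apply: (@le_trans _ _ (2 * nrm a ^+ 2 * psum f s + 2 * psum g s)).
  rewrite /psum !mulr_sumr -big_split ler_sum// => i _ /=.
  have h : nrm (a *: f i + g i) <= nrm a * nrm (f i) + nrm (g i) by rewrite -nrmZ nrmD.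
  apply: (@le_trans _ _ ((nrm a * nrm (f i) + nrm (g i)) ^+ 2)).
    by rewrite ler_pXn2r ?nnegrE ?addr_ge0 ?mulr_ge0 ?nrm_ge0.
  rewrite -subr_ge0.
  have -> : 2 * nrm a ^+ 2 * nrm (f i) ^+ 2 + 2 * nrm (g i) ^+ 2 - (nrm a * nrm (f i) + nrm (g i)) ^+ 2 =
    (nrm a * nrm (f i) - nrm (g i)) ^+ 2 by ring.
  exact: sqr_ge0.
by rewrite lerD// ler_wpM2l// mulr_ge0// sqr_ge0.
Qed.
HB.instance Definition _ :=
  GRing.isSubmodClosed.Build _ _ sqsummable sqsummable_submod.
HB.instance Definition _ := [SubChoice_isSubLmodule of l2 by <:].

Definition fin_ultra : set_system (seq I) :=
  ultra_ext (tails (fun s s' : seq I => {subset s <= s'})).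

Lemma fin_tails_proper : ProperFilter (tails (fun s s' : seq I => {subset s <= s'})).
Proof.
apply: (tails_proper [::]); first by move=> a; exists a.
by move=> a b; exists (a ++ b) => d h; split=> x xa; apply: h; rewrite mem_cat xa ?orbT.
Qed.

#[global] Instance fin_ultraP : UltraFilter fin_ultra.
Proof. by have [] := ultra_extP fin_tails_proper. Qed.

#[global] Instance fin_ultra_proper : ProperFilter fin_ultra.
Proof. exact: ultra_proper. Qed.

Lemma fin_ultra_tail (P : seq I -> Prop) s0 :
  (forall s, {subset s0 <= s} -> P s) -> fin_ultra [set s | P s].
Proof. by move=> h; apply: (ultra_extP fin_tails_proper).2; exists s0. Qed.

(** The sum over I, taken as the limit of its finite partial sums along an ultrafilter that contains
    all tails. The partial sums are bounded, so the limit exists, and algebraic identities pass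
    through it. *)
Definition l2_inner (f g : l2) : R[i] :=
  ulim fin_ultra (fun s => \sum_(i <- undup s) inner (f i) (g i)).


Lemma l2_innerP (f g : l2) :
  ucvg fin_ultra (fun s => \sum_(i <- undup s) inner (f i) (g i)) (l2_inner f g).
Proof.
have /asboolP[M hM] := l2P f; have /asboolP[N hN] := l2P g.
apply: (ulimP (M := M + N)); apply: filterE => s /=.
apply: (le_trans (nrm_sum _ _ _)); apply: le_trans (lerD (hM s) (hN s)).
rewrite /psum -big_split ler_sum// => i _ /=; apply: (le_trans (inner_le _ _)).
have := sqr_ge0 (nrm (f i) - nrm (g i)); have := nrm_ge0 (f i); have := nrm_ge0 (g i).
nra.
Qed.

Let S (f : l2) : R := Cre (l2_inner f f).

Let SP (f : l2) : ucvg fin_ultra (fun s => (psum f s)%:C) (S f)%:C.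
Proof.
apply: ucvg_near (ucvg_Re (l2_innerP f f)); apply: filterE => s /=.
by rewrite Cre_sum; congr (_%:C); apply: eq_bigr => i _; rewrite Cre_inner_nrm.
Qed.

Let psum_S (f : l2) s : psum f s <= S f.
Proof.
apply: (ucvg_real_ge (SP f)); apply: (@fin_ultra_tail _ s) => s' h.
exact: psum_sub.
Qed.

Let S_le (f : l2) (c : R) : (forall s, psum f s <= c) -> S f <= c.
Proof. by move=> h; apply: (ucvg_real_le (SP f)); apply: filterE => s /=. Qed.

Let S_ge0 (f : l2) : 0 <= S f.
Proof. exact: le_trans (psum_ge0 _ _) (psum_S f [::]). Qed.

Let iD (f g h : l2) : l2_inner (f + g) h = l2_inner f h + l2_inner g h.
Proof.
apply: (ucvg_uniq (l2_innerP _ _)).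
apply: ucvg_near (ucvgD (l2_innerP _ _) (l2_innerP _ _)); apply: filterE => s /=.
by rewrite -big_split /=; apply: eq_bigr => i _; rewrite innerDl.
Qed.

Let iZ a (f h : l2) : l2_inner (a *: f) h = a * l2_inner f h.
Proof.
apply: (ucvg_uniq (l2_innerP _ _)).
apply: ucvg_near (ucvgMl a (l2_innerP _ _)); apply: filterE => s /=.
by rewrite mulr_sumr; apply: eq_bigr => i _; rewrite innerZl.
Qed.

Let iC (f g : l2) : l2_inner f g = (l2_inner g f)^*%R.
Proof.
apply: (ucvg_uniq (l2_innerP _ _)).
apply: ucvg_near (ucvg_conj (l2_innerP _ _)); apply: filterE => s /=.
by rewrite conj_sum; apply: eq_bigr => i _; rewrite [RHS]inner_sym.
Qed.

Let iSE (f : l2) : l2_inner f f = (S f)%:C.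
Proof.
have : l2_inner f f = (l2_inner f f)^*%R by exact: iC.
rewrite /S /Cre; case: (l2_inner f f) => a b [] h; apply/eqP.
by rewrite eq_complex /= eqxx/=; apply/eqP; lra.
Qed.

Let coord_S (f : l2) i : nrm (f i) ^+ 2 <= S f.
Proof. by have := psum_S f [:: i]; rewrite /psum /= big_seq1. Qed.

Let S_eq0 (f : l2) : S f = 0 -> f = 0.
Proof.
move=> h; apply: val_inj; apply/funext => i /=; apply: nrm_eq0.
have := coord_S f i; rewrite h => h1; apply/eqP; rewrite -sqrf_eq0 eq_le h1.
exact: sqr_ge0.
Qed.

Let i_CS (f g : l2) : Cre (l2_inner f g) <= Num.sqrt (S f) * Num.sqrt (S g).
Proof.
have [f0|f0] := eqVneq (S f) 0.
  by rewrite (S_eq0 f0) -(scale0r (0 : l2)) iZ mul0r mulr_ge0 ?sqrtr_ge0.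
have [g0|g0] := eqVneq (S g) 0.
  rewrite (S_eq0 g0) -(scale0r (0 : l2)) iC iZ mul0r Cre_conj mulr_ge0 ?sqrtr_ge0//.
set a := Num.sqrt (S f); set b := Num.sqrt (S g).
have a0 : 0 < a by rewrite sqrtr_gt0 lt_def f0 S_ge0.
have b0 : 0 < b by rewrite sqrtr_gt0 lt_def g0 S_ge0.
have ea : S f = a ^+ 2 by rewrite sqr_sqrtr.
have eb : S g = b ^+ 2 by rewrite sqr_sqrtr.
(* Expanding the square of the norm of b f - a g, where a and b are the norms of f and g, gives 2ab
   (ab - Re <f, g>) >= 0. *)
have := S_ge0 (b%:C *: f + (- a)%:C *: g).
rewrite /S iD !iZ [l2_inner f _]iC [l2_inner g _]iC !iD !iZ !iSE ea eb (iC g f).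
rewrite !(conjD, conjM, cjK, conj_RC).
rewrite !(CreD, CreZ, Cre_conj).
move=> /= h.
have : 0 <= 2 * (a * b) * (a * b - Cre (l2_inner f g)) by nra.
by rewrite pmulr_rge0 ?subr_ge0// mulr_gt0 ?mulr_gt0.
Qed.

Let norm (f : l2) : R[i] := (Num.sqrt (S f))%:C.

Let normD f g : norm (f + g) <= norm f + norm g.
Proof.
rewrite /norm -RCD lecR -(@ler_pXn2r _ 2) ?nnegrE ?addr_ge0 ?sqrtr_ge0//.
rewrite sqr_sqrtr ?S_ge0// sqrrD !sqr_sqrtr ?S_ge0//.
rewrite {1}/S iD [l2_inner f _]iC [l2_inner g _]iC !iD (iC g f).
rewrite !(conjD, cjK, CreD, Cre_conj).
have -> : Cre (l2_inner f f) = S f by [].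
have -> : Cre (l2_inner g g) = S g by [].
move: (i_CS f g); move: (Cre (l2_inner f g)) (Num.sqrt (S f) * Num.sqrt (S g)) (S f) (S g) => z t u v h; lra.
Qed.

Let normZ (a : R[i]) f : norm (a *: f) = `|a| * norm f.
Proof.
rewrite nrmE /norm -RCM; congr (_ %:C).
rewrite {1}/S iZ iC iZ conjM mulrA nrm_sqrE -iC iSE -RCM /=.
by rewrite sqrtrM ?sqr_ge0// sqrtr_sqr ger0_norm ?nrm_ge0.
Qed.

Let norm0_eq0 f : norm f = 0 -> f = 0.
Proof.
move=> /complexI h; apply: S_eq0; apply/eqP; rewrite eq_le S_ge0 andbT.
by rewrite -sqrtr_eq0 h.
Qed.

HB.instance Definition _ := Lmodule_isNormed.Build R[i] l2 normD normZ norm0_eq0.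

Lemma l2_nrm_sqr (f : l2) : nrm f ^+ 2 = Cre (l2_inner f f).
Proof. by rewrite -/(S f) -(sqr_sqrtr (S_ge0 f)); congr (_ ^+ 2). Qed.

Lemma l2_psum_le (f : l2) s : psum f s <= nrm f ^+ 2.
Proof. by rewrite l2_nrm_sqr; exact: psum_S. Qed.

Lemma l2_nrm_le (f : l2) (c : R) : 0 <= c -> (forall s, psum f s <= c ^+ 2) -> nrm f <= c.
Proof.
move=> c0 h; rewrite -(@ler_pXn2r _ 2) ?nnegrE ?nrm_ge0//.
by rewrite l2_nrm_sqr; exact: S_le.
Qed.

Lemma l2_coord_le (f : l2) i : nrm (f i) <= nrm f.
Proof.
rewrite -(@ler_pXn2r _ 2) ?nnegrE ?nrm_ge0//.
by have := l2_psum_le f [:: i]; rewrite /psum /= big_seq1.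
Qed.

Let l2_complete (F : set_system l2) : ProperFilter F -> cauchy F -> cvg F.
Proof.
move=> FF /cauchy_nrmP cF.
have cx i : cvg ((fun f : l2 => f i) @ F).
  apply: cauchy_cvg; apply/cauchy_nrmP => e e0.
  have [g hg] := cF _ e0; exists (g i); apply: (@filterS _ F _ _ _ _ hg) => f /= fg.
  by apply: le_lt_trans fg; exact: (l2_coord_le (g - f) i).
pose T i : V := lim ((fun f : l2 => f i) @ F).
have TP i : ucvg F (fun f : l2 => f i) (T i).
  move=> e e0; have /cvg_nrmP/(_ e e0) := cx i; apply: filterS => t /=.
  by rewrite nrmB.
(* A finite partial sum passes to the coordinatewise limit T, so the bound holds for every finite
   set at once; this gives both that T is square-summable and that it is the limit in norm. *)
have key (g : l2) (c : R) : 0 <= c -> F [set f | nrm (g - f) < c] ->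
    forall s, psum (fun i => g i - T i) s <= c ^+ 2.
  move=> c0 hg s.
  apply: (ucvg_real_le (U := F) (f := fun f : l2 => psum (g - f) s)).
    rewrite [psum _ _]/psum RC_sum; apply: (ucvg_near (f := fun f : l2 => \sum_(i <- undup s)
       ((nrm (g i - f i))%:C * (nrm (g i - f i))%:C))).
      by apply: filterE => f /=; rewrite RC_sum; apply: eq_bigr => i _; rewrite RCX expr2.
    under [X in ucvg _ _ X]eq_bigr do rewrite RCX expr2.
    apply: ucvg_sum => i.
    by apply: ucvgM; apply: ucvg_nrm; apply: ucvgB (TP i); exact: ucvg_cst.
  apply: filterS hg => f /= fg; apply: (le_trans (l2_psum_le (g - f) _)).
  by rewrite ler_pXn2r ?nnegrE ?nrm_ge0// ltW.
have Tb : T \in sqsummable.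
  have [g hg] := cF 1 ltr01; have h := key g 1 ler01 hg.
  have h2 : (fun i => g i - T i) \in sqsummable by apply/asboolP; exists (1 ^+ 2).
  have -> : T = (g : I -> V) - (fun i => g i - T i).
    by apply/funext => i; rewrite /= /GRing.add /= /GRing.opp /= opprB addrC subrK.
  by apply: rpredB => //; exact: l2P.
apply/cvg_ex; exists (L2 Tb); apply/cvg_nrmP => e e0.
have e20 : 0 < e / 2 by rewrite divr_gt0.
have [g hg] := cF _ e20; apply: filterS (hg) => f /= fg.
have -> : L2 Tb - f = (L2 Tb - g) + (g - f) by rewrite addrA subrK.
apply: (le_lt_trans (nrmD _ _)).
rewrite [ltRHS](splitr e) ler_ltD//; rewrite nrmB; apply: l2_nrm_le; first exact: ltW.
by move=> s; apply: key => //; exact: ltW.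
Qed.
HB.instance Definition _ := Uniform_isComplete.Build l2 l2_complete.

Let bil : bilinear_for *%R (Num.conj \; *%R) l2_inner.
Proof.
split=> y a x z /=; first by rewrite iD iZ.
by rewrite iC iD iZ conjD conjM -!iC.
Qed.
HB.instance Definition _ :=
  @bilinear_isBilinear.Build R[i] l2 l2 R[i] *%R (Num.conj \; *%R) l2_inner bil.
Let herm x y : l2_inner x y = (-1) ^+ false * (l2_inner y x)^*%R.
Proof. by rewrite expr0 mul1r iC. Qed.
HB.instance Definition _ := @isHermitianSesquilinear.Build R[i] l2 false Num.conj l2_inner herm.
Let pos (u : l2) : u != 0 -> 0 < l2_inner u u.
Proof.
move=> u0; rewrite iSE ltcR lt_def S_ge0 andbT.
by apply: contra u0 => /eqP/S_eq0 ->.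
Qed.
HB.instance Definition _ := @isDotProduct.Build R[i] l2 l2_inner pos.
Let inner_normE (x : l2) : `|x| ^+ 2 = l2_inner x x.
Proof. by rewrite iSE nrmE -RCX l2_nrm_sqr. Qed.
HB.instance Definition _ := isHilbert.Build R[i] Num.conj l2 inner_normE.

Lemma l2_inner_cvg (f g : l2) :
  ucvg fin_ultra (fun s => \sum_(i <- undup s) inner (f i) (g i)) (inner f g).
Proof. exact: l2_innerP. Qed.

End square_summable.

(** * Operators on a Hilbert space *)

Section operator_ring.
Variables (R : realType) (H : complexHilbertType R).
Implicit Types (S T : bounded_op H) (x y : H).

Fact id_bounded : (@idfun H) \in @bounded_linear R H H.
Proof. by apply/asboolP; split=> //; exists 1 => x; rewrite mul1r. Qed.

Definition id_op : bounded_op H := Bop id_bounded.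

Let opA : associative (@comp_op R H).
Proof. by move=> T S U; apply: bopE. Qed.
Let op1l : left_id id_op (@comp_op R H).
Proof. by move=> T; apply: bopE. Qed.
Let op1r : right_id id_op (@comp_op R H).
Proof. by move=> T; apply: bopE. Qed.
Let opDl : left_distributive (@comp_op R H) +%R.
Proof. by move=> T S U; apply: bopE. Qed.
Let opDr : right_distributive (@comp_op R H) +%R.
Proof. by move=> T S U; apply: bopE => x /=; rewrite linearD. Qed.
(** A possibly zero ring, since H may be the zero space. *)
HB.instance Definition _ := GRing.Zmodule_isPzRing.Build (bounded_op H)
  opA op1l op1r opDl opDr.

Lemma opME S T x : (S * T) x = S (T x). Proof. by []. Qed.
Lemma op1E x : (1 : bounded_op H) x = x. Proof. by []. Qed.
Lemma opDE S T x : (S + T) x = S x + T x. Proof. by []. Qed.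
Lemma opNE S x : (- S) x = - S x. Proof. by []. Qed.
Lemma opBE S T x : (S - T) x = S x - T x. Proof. by []. Qed.
Lemma opZE (a : R[i]) S x : (a *: S) x = a *: S x. Proof. by []. Qed.
Lemma op0E x : (0 : bounded_op H) x = 0. Proof. by []. Qed.
Lemma op_sumE (I : Type) (r : seq I) (P : pred I) (F : I -> bounded_op H) x :
  (\sum_(i <- r | P i) F i) x = \sum_(i <- r | P i) F i x.
Proof. by apply: (big_morph (fun S : bounded_op H => S x)). Qed.

Lemma opZl (a : R[i]) S T : (a *: S) * T = a *: (S * T).
Proof. exact: smulZl. Qed.
Lemma opZr (a : R[i]) S T : S * (a *: T) = a *: (S * T).
Proof. exact: smulZr. Qed.

Lemma star_opM S T : star (S * T) = star T * star S.
Proof. exact: starM. Qed.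
Lemma star_opZ (a : R[i]) S : star (a *: S) = (a^*)%R *: star S.
Proof. exact: starZ. Qed.
Lemma starN S : star (- S) = - star S.
Proof. by rewrite -scaleN1r star_opZ rmorphN1 scaleN1r. Qed.
Lemma starB S T : star (S - T) = star S - star T.
Proof. by rewrite starD starN. Qed.
Lemma star0 : star (0 : bounded_op H) = 0.
Proof. by rewrite -(scale0r (0 : bounded_op H)) star_opZ conjC0 !scale0r. Qed.
Lemma star1 : star (1 : bounded_op H) = 1.
Proof. by rewrite -[LHS]mulr1 -[X in _ * X]starK -star_opM mulr1 starK. Qed.
Lemma star_sum (I : Type) (r : seq I) (P : pred I) (F : I -> bounded_op H) :
  star (\sum_(i <- r | P i) F i) = \sum_(i <- r | P i) star (F i).
Proof. by apply: (big_morph _ (@starD _ _) star0). Qed.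
Lemma starX S n : star (S ^+ n) = star S ^+ n.
Proof. by elim: n => [|n IH]; rewrite ?expr0 ?star1// exprS star_opM IH -exprSr. Qed.

Lemma nrm_opM S T : nrm (S * T) <= nrm S * nrm T.
Proof. by have := norm_smul S T; rewrite !nrmE -RCM lecR. Qed.

Lemma op_le T x : nrm (T x) <= nrm T * nrm x.
Proof. exact: opnorm_le. Qed.

Lemma op_nrm_le T (M : R) : 0 <= M -> (forall x, nrm (T x) <= M * nrm x) -> nrm T <= M.
Proof. exact: opnorm_lub. Qed.

Lemma adjl T x y : inner (T x) y = inner x (star T y).
Proof. exact: adjointP. Qed.

Lemma adjr T x y : inner x (T y) = inner (star T x) y.
Proof. by rewrite adjl starK. Qed.

Lemma star_uniq T S : (forall x y, inner (T x) y = inner x (S y)) -> star T = S.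
Proof. exact: adjoint_unique. Qed.

Lemma op_inner_le T (M : R) : 0 <= M ->
  (forall x y, nrm (inner (T x) y) <= M * nrm x * nrm y) -> nrm T <= M.
Proof.
move=> M0 h; apply: op_nrm_le => // x; apply: nrm_le_inner => //.
by rewrite mulr_ge0 ?nrm_ge0.
Qed.

Lemma nrm_star T : nrm (star T) = nrm T.
Proof.
have h S : nrm (star S) <= nrm S.
  apply: op_inner_le => [|x y]; first exact: nrm_ge0.
  rewrite inner_sym -adjl nrm_conj; apply: (le_trans (inner_le _ _)).
  by rewrite mulrAC ler_wpM2r ?nrm_ge0 ?op_le.
by apply/eqP; rewrite eq_le h/= -{1}(starK T) h.
Qed.

Lemma nrm_starM T : nrm (star T * T) = nrm T ^+ 2.
Proof. by apply: (@complexI R); rewrite RCX -!nrmE; exact: norm_starM. Qed.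

Lemma nrm_op1 : nrm (1 : bounded_op H) <= 1.
Proof. by apply: op_nrm_le => // x; rewrite mul1r. Qed.

Lemma nrm_opX T n : nrm T <= 1 -> nrm (T ^+ n) <= 1.
Proof.
move=> h; elim: n => [|n IH]; first by rewrite expr0 nrm_op1.
rewrite exprS; apply: (le_trans (nrm_opM _ _)); rewrite -[1]mul1r.
by rewrite ler_pM ?nrm_ge0.
Qed.

Lemma nrm_opXn T n (c : R) : nrm T <= c -> nrm (T ^+ n.+1) <= c ^+ n.+1.
Proof.
move=> h; elim: n => [//|n IH]; rewrite exprS [c ^+ _]exprS.
by apply: (le_trans (nrm_opM _ _)); rewrite ler_pM ?nrm_ge0.
Qed.

End operator_ring.

Section linear_combinations.
Variables (R : realType) (W : Type).

(** Vectors are handled through formal combinations. The family v may satisfy linear relations, so a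
    map given on W extends to the span only under a norm inequality valid for all lists; such
    inequalities are the hypotheses of the extension results. *)
Definition lcomb (V : lmodType R[i]) (v : W -> V) (c : seq (R[i] * W)) : V :=
  \sum_(p <- c) p.1 *: v p.2.

Definition cscale (a : R[i]) (c : seq (R[i] * W)) := [seq (a * p.1, p.2) | p <- c].

Lemma lcomb_cat (V : lmodType R[i]) (v : W -> V) c c' :
  lcomb v (c ++ c') = lcomb v c + lcomb v c'.
Proof. by rewrite /lcomb big_cat. Qed.

Lemma lcomb_scale (V : lmodType R[i]) (v : W -> V) a c :
  lcomb v (cscale a c) = a *: lcomb v c.
Proof.
by rewrite /lcomb big_map scaler_sumr; apply: eq_bigr => p _; rewrite scalerA.
Qed.

Lemma lcomb1 (V : lmodType R[i]) (v : W -> V) w : lcomb v [:: (1, w)] = v w.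
Proof. by rewrite /lcomb big_seq1 scale1r. Qed.

Lemma lcomb_nil (V : lmodType R[i]) (v : W -> V) : lcomb v [::] = 0.
Proof. by rewrite /lcomb big_nil. Qed.

End linear_combinations.

(** * Functionals and operators defined on a total family *)

Section dense_families.
Variables (R : realType) (H : complexHilbertType R) (W : Type) (v : W -> H).

Definition total_family := forall x (e : R), 0 < e -> exists c, nrm (x - lcomb v c) < e.
Hypothesis dv : total_family.

Lemma total_extr x y : (forall w, inner (v w) x = inner (v w) y) -> x = y.
Proof.
move=> h; apply: inner_extr => z; apply/eqP; rewrite -subr_eq0 -innerBr.
apply/eqP; apply: nrm_small => e e0.
have d0 : 0 < e / (nrm (x - y) + 1) by rewrite divr_gt0// ltr_wpDl ?nrm_ge0.
have [c hc] := dv z d0.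
have -> : inner z (x - y) = inner (z - lcomb v c) (x - y).
  rewrite innerBl; suff -> : inner (lcomb v c) (x - y) = 0 by rewrite subr0.
  rewrite inner_suml big1// => p _; rewrite innerZl innerBr h subrr; ring.
apply: (le_trans (inner_le _ _)).
apply: (@le_trans _ _ (e / (nrm (x - y) + 1) * nrm (x - y))).
  by rewrite ler_wpM2r ?nrm_ge0// ltW.
rewrite mulrAC ler_pdivrMr ?ltr_wpDl ?nrm_ge0// ler_wpM2l ?lerDl// ltW//.
Qed.

Lemma total_extl x y : (forall w, inner x (v w) = inner y (v w)) -> x = y.
Proof. by move=> h; apply: total_extr => w; rewrite !(inner_sym (v w)) h. Qed.

(** The inequality makes the value of a list depend only on its combination. The value at x is the
    limit along an ultrafilter of lists whose combinations converge to x, and the resulting bounded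
    functional is represented by [riesz]. *)
Lemma total_riesz (phi : W -> R[i]) (M : R) : 0 <= M ->
  (forall c, nrm (\sum_(p <- c) p.1 * phi p.2) <= M * nrm (lcomb v c)) ->
  exists z, (forall w, phi w = inner (v w) z) /\ nrm z <= M.
Proof.
move=> M0 hM.
pose Phi c := \sum_(p <- c) p.1 * phi p.2.
have PhiD c c' : Phi (c ++ c') = Phi c + Phi c' by rewrite /Phi big_cat.
have PhiZ a c : Phi (cscale a c) = a * Phi c.
  by rewrite /Phi big_map mulr_sumr; apply: eq_bigr => p _; rewrite mulrA.
have PhiB c c' : nrm (Phi c - Phi c') <= M * nrm (lcomb v c - lcomb v c').
  have -> : Phi c - Phi c' = Phi (c ++ cscale (-1) c') by rewrite PhiD PhiZ mulN1r.
  by apply: (le_trans (hM _)); rewrite lcomb_cat lcomb_scale scaleN1r.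
pose G x : set_system (seq (R[i] * W)) :=
  [set P | exists2 e : R, 0 < e & forall c, nrm (x - lcomb v c) < e -> P c].
have PG x : ProperFilter (G x).
  apply: Build_ProperFilter => [[e e0 he]|].
    by have [c hc] := dv x e0; exact: he hc.
  split; first by exists 1.
    move=> P Q [e e0 he] [d d0 hd]; exists (Num.min e d); first by rewrite lt_min e0.
    by move=> c; rewrite lt_min => /andP[h1 h2]; split; [exact: he|exact: hd].
  by move=> P Q PQ [e e0 he]; exists e => // c /he /PQ.
pose U x := ultra_ext (G x).
have UU x : UltraFilter (U x) by have [] := ultra_extP (PG x).
have UG x : G x `<=` U x by have [] := ultra_extP (PG x).
pose psi x := ulim (U x) Phi.
have near x (e : R) : 0 < e -> U x [set c | nrm (x - lcomb v c) < e].
  by move=> e0; apply: UG; exists e.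
have psiP x : ucvg (U x) Phi (psi x).
  apply: (ulimP (M := M * (nrm x + 1))); apply: filterS (near x 1 ltr01) => c /= h.
  apply: (le_trans (hM c)); rewrite ler_wpM2l//.
  by apply: (le_trans (nrm_sub_le _ x)); rewrite lerD2l nrmB ltW.
have key x c : nrm (psi x - Phi c) <= M * nrm (x - lcomb v c).
  have PU : ProperFilter (U x) by exact: ultra_proper.
  apply: (@ucvg_le _ _ (U x) PU _ (fun c' => Phi c' - Phi c)).
    by apply: ucvgB => //; exact: ucvg_cst.
  move=> e e0; have d0 : 0 < e / (M + 1) by rewrite divr_gt0// ltr_wpDl.
  apply: filterS (near x _ d0) => c' /= h; apply: (le_trans (PhiB _ _)).
  apply: (@le_trans _ _ (M * (nrm (x - lcomb v c) + e / (M + 1)))).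
    rewrite ler_wpM2l// [leRHS]addrC; apply: (le_trans (nrm_dist _ x _)).
    by rewrite lerD2r nrmB ltW.
  rewrite mulrDr lerD2l mulrCA ler_piMr ?ltW// ltr_pdivrMr ?ltr_wpDl// mul1r ltrDl//.
have psi_lin (a : R[i]) x y : psi (a *: x + y) = a * psi x + psi y.
  apply/eqP; rewrite -subr_eq0; apply/eqP/nrm_small => e e0.
  pose C := 2 * (M * (nrm a + 1)) + 1.
  have C0 : 0 < C by rewrite ltr_wpDl// !mulr_ge0 ?addr_ge0 ?nrm_ge0.
  have d0 : 0 < e / C by rewrite divr_gt0.
  have [c hc] := dv x d0; have [c' hc'] := dv y d0.
  have -> : psi (a *: x + y) - (a * psi x + psi y) =
    (psi (a *: x + y) - Phi (cscale a c ++ c')) + (a * (Phi c - psi x) + (Phi c' - psi y)).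
    rewrite PhiD PhiZ; ring.
  apply: (le_trans (nrmD _ _)); apply: (@le_trans _ _ (C * (e / C))); last by rewrite mulrC divfK ?gt_eqF.
  have h1 : nrm (psi (a *: x + y) - Phi (cscale a c ++ c')) <= M * ((nrm a + 1) * (e / C)).
    apply: (le_trans (key _ _)); rewrite ler_wpM2l// lcomb_cat lcomb_scale opprD addrACA -scalerBr.
    apply: (le_trans (nrmD _ _)); rewrite nrmZ mulrDl mul1r lerD//; last exact: ltW.
    by rewrite ler_wpM2l ?nrm_ge0// ltW.
  have h2 : nrm (a * (Phi c - psi x) + (Phi c' - psi y)) <= M * ((nrm a + 1) * (e / C)).
    apply: (le_trans (nrmD _ _)); rewrite nrmM mulrDl mul1r mulrDr lerD//.
      rewrite mulrCA ler_wpM2l ?nrm_ge0// nrmB; apply: (le_trans (key _ _)).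
      by rewrite ler_wpM2l// ltW.
    by rewrite nrmB; apply: (le_trans (key _ _)); rewrite ler_wpM2l// ltW.
  apply: (le_trans (lerD h1 h2)); rewrite /C.
  have : 0 <= e / C by exact: ltW.
  by rewrite /C; nra.
have psi_b x : nrm (psi x) <= M * nrm x.
  by have := key x [::]; rewrite /Phi big_nil lcomb_nil !subr0.
have [z hz] := riesz psi_lin psi_b.
have phiE w : phi w = inner (v w) z.
  rewrite -hz; apply/eqP; rewrite eq_sym -subr_eq0; apply/eqP/nrm_small => e e0.
  have := key (v w) [:: (1, w)]; rewrite lcomb1 subrr nrm0 mulr0 /Phi big_seq1 mul1r.
  by move=> /le_trans; apply; exact: ltW.
exists z; split=> //; apply: nrm_le_inner => // y.
by rewrite inner_sym nrm_conj -hz.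
Qed.

(** Riesz is applied twice: first in the second variable, which represents each list by a vector,
    then in the first variable, which gives an operator S with b w w' = <v w, S (v w')>. The answer
    is the adjoint of S. *)
Lemma total_form_op (b : W -> W -> R[i]) (M : R) : 0 <= M ->
  (forall c c', nrm (\sum_(p <- c) \sum_(p' <- c') p.1 * (p'.1)^*%R * b p.2 p'.2) <=
     M * nrm (lcomb v c) * nrm (lcomb v c')) ->
  exists T : bounded_op H, (forall w w', inner (T (v w)) (v w') = b w w') /\ nrm T <= M.
Proof.
move=> M0 hM.
have ex_z c : exists z, (forall w', inner z (v w') = \sum_(p <- c) p.1 * b p.2 w') /\
    nrm z <= M * nrm (lcomb v c).
  have [||z [hz nz]] := @total_riesz (fun w' => (\sum_(p <- c) p.1 * b p.2 w')^*%R)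
      (M * nrm (lcomb v c)); first by rewrite mulr_ge0 ?nrm_ge0.
    move=> c'; apply: le_trans (hM c c'); rewrite -nrm_conj conj_sum exchange_big /=.
    rewrite le_eqVlt; apply/orP; left; apply/eqP; congr (nrm _); apply: eq_bigr => p' _.
    rewrite conjM cjK mulr_sumr; apply: eq_bigr => p _; ring.
  by exists z; split=> // w'; rewrite inner_sym -hz cjK.
have [z hz] := boolp.choice ex_z.
have zE c : z c = \sum_(p <- c) p.1 *: z [:: (1, p.2)].
  apply: total_extl => w; rewrite (hz c).1 inner_suml; apply: eq_bigr => p _.
  by rewrite innerZl (hz _).1 big_seq1 mul1r.
have ex_t y : exists t, (forall w, inner (z [:: (1, w)]) y = inner (v w) t) /\
    nrm t <= M * nrm y.
  apply: total_riesz; first by rewrite mulr_ge0 ?nrm_ge0.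
  move=> c; have -> : \sum_(p <- c) p.1 * inner (z [:: (1, p.2)]) y = inner (z c) y.
    by rewrite zE inner_suml; apply: eq_bigr => p _; rewrite innerZl.
  apply: (le_trans (inner_le _ _)); rewrite mulrAC ler_wpM2r ?nrm_ge0//.
  exact: (hz c).2.
have [t ht] := boolp.choice ex_t.
have tb : t \in @bounded_linear R H H.
  apply/asboolP; split; last by exists M => y; exact: (ht y).2.
  move=> a x y; apply: total_extr => w.
  by rewrite innerDr innerZr -!(ht _).1 innerDr innerZr.
pose S : bounded_op H := Bop tb.
exists (star S); split=> [w w'|]; last by rewrite nrm_star; apply: op_nrm_le => // y; exact: (ht y).2.
by rewrite -adjr /= -(ht (v w')).1 (hz _).1 big_seq1 mul1r.
Qed.

Lemma total_op (v' : W -> H) (M : R) : 0 <= M ->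
  (forall c, nrm (lcomb v' c) <= M * nrm (lcomb v c)) ->
  exists T : bounded_op H, (forall w, T (v w) = v' w) /\ nrm T <= M.
Proof.
move=> M0 hM; have [|T [hT nT]] := @total_form_op (fun w w' => inner (v' w) (v w')) M M0.
  move=> c c'; have -> : \sum_(p <- c) \sum_(p' <- c') p.1 * (p'.1)^*%R * inner (v' p.2) (v p'.2) =
      inner (lcomb v' c) (lcomb v c').
    rewrite inner_suml; apply: eq_bigr => p _; rewrite innerZl inner_sumr mulr_sumr.
    by apply: eq_bigr => p' _; rewrite innerZr mulrA.
  by apply: (le_trans (inner_le _ _)); rewrite ler_wpM2r ?nrm_ge0.
by exists T; split=> // w; apply: total_extl => w'; rewrite hT.
Qed.

End dense_families.

Section l2_operators.
Variables (R : realType) (I : choiceType) (V : complexHilbertType R).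
Local Notation K := (l2 I V).

Lemma l2E (f g : K) : (forall i, f i = g i) -> f = g.
Proof. by move=> h; apply: val_inj; apply/funext. Qed.

Lemma psum_one (f : I -> V) i s : (forall j, j != i -> f j = 0) ->
  psum f s <= nrm (f i) ^+ 2.
Proof.
move=> h; rewrite /psum; have [|si] := boolP (i \in undup s).
  move=> si; rewrite (bigD1_seq i) ?undup_uniq//= big1 ?addr0// => j /h ->.
  by rewrite nrm0 expr0n.
rewrite big_seq big1 ?sqr_ge0// => j js; rewrite h ?nrm0 ?expr0n//.
by apply: contraNneq si => <-.
Qed.

Fact single_summable i (x : V) :
  (fun j => if j == i then x else 0) \in @sqsummable R I V.
Proof.
apply/asboolP; exists (nrm x ^+ 2) => s.
have := @psum_one (fun j => if j == i then x else 0) i s; rewrite eqxx; apply.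
by move=> j /negPf ->.
Qed.

Definition single i x : K := L2 (single_summable i x).

Lemma singleE i x j : single i x j = if j == i then x else 0. Proof. by []. Qed.

Lemma singleD i x y : single i (x + y) = single i x + single i y.
Proof. by apply: l2E => j; rewrite /= /GRing.add /=; case: eqP; rewrite ?addr0. Qed.

Lemma singleZ i a x : single i (a *: x) = a *: single i x.
Proof. by apply: l2E => j; rewrite /= /GRing.scale /=; case: eqP; rewrite ?scaler0. Qed.

Lemma single0 i : single i 0 = 0.
Proof. by rewrite -(scale0r (0 : V)) singleZ scale0r. Qed.

Lemma inner_fin (f g : K) s : uniq s -> (forall i, i \notin s -> f i = 0) ->
  inner f g = \sum_(i <- s) inner (f i) (g i).
Proof.
move=> us hs; apply: (ucvg_uniq (l2_inner_cvg f g)).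
apply: ucvg_near (ucvg_cst _); apply: (@fin_ultra_tail _ _ s) => s' ss'.
rewrite [RHS](bigID (mem s)) /= [X in _ + X]big1 ?addr0; last first.
  by move=> i /hs ->; rewrite inner0l.
rewrite -[RHS]big_filter; apply: perm_big; apply: uniq_perm => //.
  by rewrite filter_uniq ?undup_uniq.
by move=> i; rewrite mem_filter mem_undup; case: (boolP (i \in s)) => //= /ss' ->.
Qed.

Lemma inner_single i x (f : K) : inner (single i x) f = inner x (f i).
Proof.
rewrite (@inner_fin _ _ [:: i])//.
  by rewrite big_seq1 singleE eqxx.
by move=> j; rewrite inE singleE => /negPf ->.
Qed.

Lemma inner_singler i x (f : K) : inner f (single i x) = inner (f i) x.
Proof. by rewrite inner_sym inner_single -inner_sym. Qed.

Lemma nrm_single i x : nrm (single i x) = nrm x.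
Proof.
apply/eqP; rewrite -(@eqrXn2 _ 2) ?nrm_ge0//; apply/eqP.
by rewrite -!Cre_inner_nrm inner_single singleE eqxx.
Qed.

Lemma l2_extr (f g : K) : (forall i x, inner (single i x) f = inner (single i x) g) -> f = g.
Proof.
by move=> h; apply: l2E => i; apply: inner_extr => x; have := h i x; rewrite !inner_single.
Qed.

Lemma ex_diag (T : I -> bounded_op V) (M : R) : 0 <= M -> (forall i, nrm (T i) <= M) ->
  exists D : bounded_op K, (forall f i, D f i = T i (f i)) /\ nrm D <= M.
Proof.
move=> M0 hM.
have ps (f : K) s : psum (fun i => T i (f i)) s <= (M * nrm f) ^+ 2.
  apply: (@le_trans _ _ (M ^+ 2 * psum f s)); last first.
    by rewrite exprMn ler_wpM2l ?sqr_ge0 ?l2_psum_le.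
  rewrite /psum mulr_sumr ler_sum// => i _.
  rewrite -exprMn ler_pXn2r ?nnegrE ?mulr_ge0 ?nrm_ge0//.
  by apply: (le_trans (op_le _ _)); rewrite ler_wpM2r ?nrm_ge0.
have sq (f : K) : (fun i => T i (f i)) \in @sqsummable R I V.
  by apply/asboolP; exists ((M * nrm f) ^+ 2).
have Db : (fun f => L2 (sq f)) \in @bounded_linear R K K.
  apply/asboolP; split.
    by move=> a f g; apply: l2E => i /=; rewrite linearP.
  exists M => f; apply: l2_nrm_le => [|r]; last exact: ps.
  by rewrite mulr_ge0 ?nrm_ge0.
exists (Bop Db); split=> //; apply: op_nrm_le => // f.
by apply: l2_nrm_le => [|r]; [rewrite mulr_ge0 ?nrm_ge0|exact: ps].
Qed.

Lemma star_diag (D : bounded_op K) (T : I -> bounded_op V) :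
  (forall f i, D f i = T i (f i)) -> forall f i, star D f i = star (T i) (f i).
Proof.
move=> h f i; apply: inner_extr => x; rewrite -inner_single adjr starK -adjl.
by rewrite -inner_single; congr (inner _ f); apply: l2E => j; rewrite h !singleE; case: eqP => [->|_]; rewrite ?linear0.
Qed.

End l2_operators.

Section finite_l2.
Variables (R : realType) (I : finType) (V : complexHilbertType R).
Local Notation K := (l2 I V).

Fact fin_summable (f : I -> V) : f \in @sqsummable R I V.
Proof.
apply/asboolP; exists (psum f (enum I)) => s.
by apply: psum_sub => i _; rewrite mem_enum.
Qed.

Definition fin_vec (f : I -> V) : K := L2 (fin_summable f).

Lemma fin_vecE f i : fin_vec f i = f i. Proof. by []. Qed.

Lemma inner_l2 (f g : K) : inner f g = \sum_i inner (f i) (g i).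
Proof.
rewrite (@inner_fin _ _ _ f g (enum I)) ?enum_uniq ?big_enum//.
by move=> i; rewrite mem_enum.
Qed.

Lemma nrm_l2 (f : K) : nrm f ^+ 2 = \sum_i nrm (f i) ^+ 2.
Proof.
by rewrite -Cre_inner_nrm inner_l2 Cre_sum; apply: eq_bigr => i _; rewrite Cre_inner_nrm.
Qed.

Lemma l2_single_sum (f : K) : f = \sum_i single i (f i).
Proof.
apply: l2_extr => i x; rewrite inner_sumr (bigD1 i)//= big1 ?addr0 ?inner_singler ?singleE ?eqxx//.
  by rewrite inner_single.
by move=> j ji; rewrite inner_singler singleE (negPf ji) inner0l.
Qed.

End finite_l2.

Section amplification.
Variables (R : realType) (V : complexHilbertType R) (n : nat).
Local Notation K := (l2 'I_n V).
Implicit Types x y : 'M[bounded_op V]_n.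

Fact amp_bounded x :
  (fun f : K => fin_vec (fun i => \sum_j x i j (f j))) \in @bounded_linear R K K.
Proof.
apply/asboolP; split.
  move=> a f g; apply: l2E => i /=; rewrite /GRing.add /GRing.scale /=.
  rewrite scaler_sumr -big_split; apply: eq_bigr => j _ /=.
  by rewrite -linearP.
exists (\sum_i \sum_j nrm (x i j)) => f.
rewrite {1}(l2_single_sum (fin_vec _)); apply: (le_trans (nrm_sum _ _ _)).
rewrite mulr_suml ler_sum// => i _; rewrite nrm_single fin_vecE mulr_suml.
apply: (le_trans (nrm_sum _ _ _)); rewrite ler_sum// => j _.
by apply: (le_trans (op_le _ _)); rewrite ler_wpM2l ?nrm_ge0 ?l2_coord_le.
Qed.

Definition amp x : bounded_op K := Bop (amp_bounded x).

Lemma ampE x f i : amp x f i = \sum_j x i j (f j). Proof. by []. Qed.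

Fact entry_bounded (T : bounded_op K) i j :
  (fun v : V => T (single j v) i) \in @bounded_linear R V V.
Proof.
apply/asboolP; split; first by move=> a u v; rewrite singleD singleZ linearP.
by exists (nrm T) => v; apply: (le_trans (l2_coord_le _ _)); rewrite -(nrm_single j v) op_le.
Qed.

Definition entries (T : bounded_op K) : 'M[bounded_op V]_n :=
  \matrix_(i, j) Bop (entry_bounded T i j).

Lemma entriesE T i j v : entries T i j v = T (single j v) i.
Proof. by rewrite mxE. Qed.

Lemma entriesK T : amp (entries T) = T.
Proof.
apply: bopE => f; apply: l2E => i; rewrite ampE [in RHS](l2_single_sum f) linear_sum.
under eq_bigr do rewrite entriesE.
elim/big_rec2: _ => [//|j u v _ ->]; by [].
Qed.

Lemma ampK x : entries (amp x) = x.
Proof.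
apply/matrixP => i j; apply: bopE => v; rewrite entriesE ampE (bigD1 j)//= eqxx.
rewrite big1 ?addr0// => k /negPf ->; exact: linear0.
Qed.

Lemma ampD x y : amp (x + y) = amp x + amp y.
Proof.
apply: bopE => f; apply: l2E => i; rewrite ampE /= /GRing.add /= -big_split /=.
by apply: eq_bigr => j _; rewrite mxE.
Qed.

Lemma ampN x : amp (- x) = - amp x.
Proof.
apply: bopE => f; apply: l2E => i; rewrite ampE /= /GRing.opp /= -sumrN.
by apply: eq_bigr => j _; rewrite mxE.
Qed.

Lemma ampZ a x : amp (map_mx ( *:%R a) x) = a *: amp x.
Proof.
apply: bopE => f; apply: l2E => i; rewrite ampE /= /GRing.scale /= scaler_sumr.
by apply: eq_bigr => j _; rewrite mxE.
Qed.

Lemma ampM x y : amp (mx_smul x y) = amp x * amp y.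
Proof.
apply: bopE => f; apply: l2E => i; rewrite ampE opME ampE.
transitivity (\sum_k \sum_j x i j (y j k (f k))).
  by apply: eq_bigr => k _; rewrite mxE op_sumE.
rewrite exchange_big; apply: eq_bigr => j _; rewrite ampE linear_sum.
by [].
Qed.

Lemma amp_star x : amp (mx_star x) = star (amp x).
Proof.
apply/esym/star_uniq => f g; rewrite !inner_l2.
transitivity (\sum_i \sum_j inner (x i j (f j)) (g i)).
  by apply: eq_bigr => i _; rewrite ampE inner_suml.
rewrite exchange_big; apply: eq_bigr => j _; rewrite ampE inner_sumr.
by apply: eq_bigr => i _; rewrite mxE adjl.
Qed.

Lemma amp_inj : injective amp.
Proof. by move=> x y h; rewrite -(ampK x) h ampK. Qed.

Lemma nrm_entry x i j : nrm (x i j) <= nrm (amp x).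
Proof.
apply: op_nrm_le => [|v]; first exact: nrm_ge0.
rewrite -{1}(ampK x) entriesE; apply: (le_trans (l2_coord_le _ _)).
by apply: (le_trans (op_le _ _)); rewrite nrm_single.
Qed.

Lemma amp_le x (M : R) : (forall i j, nrm (x i j) <= M) -> nrm (amp x) <= (n * n)%:R * M.
Proof.
move=> h; have M0 i j : 0 <= M := le_trans (nrm_ge0 (x i j)) (h i j).
have [i0|n0] := pickP (fun i : 'I_n => true); last first.
  have -> : amp x = 0.
    by apply: bopE => f; apply: l2E => i; have := n0 i.
  rewrite nrm0; have -> : n = 0%N.
    by case: (n) n0 => // m n0; have := n0 ord0.
  by rewrite mul0r.
move=> _; apply: op_nrm_le => [|f]; first by rewrite mulr_ge0 ?ler0n ?(M0 i0 i0).
rewrite (l2_single_sum (amp x f)); apply: (le_trans (nrm_sum _ _ _)).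
have -> : (n * n)%:R * M * nrm f = \sum_(i < n) \sum_(j < n) M * nrm f.
  by rewrite !sumr_const !card_ord -mulrnA -[RHS]mulr_natl mulrA.
rewrite ler_sum// => i _; rewrite nrm_single ampE.
apply: (le_trans (nrm_sum _ _ _)); rewrite ler_sum// => j _.
apply: (le_trans (op_le _ _)); apply: ler_pM; rewrite ?nrm_ge0//.
exact: l2_coord_le.
Qed.

Lemma amp_inner x f g : inner (amp x f) g = \sum_i \sum_j inner (x i j (f j)) (g i).
Proof. by rewrite inner_l2; apply: eq_bigr => i _; rewrite ampE inner_suml. Qed.

End amplification.

Section weighted_permutation.
Variables (R : realType) (T : choiceType) (a : T -> R[i]) (s : T -> T).
Hypotheses (a1 : forall t, nrm (a t) <= 1) (sK : involutive s).
Local Notation K := (l2 T (cplx R)).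

(** The single spins have this form: s flips one site and a is a sign. *)
Lemma ex_wperm : exists D : bounded_op K, forall f t, D f t = (a t * f (s t) : R[i]).
Proof.
have ps (f : K) r : psum (fun t => (a t * f (s t) : R[i]) : cplx R) r <= nrm f ^+ 2.
  apply: le_trans (l2_psum_le f [seq s t | t <- r]).
  rewrite /psum undup_map_inj ?big_map; last exact: inv_inj.
  rewrite ler_sum// => t _; rewrite ler_pXn2r ?nnegrE ?nrm_ge0//.
  have -> : nrm ((a t * f (s t) : R[i]) : cplx R) = nrm (a t) * nrm (f (s t)).
    exact: nrmM.
  by rewrite ler_piMl ?nrm_ge0.
have sq (f : K) : (fun t => (a t * f (s t) : R[i]) : cplx R) \in @sqsummable R T (cplx R).
  by apply/asboolP; exists (nrm f ^+ 2).
have Db : (fun f => L2 (sq f)) \in @bounded_linear R K K.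
  apply/asboolP; split.
    by move=> b f g; apply: l2E => t /=; rewrite /GRing.add /GRing.scale /= /GRing.scale /=; ring.
  by exists 1 => f; rewrite mul1r; apply: l2_nrm_le => [|r]; [exact: nrm_ge0|exact: ps].
by exists (Bop Db).
Qed.

Definition wperm : bounded_op K := projT1 (cid ex_wperm).

Lemma wpermE f t : wperm f t = (a t * f (s t) : R[i]).
Proof. by rewrite /wperm; case: cid. Qed.

Lemma star_wperm (D : bounded_op K) :
  (forall f t, D f t = ((a (s t))^*%R * f (s t) : R[i])) -> star wperm = D.
Proof.
move=> hD; apply: bopE => g; apply: l2_extr => i x; rewrite -adjl.
have -> : wperm (single i x) = single (s i) ((a (s i) * x : R[i]) : cplx R).
  apply: l2E => t; rewrite wpermE !singleE (can2_eq sK sK).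
  by case: eqP => [->//|_]; rewrite mulr0.
rewrite !inner_single !cplx_innerE hD conjM cjK; ring.
Qed.

End weighted_permutation.

(** * Positivity, square roots and inverses by iteration *)

Section positivity.
Variables (R : realType) (H : complexHilbertType R).
Implicit Types (S T k w : bounded_op H) (x y : H).

Definition psd T := star T = T /\ forall x, 0 <= Cre (inner (T x) x).

Lemma psd_starM T : psd (star T * T).
Proof.
split=> [|x]; first by rewrite star_opM starK.
by rewrite opME -adjr Cre_inner_nrm sqr_ge0.
Qed.

Lemma psdD S T : psd S -> psd T -> psd (S + T).
Proof.
move=> [s1 s2] [t1 t2]; split=> [|x]; first by rewrite starD s1 t1.
by rewrite opDE innerDl CreD addr_ge0.
Qed.

Lemma psdZ (a : R) T : 0 <= a -> psd T -> psd (a%:C *: T).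
Proof.
move=> a0 [t1 t2]; split=> [|x]; first by rewrite star_opZ conj_RC t1.
by rewrite opZE innerZl CreZ mulr_ge0.
Qed.

Lemma psd0 : psd 0.
Proof. by split=> [|x]; rewrite ?star0// op0E inner0l. Qed.

Lemma psd1 : psd 1.
Proof. by split=> [|x]; rewrite ?star1// op1E Cre_inner_nrm sqr_ge0. Qed.

Lemma psd_conj S T : psd S -> psd (star T * S * T).
Proof.
move=> [s1 s2]; split=> [|x]; first by rewrite !star_opM starK s1 mulrA.
by rewrite !opME -adjr; exact: s2.
Qed.

Lemma psd_sqr T : star T = T -> psd (T * T).
Proof. by move=> h; rewrite -{1}h; exact: psd_starM. Qed.

Lemma psd_sum (I : Type) (r : seq I) (F : I -> bounded_op H) :
  (forall i, psd (F i)) -> psd (\sum_(i <- r) F i).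
Proof.
move=> h; elim: r => [|i r IH]; first by rewrite big_nil; exact: psd0.
by rewrite big_cons; exact: psdD.
Qed.

Lemma psdX T n : psd T -> psd (T ^+ n).
Proof.
move=> hT; have sT := hT.1.
have sX m : star (T ^+ m) = T ^+ m by rewrite starX sT.
rewrite -(odd_double_half n) exprD -mul2n mulnC exprM expr2.
have [od|od] := boolP (odd n); last by rewrite expr0 mul1r; apply: psd_sqr.
have -> : T ^+ true * (T ^+ n./2 * T ^+ n./2) = star (T ^+ n./2) * T * T ^+ n./2.
  by rewrite sX expr1 mulrA -exprS -exprSr.
exact: psd_conj.
Qed.

Lemma psd_subP S T : star S = S -> star T = T ->
  (forall x, Cre (inner (S x) x) <= Cre (inner (T x) x)) -> psd (T - S).
Proof.
move=> s t h; split=> [|x]; first by rewrite starB s t.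
by rewrite opBE innerBl CreB subr_ge0.
Qed.

Lemma nrm_le1P T : nrm T <= 1 <-> psd (1 - star T * T).
Proof.
have E x : Cre (inner ((1 - star T * T) x) x) = nrm x ^+ 2 - nrm (T x) ^+ 2.
  by rewrite opBE op1E opME innerBl CreB -adjr !Cre_inner_nrm.
split=> [h|[_ h]].
  split=> [|x]; first by rewrite starB star1 star_opM starK.
  rewrite E subr_ge0 ler_pXn2r ?nnegrE ?nrm_ge0//.
  by apply: (le_trans (op_le _ _)); rewrite ler_piMl ?nrm_ge0.
apply: op_nrm_le => // x; rewrite mul1r -(@ler_pXn2r _ 2) ?nnegrE ?nrm_ge0//.
by rewrite -subr_ge0 -E.
Qed.

Lemma psd_1m T : star T = T -> nrm T <= 1 -> psd (1 - T).
Proof.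
move=> s h; split=> [|x]; first by rewrite starB star1 s.
rewrite opBE op1E innerBl CreB Cre_inner_nrm subr_ge0.
apply: (le_trans (ler_norm _)); apply: (le_trans (Cre_le_nrm _)).
apply: (le_trans (inner_le _ _)); rewrite expr2 ler_wpM2r ?nrm_ge0//.
by apply: (le_trans (op_le _ _)); rewrite ler_piMl ?nrm_ge0.
Qed.

(** Positivity of T tested at x - c^-1 T x, together with T <= c at the vector T x, gives |T x|^2 <=
    c <T x, x>. No spectral theory enters. *)
Lemma psd_nrm_le T (c : R) : 0 < c -> psd T -> psd (c%:C *: (1 : bounded_op H) - T) -> nrm T <= c.
Proof.
move=> c0 [s h] [_ h']; apply: op_nrm_le => [|x]; first exact: ltW.
have le y : Cre (inner (T y) y) <= c * nrm y ^+ 2.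
  have := h' y; rewrite opBE opZE op1E innerBl innerZl CreB CreZ Cre_inner_nrm.
  by rewrite subr_ge0.
have lT : T (x + (- c^-1)%:C *: T x) = T x + (- c^-1)%:C *: T (T x).
  by rewrite linearD linearZ.
have := h (x + (- c^-1)%:C *: T x).
rewrite lT innerDl !innerDr !innerZl !innerZr !CreD conj_RC !CreZ.
rewrite [inner (T (T x)) x]adjl s Cre_inner_nrm => h1.
have := le (T x); have := le x; move: h1.
set a := Cre _; set b := Cre _; set m := nrm _ ^+ 2; set nx := nrm x.
move=> h1 h2 h3; rewrite -(@ler_pXn2r _ 2) ?nnegrE ?mulr_ge0 ?nrm_ge0 ?(ltW c0)// -/m.
have h4 : - c^-1 * (- c^-1 * b) <= c^-1 * m.
  have -> : - c^-1 * (- c^-1 * b) = c^-1 * (c^-1 * b) by ring.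
  by rewrite ler_pM2l ?invr_gt0// ler_pdivrMl.
have : c^-1 * m <= a by lra.
rewrite ler_pdivrMl// => h5; apply: (le_trans h5).
by rewrite exprMn expr2 -mulrA ler_pM2l.
Qed.

End positivity.

Section banach_iteration.
Variables (R : realType) (V : completeNormedModType R[i]).

Lemma cauchy_bound (u : nat -> V) (c : nat -> R) :
  (forall n m, (n <= m)%N -> nrm (u m - u n) <= c n) ->
  (forall e, 0 < e -> exists N, forall n, (N <= n)%N -> c n < e) ->
  exists l, forall n, nrm (l - u n) <= c n.
Proof.
move=> hu hc.
have cu : cvg (u @ \oo).
  apply: cauchy_cvg; apply/cauchy_nrmP => e e0; have [N hN] := hc e e0.
  exists (u N); exists N => // n /= Nn; rewrite nrmB; apply: (le_lt_trans (hu _ _ Nn)).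
  exact: hN.
exists (lim (u @ \oo)) => n; rewrite nrmB; apply: (cvg_nrm_le _ cu).
by exists n => // m /= nm; rewrite nrmB; exact: hu.
Qed.

Definition nclosed (D : set V) :=
  forall x, (forall e : R, 0 < e -> exists2 y, D y & nrm (x - y) < e) -> D x.

Lemma closed_nclosed (D : set V) : closed D <-> nclosed D.
Proof.
split=> [cD x h|h].
  apply: cD => B /nbhs_ballP[e /= e0 hB].
  have er : e = (complex.Re e)%:C by rewrite RRe_real// gtr0_real.
  have e0' : 0 < complex.Re e by rewrite er ltcR in e0.
  have [y Dy hy] := h _ e0'; exists y; split=> //; apply: hB.
  by rewrite -ball_normE /= nrmE er ltcR.
move=> x cx; apply: h => e e0.
have /cx[y [Dy]] : nbhs x (ball x e%:C) by apply: nbhsx_ballx; rewrite ltcR.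
by rewrite -ball_normE /= nrmE ltcR => hy; exists y.
Qed.

(** The second clause transports properties to the fixed point: commutation, selfadjointness and
    membership in a subalgebra are closed conditions that hold at 0 and are stable under f. *)
Lemma contraction_fixpoint (f : V -> V) (th : R) : 0 <= th < 1 ->
  (forall x y, nrm (f x - f y) <= th * nrm (x - y)) ->
  exists l, f l = l /\ forall D : set V, nclosed D -> D 0 -> (forall x, D x -> D (f x)) -> D l.
Proof.
move=> /andP[th0 th1] hf; pose u n := iter n f 0; pose C := nrm (f 0) / (1 - th).
have t1 : 0 < 1 - th by rewrite subr_gt0.
have d n : nrm (u n.+1 - u n) <= th ^+ n * nrm (f 0).
  elim: n => [|n IH]; first by rewrite expr0 mul1r subr0.
  by apply: (le_trans (hf _ _)); rewrite exprS -mulrA ler_wpM2l.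
have C0 : 0 <= C by rewrite divr_ge0 ?nrm_ge0// ltW.
have hu n m : (n <= m)%N -> nrm (u m - u n) <= th ^+ n * C.
  move=> /subnK <-; move: (m - n)%N => k {m}; elim: k n => [|k IH] n.
    by rewrite add0n subrr nrm0 mulr_ge0 ?exprn_ge0.
  rewrite addSnnS; apply: (le_trans (nrm_dist _ (u n.+1) _)).
  apply: (le_trans (lerD (IH _) (d n))).
  rewrite exprSr -mulrA -mulrDr ler_wpM2l ?exprn_ge0//.
  have -> : nrm (f 0) = (1 - th) * C by rewrite /C mulrC divfK// gt_eqF.
  by rewrite -mulrDl; rewrite addrC subrK mul1r.
have [e e0|l hl] := cauchy_bound hu.
  have c1 : 0 < C + 1 by rewrite ltr_wpDl.
  have [N hN] : exists N, th ^+ N < e / (C + 1).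
    have : th ^+ n @[n --> \oo] --> 0 by apply: cvg_expr; rewrite ger0_norm.
    move=> /cvgrPdist_lt/(_ (e / (C + 1)))[|N _ hN]; first by rewrite divr_gt0.
    exists N; have := hN N (leqnn N) => /=; rewrite sub0r normrN ger0_norm ?exprn_ge0//.
  exists N => n Nn; apply: (@le_lt_trans _ _ (th ^+ N * C)).
    by rewrite ler_wpM2r// ler_wiXn2l ?th0// ltW.
  apply: (@le_lt_trans _ _ (th ^+ N * (C + 1))); first by rewrite ler_wpM2l ?exprn_ge0// lerDl.
  by rewrite -ltr_pdivlMr.
have small e : 0 < e -> exists N, nrm (l - u N) < e /\ nrm (l - u N.+1) < e.
  move=> e0; have c1 : 0 < C + 1 by rewrite ltr_wpDl.
  have [N hN] : exists N, th ^+ N < e / (C + 1).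
    have : th ^+ n @[n --> \oo] --> 0 by apply: cvg_expr; rewrite ger0_norm.
    move=> /cvgrPdist_lt/(_ (e / (C + 1)))[|N _ hN]; first by rewrite divr_gt0.
    exists N; have := hN N (leqnn N) => /=; rewrite sub0r normrN ger0_norm ?exprn_ge0//.
  have h : th ^+ N * C < e.
    apply: (@le_lt_trans _ _ (th ^+ N * (C + 1))); first by rewrite ler_wpM2l ?exprn_ge0// lerDl.
    by rewrite -ltr_pdivlMr.
  exists N; split; apply: le_lt_trans h => //; apply: (le_trans (hl _)).
  by rewrite ler_wpM2r// exprS ler_piMl ?exprn_ge0// ltW.
exists l; split=> [|D cD D0 Df].
  apply/eqP; rewrite -subr_eq0; apply/eqP/nrm_small => e e0.
  have e2 : 0 < e / 2 by rewrite divr_gt0.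
  have [N [h1 h2]] := small _ e2; apply: (le_trans (nrm_dist _ (u N.+1) _)).
  rewrite (splitr e) lerD//; last by rewrite nrmB ltW.
  apply: (le_trans (hf _ _)); apply: le_trans (ltW h1).
  by rewrite ler_piMl ?nrm_ge0// ltW.
have Du n : D (u n) by elim: n => [//|n IH]; exact: Df.
by apply: cD => e /small[N [h _]]; exists (u N).
Qed.

End banach_iteration.

Section functional_calculus.
Variables (R : realType) (H : complexHilbertType R).
Implicit Types (S T k w y r z : bounded_op H).

Lemma op_cauchy_bound (u : nat -> bounded_op H) (c : nat -> R) :
  (forall n m, (n <= m)%N -> nrm (u m - u n) <= c n) ->
  (forall e, 0 < e -> exists N, forall n, (N <= n)%N -> c n < e) ->
  exists l : bounded_op H, forall n, nrm (l - u n) <= c n.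
Proof. exact: cauchy_bound. Qed.

Definition opclosed (D : set (bounded_op H)) := forall x : bounded_op H,
  (forall e : R, 0 < e -> exists2 y : bounded_op H, D y & nrm (x - y) < e) -> D x.

Lemma closed_opclosed (D : set (bounded_op H)) : closed D <-> opclosed D.
Proof. exact: closed_nclosed. Qed.

Lemma op_contraction (f : bounded_op H -> bounded_op H) (th : R) : 0 <= th < 1 ->
  (forall x y : bounded_op H, nrm (f x - f y) <= th * nrm (x - y)) ->
  exists l : bounded_op H, f l = l /\
    forall D : set (bounded_op H), opclosed D -> D 0 -> (forall x, D x -> D (f x)) -> D l.
Proof. exact: contraction_fixpoint. Qed.

Definition subalg (D : set (bounded_op H)) :=
  [/\ D 0, forall (a : R[i]) x y, D x -> D y -> D (a *: x + y),
      forall x y, D x -> D y -> D (x * y), forall x, D x -> D (star x) & opclosed D].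

Lemma cstar_subalgebraP D : cstar_subalgebra D <-> subalg D.
Proof.
by split=> -[h1 h2 h3 h4 /closed_opclosed h5]; split.
Qed.

Lemma subalgD D S T : subalg D -> D S -> D T -> D (S + T).
Proof. by move=> [_ h _ _ _] hS hT; rewrite -[S]scale1r; exact: h. Qed.
Lemma subalgZ D a T : subalg D -> D T -> D (a *: T).
Proof. by move=> [h0 h _ _ _] hT; rewrite -[_ *: _]addr0; exact: h. Qed.
Lemma subalgN D T : subalg D -> D T -> D (- T).
Proof. by move=> hD hT; rewrite -scaleN1r; exact: subalgZ. Qed.
Lemma subalgB D S T : subalg D -> D S -> D T -> D (S - T).
Proof. by move=> hD hS hT; apply: subalgD => //; exact: subalgN. Qed.
Lemma subalg_sum D (I : Type) (s : seq I) (F : I -> bounded_op H) :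
  subalg D -> (forall i, D (F i)) -> D (\sum_(i <- s) F i).
Proof.
move=> hD hF; elim: s => [|i s IH]; first by rewrite big_nil; case: hD.
by rewrite big_cons; exact: subalgD.
Qed.
Lemma subalgXS D T n : subalg D -> D T -> D (T ^+ n.+1).
Proof.
move=> hD hT; elim: n => [//|n IH]; rewrite exprS; case: hD => _ _ h _ _; exact: h.
Qed.

Lemma opclosed_commute z : opclosed [set x : bounded_op H | z * x = x * z].
Proof.
move=> x h; apply/eqP; rewrite -subr_eq0; apply/eqP/nrm_small => e e0.
have d0 : 0 < e / (2 * nrm z + 1) by rewrite divr_gt0// ltr_wpDl// mulr_ge0// nrm_ge0.
have [y /= hy hxy] := h _ d0.
have -> : z * x - x * z = z * (x - y) - (x - y) * z.
  by rewrite mulrBr mulrBl hy opprB addrA subrK.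
apply: (le_trans (nrmBD _ _)).
have h1 := nrm_opM z (x - y); have h2 := nrm_opM (x - y) z.
have h3 : nrm z * nrm (x - y) <= nrm z * (e / (2 * nrm z + 1)) by rewrite ler_wpM2l ?nrm_ge0// ltW.
apply: (@le_trans _ _ (2 * nrm z * (e / (2 * nrm z + 1)))).
  by rewrite [nrm (x - y) * _]mulrC in h2; lra.
rewrite mulrA ler_pdivrMr; first by rewrite mulrC ler_wpM2l ?lerDl// ltW.
by rewrite ltr_wpDl// mulr_ge0// nrm_ge0.
Qed.

Lemma opclosed_sadj : opclosed [set x : bounded_op H | star x = x].
Proof.
move=> x h; apply/eqP; rewrite -subr_eq0; apply/eqP/nrm_small => e e0.
have e2 : 0 < e / 2 by rewrite divr_gt0.
have [y /= hy hxy] := h _ e2.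
apply: (le_trans (nrm_dist _ y _)); rewrite -{1}hy -starB nrm_star (splitr e).
by rewrite lerD// ?(nrmB y) ltW.
Qed.

Lemma opclosed_mul (D : set (bounded_op H)) z : opclosed D ->
  opclosed [set x : bounded_op H | D (x * z)].
Proof.
move=> cD x h; apply: cD => e e0.
have d0 : 0 < e / (nrm z + 1) by rewrite divr_gt0// ltr_wpDl// nrm_ge0.
have [y /= hy hxy] := h _ d0; exists (y * z) => //; rewrite -mulrBl.
apply: (le_lt_trans (nrm_opM _ _)).
apply: (@le_lt_trans _ _ (e / (nrm z + 1) * nrm z)); first by rewrite ler_wpM2r ?nrm_ge0// ltW.
rewrite mulrAC ltr_pdivrMr ?ltr_wpDl ?nrm_ge0// ltr_pM2l// ltrDl//.
Qed.

(* [1 - r] is a square root of [1 - y]: the iteration r <- (y + r^2)/2 is dominated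
   by the scalar iteration for y = 1, which increases to 1. *)
Lemma ex_sqrt1m y : nrm y <= 1 -> star y = y -> exists r,
  [/\ nrm r <= 1, star r = r, (1 - r) * (1 - r) = 1 - y &
      forall D : set (bounded_op H), opclosed D -> D 0 ->
        (forall x, D x -> D (2^-1%:C *: (y + x * x))) -> D r].
Proof.
move=> y1 sy.
pose f x := 2^-1%:C *: (y + x * x).
have fB (a b : bounded_op H) : b * a = a * b -> f a - f b = 2^-1%:C *: ((a - b) * (a + b)).
  move=> ba; rewrite /f -scalerBr opprD addrACA subrr add0r; congr (_ *: _).
  by rewrite mulrBl !mulrDr ba opprD addrA addrK.
have [u [u0 uS]] : exists u : nat -> bounded_op H, u 0 = 0 /\ forall n, u n.+1 = f (u n).
  by exists (fun n => iter n f 0).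
pose rho n : R := iter n (fun t => (1 + t ^+ 2) / 2) 0.
have rho01 n : 0 <= rho n <= 1.
  elim: n => [|n /andP[h1 h2]] /=; first by rewrite lexx ler01.
  have : rho n ^+ 2 <= 1 by rewrite expr_le1.
  by have := sqr_ge0 (rho n); rewrite /rho /=; lra.
(* The gap g = 1 - rho n evolves by g - g^2/2, and 2/(n+2) is a supersolution of this recursion. *)
have gap n : 1 - rho n <= 2 / n.+2%:R.
  elim: n => [|n IH]; first by rewrite /rho /= subr0 divff.
  have -> : 1 - rho n.+1 = (1 - rho n) * (1 - (1 - rho n) / 2) by rewrite /rho /=; field.
  set g := 1 - rho n in IH *.
  have [g0 g1] : 0 <= g /\ g <= 1 by have := rho01 n; rewrite /g; lra.
  have n2 : 0 < n.+2%:R :> R by rewrite ltr0n.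
  have n3 : 0 < n.+3%:R :> R by rewrite ltr0n.
  set x := 2 / n.+2%:R in IH *.
  have x1 : x <= 1 by rewrite /x ler_pdivrMr// mul1r ler_nat.
  apply: (@le_trans _ _ (x * (1 - x / 2))); first by nra.
  have -> : x * (1 - x / 2) = 2 * n.+1%:R / n.+2%:R ^+ 2.
    have n20 : n.+1%:R + 1 != 0 :> R by rewrite natr1 gt_eqF.
    by rewrite /x -[n.+2%:R]natr1; field.
  rewrite ler_pdivrMr ?exprn_gt0// mulrAC ler_pdivlMr// -mulrA ler_pM2l//.
  rewrite -[n.+3]addn2 -[n.+2]addn1 !natrD; have := ler0n R n.+1; nra.
have comm z n : z * y = y * z -> z * u n = u n * z.
  move=> zy; elim: n => [|n IH]; first by rewrite u0 mulr0 mul0r.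
  by rewrite uS /f opZr opZl mulrDr mulrDl zy mulrA IH -mulrA IH mulrA.
have uy n : u n * y = y * u n by apply/esym/comm.
have uu n m : u m * u n = u n * u m by exact: comm.
have half : nrm (2^-1%:C : R[i]) = 2^-1 by rewrite nrmC ger0_norm.
have nu n : nrm (u n) <= rho n.
  elim: n => [|n IH]; first by rewrite u0 nrm0.
  have -> : rho n.+1 = 2^-1 * (1 + rho n ^+ 2) by rewrite mulrC.
  rewrite uS /f nrmZ half ler_pM2l//.
  apply: (le_trans (nrmD _ _)); rewrite lerD//.
  by apply: (le_trans (nrm_opM _ _)); rewrite expr2 ler_pM ?nrm_ge0.
(* Differences of iterates factor as half of difference times sum, because all u n commute; the
   scalar iteration factors in the same way and dominates. *)
have du n m : nrm (u (n + m)%N - u n) <= rho (n + m)%N - rho n.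
  elim: n => [|n IH]; first by rewrite add0n u0 !subr0.
  rewrite addSn !uS (fB _ _ (uu (n + m)%N n)) /rho /= -/(rho n) -/(rho (n + m)%N) nrmZ half.
  have h1 : nrm ((u (n + m)%N - u n) * (u (n + m)%N + u n)) <=
     (rho (n + m)%N - rho n) * (rho (n + m)%N + rho n).
    apply: (le_trans (nrm_opM _ _)); rewrite ler_pM ?nrm_ge0//.
    by apply: (le_trans (nrmD _ _)); rewrite lerD.
  have -> : (1 + rho (n + m)%N ^+ 2) / 2 - (1 + rho n ^+ 2) / 2 =
     2^-1 * ((rho (n + m)%N - rho n) * (rho (n + m)%N + rho n)) by field.
  by rewrite ler_pM2l.
have [n m nm|e e0|r hr] := @op_cauchy_bound u (fun n => 1 - rho n).
- rewrite -(subnKC nm); apply: (le_trans (du _ _)).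
  by have := rho01 (n + (m - n))%N; lra.
- have [N _ hN] : \forall n \near \oo, n.+1%:R^-1 < e / 2 :> R.
    have e2 : 0 < e / 2 by rewrite divr_gt0.
    exact: near_infty_natSinv_lt (PosNum e2).
  exists N => n Nn; apply: (le_lt_trans (gap n)).
  have := hN n.+1 (leq_trans Nn (leqnSn _)); rewrite /= => h; rewrite mulrC -ltr_pdivlMr//.
have small e : 0 < e -> exists n, nrm (r - u n) < e /\ nrm (r - u n.+1) < e.
  move=> e0; have [N _ hN] : \forall n \near \oo, n.+1%:R^-1 < e / 2 :> R.
    have e2 : 0 < e / 2 by rewrite divr_gt0.
    exact: near_infty_natSinv_lt (PosNum e2).
  have h n : (N <= n)%N -> nrm (r - u n) < e.
    move=> Nn; apply: (le_lt_trans (hr n)); apply: (le_lt_trans (gap n)).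
    have := hN n.+1 (leq_trans Nn (leqnSn _)); rewrite /= => h; rewrite mulrC -ltr_pdivlMr//.
  by exists N; split; apply: h.
have rD (D : set (bounded_op H)) : opclosed D -> D 0 ->
    (forall x, D x -> D (2^-1%:C *: (y + x * x))) -> D r.
  move=> cD D0 Df; have Du n : D (u n) by elim: n => [|n IH]; rewrite ?u0// uS; exact: Df.
  by apply: cD => e /small[n [h _]]; exists (u n).
have comm_r z : z * y = y * z -> z * r = r * z.
  move=> zy; apply: (rD _ (@opclosed_commute z)); first by rewrite /= mulr0 mul0r.
  move=> x /= hx; rewrite opZr opZl mulrDr mulrDl zy; congr (_ *: (_ + _)).
  by rewrite mulrA hx -mulrA hx mulrA.
have nr : nrm r <= 1.
  apply/ler_addgt0Pr => e /small[n [h _]]; apply: (le_trans (nrm_sub_le _ (u n))).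
  by rewrite lerD ?(ltW h)//; apply: (le_trans (nu n)); have := rho01 n; lra.
exists r; split=> //.
- apply: (rD _ opclosed_sadj); first by rewrite /= star0.
  by move=> x /= sx; rewrite star_opZ conj_RC starD star_opM sx sy.
suff e : r + r = y + r * r.
  have e' : r * r = r + r - y by rewrite e addrAC subrr add0r.
  have e2 : r + r - y - r = r - y by rewrite addrAC addrK.
  by rewrite mulrBl mul1r mulrBr mulr1 e' opprB e2 addrA subrK.
have fr : f r = r.
  apply/eqP; rewrite -subr_eq0; apply/eqP/nrm_small => e e0.
  have e2 : 0 < e / 2 by rewrite divr_gt0.
  have [n [h1 h2]] := small _ e2.
  apply: (le_trans (nrm_dist _ (u n.+1) _)); rewrite (splitr e).
  apply: lerD; last by rewrite nrmB; exact: ltW h2.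
  rewrite uS (fB _ _ (comm_r (u n) (uy n))) nrmZ half.
  have un1 : nrm (u n) <= 1 by apply: (le_trans (nu n)); case/andP: (rho01 n).
  move: (u n) un1 h1 => w w1 h1.
  have h3 : nrm ((r - w) * (r + w)) <= e / 2 * (1 + 1).
    apply: (le_trans (nrm_opM _ _)).
    apply: ler_pM; [exact: nrm_ge0|exact: nrm_ge0|exact: ltW|].
    by apply: (le_trans (nrmD _ _)); exact: lerD.
  by move: h3; lra.
by rewrite -{1 2}fr /f -scalerDl -RCD (_ : 2^-1 + 2^-1 = 1 :> R) ?scale1r//; lra.
Qed.

(** The complement v = 1 - w solves (1 + |k|) v = k + (|k| - k) v, and positivity of k gives | |k| -
    k | <= |k|, so the map is a contraction of ratio |k| / (1 + |k|). It is stated for 1 - w because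
    this element lies in every closed algebra containing k, with or without a unit. *)
Lemma ex_inv1p k : psd k -> exists w, [/\ (1 + k) * w = 1, w * (1 + k) = 1,
  nrm w <= 1, star w = w &
  (forall D, subalg D -> D k -> D (1 - w)) /\ (forall z, z * k = k * z -> z * w = w * z)].
Proof.
move=> [sk pk].
pose c : R := 1 + nrm k.
have c0 : 0 < c by rewrite ltr_wpDr ?nrm_ge0.
pose z : bounded_op H := (nrm k)%:C *: (1 : bounded_op H) - k.
have nz : nrm z <= nrm k.
  have [k0|k0] := eqVneq (nrm k) 0.
    by rewrite /z (nrm_eq0 k0) nrm0 scale0r subrr nrm0.
  have kp : 0 < nrm k by rewrite lt_def k0 nrm_ge0.
  apply: psd_nrm_le => //; last by rewrite /z opprB addrC subrK; split.
  have -> : z = (nrm k)%:C *: (1 - (nrm k)^-1%:C *: k).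
    by rewrite scalerBr scalerA -RCM divff// scale1r.
  apply: psdZ; first exact: ltW.
  apply: psd_1m; first by rewrite star_opZ conj_RC sk.
  by rewrite nrmZ nrmC ger0_norm ?invr_ge0 ?nrm_ge0// mulVf.
pose f v := c^-1%:C *: (k + z * v).
have [||v [fv vD]] := @op_contraction f (nrm k / c).
- by rewrite divr_ge0 ?nrm_ge0 ?(ltW c0)//= ltr_pdivrMr// mul1r /c ltrDr.
- move=> x y; rewrite /f -scalerBr opprD addrACA subrr add0r -mulrBr nrmZ nrmC.
  rewrite ger0_norm ?invr_ge0 ?(ltW c0)// [nrm k / c]mulrC -mulrA ler_pM2l ?invr_gt0//.
  by apply: (le_trans (nrm_opM _ _)); rewrite ler_wpM2r ?nrm_ge0.
have vz y : y * k = k * y -> y * v = v * y.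
  move=> yk; apply: (vD _ (@opclosed_commute y)); first by rewrite /= mulr0 mul0r.
  move=> x /= hx; change (y * f x = f x * y).
  rewrite /f opZr opZl [y * (_ + _)]mulrDr [(_ + _) * y]mulrDl yk; congr (_ *: (_ + _)).
  have yz : y * z = z * y by rewrite /z mulrBr mulrBl opZr opZl mulr1 mul1r yk.
  by rewrite mulrA yz -mulrA hx mulrA.
have sv : star v = v.
  have : star v = v /\ k * v = v * k.
    split; last exact: vz.
    have := vD [set x | star x = x /\ k * x = x * k]; case.
    + move=> x h; split.
        by apply: opclosed_sadj => e /h[y [h1 h2] h3]; exists y.
      by apply: opclosed_commute => e /h[y [h1 h2] h3]; exists y.
    + by rewrite /= star0 mulr0 mul0r.
    + move=> x /= [h1 h2]; rewrite /f star_opZ conj_RC starD star_opM sk h1.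
      rewrite opZr opZl [k * (_ + _)]mulrDr [(_ + _) * k]mulrDl.
      have sz : star z = z by rewrite /z starB star_opZ conj_RC star1 sk.
      have xz : x * z = z * x by rewrite /z mulrBr mulrBl opZr opZl mulr1 mul1r h2.
      have kz : k * z = z * k by rewrite /z mulrBr mulrBl opZr opZl mulr1 mul1r.
      by rewrite sz xz mulrA kz -mulrA h2 mulrA.
    by [].
  by case.
have cv : c%:C *: v = k + z * v.
  by rewrite -{1}fv /f scalerA -RCM divff ?gt_eqF// scale1r.
have kv : v + k * v = k.
  move: cv; rewrite /z mulrBl opZl mul1r /c RCD scalerDl scale1r addrCA => /eqP.
  rewrite [X in X == _]addrC (inj_eq (addrI _)) => /eqP e.
  by rewrite {1}e subrK.
have e1 : (1 + k) * (1 - v) = 1.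
  by rewrite mulrBr mulr1 mulrDl mul1r kv addrK.
have comm : (1 + k) * (1 - v) = (1 - v) * (1 + k).
  have kv' := vz k erefl.
  by rewrite mulrBr mulrBl !mulr1 mul1r mulrDl mulrDr mul1r mulr1 kv'.
exists (1 - v); split=> //.
- by rewrite -comm.
- apply: op_nrm_le => // x; rewrite mul1r.
  set u := (1 - v) x.
  have xu : x = u + k u by exact: esym (congr1 (fun T : bounded_op H => T x) e1).
  have h : nrm u ^+ 2 <= Cre (inner x u).
    by rewrite [in inner x u]xu innerDl CreD Cre_inner_nrm lerDl.
  have h2 : Cre (inner x u) <= nrm x * nrm u.
    by apply: (le_trans (ler_norm _)); apply: (le_trans (Cre_le_nrm _)); exact: inner_le.
  have [->|u0] := eqVneq (nrm u) 0; first exact: nrm_ge0.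
  have up : 0 < nrm u by rewrite lt_def u0 nrm_ge0.
  by rewrite -(ler_pM2r up) -expr2; exact: le_trans h h2.
- by rewrite starB star1 sv.
split=> [D hD Dk|y yk]; last by rewrite mulrBr mulrBl mulr1 mul1r vz.
rewrite opprB addrC subrK; have [h0 h1 h2 h3 h4] := hD.
apply: vD => // x Dx; rewrite /f; apply: subalgZ => //; apply: subalgD => //.
rewrite /z mulrBl opZl mul1r; apply: subalgB => //; first exact: subalgZ.
exact: h2.
Qed.

End functional_calculus.

Lemma resolvent_iter (A : pzRingType) (h w k m : A) n : h * w = w * h ->
  h * m = (1 + k) * m -> w * (1 + k) = 1 -> m = h ^+ n * (w ^+ n * m).
Proof.
move=> hw hm wk; rewrite mulrA -exprMn_comm//.
have e : h * w * m = m by rewrite hw -mulrA hm mulrA wk mul1r.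
by elim: n => [|n IH]; rewrite ?expr0 ?mul1r// exprS -mulrA -IH e.
Qed.

(** * Uniqueness of C*-norms, on operators and on matrices *)

Section uniqueness_of_cstar_norms.
Variables (R : realType) (H : complexHilbertType R).
Variables (D : set (bounded_op H)) (N : bounded_op H -> R).
Hypotheses (hD : subalg D)
  (N0 : forall x, D x -> N x = 0 -> x = 0)
  (ND : forall x y, D x -> D y -> N (x + y) <= N x + N y)
  (NZ : forall (a : R[i]) x, D x -> N (a *: x) = nrm a * N x)
  (NM : forall x y, D x -> D y -> N (x * y) <= N x * N y)
  (NS : forall x, D x -> N (star x * x) = N x ^+ 2).
Implicit Types (x y T h : bounded_op H).

Let DM x y : D x -> D y -> D (x * y). Proof. by case: hD => _ _ h _ _; exact: h. Qed.
Let Dstar x : D x -> D (star x). Proof. by case: hD => _ _ _ h _; exact: h. Qed.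
Let D0 : D 0. Proof. by case: hD. Qed.

Let N00 : N 0 = 0.
Proof. by rewrite -(scale0r (0 : bounded_op H)) NZ// nrm0 mul0r. Qed.

Let N_ge0 x : D x -> 0 <= N x.
Proof.
move=> Dx; have : N (x + (-1) *: x) <= N x + N ((-1) *: x) by apply: ND => //; exact: subalgZ.
rewrite scaleN1r subrr N00 -scaleN1r NZ// nrmN nrm1 mul1r; lra.
Qed.

(** The two-sided multipliers would serve as well; what matters is that D may lack a unit, so that
    square roots and unitaries live in this closed unital algebra and act on D from the left. *)
Let M : set (bounded_op H) := [set T | forall d, D d -> D (T * d) /\ D (star T * d)].

Let Dclosed : opclosed D. Proof. by case: hD. Qed.
Let DMm x : D x -> M x.
Proof. by move=> Dx d Dd; split; apply: DM => //; exact: Dstar. Qed.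
Let M1 : M 1. Proof. by move=> d Dd; rewrite star1 mul1r. Qed.
Let subM : subalg M.
Proof.
split.
- by move=> d Dd; rewrite star0 mul0r.
- move=> a x y Mx My d Dd; have [h1 h2] := Mx _ Dd; have [h3 h4] := My _ Dd.
  rewrite starD star_opZ !mulrDl !opZl.
  by split; (apply: subalgD => //; apply: subalgZ).
- move=> x y Mx My d Dd; rewrite star_opM -!mulrA.
  by split; [apply: (Mx _ (My _ Dd).1).1|apply: (My _ (Mx _ Dd).2).2].
- by move=> x Mx d Dd; have [h1 h2] := Mx _ Dd; rewrite starK.
move=> T hT d Dd; split; apply: (opclosed_mul (D := D) (z := d) Dclosed).
  by move=> e /hT[y My hy]; exists y => //; exact: (My _ Dd).1.
move=> e /hT[y My hy]; exists (star y); first exact: (My _ Dd).2.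
by rewrite -starB nrm_star.
Qed.
Let Mclosed : opclosed M. Proof. by case: subM. Qed.
Let M0 : M 0. Proof. by case: subM. Qed.
Let MM x y : M x -> M y -> M (x * y). Proof. by case: subM => _ _ h _ _; exact: h. Qed.
Let MD x y : M x -> M y -> M (x + y). Proof. exact: (subalgD subM). Qed.
Let MZ (a : R[i]) x : M x -> M (a *: x). Proof. exact: (subalgZ _ subM). Qed.
Let MB x y : M x -> M y -> M (x - y). Proof. exact: (subalgB subM). Qed.
Let MX x n : M x -> M (x ^+ n).
Proof. by move=> h; elim: n => [|n IH]; rewrite ?expr0// exprS; exact: MM. Qed.

(* A selfadjoint contraction is the mean of the two unitaries a +- i sqrt(1 - a^2). *)
Let N_le1 a : D a -> star a = a -> nrm a <= 1 -> N a <= 1.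
Proof.
move=> Da sa a1.
have [||r [r1 sr re rD]] := @ex_sqrt1m _ _ (a * a).
- by apply: (le_trans (nrm_opM _ _)); rewrite -[1]mul1r ler_pM ?nrm_ge0.
- by rewrite star_opM sa.
set s := 1 - r in re.
have ss : star s = s by rewrite /s starB star1 sr.
have Mr : M r.
  apply: (rD _ Mclosed M0) => x Mx; apply/MZ/MD; last exact: MM.
  by apply: MM; exact: DMm.
have Ms : M s by exact: MB.
have sa_comm : a * s = s * a.
  rewrite /s mulrBr mulrBl mulr1 mul1r; congr (_ - _).
  apply: (rD _ (@opclosed_commute _ _ a)); first by rewrite /= mulr0 mul0r.
  move=> x /= hx; rewrite opZr opZl mulrDr mulrDl -mulrA; congr (_ *: (_ + _)).
  by rewrite mulrA hx -mulrA hx mulrA.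
pose ii : R[i] := 0 +i* 1.
have i2 : ii * ii = -1.
  by apply/eqP; rewrite eq_complex /=; apply/andP; split; apply/eqP; ring.
have ic : (ii^*)%R = - ii by apply/eqP; rewrite eq_complex /= oppr0 !eqxx.
pose u := a + ii *: s; pose u' := a - ii *: s.
have uu' : u' * u = 1.
  rewrite /u /u' mulrBl !mulrDr !opZl !opZr scalerA i2 scaleN1r sa_comm re.
  by rewrite opprB addrACA subrr addr0 addrC subrK.
have u'u : u * u' = 1.
  rewrite /u /u' mulrDl !mulrBr !opZl !opZr scalerA i2 scaleN1r sa_comm re.
  by rewrite addrA subrK opprK addrC subrK.
have su : star u = u'.
  rewrite /u starD sa star_opZ ss /u'; congr (_ + _).
  by rewrite ic scaleNr.
have su' : star u' = u by rewrite -su starK.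
have Mu : M u by apply: MD; [exact: DMm|exact: MZ].
have Mu' : M u' by apply: MB; [exact: DMm|exact: MZ].
(* Multiplication by a unitary multiplier preserves N by the C*-identity alone: the product of v d
   with its adjoint on the left is that of d. *)
have iso v w d : M v -> star v = w -> w * v = 1 -> D d -> N (v * d) = N d.
  move=> Mv sv wv Dd; have Dvd := (Mv _ Dd).1.
  apply/eqP; rewrite -(@eqrXn2 _ 2) ?N_ge0//; apply/eqP.
  by rewrite -!NS// star_opM sv mulrA -[_ * w * v]mulrA wv mulr1.
have h d : D d -> N (a * d) <= N d.
  move=> Dd; have -> : a * d = 2^-1%:C *: (u * d + u' * d).
    rewrite -mulrDl /u /u' addrACA subrr addr0 -opZl scalerDr -scalerDl -RCD.
    by rewrite (_ : 2^-1 + 2^-1 = 1 :> R) ?scale1r//; lra.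
  have D1 := (Mu _ Dd).1; have D2 := (Mu' _ Dd).1.
  rewrite NZ; last exact: subalgD.
  rewrite nrmC ger0_norm//; have := ND D1 D2.
  rewrite (iso _ _ _ Mu su uu' Dd) (iso _ _ _ Mu' su' u'u Dd); lra.
have := h a Da; rewrite -{1}sa NS// => h1.
have := N_ge0 Da; nra.
Qed.

Let N_le_sadj a : D a -> star a = a -> N a <= nrm a.
Proof.
move=> Da sa; apply/ler_addgt0Pr => e e0.
have c0 : 0 < nrm a + e by rewrite ltr_wpDl ?nrm_ge0.
have := @N_le1 ((nrm a + e)^-1%:C *: a); rewrite star_opZ conj_RC sa NZ// nrmZ nrmC.
rewrite ger0_norm ?invr_ge0 ?(ltW c0)// !ler_pdivrMl// !mulr1; apply=> //.
  exact: subalgZ.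
by rewrite lerDl ltW.
Qed.

Let N_le x : D x -> N x <= nrm x.
Proof.
move=> Dx; rewrite -(@ler_pXn2r _ 2) ?nnegrE ?nrm_ge0 ?N_ge0//.
rewrite -NS// -nrm_starM; apply: N_le_sadj; first by apply: DM => //; exact: Dstar.
by rewrite star_opM starK.
Qed.

(** The two norms are played against each other: powers of h tend to 0 for N, while w^n m d stays
    bounded for the operator norm, hence for N by [N_le]. *)
Let iter_kill (h w m d : bounded_op H) : D h -> N h < 1 -> M w -> nrm w <= 1 -> M m ->
  (forall n, m = h ^+ n * (w ^+ n * m)) -> D d -> m * d = 0.
Proof.
move=> Dh Nh Mw nw Mm wm Dd; have Dmd := (Mm _ Dd).1; apply: N0 => //.
have Nh0 := N_ge0 Dh.
have NX n : N (h ^+ n.+1) <= N h ^+ n.+1.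
  elim: n => [|n IH]; first by rewrite !expr1.
  rewrite exprS [N h ^+ _]exprS.
  by apply: (le_trans (NM Dh (subalgXS n hD Dh))); rewrite ler_wpM2l.
have bd n : N (m * d) <= N h ^+ n.+1 * nrm (m * d).
  have Dwm : D (w ^+ n.+1 * (m * d)) by have [] := MX n.+1 Mw Dmd.
  have e : m * d = h ^+ n.+1 * (w ^+ n.+1 * (m * d)) by rewrite {1}(wm n.+1) -!mulrA.
  rewrite {1}e; apply: (le_trans (NM (subalgXS n hD Dh) Dwm)).
  apply: ler_pM; [by apply: N_ge0; exact: (subalgXS n hD Dh)|exact: N_ge0|exact: NX|].
  apply: (le_trans (N_le Dwm)); apply: (le_trans (nrm_opM _ _)).
  by apply: ler_piMl; [exact: nrm_ge0|exact: nrm_opX].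
apply/eqP; rewrite eq_le N_ge0 ?andbT//.
apply/ler_addgt0Pr => e e0; rewrite add0r.
have c1 : 0 < nrm (m * d) + 1 by rewrite ltr_wpDl ?nrm_ge0.
have : N h ^+ n @[n --> \oo] --> 0 by apply: cvg_expr; rewrite ger0_norm.
move=> /cvgrPdist_lt/(_ (e / (nrm (m * d) + 1)))[|n _ hn]; first by rewrite divr_gt0.
have := hn n.+1 (leqnSn n) => /=; rewrite sub0r normrN ger0_norm ?exprn_ge0// => {}hn.
apply: (le_trans (bd n)); apply: (@le_trans _ _ (N h ^+ n.+1 * (nrm (m * d) + 1))).
  by apply: ler_wpM2l; [exact: exprn_ge0|rewrite lerDl].
by rewrite -ler_pdivlMr// ltW.
Qed.

(* If N h < 1, then the positive part m of h - 1 satisfies h m = (1 + k) m with k >= 0,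
   so that m = h^n (1 + k)^-n m for all n, and N kills m * d for every d in D. *)
Let le_1 x : D x -> N x < 1 -> nrm x <= 1.
Proof.
move=> Dx Nx; pose h := star x * x.
have comm_aux (b : R[i]) (u z w : bounded_op H) : z * u = u * z -> z * w = w * z ->
    z * (b *: (1 - u * u + w * w)) = b *: (1 - u * u + w * w) * z.
  move=> zu zw; rewrite opZr opZl; congr (_ *: _).
  by rewrite mulrDr mulrDl mulrBr mulrBl mulr1 mul1r !mulrA zu zw -!mulrA zu zw.
have Dh : D h by apply: DM => //; exact: Dstar.
have ph : psd h by exact: psd_starM.
have sh := ph.1.
have Nh : N h < 1 by rewrite /h NS// expr_lt1 ?N_ge0.
pose c : R := nrm h + 1.
have c0 : 0 < c by rewrite ltr_wpDl ?nrm_ge0.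
pose y := c^-1%:C *: (h - 1).
have sy : star y = y by rewrite /y star_opZ conj_RC starB star1 sh.
have ny : nrm y <= 1.
  rewrite /y nrmZ nrmC ger0_norm ?invr_ge0 ?(ltW c0)// ler_pdivrMl// mulr1.
  by apply: (le_trans (nrmBD _ _)); rewrite lerD2l nrm_op1.
have pyy : psd (y * y) by exact: psd_sqr.
have p1y : psd (1 - y * y).
  by have := (nrm_le1P y).1 ny; rewrite sy.
(* The element p = 1 - r is a positive square root of y^2, the absolute value of y, so that m = p +
   y is twice the positive part of y and p m = y m. *)
have [||r [r1 sr re rD]] := @ex_sqrt1m _ _ (1 - y * y).
- by apply: psd_nrm_le => //; rewrite scale1r opprB addrC subrK.
- by rewrite starB star1 star_opM sy.
have {}re : (1 - r) * (1 - r) = y * y by rewrite re opprB addrC subrK.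
pose p := 1 - r.
have pp : psd p by exact: psd_1m.
have Mh : M h by exact: DMm.
have My : M y by apply/MZ/MB.
have Mr : M r.
  apply: (rD _ Mclosed M0) => z Mz; apply/MZ/MD; last exact: MM.
  by apply: MB => //; exact: MM.
have Mp : M p by exact: MB.
have comm_p z : z * y = y * z -> z * p = p * z.
  move=> zy; rewrite /p mulrBr mulrBl mulr1 mul1r; congr (_ - _).
  apply: (rD _ (@opclosed_commute _ _ z)); first by rewrite /= mulr0 mul0r.
  by move=> w /= hw; exact: comm_aux.
have hy : h * y = y * h by rewrite /y opZr opZl mulrBr mulrBl mulr1 mul1r.
have yp : y * p = p * y by exact: comm_p.
have hp : h * p = p * h by exact: comm_p.
pose m := p + y; pose k := c%:C *: p.
have hE : h = 1 + c%:C *: y by rewrite /y scalerA -RCM divff ?gt_eqF// scale1r addrC subrK.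
have pm : p * m = y * m by rewrite [LHS](mulrDr p p y) [RHS](mulrDr y p y) -yp [p * p]re addrC.
have hm : h * m = (1 + k) * m.
  have e : (c%:C *: y) * m = k * m.
    by apply: etrans (opZl _ y m) _; rewrite -pm; apply: esym; exact: (opZl _ p m).
  apply: (@etrans _ _ ((1 + c%:C *: y) * m)); first by rewrite -hE.
  by apply: etrans (mulrDl 1 _ m) _; rewrite e; apply: esym; exact: (mulrDl 1 k m).
have Mm : M m by exact: MD.
have pk : psd k by apply: psdZ => //; exact: ltW.
have [w [w1 w2 nw sw [wD wc]]] := ex_inv1p pk.
have Mw : M w.
  have -> : w = 1 - (1 - w) by rewrite opprB addrC subrK.
  by apply: MB => //; apply: (wD _ subM); exact: MZ.
have hw : h * w = w * h by apply: wc; rewrite /k opZr opZl hp.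
have wm n : m = h ^+ n * (w ^+ n * m) := resolvent_iter n hw hm w2.
have md d : D d -> m * d = 0 by exact: (@iter_kill h w m d).
(* A multiplier that annihilates D need not be 0, but m = w h m = w m h and h belongs to D. *)
have m0 : m = 0.
  have hm' : h * m = m * h by rewrite /m mulrDr mulrDl hp hy.
  by rewrite -[m]mul1r -w2 -mulrA -hm hm' (md h Dh) mulr0.
apply/nrm_le1P; rewrite -/h hE opprD addrA subrr add0r.
have -> : - (c%:C *: y) = c%:C *: p by rewrite -scalerN; congr (_ *: _); apply/eqP; rewrite eq_sym -addr_eq0; apply/eqP.
exact: pk.
Qed.

Theorem cstar_norm_unique x : D x -> N x = nrm x.
Proof.
move=> Dx; apply/eqP; rewrite eq_le N_le//=; apply/ler_addgt0Pr => e e0.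
have c0 : 0 < N x + e by rewrite ltr_wpDl ?N_ge0.
have := @le_1 ((N x + e)^-1%:C *: x); rewrite NZ// nrmZ nrmC.
rewrite ger0_norm ?invr_ge0 ?(ltW c0)// ltr_pdivrMl// ler_pdivrMl// !mulr1.
apply; [exact: subalgZ|by rewrite ltrDl].
Qed.

End uniqueness_of_cstar_norms.

Section matrix_cstar_norm.
Variables (R : realType) (A : starAlgType R) (H : complexHilbertType R).
Variable rho : A -> bounded_op H.
Hypotheses (rho_lin : forall (a : R[i]) x y, rho (a *: x + y) = a *: rho x + rho y)
  (rhoM : forall x y, rho (smul x y) = rho x * rho y)
  (rhoS : forall x, rho (star x) = star (rho x))
  (rho_inj : injective rho) (rho_cl : opclosed (range rho)).
Variable n : nat.
Implicit Types x y : 'M[A]_n.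

Let rho0 : rho 0 = 0.
Proof. by have := rho_lin (-1) 0 0; rewrite scaler0 add0r scaleN1r addNr. Qed.
Let rhoD (x y : A) : rho (x + y) = rho x + rho y.
Proof. by have := rho_lin 1 x y; rewrite !scale1r. Qed.
Let rhoZ a (x : A) : rho (a *: x) = a *: rho x.
Proof. by have := rho_lin a x 0; rewrite rho0 !addr0. Qed.
Let rho_sum (I : Type) (r : seq I) (F : I -> A) :
  rho (\sum_(i <- r) F i) = \sum_(i <- r) rho (F i).
Proof. exact: (big_morph rho rhoD rho0). Qed.

Definition rep x := amp (map_mx rho x).

Let repD x y : rep (x + y) = rep x + rep y.
Proof. by rewrite /rep -ampD; congr amp; apply/matrixP => i j; rewrite !mxE rhoD. Qed.
Let repZ a x : rep (map_mx ( *:%R a) x) = a *: rep x.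
Proof. by rewrite /rep -ampZ; congr amp; apply/matrixP => i j; rewrite !mxE rhoZ. Qed.
Let repM x y : rep (mx_smul x y) = rep x * rep y.
Proof.
rewrite /rep -ampM; congr amp; apply/matrixP => i j; rewrite !mxE rho_sum.
by apply: eq_bigr => k _; rewrite !mxE rhoM.
Qed.
Let repS x : rep (mx_star x) = star (rep x).
Proof. by rewrite /rep -amp_star; congr amp; apply/matrixP => i j; rewrite !mxE rhoS. Qed.
Let rep_inj : injective rep.
Proof.
move=> x y /amp_inj/matrixP h; apply/matrixP => i j; apply: rho_inj.
by have := h i j; rewrite !mxE.
Qed.
Let rep0 : rep 0 = 0.
Proof. by rewrite -(addrK (rep 0) (rep 0)) -repD addr0 subrr. Qed.

Let rep_sub : subalg (range rep).
Proof.
split.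
- by exists 0.
- move=> a _ _ [x _ <-] [y _ <-]; exists (map_mx ( *:%R a) x + y) => //.
  by rewrite repD repZ.
- by move=> _ _ [x _ <-] [y _ <-]; exists (mx_smul x y).
- by move=> _ [x _ <-]; exists (mx_star x).
move=> T hT.
have hij i j : range rho (entries T i j).
  apply: rho_cl => e /hT[_ [x _ <-] hx]; exists (rho (x i j)); first by exists (x i j).
  apply: le_lt_trans hx; have := nrm_entry (entries T - map_mx rho x) i j.
  by rewrite ampD ampN entriesK !mxE.
have hc i : exists f : 'I_n -> A, forall j, rho (f j) = entries T i j.
  have h j : exists x : A, rho x = entries T i j by have [x _ hx] := hij i j; exists x.
  by have [f hf] := boolp.choice h; exists f.
have [f hf] := boolp.choice hc.
exists (\matrix_(i, j) f i j) => //; rewrite /rep -[RHS]entriesK; congr amp.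
by apply/matrixP => i j; rewrite !mxE hf mxE.
Qed.

(** [cstar_mxnorm] is some function satisfying the axioms of a C*-norm, if there is one. The
    faithful representation provides one, and closedness of its range lets the uniqueness theorem
    identify any other with it. *)
Lemma cstar_mxnormE x : cstar_mxnorm x = nrm (rep x).
Proof.
have ex : is_cstar_mxnorm (fun x : 'M[A]_n => nrm (rep x)).
  split.
  - by move=> y /nrm_eq0 h; apply: rep_inj; rewrite h rep0.
  - by move=> y z; rewrite repD nrmD.
  - by move=> a y; rewrite repZ nrmZ.
  - by move=> y z; rewrite repM nrm_opM.
  by move=> y; rewrite repM repS nrm_starM.
have [N0 ND NZ NM NS] : is_cstar_mxnorm (@cstar_mxnorm R A n) by apply: (@getPex _ (@is_cstar_mxnorm R A n)); eexists; exact: ex.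
pose inv T : 'M[A]_n := xget 0 [set y | rep y = T].
have invK y : inv (rep y) = y.
  by rewrite /inv; case: xgetP => [z _ /rep_inj|/(_ y erefl)].
pose N T := cstar_mxnorm (inv T).
rewrite -{1}(invK x) -/(N (rep x)); apply: (cstar_norm_unique rep_sub); last by exists x.
- by move=> _ [y _ <-]; rewrite /N invK => /N0 ->.
- by move=> _ _ [y _ <-] [z _ <-]; rewrite /N -repD !invK.
- by move=> a _ [y _ <-]; rewrite /N -repZ !invK.
- by move=> _ _ [y _ <-] [z _ <-]; rewrite /N -repM !invK.
by move=> _ [y _ <-]; rewrite /N -repS -repM !invK.
Qed.

End matrix_cstar_norm.

(** * Lifting along *-homomorphisms *)

Section star_homomorphisms.
Variables (R : realType) (H H' : complexHilbertType R).
Implicit Types (D : set (bounded_op H)) (p : bounded_op H -> bounded_op H').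

Definition star_hom D p :=
  [/\ forall (a : R[i]) x y, D x -> D y -> p (a *: x + y) = a *: p x + p y,
      forall x y, D x -> D y -> p (x * y) = p x * p y
    & forall x, D x -> p (star x) = star (p x)].

Section theory.
Variables (D : set (bounded_op H)) (p : bounded_op H -> bounded_op H').
Hypotheses (hD : subalg D) (hp : star_hom D p).
Implicit Types x y : bounded_op H.

Let D0 : D 0. Proof. by case: hD. Qed.

Lemma star_homD x y : D x -> D y -> p (x + y) = p x + p y.
Proof. by move=> Dx Dy; case: hp => /(_ 1 _ _ Dx Dy); rewrite !scale1r. Qed.
Lemma star_hom0 : p 0 = 0.
Proof. by case: hp => /(_ (-1) _ _ D0 D0); rewrite !scaleN1r !addNr. Qed.
Lemma star_homZ (a : R[i]) x : D x -> p (a *: x) = a *: p x.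
Proof. by move=> Dx; case: hp => /(_ a _ _ Dx D0); rewrite star_hom0 !addr0. Qed.
Lemma star_homN x : D x -> p (- x) = - p x.
Proof. by move=> Dx; rewrite -scaleN1r star_homZ// scaleN1r. Qed.
Lemma star_homB x y : D x -> D y -> p (x - y) = p x - p y.
Proof.
move=> Dx Dy; rewrite (star_homD Dx) ?(star_homN Dy)//; exact: (subalgN hD Dy).
Qed.
Lemma star_homM x y : D x -> D y -> p (x * y) = p x * p y.
Proof. by case: hp => _ h _; exact: h. Qed.
Lemma star_homS x : D x -> p (star x) = star (p x).
Proof. by case: hp => _ _; exact. Qed.
Lemma star_homX x n : D x -> p (x ^+ n.+1) = p x ^+ n.+1.
Proof.
move=> Dx; elim: n => [|n IH]; first by rewrite !expr1.
rewrite exprS [in RHS]exprS -IH; apply: star_homM => //; exact: subalgXS.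
Qed.

(** The maximum of |x| and |p x| is again a C*-norm on D, hence equal to |x|. *)
Lemma star_hom_le x : D x -> nrm (p x) <= nrm x.
Proof.
move=> Dx; have [_ _ DM DS _] := hD.
pose N T := Num.max (nrm T) (nrm (p T)).
have h : N x = nrm x.
  apply: (cstar_norm_unique hD) => //.
  - move=> y Dy; rewrite /N => h; apply: nrm_eq0; apply/eqP.
    by rewrite eq_le nrm_ge0 andbT -{1}h le_max lexx.
  - move=> y z Dy Dz; rewrite /N star_homD// ge_max; apply/andP; split;
      apply: (le_trans (nrmD _ _)); apply: lerD; by rewrite le_max lexx ?orbT.
  - by move=> a y Dy; rewrite /N star_homZ// !nrmZ -maxr_pMr// nrm_ge0.
  - move=> y z Dy Dz; rewrite /N star_homM// ge_max; apply/andP; split;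
      apply: (le_trans (nrm_opM _ _)); apply: ler_pM; rewrite ?nrm_ge0//;
      by rewrite le_max lexx ?orbT.
  - move=> y Dy; rewrite /N star_homM ?star_homS//; last exact: DS.
    rewrite !nrm_starM /Num.max; have := nrm_ge0 y; have := nrm_ge0 (p y).
    move: (nrm y) (nrm (p y)) => u v v0 u0; rewrite ltr_pXn2r ?nnegrE//.
    by case: ifP.
by rewrite -h /N le_max lexx orbT.
Qed.

(* Multiply d by (1 + (d^* d)^m)^-1 with m large: this forces the norm below 1, while
   the image p d, already of norm < 1, hardly moves. *)
Lemma contractive_lift d (e : R) : D d -> nrm (p d) < 1 -> 0 < e ->
  exists y, [/\ D y, nrm y <= 1 & nrm (p y - p d) <= e].
Proof.
move=> Dd pd1 e0; have [_ _ DM DS _] := hD.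
set th := nrm (p d) in pd1; have th0 : 0 <= th by exact: nrm_ge0.
(* The factor 3 comes from p z = p k - p k p z with |p z| <= 2 and |p k| <= th^j. *)
have [j hj] : exists j, 3 * th ^+ j <= e.
  have : th ^+ n @[n --> \oo] --> 0 by apply: cvg_expr; rewrite ger0_norm.
  move=> /cvgrPdist_lt/(_ (e / 3))[|n _ hn]; first by rewrite divr_gt0.
  exists n; have := hn n (leqnn n) => /=; rewrite sub0r normrN ger0_norm ?exprn_ge0//; lra.
pose h := star d * d; have ph : psd h by exact: psd_starM.
have Dh : D h by apply: DM => //; exact: DS.
pose c i : R := (2 ^+ i)^-1.
have c0 i : 0 < c i by rewrite /c invr_gt0 exprn_gt0.
have cS i : c i = c i.+1 + c i.+1 by rewrite /c exprS invfM; lra.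
have c1 i : c i <= 1 by rewrite /c invf_le1 ?exprn_gt0// exprn_ege1// ler1n.
(* By doubling, from 2 h^s <= 1 + h^(2s). The inequality h <= 1 + h^m that results is what makes h
   <= (1 + h^m)^2. *)
have hle i (x : H) : Cre (inner (h x) x) <= (1 - c i) * nrm x ^+ 2 + c i * Cre (inner ((h ^+ (2 ^ i)) x) x).
  elim: i => [|i IH].
    by rewrite /c expr0 invr1 subrr mul0r add0r expn0 expr1 mul1r.
  have -> : h ^+ (2 ^ i.+1) = h ^+ (2 ^ i) * h ^+ (2 ^ i) by rewrite expnS mul2n -addnn exprD.
  have sk : star (h ^+ (2 ^ i)) = h ^+ (2 ^ i) := (psdX _ ph).1.
  apply: (le_trans IH); rewrite opME (adjl _ ((h ^+ (2 ^ i)) x) x) sk Cre_inner_nrm.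
  have := nrmB_sqr ((h ^+ (2 ^ i)) x) x; have := sqr_ge0 (nrm ((h ^+ (2 ^ i)) x - x)).
  have := c0 i.+1; have := cS i; move: (c i) (c i.+1) (nrm x ^+ 2) => t u v.
  move: (Cre _) (nrm _ ^+ 2) (nrm _ ^+ 2) => a b b'; nra.
set m := (2 ^ j)%N in hle.
have [m' m'E] : exists m', m = m'.+1 by exists m.-1; rewrite prednK// expn_gt0.
have [k kE] : exists k, k = h ^+ m by eexists.
have pk : psd k by rewrite kE; exact: psdX.
have Dk : D k by rewrite kE m'E; exact: subalgXS.
have [w [w1 w2 nw sw [wD wc]]] := ex_inv1p pk.
have [z zE] : exists z, z = 1 - w by eexists.
have Dz : D z by rewrite zE; exact: wD.
have zk : z = k - k * z.
  have kw : k * w = 1 - w by rewrite -w1 mulrDl mul1r addrC addKr.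
  by rewrite zE mulrBr mulr1 kw subKr.
(* This is d (1 + k)^-1 with k = h^m, written without the unit so that it visibly lies in D. *)
exists (d - d * z); split.
- by apply: (subalgB hD Dd); exact: DM.
- have -> : d - d * z = d * w by rewrite zE mulrBr mulr1 opprB addrC subrK.
  apply/nrm_le1P; rewrite star_opM sw.
  have -> : 1 - w * star d * (d * w) = star w * ((1 + k) * (1 + k) - h) * w.
    rewrite sw mulrBr mulrBl; congr (_ - _); last by rewrite /h !mulrA.
    by rewrite -!mulrA w1 mulr1 w2.
  apply: psd_conj.
  apply: psd_subP; first exact: ph.1.
    by rewrite star_opM starD star1 pk.1.
  move=> x; have := hle j x; rewrite -/m -kE.
  rewrite opME (adjl (1 + k) ((1 + k) x) x) starD star1 pk.1 Cre_inner_nrm opDE op1E nrmD_sqr.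
  rewrite (inner_sym x (k x)) Cre_conj; have := pk.2 x; have := c0 j; have := c1 j.
  move: (c j) (nrm x ^+ 2) (nrm (k x) ^+ 2) (sqr_ge0 (nrm x)) (sqr_ge0 (nrm (k x))) => t u v u0 v0.
  move: (Cre _) (Cre _) => a b; nra.
have Ddz : D (d * z) by exact: DM.
rewrite (star_homB Dd Ddz) (star_homM Dd Dz) addrAC subrr add0r nrmN.
have pz : p z = p k - p k * p z.
  by rewrite {1}zk star_homB ?star_homM//; exact: DM.
have nz : nrm (p z) <= 2.
  apply: (le_trans (star_hom_le Dz)); rewrite zE; apply: (le_trans (nrmBD _ _)).
  by have := @nrm_op1 _ H; lra.
have npk : nrm (p k) <= th ^+ j.
  rewrite kE m'E star_homX// /h star_homM ?star_homS//; last exact: DS.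
  apply: (le_trans (nrm_opXn _ (lexx _))); rewrite nrm_starM -/th -exprM -m'E.
  apply: ler_wiXn2l => //; first exact: ltW.
  by rewrite /m; have := @ltn_expl 2 j; lia.
have npz : nrm (p z) <= 3 * th ^+ j.
  rewrite pz; apply: (le_trans (nrmBD _ _)).
  have := nrm_opM (p k) (p z); have := nrm_ge0 (p k); have := nrm_ge0 (p z).
  move: (nrm (p k)) (nrm (p z)) (nrm (p k * p z)) npk nz => u v t; nra.
apply: (le_trans (nrm_opM _ _)); apply: (le_trans _ hj).
apply: le_trans npz; rewrite ler_piMl ?nrm_ge0//; exact: ltW.
Qed.

End theory.

Section lifting.
Variables (D : set (bounded_op H)) (p : bounded_op H -> bounded_op H').
Variable A : set (bounded_op H').
Hypotheses (hD : subalg D) (hp : star_hom D p) (hA : subalg A).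
Hypothesis pA : forall x, D x -> A (p x).
Hypothesis pd : forall a (e : R), A a -> 0 < e -> exists2 x, D x & nrm (p x - a) < e.

(** Scaling a to norm slightly below 1 leaves room for an approximate preimage whose image still has
    norm below 1, which is the hypothesis of [contractive_lift]. *)
Lemma norm_lift a (e : R) : A a -> 0 < e ->
  exists x, [/\ D x, nrm x <= nrm a & nrm (p x - a) <= e].
Proof.
move=> Aa e0; have [D0 _ _ _ _] := hD; have e4 (s : R) : s + s + 2 * s <= 4 * s by lra.
have [a0|a0] := eqVneq (nrm a) 0.
  by exists 0; rewrite (star_hom0 hD hp) (nrm_eq0 a0) subrr !nrm0 lexx; split=> //; exact: ltW.
have M0 : 0 < nrm a by rewrite lt_def nrm_ge0 andbT.
set M := nrm a in M0 *.
(* After scaling by t the errors add up to 4 et: one for the preimage, one for the contractive lift,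
   two for the shortening of a. Scaling back multiplies by M. *)
pose et := Num.min (4^-1) (e / (4 * M)).
have et0 : 0 < et by rewrite lt_min; apply/andP; split; rewrite ?divr_gt0// ?mulr_gt0//; lra.
have et1 : et <= 4^-1 by rewrite ge_min lexx.
have et2 : 4 * M * et <= e by rewrite mulrC -ler_pdivlMr ?mulr_gt0// ge_min lexx orbT.
pose t := (1 - 2 * et) / M.
have t0 : 0 <= t by rewrite divr_ge0 ?(ltW M0)//; lra.
have nt : nrm (t%:C *: a) = 1 - 2 * et by rewrite nrmZ nrmC ger0_norm// divfK// gt_eqF.
have [d Dd hd] := pd (subalgZ t%:C hA Aa) et0.
have pd1 : nrm (p d) < 1 by have := nrm_sub_le (p d) (t%:C *: a); rewrite nt; lra.
have [y [Dy y1 hy]] := contractive_lift hD hp Dd pd1 et0.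
exists (M%:C *: y); split; first exact: (subalgZ _ hD Dy).
  by rewrite nrmZ nrmC ger0_norm ?(ltW M0)// ler_piMr// ltW.
have -> : a = M%:C *: (t%:C *: a + ((2 * et) / M)%:C *: a).
  rewrite -scalerDl -RCD -mulrDl subrK scalerA -RCM mulrCA divff ?gt_eqF// mulr1.
  by rewrite scale1r.
rewrite (star_homZ hD hp _ Dy) -scalerBr nrmZ nrmC ger0_norm ?(ltW M0)//.
rewrite opprD addrA; set c := ((2 * et) / M)%:C *: a.
have nc : nrm c = 2 * et.
  rewrite /c nrmZ nrmC -/M ger0_norm ?divfK ?gt_eqF//.
  by apply: divr_ge0; [lra|exact: ltW].
have h1 := nrm_dist (p y) (p d) (t%:C *: a); have h2 := nrmBD (p y - t%:C *: a) c.
apply: (@le_trans _ _ (M * (4 * et))); last by rewrite mulrA [M * _]mulrC.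
apply: ler_wpM2l; first exact: ltW.
apply: (le_trans h2); rewrite nc; apply: le_trans (e4 et); rewrite lerD2r.
by apply: (le_trans h1); rewrite lerD// ltW.
Qed.

(** Each residual is lifted up to half its norm, and the corrections form a geometric series whose
    norms sum to at most 2 |a|. *)
Lemma exact_lift a : A a -> exists z, [/\ D z, p z = a & nrm z <= 2 * nrm a].
Proof.
move=> Aa; have [D0 _ _ _ Dcl] := hD.
have hL b : exists x, A b -> [/\ D x, nrm x <= nrm b & nrm (p x - b) <= nrm b / 2].
  have [Ab|nAb] := pselect (A b); last by exists 0.
  have [b0|b0] := eqVneq (nrm b) 0.
    exists 0 => _; rewrite (nrm_eq0 b0) (star_hom0 hD hp) subrr nrm0 mul0r.
    by split; rewrite ?nrm0.
  have [||x hx] := @norm_lift b (nrm b / 2) => //; last by exists x.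
  by rewrite divr_gt0// lt_def b0 nrm_ge0.
have [L {}hL] := boolp.choice hL.
pose r k := iter k (fun b => b - p (L b)) a.
have rA k : A (r k) /\ nrm (r k) <= nrm a / 2 ^+ k.
  elim: k => [|k [Ak nk]]; first by rewrite /r /= expr0 divr1.
  have [Dx _ hx] := hL _ Ak; split; first by apply: (subalgB hA Ak); exact: pA.
  rewrite /r iterS -/(r k) nrmB; apply: (le_trans hx).
  by rewrite exprSr invfM mulrA ler_pM2r.
pose S n : bounded_op H := \sum_(k < n) L (r k).
have DL k : D (L (r k)) by have [] := hL _ (rA k).1.
have DS n : D (S n) by apply: (subalg_sum _ hD).
have pS n : p (S n) = a - r n.
  elim: n => [|n IH]; first by rewrite /S big_ord0 (star_hom0 hD hp) subrr.
  rewrite /S big_ord_recr /= (star_homD hp (DS n) (DL n)) IH.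
  by rewrite opprB addrA addrAC.
pose c n : R := 2 * (nrm a / 2 ^+ n).
have cS n m : (n <= m)%N -> nrm (S m - S n) <= c n - c m.
  elim: m => [|m IH]; first by rewrite leqn0 => /eqP ->; rewrite !subrr nrm0.
  rewrite leq_eqVlt => /orP[/eqP <-|]; first by rewrite !subrr nrm0.
  rewrite ltnS => /IH h; rewrite {1}/S big_ord_recr /= -/(S m) addrAC.
  apply: (le_trans (nrmD _ _)).
  have [_ hx _] := hL _ (rA m).1; have := (rA m).2.
  rewrite /c exprSr invfM in h *; lra.
have c0 n : 0 <= c n by rewrite /c mulr_ge0// divr_ge0 ?nrm_ge0 ?exprn_ge0.
have csmall e : 0 < e -> exists N, forall n, (N <= n)%N -> 2 * c n < e.
  move=> e0; have a0 := nrm_ge0 a; have c1 : 0 < nrm a + 1 by rewrite ltr_wpDl.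
  have : (2^-1 : R) ^+ n @[n --> \oo] --> 0 by apply: cvg_expr; rewrite ger0_norm; lra.
  move=> /cvgrPdist_lt/(_ (e / (4 * (nrm a + 1))))[|N _ hN].
    by rewrite divr_gt0// mulr_gt0.
  exists N => n /hN /=; have p0 : 0 <= (2^-1 : R) ^+ n by rewrite exprn_ge0.
  rewrite sub0r normrN (ger0_norm p0) ltr_pdivlMr ?mulr_gt0// /c -exprVn.
  move: (2^-1 ^+ n) p0 => t t0; nra.
have [||l hl] := @op_cauchy_bound _ _ S c.
- by move=> n m /cS; have := c0 m; lra.
- move=> e /csmall[N hN]; exists N => n /hN; have := c0 n; lra.
have Dl : D l.
  apply: Dcl => e /csmall[N hN]; exists (S N) => //; apply: (le_lt_trans (hl N)).
  by have := hN N (leqnn N); have := c0 N; lra.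
exists l; split=> //; last first.
  by have := hl 0%N; rewrite /S big_ord0 subr0 /c expr0 divr1.
apply/eqP; rewrite -subr_eq0; apply/eqP; apply: nrm_small => e e0.
have [N /(_ N (leqnn N)) hN] := csmall e e0.
have := nrm_dist (p l) (p (S N)) a; rewrite -(star_homB hD hp Dl (DS N)) pS.
have := star_hom_le hD hp (subalgB hD Dl (DS N)); have := hl N; have := (rA N).2.
rewrite [a - r N - a]addrAC subrr add0r nrmN.
have : nrm a / 2 ^+ N <= c N by rewrite /c; have := c0 N; rewrite /c; lra.
lra.
Qed.

End lifting.
End star_homomorphisms.

Section matrices_over_subalgebras.
Variables (R : realType) (H H' : complexHilbertType R).
Variables (D : set (bounded_op H)) (p : bounded_op H -> bounded_op H') (n : nat).
Hypotheses (hD : subalg D).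

(** Matrices over D are viewed as operators on a finite sum of copies of H, so that the lifting
    theorems apply to whole matrices and not only to single entries. *)
Definition amp_set : set (bounded_op (l2 'I_n H)) := [set T | forall i j, D (entries T i j)].
Definition amp_map (T : bounded_op (l2 'I_n H)) := amp (map_mx p (entries T)).

Implicit Types S T : bounded_op (l2 'I_n H).

Lemma entriesP (a : R[i]) S T i j : entries (a *: S + T) i j = a *: entries S i j + entries T i j.
Proof.
have -> : entries (a *: S + T) = map_mx ( *:%R a) (entries S) + entries T.
  by apply: amp_inj; rewrite ampD ampZ !entriesK.
by move: (entries S) (entries T) => X Y; rewrite !mxE.
Qed.
Lemma entriesM S T i j : entries (S * T) i j = \sum_k entries S i k * entries T k j.
Proof.
have -> : entries (S * T) = mx_smul (entries S) (entries T).
  by apply: amp_inj; rewrite ampM !entriesK.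
by rewrite mxE.
Qed.
Lemma entriesS S i j : entries (star S) i j = star (entries S j i).
Proof.
have -> : entries (star S) = mx_star (entries S).
  by apply: amp_inj; rewrite amp_star !entriesK.
by rewrite mxE.
Qed.
Lemma entriesB S T i j : entries (S - T) i j = entries S i j - entries T i j.
Proof.
have -> : entries (S - T) = entries S - entries T.
  by apply: amp_inj; rewrite ampD ampN !entriesK.
by move: (entries S) (entries T) => X Y; rewrite !mxE.
Qed.

Lemma subalg_amp : subalg amp_set.
Proof.
have [D0 DP DM DS Dcl] := hD; split.
- move=> i j; rewrite -(subrr (0 : bounded_op (l2 'I_n H))) entriesB subrr; exact: D0.
- by move=> a x y hx hy i j; rewrite entriesP; apply: DP; [exact: hx|exact: hy].
- move=> x y hx hy i j; rewrite entriesM; apply: (subalg_sum _ hD) => k.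
  by apply: DM; [exact: hx|exact: hy].
- by move=> x hx i j; rewrite entriesS; apply: DS; exact: hx.
move=> x hx i j; apply: Dcl => e /hx[y hy he]; exists (entries y i j); first exact: hy.
by apply: le_lt_trans he; have := nrm_entry (entries (x - y)) i j; rewrite entriesK entriesB.
Qed.

Hypothesis hp : star_hom D p.

Lemma star_hom_amp : star_hom amp_set amp_map.
Proof.
have [D0 DP DM DS Dcl] := hD; have [pP pM pS] := hp; split.
- move=> a x y hx hy; rewrite /amp_map -ampZ -ampD; congr amp; apply/matrixP => i j.
  rewrite mxE entriesP pP; [|exact: hx|exact: hy].
  by move: (entries x) (entries y) => X Y; rewrite !mxE.
- move=> x y hx hy; rewrite /amp_map -ampM; congr amp; apply/matrixP => i j.
  rewrite mxE entriesM [in RHS]mxE.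
  transitivity (\sum_k p (entries x i k * entries y k j)).
    elim: (index_enum _) => [|k s IH]; first by rewrite !big_nil (star_hom0 hD hp).
    have Dxy l : D (entries x i l * entries y l j) by apply: DM; [exact: hx|exact: hy].
    by rewrite !big_cons (star_homD hp (Dxy k)) ?IH//; apply: (subalg_sum _ hD) => l.
  apply: eq_bigr => k _; rewrite (star_homM hp (hx i k) (hy k j)).
  by move: (entries x) (entries y) => X Y; rewrite !mxE.
move=> x hx; rewrite /amp_map -amp_star; congr amp; apply/matrixP => i j.
by rewrite mxE entriesS (star_homS hp (hx j i)); move: (entries x) => X; rewrite !mxE.
Qed.

Variable A : set (bounded_op H').
Hypothesis pd : forall a (e : R), A a -> 0 < e -> exists2 x, D x & nrm (p x - a) < e.

Lemma amp_dense (a : bounded_op (l2 'I_n H')) (e : R) :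
  (forall i j, A (entries a i j)) -> 0 < e ->
  exists2 x, amp_set x & nrm (amp_map x - a) < e.
Proof.
move=> Aa e0; pose f : R := e / (n * n).+1%:R; have f0 : 0 < f by rewrite divr_gt0.
have h i j : exists x, D x /\ nrm (p x - entries a i j) < f.
  by have [x Dx hx] := pd (Aa i j) f0; exists x.
have h2 i : exists g : 'I_n -> bounded_op H,
  forall j, D (g j) /\ nrm (p (g j) - entries a i j) < f.
  by have [g hg] := boolp.choice (h i); exists g.
have [g hg] := boolp.choice h2.
exists (amp (\matrix_(i, j) g i j)).
  by move=> i j; rewrite ampK mxE; have [] := hg i j.
rewrite /amp_map ampK -[a in X in X < _]entriesK -ampN -ampD.
apply: (@le_lt_trans _ _ ((n * n)%:R * f)).
  apply: amp_le => i j; apply/ltW; have [_] := hg i j.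
  by move: (entries a) => X; rewrite !mxE.
by rewrite /f mulrA ltr_pdivrMr// mulrC ltr_pM2l// ltr_nat.
Qed.

End matrices_over_subalgebras.

(** * Quasi-units, norms of block matrices, and chains of quasi-units *)

Section approximate_units.
Variables (R : realType) (H : complexHilbertType R).

Lemma psd_frac (k w : bounded_op H) : psd k -> star w = w -> (1 + k) * w = 1 ->
  w * (1 + k) = 1 -> psd w /\ psd (1 - w).
Proof.
move=> pk sw w1 w2; have e : w = star w * (1 + k) * w by rewrite sw w2 mul1r.
have kw : k * w = 1 - w by rewrite -w1 mulrDl mul1r addrC addKr.
have wk : w * k = 1 - w by rewrite -w2 mulrDr mulr1 addrC addKr.
split; first by rewrite e; apply: psd_conj; apply: psdD => //; exact: psd1.
have -> : 1 - w = star w * k * w + star (k * w) * (k * w).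
  rewrite sw star_opM sw pk.1 -mulrA -[w * k * (k * w)]mulrA -mulrDr.
  by rewrite -{1}[k * w]mul1r -mulrDl mulrA w2 mul1r kw.
by apply: psdD; [exact: psd_conj|exact: psd_starM].
Qed.

(** With k = e^-2 times the sum of the c [star c], take u = k (1 + k)^-1. Since k dominates each
    summand, (1 + k)^-1 c has norm at most e. The estimate is one-sided, so absorption on the right
    requires the adjoints in the list. *)
Lemma quasi_unit (D : set (bounded_op H)) (cs : seq (bounded_op H)) (e : R) :
  subalg D -> 0 < e -> (forall c, c \in cs -> D c) ->
  exists u, [/\ D u, psd u, psd (1 - u) & forall c, c \in cs -> nrm ((1 - u) * c) <= e].
Proof.
move=> hD e0 hcs; have [D0 _ DM DS _] := hD.
pose f c : bounded_op H := if c \in cs then (e^-1)%:C *: c else 0.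
have Df c : D (f c) by rewrite /f; case: ifP => // /hcs h; exact: (subalgZ _ hD h).
have [k kE] : exists k, k = \sum_(c <- cs) f c * star (f c) by eexists.
have pff c : psd (f c * star (f c)) by rewrite -{1}[f c]starK; exact: psd_starM.
have pk : psd k by rewrite kE; apply: psd_sum.
have Dk : D k by rewrite kE; apply: (subalg_sum _ hD) => c; apply: DM => //; exact: DS.
have [w [w1 w2 nw sw [wD wc]]] := ex_inv1p pk.
have [pw p1w] := psd_frac pk sw w1 w2.
have kw : k * w = 1 - w by rewrite -w1 mulrDl mul1r addrC addKr.
exists (1 - w); split=> //; [exact: wD|by rewrite opprB addrC subrK|].
move=> c cin; rewrite opprB addrC subrK.
have -> : w * c = e%:C *: (w * f c).
  by rewrite /f cin opZr scalerA -RCM divff ?gt_eqF// scale1r.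
rewrite nrmZ nrmC gtr0_norm//; rewrite -[leRHS]mulr1; apply: ler_wpM2l; first exact: ltW.
rewrite -nrm_star; apply/nrm_le1P; rewrite starK star_opM sw.
have -> : 1 - w * f c * (star (f c) * w) =
   (1 - w) + (star w * w + star w * (k - f c * star (f c)) * w).
  rewrite sw mulrBr mulrBl -[w * k * w]mulrA kw mulrBr mulr1 !mulrA.
  have ac (V : zmodType) (o t u v : V) : o - t = o - v + (u + (v - u - t)).
    by rewrite -[v - u - t]addrA addrCA addNKr addrA subrK.
  exact: ac.
apply: psdD => //; apply: psdD; first exact: psd_starM.
apply: psd_conj; rewrite kE (big_rem c cin) /= addrC addrK; apply: psd_sum => c'.
exact: pff.
Qed.

End approximate_units.

Section operator_linearity.
Variables (R : realType) (H : complexHilbertType R) (T : bounded_op H).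
Lemma opvD (x y : H) : T (x + y) = T x + T y. Proof. exact: linearD. Qed.
Lemma opvB (x y : H) : T (x - y) = T x - T y. Proof. exact: linearB. Qed.
Lemma opvZ (a : R[i]) (x : H) : T (a *: x) = a *: T x. Proof. exact: linearZ. Qed.
Lemma opv0 : T 0 = 0. Proof. exact: linear0. Qed.
Lemma opv_sum (I : Type) (r : seq I) (P : pred I) (F : I -> H) :
  T (\sum_(i <- r | P i) F i) = \sum_(i <- r | P i) T (F i).
Proof. exact: linear_sum. Qed.
End operator_linearity.

Section scalar_matrices.
Variable R : realType.

Lemma op_inner_le1 (H : complexHilbertType R) (T : bounded_op H) (M : R) : 0 <= M ->
  (forall x y, nrm x <= 1 -> nrm y <= 1 -> nrm (inner (T x) y) <= M) -> nrm T <= M.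
Proof.
move=> M0 h; apply: op_inner_le => // x y.
have [x0|x0] := eqVneq (nrm x) 0.
  by rewrite (nrm_eq0 x0) linear0 inner0l !nrm0 mulr0 mul0r.
have [y0|y0] := eqVneq (nrm y) 0.
  by rewrite (nrm_eq0 y0) inner0r !nrm0 mulr0.
have px : 0 < nrm x by rewrite lt_def x0 nrm_ge0.
have py : 0 < nrm y by rewrite lt_def y0 nrm_ge0.
have u (V : normedModType R[i]) (z : V) : 0 < nrm z -> nrm ((nrm z)^-1%:C *: z) <= 1.
  by move=> pz; rewrite nrmZ nrmC ger0_norm ?invr_ge0 ?nrm_ge0// (mulVf (lt0r_neq0 pz)).
have := h _ _ (u _ x px) (u _ y py).
rewrite opvZ innerZl innerZr conj_RC !nrmM !nrmC !ger0_norm ?invr_ge0 ?nrm_ge0//.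
by rewrite ler_pdivrMl// ler_pdivrMl// mulrC [nrm x * M]mulrC.
Qed.

Definition scalar_op (z : R[i]^o) : bounded_op (cplx R) := (z : R[i]) *: (1 : bounded_op (cplx R)).

Lemma scalar_opE z (x : cplx R) : scalar_op z x = (z : R[i]) * (x : R[i]) :> R[i].
Proof. by []. Qed.

Lemma scalar_mxnormE n (x : 'M[R[i]^o]_n) : cstar_mxnorm x = nrm (amp (map_mx scalar_op x)).
Proof.
apply: cstar_mxnormE.
- by move=> a y z; rewrite /scalar_op scalerDl scalerA.
- by move=> y z; rewrite /scalar_op opZl mul1r scalerA.
- move=> y; rewrite /scalar_op star_opZ star1; congr (_ *: _).
- by move=> y z /(congr1 (fun T : bounded_op (cplx R) => T (1 : R[i]))); rewrite !scalar_opE !mulr1.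
move=> T hT; exists (T (1 : R[i])) => //.
apply/eqP; rewrite -subr_eq0; apply/eqP; apply: nrm_small => e e0.
have [y [z _ <-] hz] := hT (e / 2) (divr_gt0 e0 (ltr0Sn _ _)).
have -> : scalar_op (T (1 : R[i])) - T = scalar_op ((T - scalar_op z) (1 : R[i])) - (T - scalar_op z).
  rewrite opBE /scalar_op.
  have -> : (z *: (1 : bounded_op (cplx R))) (1 : R[i]) = z by exact: mulr1.
  by rewrite scalerBl opprB addrA subrK.
apply: (le_trans (nrmBD _ _)); rewrite [leRHS](splitr e); apply: lerD; last exact: ltW.
rewrite /scalar_op nrmZ; apply: (@le_trans _ _ (nrm (T - scalar_op z) * 1)); last by rewrite mulr1 ltW.
rewrite -[leRHS]mulr1; apply: ler_pM; rewrite ?nrm_ge0 ?nrm_op1//.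
by apply: (le_trans (op_le _ (1 : cplx R))); rewrite ler_wpM2l ?nrm_ge0// [leLHS](nrm1 R).
Qed.

Section block.
Variables m n : nat.

Definition unit_family (f : 'I_m -> 'I_n -> R[i]) := \sum_k \sum_i nrm (f k i) ^+ 2 <= 1.

Definition block_form (B : 'I_m -> 'I_m -> 'I_n -> 'I_n -> R[i]) (f g : 'I_m -> 'I_n -> R[i]) :=
  \sum_k \sum_i \sum_l \sum_j B k l i j * f l j * (g k i)^*%R.

Lemma sum_sig (V : nmodType) (G : 'I_m -> 'I_n -> V) :
  \sum_(s < \sum_(k < m) n) G (@tagnat.sig1 m (fun=> n) s) (@tagnat.sig2 m (fun=> n) s) =
  \sum_k \sum_i G k i.
Proof.
rewrite [RHS](sig_big_dep (J := fun=> 'I_n) xpredT (fun _ _ => true) (fun k i => G k i)) /=.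
by rewrite (reindex _ (@tagnat.sig_bij_on m (fun=> n))).
Qed.

(** The norm of a block matrix read as a form on doubly indexed families. Here blocks and entries
    play symmetric roles, so the two can be exchanged, which is what links the norms on the dual and
    on the bidual. *)
Lemma block_normP (B : 'I_m -> 'I_m -> 'M[R[i]^o]_n) (M : R) : 0 <= M ->
  cstar_mxnorm (\mxblock_(k < m, l < m) B k l : 'M[R[i]^o]_(\sum_(k < m) n)) <= M <->
  forall f g, unit_family f -> unit_family g ->
    nrm (block_form (fun k l i j => B k l i j) f g) <= M.
Proof.
move=> M0; rewrite scalar_mxnormE; set X := amp _.
have XE (f g : 'I_m -> 'I_n -> R[i]) (x y : l2 'I_(\sum_(k < m) n) (cplx R)) :
    (forall s, x s = f (@tagnat.sig1 m (fun=> n) s) (@tagnat.sig2 m (fun=> n) s)) ->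
    (forall s, y s = g (@tagnat.sig1 m (fun=> n) s) (@tagnat.sig2 m (fun=> n) s)) ->
    inner (X x) y = block_form (fun k l i j => B k l i j) f g /\
    (nrm x ^+ 2 = \sum_k \sum_i nrm (f k i) ^+ 2).
  move=> xE yE; split.
    rewrite /X amp_inner /block_form -(sum_sig (fun k i => \sum_l \sum_j B k l i j * f l j * (g k i)^*%R)).
    apply: eq_bigr => s _; rewrite -(sum_sig (fun l j => B (tagnat.sig1 s) l (tagnat.sig2 s) j * f l j * _)).
    by apply: eq_bigr => t _; rewrite cplx_innerE !mxE scalar_opE xE yE.
  rewrite nrm_l2 -(sum_sig (fun k i => nrm (f k i) ^+ 2)); apply: eq_bigr => s _.
  by rewrite xE.
split=> [h f g f1 g1|h].
  have [e1 e2] := XE f g (fin_vec (fun s => f (tagnat.sig1 s) (tagnat.sig2 s) : cplx R))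
    (fin_vec (fun s => g (tagnat.sig1 s) (tagnat.sig2 s) : cplx R)) (fun=> erefl) (fun=> erefl).
  have [_ e3] := XE g g (fin_vec (fun s => g (tagnat.sig1 s) (tagnat.sig2 s) : cplx R))
    (fin_vec (fun s => g (tagnat.sig1 s) (tagnat.sig2 s) : cplx R)) (fun=> erefl) (fun=> erefl).
  rewrite -e1; move: e2 e3; set x := fin_vec _; set y := fin_vec _ => e2 e3.
  have x1 : nrm x <= 1 by rewrite -(@expr_le1 _ 2) ?nrm_ge0// e2.
  have y1 : nrm y <= 1 by rewrite -(@expr_le1 _ 2) ?nrm_ge0// e3.
  apply: (le_trans (inner_le _ _)); apply: (@le_trans _ _ (M * 1 * 1)); last by rewrite !mulr1.
  apply: ler_pM; rewrite ?nrm_ge0//; apply: (le_trans (op_le _ _)).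
  by apply: ler_pM; rewrite ?nrm_ge0.
apply: op_inner_le1 => // x y x1 y1.
pose co (z : l2 'I_(\sum_(k < m) n) (cplx R)) (k : 'I_m) (i : 'I_n) : R[i] :=
  z (@tagnat.rank m (fun=> n) (existT (fun=> 'I_n) k i)).
have coE (z : l2 'I_(\sum_(k < m) n) (cplx R)) s : z s = co z (@tagnat.sig1 m (fun=> n) s) (@tagnat.sig2 m (fun=> n) s).
  by rewrite /co -[in LHS](tagnat.sigK s) tagnat.sigE12.
have [e1 e2] := XE (co x) (co y) x y (coE x) (coE y).
have [_ e3] := XE (co y) (co y) y y (coE y) (coE y).
by rewrite e1; apply: h; rewrite /unit_family -?e2 -?e3 expr_le1 ?nrm_ge0.
Qed.

End block.
End scalar_matrices.

Section kernels.
Variables (R : realType) (H H' : complexHilbertType R).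
Variables (D : set (bounded_op H)) (p : bounded_op H -> bounded_op H').
Hypotheses (hD : subalg D) (hp : star_hom D p).

Lemma subalg_ker : subalg [set x | D x /\ p x = 0].
Proof.
have [D0 DP DM DS Dcl] := hD; have [pP pM pS] := hp; split.
- by split=> //; exact: (star_hom0 hD hp).
- by move=> a x y [Dx px] [Dy py]; split; [exact: DP|rewrite pP// px py scaler0 addr0].
- by move=> x y [Dx px] [Dy py]; split; [exact: DM|rewrite pM// px mul0r].
- by move=> x [Dx px]; split; [exact: DS|rewrite pS// px star0].
move=> x hx; have Dx : D x by apply: Dcl => e /hx[y [Dy _] he]; exists y.
split=> //; apply: nrm_small => e /hx[y [Dy py] he].
rewrite -[p x]subr0 -py -(star_homB hD hp Dx Dy); apply: le_trans (ltW he).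
exact: (star_hom_le hD hp (subalgB hD Dx Dy)).
Qed.

(** Repeated use of [quasi_unit] in the kernel: the k-th element takes account of all earlier ones
    and of their products with b and [star b], which stay in the kernel because it is an ideal of D.
    The list [lst k] holds the elements of index below k. *)
Lemma ex_chain (bs : seq (bounded_op H)) (d : R) : 0 < d -> (forall b, b \in bs -> D b) ->
  exists e : nat -> bounded_op H,
  [/\ forall k, [/\ D (e k), p (e k) = 0, psd (e k) & psd (1 - e k)],
      forall j k, (j < k)%N -> nrm ((1 - e k) * e j) <= d,
      forall b j k, b \in bs -> (j < k)%N ->
         nrm ((1 - e k) * (b * e j)) <= d /\ nrm ((1 - e k) * (star b * e j)) <= d
    & forall b k, b \in bs -> p b = 0 -> nrm ((1 - e k) * b) <= d].
Proof.
move=> d0 hbs; have [_ _ DM DS _] := hD; have [_ pM pS] := hp; have hJ := subalg_ker.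
pose cs (es : seq (bounded_op H)) := [seq b <- bs | p b == 0] ++ es ++
  [seq b * e | b <- bs, e <- es] ++ [seq star (b : bounded_op H) * e | b <- bs, e <- es].
pose Js (es : seq (bounded_op H)) := forall e, e \in es -> D e /\ p e = 0.
have hF es : exists u, Js es -> [/\ D u /\ p u = 0, psd u, psd (1 - u) &
    forall c, c \in cs es -> nrm ((1 - u) * c) <= d].
  have [hes|hes] := pselect (Js es); last by exists 0.
  have [|u hu] := quasi_unit (cs := cs es) hJ d0; last by exists u.
  move=> c; rewrite !mem_cat mem_filter => /or4P[/andP[/eqP pc cb]|/hes//|/allpairsP[[b e]]|/allpairsP[[b e]]].
  - by split=> //; exact: hbs.
  - move=> /= [hb /hes[De pe] ->]; have Db := hbs _ hb.
    by split; [exact: DM|rewrite pM// pe mulr0].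
  move=> /= [hb /hes[De pe] ->]; have Db := DS _ (hbs _ hb).
  by split; [exact: DM|rewrite pM// pe mulr0].
have [F {}hF] := boolp.choice hF.
pose lst k := iter k (fun es => F es :: es) [::].
have hl k : Js (lst k).
  elim: k => [//|k IH]; rewrite /lst iterS -/(lst k) => e; rewrite inE => /orP[/eqP ->|/IH//].
  by have [] := hF _ IH.
have lt_lst j k : (j < k)%N -> F (lst j) \in lst k.
  elim: k => [//|k IH]; rewrite ltnS leq_eqVlt /lst iterS -/(lst k) inE => /orP[/eqP ->|/IH ->].
    by rewrite eqxx.
  by rewrite orbT.
exists (fun k => F (lst k)); split.
- by move=> k; have [[? ?] ? ? _] := hF _ (hl k).
- move=> j k jk; have [_ _ _] := hF _ (hl k); apply.
  by rewrite !mem_cat lt_lst ?orbT.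
- move=> b j k hb jk; have [_ _ _ h] := hF _ (hl k); split; apply: h; rewrite !mem_cat.
    by rewrite [X in [|| _, _, X | _]](_ : _ = true) ?orbT//; apply/allpairsP; exists (b, F (lst j)); rewrite /= hb lt_lst.
  by rewrite [X in [|| _, _, _ | X]](_ : _ = true) ?orbT//; apply/allpairsP; exists (b, F (lst j)); rewrite /= hb lt_lst.
move=> b k hb pb; have [_ _ _] := hF _ (hl k); apply.
by rewrite !mem_cat mem_filter pb eqxx hb.
Qed.

End kernels.

Section chains.
Variables (R : realType) (H : complexHilbertType R) (e : nat -> bounded_op H) (d : R).
Hypotheses (d0 : 0 <= d) (pe : forall k, psd (e k)) (pe1 : forall k, psd (1 - e k))
  (ee : forall j k, (j < k)%N -> nrm ((1 - e k) * e j) <= d).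
Implicit Types x y : H.

Lemma chain_sqr k x : nrm (e k x) ^+ 2 <= Cre (inner (e k x) x).
Proof.
have := (pe1 k).2 (e k x); have := (pe k).2 (x - e k x).
rewrite opvB opBE op1E !innerBl !innerBr !CreB (adjl (e k) (e k x) x) (pe k).1 Cre_inner_nrm; lra.
Qed.

Lemma chain_nrm k x : nrm (e k x) ^+ 2 + nrm ((1 - e k) x) ^+ 2 <= nrm x ^+ 2.
Proof.
have := chain_sqr k x; rewrite opBE op1E nrmB_sqr inner_sym Cre_conj; lra.
Qed.

(** Since e_(k+1) e_k is within d of e_k and e^2 <= e, the square of the increment is at most the
    increment itself up to 2d, and the increments telescope. *)
Lemma chain_telescope m n x :
  \sum_(k < n) nrm ((e (m + k).+1 - e (m + k)) x) ^+ 2 <= (1 + 2 * n%:R * d) * nrm x ^+ 2.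
Proof.
have h k : nrm ((e k.+1 - e k) x) ^+ 2 <=
    Cre (inner (e k.+1 x) x) - Cre (inner (e k x) x) + 2 * d * nrm x ^+ 2.
  rewrite opBE nrmB_sqr adjl (pe k.+1).1.
  have -> : e k.+1 (e k x) = e k x - ((1 - e k.+1) * e k) x.
    by rewrite opME opBE op1E subKr.
  rewrite innerBr CreB; have h1 := chain_sqr k x; have h2 := chain_sqr k.+1 x.
  have h3 : Cre (inner x (((1 - e k.+1) * e k) x)) <= d * nrm x ^+ 2.
    apply: (le_trans (ler_norm _)); apply: (le_trans (Cre_le_nrm _)).
    apply: (le_trans (inner_le _ _)); rewrite expr2 mulrC mulrA.
    apply: ler_wpM2r; first exact: nrm_ge0.
    apply: (le_trans (op_le _ _)); apply: ler_wpM2r; [exact: nrm_ge0|exact: ee].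
  rewrite (inner_sym x (e k x)) Cre_conj; lra.
apply: (@le_trans _ _ (Cre (inner (e (m + n) x) x) - Cre (inner (e m x) x) + n%:R * (2 * d * nrm x ^+ 2))).
  elim: n => [|n IH]; first by rewrite big_ord0 addn0 subrr mul0r addr0.
  rewrite big_ord_recr /= addnS -natr1 mulrDl mul1r; have := h (m + n)%N; lra.
have h1 := (pe m).2 x; have h2 : Cre (inner (e (m + n) x) x) <= nrm x ^+ 2.
  by have := (pe1 (m + n)).2 x; rewrite opBE op1E innerBl CreB Cre_inner_nrm; lra.
have -> : n%:R * (2 * d * nrm x ^+ 2) = 2 * n%:R * d * nrm x ^+ 2 by ring.
rewrite mulrDl mul1r; lra.
Qed.

(** This is the near orthogonality of the cross terms: up to small errors e_k b (1 - e_k) is an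
    increment times b times the next increment, and the squares of the increments sum to about 1.
    The main term therefore stays of order |b| however long the chain, and is negligible after
    division by n. *)
Lemma chain_avg (b : bounded_op H) n :
  (forall j k, (j < k)%N -> nrm ((1 - e k) * (star b * e j)) <= d) ->
  nrm (\sum_(k < n) e k.+1 * b * (1 - e k.+1)) <= n%:R * (3 * d) + nrm b * (1 + 2 * n%:R * d).
Proof.
move=> hb; have hb' j k : (j < k)%N -> nrm (e j * b * (1 - e k)) <= d.
  move=> /hb; rewrite -nrm_star !star_opM starK starB star1 (pe k).1 (pe j).1.
  by rewrite ?mulrA.
pose P k := e k.+1 - e k; pose Q k := e k.+2 - e k.+1.
(* The three terms split off have the form e_j b (1 - e_k) with j < k, each of norm at most d. *)
have dec k : e k.+1 * b * (1 - e k.+1) = (e k.+1 * b * (1 - e k.+2)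
    + (e k * b * (1 - e k.+1) - e k * b * (1 - e k.+2))) + P k * b * Q k.
  rewrite /P /Q !mulrBl !mulrBr !mulr1; move: (e k.+1 * b) (e k * b) => u v.
  move: (u * e k.+1) (u * e k.+2) (v * e k.+1) (v * e k.+2) => a1 a2 a3 a4.
  apply/eqP; rewrite -subr_eq0; apply/eqP; apply: bopE => x.
  rewrite !(opBE, opDE, op0E); apply: inner_extl => z.
  rewrite !(innerDl, innerNl, inner0l); ring.
under eq_bigr do rewrite dec.
rewrite big_split /=; apply: (le_trans (nrmD _ _)); apply: lerD.
  apply: (le_trans (nrm_sum _ _ _)); apply: (@le_trans _ _ (\sum_(k < n) 3 * d)).
    apply: ler_sum => k _; apply: (le_trans (nrmD _ _)).
    have h1 := hb' k.+1 k.+2 (ltnSn _); have h2 := hb' k k.+1 (ltnSn _).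
    have h3 := hb' k k.+2 (leqnSn _); have -> : 3 * d = d + (d + d) by ring.
    by apply: (lerD h1); apply: (le_trans (nrmBD _ _)); exact: (lerD h2 h3).
  by rewrite sumr_const card_ord [n%:R * _]mulr_natl.
have c0 : 0 <= 1 + 2 * n%:R * d by rewrite addr_ge0// !mulr_ge0.
apply: op_inner_le1; first by rewrite mulr_ge0 ?nrm_ge0.
move=> x y x1 y1; rewrite op_sumE inner_suml; apply: (le_trans (nrm_sum _ _ _)).
have sP k : star (P k) = P k by rewrite starB !(pe _).1.
apply: (@le_trans _ _ (\sum_(k < n) nrm b * (nrm (Q k x) ^+ 2 + nrm (P k y) ^+ 2) / 2)).
  apply: ler_sum => k _; rewrite -mulrA !opME adjl sP; apply: (le_trans (inner_le _ _)).
  apply: (@le_trans _ _ (nrm b * nrm (Q k x) * nrm (P k y))).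
    by apply: ler_wpM2r; [exact: nrm_ge0|exact: op_le].
  rewrite -!mulrA; apply: ler_wpM2l; first exact: nrm_ge0.
  have := sqr_ge0 (nrm (Q k x) - nrm (P k y)); move: (nrm _) (nrm _) => u v; nra.
rewrite -mulr_suml -mulr_sumr -mulrA; apply: ler_wpM2l; first exact: nrm_ge0.
rewrite big_split /= ler_pdivrMr//.
have tr (m : nat) z (F : nat -> bounded_op H) : (forall k, F k = e (m + k).+1 - e (m + k)) -> nrm z <= 1 ->
    \sum_(k < n) nrm (F k z) ^+ 2 <= 1 + 2 * n%:R * d.
  move=> hF z1; under eq_bigr do rewrite hF.
  apply: (le_trans (chain_telescope m n z)); rewrite -[leRHS]mulr1; apply: ler_wpM2l => //.
  by rewrite expr_le1 ?nrm_ge0.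
have h1 := tr 1%N x Q (fun=> erefl) x1; have h2 := tr 0%N y P (fun=> erefl) y1; lra.
Qed.

End chains.

(** * The weak expectation property from approximate lifts *)

Section approximation_filter.
Variable T : choiceType.

(** An index is a finite list of elements to be respected and an integer n giving the precision
    1/(n+1). It serves both with operators on K and with vectors of H as elements. *)
Definition approx_ultra : set_system (seq T * nat) :=
  ultra_ext (tails (fun a b : seq T * nat => {subset a.1 <= b.1} /\ (a.2 <= b.2)%N)).

Lemma approx_tails_proper :
  ProperFilter (tails (fun a b : seq T * nat => {subset a.1 <= b.1} /\ (a.2 <= b.2)%N)).
Proof.
apply: (tails_proper ([::], 0%N)); first by move=> a; exists a; split.
move=> a b; exists (a.1 ++ b.1, maxn a.2 b.2) => c [/= h1]; rewrite geq_max => /andP[h2 h3].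
by split; split=> // x hx; apply: h1; rewrite mem_cat hx ?orbT.
Qed.

#[global] Instance approx_ultraP : UltraFilter approx_ultra.
Proof. by have [] := ultra_extP approx_tails_proper. Qed.

#[global] Instance approx_ultra_proper : ProperFilter approx_ultra.
Proof. exact: ultra_proper. Qed.

Lemma approx_tail (P : seq T * nat -> Prop) (s0 : seq T) n0 :
  (forall s n, {subset s0 <= s} -> (n0 <= n)%N -> P (s, n)) -> approx_ultra [set l | P l].
Proof.
move=> h; apply: (ultra_extP approx_tails_proper).2; exists (s0, n0) => -[s n] [h1 h2]; exact: h.
Qed.

End approximation_filter.

Lemma invS_small (R : realType) (c e : R) : 0 <= c -> 0 < e ->
  exists n0, forall n, (n0 <= n)%N -> c / n.+1%:R <= e.
Proof.
move=> c0 e0; exists (Num.bound (c / e)) => n hn.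
have n0 : 0 < n.+1%:R :> R by [].
rewrite ler_pdivrMr// mulrC -ler_pdivrMr//; apply/ltW.
have := archi_boundP (divr_ge0 c0 (ltW e0)); move/lt_le_trans; apply.
by rewrite ler_nat; exact: leqW.
Qed.

Section bounded_linear_functionals.
Variables (R : realType).

Lemma ex_linear (U V : lmodType R[i]) (f : U -> V) : linear f ->
  exists g : {linear U -> V}, forall x, g x = f x.
Proof. by move=> lf; exists (HB.pack_for {linear U -> V} f (GRing.isLinear.Build _ _ _ _ f lf)). Qed.

Lemma cs2 (a b c d f g : R) : 0 <= f -> 0 <= g -> a ^+ 2 + c ^+ 2 <= f ^+ 2 ->
  b ^+ 2 + d ^+ 2 <= g ^+ 2 -> a * b + c * d <= f * g.
Proof.
move=> f0 g0 h1 h2; apply: (le_trans (ler_norm _)).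
rewrite -(@ler_pXn2r _ 2) ?nnegrE ?mulr_ge0// -normrX ger0_norm ?sqr_ge0// exprMn.
apply: le_trans (ler_pM _ _ h1 h2); rewrite ?addr_ge0 ?sqr_ge0//.
rewrite -subr_ge0; have -> : (a ^+ 2 + c ^+ 2) * (b ^+ 2 + d ^+ 2) - (a * b + c * d) ^+ 2 =
  (a * d - c * b) ^+ 2 by ring.
exact: sqr_ge0.
Qed.

Lemma block_form_swap m n (B : 'I_m -> 'I_m -> 'I_n -> 'I_n -> R[i]) f g :
  block_form B f g = block_form (fun i j k l => B k l i j) (fun i k => f k i) (fun i k => g k i).
Proof.
rewrite /block_form exchange_big; apply: eq_bigr => i _; apply: eq_bigr => k _.
exact: exchange_big.
Qed.

Lemma unit_family_swap m n (f : 'I_m -> 'I_n -> R[i]) :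
  unit_family f -> unit_family (fun i k => f k i).
Proof. by rewrite /unit_family exchange_big. Qed.

Lemma unit_family_le1 m n (f : 'I_m -> 'I_n -> R[i]) k i : unit_family f -> nrm (f k i) <= 1.
Proof.
move=> h; rewrite -(@expr_le1 _ 2) ?nrm_ge0//; apply: le_trans h.
rewrite (bigD1 k)//= (bigD1 i)//= -addrA lerDl.
by rewrite addr_ge0// sumr_ge0// => *; rewrite ?sumr_ge0// => *; rewrite sqr_ge0.
Qed.

Lemma block_form_bound m n (B : 'I_m -> 'I_m -> 'I_n -> 'I_n -> R[i]) f g :
  unit_family f -> unit_family g ->
  nrm (block_form B f g) <= \sum_k \sum_i \sum_l \sum_j nrm (B k l i j).
Proof.
move=> f1 g1; apply: (le_trans (nrm_sum _ _ _)); apply: ler_sum => k _.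
apply: (le_trans (nrm_sum _ _ _)); apply: ler_sum => i _.
apply: (le_trans (nrm_sum _ _ _)); apply: ler_sum => l _.
apply: (le_trans (nrm_sum _ _ _)); apply: ler_sum => j _.
rewrite !nrmM nrm_conj -mulrA ler_piMr ?nrm_ge0//.
by rewrite mulr_ile1 ?nrm_ge0// unit_family_le1.
Qed.

Lemma ucvg_block (T : Type) (U : set_system T) (FU : Filter U) m n
    (B : T -> 'I_m -> 'I_m -> 'I_n -> 'I_n -> R[i]) (L : 'I_m -> 'I_m -> 'I_n -> 'I_n -> R[i]) f g :
  (forall k l i j, ucvg U (fun t => B t k l i j) (L k l i j)) ->
  ucvg U (fun t => block_form (B t) f g) (block_form L f g).
Proof.
move=> h; do 4! (apply: ucvg_sum => ?).
rewrite -mulrA mulrC; apply: ucvg_near (ucvgMl _ (h _ _ _ _)); apply: filterE => t /=.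
by rewrite mulrC mulrA.
Qed.

End bounded_linear_functionals.

Section generated_algebra_norm.
Variables (R : realType) (H : complexHilbertType R) (X : set (bounded_op H)).

Lemma cstar_gen_mxnormE n (W : 'M[cstar_gen X]_n) :
  cstar_mxnorm W = nrm (amp (map_mx (val : cstar_gen X -> bounded_op H) W)).
Proof.
pose v : cstar_gen X -> bounded_op H := val.
have h1 (a : R[i]) x y : v (a *: x + y) = a *: v x + v y by [].
have h2 x y : v (smul x y) = v x * v y by [].
have h3 x : v (star x) = star (v x) by [].
have h4 : injective v by exact: val_inj.
have h5 : opclosed (range v).
  move=> T hT; have TX : T \in in_cstar_gen X.
    apply/asboolP => M hM; have [/cstar_subalgebraP[_ _ _ _ Mcl] _] := hM.
    apply: Mcl => e /hT[_ [b _ <-] hb]; exists (v b) => //.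
    by have /asboolP := valP b; apply.
  by exists (CstarGen TX).
exact: (cstar_mxnormE h1 h2 h3 h4 h5).
Qed.

End generated_algebra_norm.

Lemma corner_defect (A : pzRingType) (e b : A) :
  e * b * e + (1 - e) * b * (1 - e) - b = - (e * b * (1 - e) + (1 - e) * (b * e)).
Proof.
have e1 : e + (1 - e) = 1 by rewrite addrC subrK.
apply/eqP; rewrite -subr_eq0 opprK; apply/eqP.
by rewrite addrAC [(1 - e) * (b * e)]mulrA addrACA -!mulrDr subrK e1 !mulr1 -mulrDl e1 mul1r subrr.
Qed.

Section kirchberg.
Variables (R : realType) (K F : complexHilbertType R).
Variables (D : set (bounded_op K)) (A : set (bounded_op F)) (p : bounded_op K -> bounded_op F).
Hypotheses (hD : subalg D) (hA : subalg A) (hp : star_hom D p)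
  (pA : forall x, D x -> A (p x))
  (pd : forall a (e : R), A a -> 0 < e -> exists2 x, D x & nrm (p x - a) < e)
  (hJ : forall e e' x, D e -> p e = 0 -> D e' -> p e' = 0 ->
     D (e * x * e') /\ p (e * x * e') = 0).

Local Notation Lam := (seq (bounded_op K) * nat)%type.
Local Notation U := (@approx_ultra (bounded_op K)).
Local Notation B := (cstar_gen D).
Implicit Types (l : Lam) (x y b : bounded_op K) (phi : dual_space B).

Let N l : R := l.2.+1%:R^-1.
Let N0 l : 0 < N l. Proof. by rewrite /N invr_gt0. Qed.

Let bs_sub l b : b \in [seq b <- l.1 | `[< D b >]] -> D b.
Proof. by rewrite mem_filter => /andP[/asboolP]. Qed.
Let ex_e l := ex_chain hD hp (N0 l) (@bs_sub l).
Let e l : nat -> bounded_op K := projT1 (cid (ex_e l)).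
Let eP l := projT2 (cid (ex_e l)).

Let eD l k : D (e l k) /\ p (e l k) = 0. Proof. by have [/(_ k)[]] := eP l. Qed.
Let epsd l k : psd (e l k). Proof. by have [/(_ k)[]] := eP l. Qed.
Let epsd1 l k : psd (1 - e l k). Proof. by have [/(_ k)[]] := eP l. Qed.
Let ee l j k : (j < k)%N -> nrm ((1 - e l k) * e l j) <= N l.
Proof. by have [_ h _ _] := eP l; exact: h. Qed.

(** The index is shifted by one because [chain_avg] compares e_(k+1) with its predecessor e_k. *)
Let em l k (x y : bounded_op K) := e l k.+1 * x * e l k.+1 + (1 - e l k.+1) * y * (1 - e l k.+1).
Let w l x y : bounded_op K := (N l)%:C *: \sum_(k < l.2.+1) em l k x y.

Let w_lin l (a : R[i]) x x' y y' : w l (a *: x + x') (a *: y + y') = a *: w l x y + w l x' y'.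
Proof.
rewrite /w scalerA mulrC -scalerA -scalerDr; congr (_ *: _).
rewrite scaler_sumr -big_split; apply: eq_bigr => k _; rewrite /em.
have cmp (u v z z' : bounded_op K) : u * (a *: z + z') * v = a *: (u * z * v) + u * z' * v.
  by rewrite mulrDr opZr mulrDl opZl.
by rewrite !cmp scalerDr addrACA.
Qed.

Let wD l x y : D y -> D (w l x y).
Proof.
move=> Dy; have [_ _ DM _ _] := hD; apply: (subalgZ _ hD); apply: (subalg_sum _ hD) => k.
have [De pe] := eD l k.+1.
apply: (subalgD hD); first by have [] := hJ x De pe De pe.
rewrite mulrBl mul1r mulrBr mulr1.
have De1 : D (y - e l k.+1 * y) by apply: (subalgB hD Dy); exact: DM.
by apply: (subalgB hD De1); exact: DM.
Qed.

(** Since e^2 + (1 - e)^2 <= 1, the vectors cut by e and by 1 - e satisfy Pythagoras as an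
    inequality, and Cauchy-Schwarz bounds the two corners together by the larger of the two norms.
    This holds for all matrix sizes and survives averaging. *)
Let w_mx n l (X Y : 'M[bounded_op K]_n) (M : R) : nrm (amp X) <= M -> nrm (amp Y) <= M ->
  nrm (amp (\matrix_(i, j) w l (X i j) (Y i j))) <= M.
Proof.
move=> hX hY; have M0 : 0 <= M := le_trans (nrm_ge0 _) hX.
have hk k : nrm (amp (\matrix_(i, j) em l k (X i j) (Y i j))) <= M.
  apply: op_inner_le => // f g; rewrite amp_inner.
  set E := e l k.+1.
  pose c (T : bounded_op K) (f : l2 'I_n K) : l2 'I_n K := fin_vec (fun i => T (f i)).
  have -> : \sum_i \sum_j inner ((\matrix_(i, j) em l k (X i j) (Y i j)) i j (f j)) (g i) =
      inner (amp X (c E f)) (c E g) + inner (amp Y (c (1 - E) f)) (c (1 - E) g).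
    rewrite !amp_inner -big_split; apply: eq_bigr => i _ /=.
    rewrite -big_split; apply: eq_bigr => j _ /=.
    rewrite mxE /em -/E opDE innerDl !opME; congr (_ + _).
      by rewrite adjl (epsd l k.+1).1.
    by rewrite adjl (epsd1 l k.+1).1.
  have cn (h : l2 'I_n K) : nrm (c E h) ^+ 2 + nrm (c (1 - E) h) ^+ 2 <= nrm h ^+ 2.
    rewrite !nrm_l2 -big_split; apply: ler_sum => i _ /=.
    exact: (chain_nrm (epsd l) (epsd1 l)).
  have hT (T : bounded_op (l2 'I_n K)) f1 g1 : nrm T <= M -> nrm (inner (T f1) g1) <= M * (nrm f1 * nrm g1).
    move=> hT; apply: (le_trans (inner_le _ _)); rewrite mulrA.
    apply: ler_wpM2r; first exact: nrm_ge0.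
    by apply: (le_trans (op_le _ _)); rewrite ler_wpM2r ?nrm_ge0.
  apply: (le_trans (nrmD _ _)); apply: (le_trans (lerD (hT _ _ _ hX) (hT _ _ _ hY))).
  by rewrite -mulrDr -mulrA; apply: ler_wpM2l => //; apply: cs2; rewrite ?nrm_ge0.
have -> : amp (\matrix_(i, j) w l (X i j) (Y i j)) =
    (N l)%:C *: \sum_(k < l.2.+1) amp (\matrix_(i, j) em l k (X i j) (Y i j)).
  apply: bopE => f; apply: l2_extr => i v; rewrite !inner_single opZE op_sumE.
  congr (inner v _); rewrite ampE.
  have sumE (s : seq 'I_(l.2.+1)) (G : 'I_(l.2.+1) -> l2 'I_n K) :
      (\sum_(k <- s) G k) i = \sum_(k <- s) G k i.
    by elim: s => [|k s IH]; rewrite ?big_nil// !big_cons -IH.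
  transitivity ((N l)%:C *: (\sum_(k < l.2.+1) amp (\matrix_(i, j) em l k (X i j) (Y i j)) f i)).
    under [in RHS]eq_bigr do rewrite ampE.
    rewrite exchange_big scaler_sumr; apply: eq_bigr => j _ /=; rewrite mxE /w opZE op_sumE.
    by congr (_ *: _); apply: eq_bigr => k _; rewrite mxE.
  by rewrite -sumE.
rewrite nrmZ nrmC ger0_norm ?(ltW (N0 l))//.
apply: (@le_trans _ _ (N l * \sum_(k < l.2.+1) M)).
  apply: ler_wpM2l; first exact/ltW/N0.
  by apply: (le_trans (nrm_sum _ _ _)); apply: ler_sum => k _; exact: hk.
by rewrite sumr_const card_ord -mulr_natl mulrA /N mulVf// mul1r.
Qed.

Let w_le l x y (M : R) : nrm x <= M -> nrm y <= M -> nrm (w l x y) <= M.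
Proof.
move=> hx hy; have cst z : nrm z <= M -> nrm (amp (const_mx z : 'M[bounded_op K]_1)) <= M.
  move=> hz; have := @amp_le _ _ 1 (const_mx z) M; rewrite mul1n mul1r; apply => i j.
  by rewrite mxE.
apply: le_trans (w_mx l (cst x hx) (cst y hy)).
by apply: le_trans (nrm_entry _ ord0 ord0); rewrite !mxE.
Qed.

(** The chain almost absorbs y, so the second corner vanishes in the limit; the choice of the lift y
    will not matter beyond its image under p. *)
Let w_ker l y : y \in l.1 -> D y -> p y = 0 -> nrm (w l 0 y) <= N l.
Proof.
move=> yl Dy py; rewrite /w nrmZ nrmC (ger0_norm (ltW (N0 l))).
rewrite -[leRHS]mulr1 ler_pM2l//; apply: (le_trans (nrm_sum _ _ _)).
apply: (@le_trans _ _ (\sum_(k < l.2.+1) N l)); last first.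
  by rewrite sumr_const card_ord -mulr_natl /N mulfV.
apply: ler_sum => k _; rewrite /em mulr0 mul0r add0r; apply: (le_trans (nrm_opM _ _)).
rewrite -[leRHS]mulr1; apply: ler_pM; rewrite ?nrm_ge0//.
  by have [_ _ _] := eP l; apply=> //; rewrite mem_filter yl andbT; apply/asboolP.
apply: (psd_nrm_le ltr01 (epsd1 l k.+1)).
by rewrite scale1r opprB addrC subrK.
Qed.

(** The defect is minus the average of the two kinds of cross terms. One is controlled by
    [chain_avg] for b, the other is the adjoint of the case of [star b]. *)
Let w_id l b : b \in l.1 -> D b -> nrm (w l b b - b) <= (6 * (1 + nrm b)) / l.2.+1%:R.
Proof.
(* As the length of the chain times its precision is 1, each of the two bounds is 3 + 3 |b|. *)
have ar (u : R) : 0 <= u -> 3 + u * (1 + 2 * 1) + (3 + u * (1 + 2 * 1)) <= 6 * (1 + u) by lra.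
move=> bl Db; set n := l.2.+1.
have hb j k : (j < k)%N -> nrm ((1 - e l k) * (b * e l j)) <= N l /\
    nrm ((1 - e l k) * (star b * e l j)) <= N l.
  by have [_ _ h _] := eP l; apply: h; rewrite mem_filter bl andbT; apply/asboolP.
have h1 := chain_avg (ltW (N0 l)) (epsd l) (epsd1 l) (@ee l) n (fun j k jk => (hb j k jk).2).
have := chain_avg (b := star b) (ltW (N0 l)) (epsd l) (epsd1 l) (@ee l) n.
rewrite starK => /(_ (fun j k jk => (hb j k jk).1)).
rewrite -nrm_star star_sum nrm_star.
under eq_bigr do rewrite !star_opM starK starB star1 (epsd l _).1.
move=> h2.
have -> : w l b b - b = - (N l)%:C *: (\sum_(k < n) e l k.+1 * b * (1 - e l k.+1)
   + \sum_(k < n) (1 - e l k.+1) * (b * e l k.+1)).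
  have bE : b = (N l)%:C *: \sum_(k < n) b.
    have nN : (N l)%:C * n%:R = 1 :> R[i].
      by rewrite -(rmorph_nat (real_complex R)) -RCM /N mulVf.
    by rewrite sumr_const card_ord -scaler_nat scalerA nN scale1r.
  rewrite [X in w l b b - X]bE /w -scalerBr scaleNr -scalerN; congr (_ *: _).
  rewrite /n -sumrB -big_split -sumrN; apply: eq_bigr => k _ /=; rewrite /em.
  exact: corner_defect.
rewrite scaleNr nrmN nrmZ nrmC (ger0_norm (ltW (N0 l))) mulrC.
rewrite -/(N l); apply: ler_wpM2r; first exact/ltW/N0.
apply: (le_trans (nrmD _ _)); apply: (le_trans (lerD h1 h2)).
have nN : n%:R * N l = 1 by rewrite /N /n mulfV// pnatr_eq0.
rewrite (_ : n%:R * (3 * N l) = 3); last by rewrite mulrCA nN mulr1.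
rewrite -[2 * n%:R * N l]mulrA nN; exact/ar/nrm_ge0.
Qed.

(** D is already a closed *-subalgebra, so [cstar_gen D] is D itself turned into a type of
    C*-algebras. *)
Let genD x : x \in in_cstar_gen D = `[< D x >].
Proof.
apply/asbool_equiv_eq; split=> [h|Dx]; last by move=> M [_]; exact.
by apply: h; split=> //; apply/cstar_subalgebraP.
Qed.

Let toB x : B := insubd (0 : B) x.
Let toBK x : D x -> val (toB x) = x.
Proof. by move=> Dx; rewrite /toB insubdK// genD; apply/asboolP. Qed.
Let valD (b : B) : D (val b).
Proof. by have := valP b; rewrite genD => /asboolP. Qed.
Let valK (b : B) : toB (val b) = b.
Proof. by apply: val_inj; rewrite toBK. Qed.

Let ev phi x : R[i] := phi (toB x).
Let ev_lin phi (a : R[i]) x y : D x -> D y -> ev phi (a *: x + y) = a * ev phi x + ev phi y.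
Proof.
move=> Dx Dy; rewrite /ev; have -> : toB (a *: x + y) = a *: toB x + toB y.
  apply: val_inj; rewrite toBK; last by case: hD => _ h _ _ _; exact: h.
  have -> : val (a *: toB x + toB y) = a *: val (toB x) + val (toB y) by [].
  by rewrite (toBK Dx) (toBK Dy).
by rewrite linearP.
Qed.
Let ev_le phi x : D x -> nrm (ev phi x) <= nrm phi * nrm x.
Proof.
move=> Dx; have := opnorm_le phi (toB x).
by have -> : nrm (toB x) = nrm x by rewrite -[in RHS](toBK Dx).
Qed.

(** The averages need not converge in D: the limit is taken one functional at a time and so belongs
    to the bidual. *)
Let V' x y phi := ulim U (fun l => ev phi (w l x y)).

Let V'cvg x y phi : D y -> ucvg U (fun l => ev phi (w l x y)) (V' x y phi).
Proof.
move=> Dy; apply: (@ulimP _ _ _ _ _ (nrm phi * (nrm x + nrm y))); apply: filterE => l /=.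
apply: (le_trans (ev_le _ (wD l x Dy))); apply: ler_wpM2l; first exact: nrm_ge0.
by apply: w_le; rewrite ?lerDl ?lerDr nrm_ge0.
Qed.

Let V'lin (a : R[i]) x x' y y' phi : D y -> D y' ->
  V' (a *: x + x') (a *: y + y') phi = a * V' x y phi + V' x' y' phi.
Proof.
move=> Dy Dy'; apply: ulim_eq.
apply: ucvg_near (ucvgD (ucvgMl a (V'cvg x phi Dy)) (V'cvg x' phi Dy')).
by apply: filterE => l /=; rewrite w_lin ev_lin//; exact: wD.
Qed.

Let V'phi (a : R[i]) x y phi phi' : D y ->
  V' x y (a *: phi + phi') = a * V' x y phi + V' x y phi'.
Proof.
move=> Dy; apply: ulim_eq.
by apply: (ucvgD (ucvgMl _ (V'cvg x phi Dy)) (V'cvg x phi' Dy)).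
Qed.

Let V'bnd x y phi M : D y -> nrm x <= M -> nrm y <= M -> nrm (V' x y phi) <= nrm phi * M.
Proof.
move=> Dy hx hy; apply: (ucvg_leW (V'cvg x phi Dy)); apply: filterE => l /=.
apply: (le_trans (ev_le _ (wD l x Dy))); apply: ler_wpM2l; [exact: nrm_ge0|exact: w_le].
Qed.

Let V'ker y phi : D y -> p y = 0 -> V' 0 y phi = 0.
Proof.
move=> Dy py; apply: ulim_eq => r r0.
have r2 : 0 < r / 2 by rewrite divr_gt0.
have r3 : r / 2 < r by lra.
have [n0 hn0] := invS_small (nrm_ge0 phi) r2.
apply: (@approx_tail _ (fun l => nrm (ev phi (w l 0 y) - 0) < r) [:: y] n0) => s n hs hn.
rewrite subr0; apply: (le_lt_trans (ev_le _ (wD (s, n) 0 Dy))).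
have ys : y \in s by apply: hs; rewrite inE.
apply: (@le_lt_trans _ _ (nrm phi / n.+1%:R)).
  by apply: ler_wpM2l; [exact: nrm_ge0|exact: w_ker].
exact: (le_lt_trans (hn0 n hn) r3).
Qed.

Let V'id b phi : D b -> V' b b phi = ev phi b.
Proof.
move=> Db; apply: ulim_eq => r r0.
have r2 : 0 < r / 2 by rewrite divr_gt0.
have r3 : r / 2 < r by lra.
have [|n0 hn0] := @invS_small R (nrm phi * (6 * (1 + nrm b))) _ _ r2.
  by rewrite !mulr_ge0 ?addr_ge0 ?nrm_ge0.
apply: (@approx_tail _ (fun l => nrm (ev phi (w l b b) - ev phi b) < r) [:: b] n0) => s n hs hn.
have -> : ev phi (w (s, n) b b) - ev phi b = ev phi (w (s, n) b b - b).
  have -> : w (s, n) b b - b = (-1) *: b + w (s, n) b b by rewrite scaleN1r addrC.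
  by rewrite ev_lin// ?mulN1r 1?addrC//; exact: wD.
have Dw : D (w (s, n) b b - b) by apply: (subalgB hD) => //; exact: wD.
apply: (le_lt_trans (ev_le _ Dw)).
have bs : b \in s by apply: hs; rewrite inE.
apply: (@le_lt_trans _ _ (nrm phi * (6 * (1 + nrm b)) / n.+1%:R)).
  by rewrite -mulrA; apply: ler_wpM2l; [exact: nrm_ge0|exact: w_id].
exact: (le_lt_trans (hn0 n hn) r3).
Qed.

(** For fixed l, the definition of the norm on the dual bounds phi applied entrywise to one
    contractive matrix over D. Exchanging the two pairs of indices turns this into the estimate
    required on the bidual, which then passes to the limit. *)
Let V'mx n m (X Y : 'M[bounded_op K]_n) (phi : 'M[dual_space B]_m) f g :
  (forall i j, D (Y i j)) -> nrm (amp X) <= 1 -> nrm (amp Y) <= 1 ->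
  (dual_mxnorms (@cstar_mxnorms R B) phi <= 1)%E -> unit_family f -> unit_family g ->
  nrm (block_form (fun i j k h => V' (X i j) (Y i j) (phi k h)) f g) <= 1.
Proof.
move=> DY X1 Y1 phi1 f1 g1.
have cv : ucvg U (fun l => block_form (fun i j k k' => ev (phi k k') (w l (X i j) (Y i j))) f g)
   (block_form (fun i j k h => V' (X i j) (Y i j) (phi k h)) f g).
  by apply: ucvg_block => i j k k'; exact: V'cvg.
apply: (ucvg_leW cv); apply: filterE => l /=.
rewrite block_form_swap.
pose W : 'M[B]_n := \matrix_(i, j) toB (w l (X i j) (Y i j)).
have W1 : cstar_mxnorm W <= 1.
  rewrite cstar_gen_mxnormE (_ : map_mx val W = \matrix_(i, j) w l (X i j) (Y i j)); first exact: w_mx.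
  by apply/matrixP => i j; rewrite !mxE toBK//; exact: wD.
have : ((cstar_mxnorm (\mxblock_(k < m, k' < m) map_mx (phi k k') W
           : 'M[R[i]^o]_(\sum_(k < m) n)))%:E <= 1)%E.
  apply: le_trans phi1; apply: ereal_sup_ubound; exists n, W; split; last by [].
  by rewrite /cstar_mxnorms lee_fin; exact: W1.
rewrite lee_fin => /(block_normP (fun k k' => map_mx (phi k k') W) ler01).
move=> /(_ _ _ (unit_family_swap f1) (unit_family_swap g1)).
congr (nrm _ <= _); rewrite /block_form; do 4! (apply: eq_bigr => ? _).
by rewrite !mxE.
Qed.

Let ex_sec a : exists z, A a -> [/\ D z, p z = a & nrm z <= 2 * nrm a].
Proof.
have [Aa|nA] := pselect (A a); last by exists 0.
by have [z hz] := exact_lift hD hp hA pA pd Aa; exists z.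
Qed.
Let sec a := projT1 (cid (ex_sec a)).
Let secP a : A a -> [/\ D (sec a), p (sec a) = a & nrm (sec a) <= 2 * nrm a].
Proof. exact: (projT2 (cid (ex_sec a))). Qed.

Definition lift_cc (psi : bounded_op K -> bounded_op F) :=
  [/\ forall (a : R[i]) x y, psi (a *: x + y) = a *: psi x + psi y,
      forall x, A (psi x)
    & forall n (X : 'M[bounded_op K]_n), nrm (amp (map_mx psi X)) <= nrm (amp X)].

Section one_map.
Variable psi : bounded_op K -> bounded_op F.
Hypothesis hpsi : lift_cc psi.

Let psiA x : A (psi x). Proof. by case: hpsi. Qed.
Let Ds x : D (sec (psi x)). Proof. by have [] := secP (psiA x). Qed.

Let psi_le x : nrm (psi x) <= nrm x.
Proof.
have [_ _ /(_ _ (const_mx x : 'M[bounded_op K]_1)) h] := hpsi.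
have h1 := nrm_entry (map_mx psi (const_mx x : 'M[bounded_op K]_1)) ord0 ord0.
rewrite !mxE in h1; apply: (le_trans h1); apply: (le_trans h).
have := @amp_le _ _ 1 (const_mx x) (nrm x); rewrite mul1n mul1r; apply => i j.
by rewrite mxE.
Qed.

Let V x phi := V' x (sec (psi x)) phi.

(** V' sees y only through p y, since two lifts differ by an element of the kernel. Hence the
    nonlinear section [sec] still yields a linear V. The factor 2 is the norm bound of [exact_lift],
    applied to the difference of the images. *)
Let V_eps x y phi (r : R) : D y -> nrm (p y - psi x) <= r ->
  nrm (V x phi - V' x y phi) <= nrm phi * (2 * r).
Proof.
move=> Dy hr; have Apy : A (psi x - p y) by apply: (subalgB hA (psiA x)); exact: pA.
have [Dz pz nz] := secP Apy; set z := sec _ in Dz pz nz.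
have Dyz : D (y + z) by exact: (subalgD hD).
have Du : D (sec (psi x) - (y + z)) by exact: (subalgB hD).
have pu : p (sec (psi x) - (y + z)) = 0.
  rewrite (star_homB hD hp (Ds x) Dyz) (star_homD hp Dy Dz) pz.
  by have [_ -> _] := secP (psiA x); rewrite addrC [p y + _]addrC subrK addNr.
have -> : V x phi = V' x y phi + V' 0 z phi.
  have -> : V x phi = V' x (y + z) phi + V' 0 (sec (psi x) - (y + z)) phi.
    have := V'lin 1 x 0 phi Dyz Du; rewrite !scale1r mul1r addr0 => <-.
    by rewrite /V [y + z + _]addrC subrK.
  rewrite (V'ker phi Du pu) addr0; have := V'lin 1 x 0 phi Dy Dz.
  by rewrite !scale1r mul1r addr0.
rewrite addrC addKr; apply: V'bnd => //.
  by rewrite nrm0 mulr_ge0//; apply: le_trans hr; exact: nrm_ge0.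
by apply: (le_trans nz); rewrite nrmB ler_pM2l.
Qed.

Let Vlin (a : R[i]) x x' phi : V (a *: x + x') phi = a * V x phi + V x' phi.
Proof.
rewrite -V'lin//; apply/eqP; rewrite -subr_eq0; apply/eqP; apply: nrm_small => r r0.
have [_ DP _ _ _] := hD; have Dy : D (a *: sec (psi x) + sec (psi x')) by exact: DP.
have := @V_eps (a *: x + x') _ phi 0 Dy; rewrite !mulr0 => h; apply: le_trans (ltW r0); apply: h.
have [pP _ _] := hp; rewrite pP//; have [_ -> _] := secP (psiA x); have [_ -> _] := secP (psiA x').
by have [-> _ _] := hpsi; rewrite subrr nrm0.
Qed.

Let Vphi (a : R[i]) x phi phi' : V x (a *: phi + phi') = a * V x phi + V x phi'.
Proof. exact: V'phi. Qed.

Let Vbnd x phi : nrm (V x phi) <= nrm phi * (2 * nrm x).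
Proof.
apply: V'bnd => //; first by have := nrm_ge0 x; lra.
have [_ _ h] := secP (psiA x); apply: (le_trans h).
by rewrite ler_pM2l//; exact: psi_le.
Qed.

Let Vid b phi : D b -> nrm (V b phi - ev phi b) <= nrm phi * (2 * nrm (p b - psi b)).
Proof. by move=> Db; rewrite -V'id//; exact: V_eps. Qed.

(** Lifting each entry by [sec] need not give a contractive matrix. A norm-preserving approximate
    lift of the whole matrix does, and [V_eps] pays for replacing one by the other; C collects the
    resulting coefficients. *)
Let Vmx n m (X : 'M[bounded_op K]_n) (phi : 'M[dual_space B]_m) f g :
  nrm (amp X) <= 1 -> (dual_mxnorms (@cstar_mxnorms R B) phi <= 1)%E ->
  unit_family f -> unit_family g ->
  nrm (block_form (fun i j k h => V (X i j) (phi k h)) f g) <= 1.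
Proof.
move=> X1 phi1 f1 g1; apply/ler_addgt0Pr => r r0.
pose C := \sum_(i < n) \sum_(k < m) \sum_(j < n) \sum_(h < m) nrm (phi k h) * 2.
have C0 : 0 <= C by do 4! (apply: sumr_ge0 => ? _); rewrite mulr_ge0 ?nrm_ge0.
have d0 : 0 < r / (C + 1) by rewrite divr_gt0// ltr_wpDl.
have [_ _ /(_ _ X) hX] := hpsi.
have Ap i j : A (entries (amp (map_mx psi X)) i j) by rewrite ampK mxE.
have [|y [Dy y1 hy]] := norm_lift (p := @amp_map _ _ _ p n) (A := [set T | forall i j, A (entries T i j)])
  (subalg_amp n hD) (star_hom_amp n hD hp) (subalg_amp n hA) _ Ap d0.
  by move=> T e' AT e'0; exact: (amp_dense pd AT e'0).
pose Y := entries y.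
have hV := @V'mx n m X Y phi f g Dy X1 _ phi1 f1 g1.
have hpe i j : nrm (p (Y i j) - psi (X i j)) <= r / (C + 1).
  apply: le_trans hy; have := nrm_entry (map_mx p Y - map_mx psi X) i j.
  by rewrite ampD ampN /amp_map -/Y; clear hV; move: Y => Z; rewrite !mxE.
have hdiff : nrm (block_form (fun i j k h => V (X i j) (phi k h)) f g -
    block_form (fun i j k h => V' (X i j) (Y i j) (phi k h)) f g) <= r.
  have -> : block_form (fun i j k h => V (X i j) (phi k h)) f g -
    block_form (fun i j k h => V' (X i j) (Y i j) (phi k h)) f g =
    block_form (fun i j k h => V (X i j) (phi k h) - V' (X i j) (Y i j) (phi k h)) f g.
    by rewrite /block_form; do 4! (rewrite -sumrB; apply: eq_bigr => ? _); rewrite -!mulrBl.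
  apply: (le_trans (block_form_bound _ f1 g1)).
  apply: (@le_trans _ _ (C * (r / (C + 1)))); last first.
    by rewrite mulrCA ler_piMr ?(ltW r0)// ler_pdivrMr ?mul1r ?ltr_wpDl// lerDl.
  rewrite {1}/C; do 4! (rewrite mulr_suml; apply: ler_sum => ? _); rewrite -mulrA.
  apply: V_eps; first exact: Dy.
  exact: hpe.
apply: (le_trans (nrm_sub_le _ (block_form (fun i j k h => V' (X i j) (Y i j) (phi k h)) f g))).
apply: lerD; last exact: hdiff.
by apply: hV; rewrite entriesK; apply: (le_trans y1); exact: (le_trans hX).
Qed.

Lemma approx_bidual : exists V : bounded_op K -> dual_space B -> R[i],
  [/\ forall (a : R[i]) x x' phi, V (a *: x + x') phi = a * V x phi + V x' phi,
      forall (a : R[i]) x phi phi', V x (a *: phi + phi') = a * V x phi + V x phi',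
      forall x phi, nrm (V x phi) <= nrm phi * (2 * nrm x),
      forall (b : B) phi, nrm (V (val b) phi - phi b) <= nrm phi * (2 * nrm (p (val b) - psi (val b)))
    & forall n m (X : 'M[bounded_op K]_n) (phi : 'M[dual_space B]_m) f g,
      nrm (amp X) <= 1 -> (dual_mxnorms (@cstar_mxnorms R B) phi <= 1)%E ->
      unit_family f -> unit_family g ->
      nrm (block_form (fun i j k h => V (X i j) (phi k h)) f g) <= 1].
Proof.
exists V; split; [exact: Vlin|exact: Vphi|exact: Vbnd| |exact: Vmx].
by move=> b phi; have := Vid phi (valD b); rewrite /ev valK.
Qed.

End one_map.
End kirchberg.

Section weak_expectation.
Variables (R : realType) (K F : complexHilbertType R).
Variables (D : set (bounded_op K)) (A : set (bounded_op F)) (p : bounded_op K -> bounded_op F).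
Hypotheses (hD : subalg D) (hA : subalg A) (hp : star_hom D p)
  (pA : forall x, D x -> A (p x))
  (pd : forall a (e : R), A a -> 0 < e -> exists2 x, D x & nrm (p x - a) < e)
  (hJ : forall e e' x, D e -> p e = 0 -> D e' -> p e' = 0 ->
     D (e * x * e') /\ p (e * x * e') = 0)
  (approx : forall (bs : seq (bounded_op K)) (r : R), (forall b, b \in bs -> D b) -> 0 < r ->
     exists psi, lift_cc A psi /\ forall b, b \in bs -> nrm (p b - psi b) <= r).

Local Notation B := (cstar_gen D).
Local Notation U := (@approx_ultra (bounded_op K)).

Lemma gen_elt (b : B) : D (val b).
Proof. by have /asboolP := valP b; apply; split=> //; apply/cstar_subalgebraP. Qed.

Lemma op_mxnormE n (X : 'M[bounded_op K]_n) : cstar_mxnorm X = nrm (amp X).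
Proof.
by rewrite (@cstar_mxnormE R (bounded_op K) K id) ?/rep ?map_mx_id//; move=> T hT; exists T.
Qed.

Lemma block_formZ m n (c : R[i]) (Bk : 'I_m -> 'I_m -> 'I_n -> 'I_n -> R[i]) f g :
  block_form (fun i j k l => c * Bk i j k l) f g = c * block_form Bk f g.
Proof. by rewrite /block_form; do 4! (rewrite mulr_sumr; apply: eq_bigr => ? _); rewrite !mulrA. Qed.

(** The factorization is the inclusion of D in B(K) followed by a second limit, over psi, of the
    maps of [approx_bidual]. In this limit the error |p b - psi b| disappears. *)
Lemma wep : WEP (cstar_gen D).
Proof.
pose bnd (V : bounded_op K -> dual_space B -> R[i]) :=
  [/\ forall (a : R[i]) x x' phi, V (a *: x + x') phi = a * V x phi + V x' phi,
      forall (a : R[i]) x phi phi', V x (a *: phi + phi') = a * V x phi + V x phi',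
      forall x phi, nrm (V x phi) <= nrm phi * (2 * nrm x)
    & forall n m (X : 'M[bounded_op K]_n) (phi : 'M[dual_space B]_m) f g,
      nrm (amp X) <= 1 -> (dual_mxnorms (@cstar_mxnorms R B) phi <= 1)%E ->
      unit_family f -> unit_family g ->
      nrm (block_form (fun i j k h => V (X i j) (phi k h)) f g) <= 1].
have exV (t : seq (bounded_op K) * nat) : exists V, bnd V /\
    forall (b : B) phi, val b \in t.1 -> nrm (V (val b) phi - phi b) <= 2 * nrm phi / t.2.+1%:R.
  have [||psi [hpsi psiE]] := @approx [seq b <- t.1 | `[< D b >]] (t.2.+1%:R^-1).
  - by move=> b; rewrite mem_filter => /andP[/asboolP].
  - by rewrite invr_gt0.
  have [V [h1 h2 h3 h4 h5]] := approx_bidual hD hA hp pA pd hJ hpsi.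
  exists V; split; first by split.
  move=> b phi bt; apply: (le_trans (h4 b phi)); rewrite mulrCA -mulrA.
  apply: ler_wpM2l => //; apply: ler_wpM2l; first exact: nrm_ge0.
  by apply: psiE; rewrite mem_filter bt andbT; apply/asboolP; exact: gen_elt.
have [V {}exV] := boolp.choice exV.
pose Vl x phi := ulim U (fun t => V t x phi).
have cv x phi : ucvg U (fun t => V t x phi) (Vl x phi).
  apply: (@ulimP _ _ _ _ _ (nrm phi * (2 * nrm x))); apply: filterE => t /=.
  by have [[_ _ h _] _] := exV t; exact: h.
have Vlin (a : R[i]) x x' phi : Vl (a *: x + x') phi = a * Vl x phi + Vl x' phi.
  apply: ulim_eq; apply: ucvg_near (ucvgD (ucvgMl a (cv x phi)) (cv x' phi)).
  by apply: filterE => t /=; have [[-> _ _ _] _] := exV t.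
have Vphi (a : R[i]) x phi phi' : Vl x (a *: phi + phi') = a * Vl x phi + Vl x phi'.
  apply: ulim_eq; apply: ucvg_near (ucvgD (ucvgMl a (cv x phi)) (cv x phi')).
  by apply: filterE => t /=; have [[_ -> _ _] _] := exV t.
have Vbnd x phi : nrm (Vl x phi) <= nrm phi * (2 * nrm x).
  apply: (ucvg_leW (cv x phi)); apply: filterE => t /=.
  by have [[_ _ h _] _] := exV t; exact: h.
have Vid (b : B) phi : Vl (val b) phi = phi b.
  apply: ulim_eq => r r0; have r2 : 0 < r / 2 by rewrite divr_gt0.
  have r3 : r / 2 < r by lra.
  have [|n0 hn0] := @invS_small R (2 * nrm phi) _ _ r2; first by rewrite mulr_ge0 ?nrm_ge0.
  apply: (@approx_tail _ (fun t => nrm (V t (val b) phi - phi b) < r) [:: val b] n0) => s n hs hn.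
  have [_ h] := exV (s, n); apply: le_lt_trans (le_lt_trans (hn0 n hn) r3).
  by apply: (h b phi); apply: hs; rewrite inE.
have Vmx n m (X : 'M[bounded_op K]_n) (phi : 'M[dual_space B]_m) f g :
    (dual_mxnorms (@cstar_mxnorms R B) phi <= 1)%E -> unit_family f -> unit_family g ->
    nrm (block_form (fun i j k h => Vl (X i j) (phi k h)) f g) <= nrm (amp X).
  move=> phi1 f1 g1; apply/ler_addgt0Pr => e e0; set M := nrm (amp X) + e.
  have M0 : 0 < M by rewrite ltr_wpDl ?nrm_ge0.
  have cb : ucvg U (fun t => block_form (fun i j k h => V t (X i j) (phi k h)) f g)
     (block_form (fun i j k h => Vl (X i j) (phi k h)) f g).
    by apply: ucvg_block => i j k h; exact: cv.
  apply: (ucvg_leW cb); apply: filterE => t /=.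
  have [[h1 h2 h3 h4] _] := exV t.
  have V0 ph : V t 0 ph = 0.
    by have := h1 (-1) 0 0 ph; rewrite scaler0 addr0 mulN1r addNr.
  have VZ a x ph : V t (a *: x) ph = a * V t x ph.
    by have := h1 a x 0 ph; rewrite V0 !addr0.
  have := h4 n m (map_mx ( *:%R M^-1%:C) X) phi f g _ phi1 f1 g1.
  rewrite ampZ nrmZ nrmC ger0_norm ?invr_ge0 ?(ltW M0)// ler_pdivrMl// mulr1 lerDl => /(_ (ltW e0)).
  have -> : block_form (fun i j k h => V t ((map_mx ( *:%R M^-1%:C) X) i j) (phi k h)) f g =
     M^-1%:C * block_form (fun i j k h => V t (X i j) (phi k h)) f g.
    rewrite -block_formZ /block_form; do 4! (apply: eq_bigr => ? _).
    by rewrite mxE VZ.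
  by rewrite nrmM nrmC ger0_norm ?invr_ge0 ?(ltW M0)// ler_pdivrMl// mulr1.
have vb x : (fun phi => Vl x phi : R[i]^o) \in @bounded_linear R (dual_space B) R[i]^o.
  apply/asboolP; split; first by move=> a phi phi'; exact: Vphi.
  by exists (2 * nrm x) => phi; rewrite mulrC; exact: Vbnd.
pose v x : bidual_space B := Bop (vb x).
have vlin : linear v by move=> a x y; apply: bopE => phi; exact: Vlin.
have [vL vLE] := ex_linear vlin.
have ulin : linear (val : B -> bounded_op K) by move=> a x y.
have [uL uLE] := ex_linear ulin.
exists K, uL, vL; split.
- move=> n x; rewrite lee_fin op_mxnormE cstar_gen_mxnormE.
  suff -> : map_mx uL x = map_mx (val : B -> bounded_op K) x by exact: lexx.
  by apply/matrixP => i j; rewrite !mxE uLE.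
- move=> n X; apply: ge_ereal_sup => _ [m [phi [phi1 ->]]].
  rewrite lee_fin op_mxnormE.
  apply/(block_normP (fun i j => map_mx (map_mx vL X i j) phi) (nrm_ge0 _)) => f g f1 g1.
  have := Vmx n m X phi f g phi1 f1 g1; congr (nrm _ <= _).
  by rewrite /block_form; do 4! (apply: eq_bigr => ? _); rewrite !mxE vLE.
by move=> b; rewrite uLE vLE; apply: bopE => phi; exact: Vid.
Qed.

Theorem qwep_of_lifts (X : set (bounded_op F)) :
  (forall a, A a <-> smallest (@cstar_subalgebra R (bounded_op F)) X a) -> QWEP (cstar_gen X).
Proof.
move=> AX; have pAX (b : B) : p (val b) \in in_cstar_gen X.
  by apply/asboolP/AX/pA; exact: gen_elt.
have [pP pM pS] := hp.
pose P (b : B) : cstar_gen X := CstarGen (pAX b).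
have Plin : linear P.
  by move=> a x y; apply: val_inj; rewrite /= pP//; exact: gen_elt.
have [PL PLE] := ex_linear Plin.
exists (cstar_gen D), (PL @^-1` [set 0]), PL; split; first exact: wep.
  split.
  - by rewrite /= linear0.
  - by move=> a x y /= hx hy; rewrite linearP hx hy scaler0 addr0.
  - move=> b x /= hx; have px : p (val x) = 0 by have := congr1 val hx; rewrite PLE.
    by split; rewrite PLE; apply: val_inj => /=; rewrite pM ?px ?mulr0 ?mul0r//; exact: gen_elt.
  apply/closed_nclosed => x hx /=; rewrite PLE; apply: val_inj => /=.
  apply: nrm_small => e e0; have [y /= hy he] := hx e e0.
  have py : p (val y) = 0 by have := congr1 val hy; rewrite PLE.
  rewrite -[p (val x)]subr0 -py.
  have [Dx Dy] : D (val x) /\ D (val y) by split; exact: gen_elt.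
  rewrite -(star_homB hD hp Dx Dy); apply: le_trans (ltW he).
  have Dxy := subalgB hD Dx Dy; exact: (star_hom_le hD hp Dxy).
split=> //.
- by move=> x y; rewrite !PLE; apply: val_inj; rewrite /= pM//; exact: gen_elt.
- by move=> x; rewrite !PLE; apply: val_inj; rewrite /= pS//; exact: gen_elt.
move=> a _; have Aa : A (val a) by apply/AX; have /asboolP := valP a.
have [z [Dz pz _]] := exact_lift hD hp hA pA pd Aa.
have zD : z \in in_cstar_gen D by apply/asboolP => M [_]; apply.
by exists (CstarGen zD) => //; rewrite PLE; apply: val_inj.
Qed.

End weak_expectation.

(** * The q-Fock space and Wick words *)

Section contractions.
Variables (Z : Type) (K : comPzRingType) (V : lmodType K) (q : K).
Implicit Types (a : Z -> K) (w : seq Z) (F G : seq Z -> V).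

(* When F t is the elementary tensor t and a v = <v, h>, this is the action of the
   annihilation operator of h on w. *)
Fixpoint qann a w F : V :=
  if w is v :: w' then a v *: F w' + q *: qann a w' (fun t => F (v :: t)) else 0.

Lemma eq_qann a w F G : (forall t, size t = (size w).-1 -> F t = G t) -> qann a w F = qann a w G.
Proof.
elim: w F G => [//|v w IH] F G h /=; congr (_ *: _ + _ *: _); first exact: h.
case: w h {IH} (IH (fun t => F (v :: t)) (fun t => G (v :: t))) => [//|v' w] h; apply=> t ht.
by apply: h; rewrite /= ht.
Qed.

Lemma qannE (z0 : Z) a w F : qann a w F =
  \sum_(k < size w) (q ^+ k * a (nth z0 w k)) *: F (take k w ++ drop k.+1 w).
Proof.
elim: w F => [|v w IH] F /=; first by rewrite big_ord0.
rewrite big_ord_recl /= expr0 mul1r drop0 IH scaler_sumr; congr (_ + _).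
by apply: eq_bigr => k _; rewrite scalerA mulrA -exprS.
Qed.

Lemma qannP a w (c : K) F G : qann a w (fun t => c *: F t + G t) = c *: qann a w F + qann a w G.
Proof.
elim: w F G => [|v w IH] F G /=; first by rewrite scaler0 addr0.
rewrite (IH (fun t => F (v :: t))) !scalerDr !scalerA addrACA; congr (_ + _).
by rewrite [a v * c]mulrC [q * c]mulrC.
Qed.

Lemma qann0 a w : qann a w (fun=> 0) = 0.
Proof. by elim: w => [//|v w IH] /=; rewrite IH !scaler0 addr0. Qed.

Lemma qann_sum (I : Type) (r : seq I) (c : I -> K) (f : I -> seq Z -> V) a w :
  qann a w (fun t => \sum_(i <- r) c i *: f i t) = \sum_(i <- r) c i *: qann a w (f i).
Proof.
elim: r => [|i r IH].
  by rewrite big_nil -[RHS](qann0 a w); apply: eq_qann => t _; rewrite big_nil.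
rewrite big_cons -IH -qannP; apply: eq_qann => t _; by rewrite big_cons.
Qed.

Lemma qann_cat a w1 w2 F : qann a (w1 ++ w2) F =
  qann a w1 (fun t => F (t ++ w2)) + q ^+ size w1 *: qann a w2 (fun t => F (w1 ++ t)).
Proof.
elim: w1 F => [|v w1 IH] F /=; first by rewrite add0r expr0 scale1r.
by rewrite IH scalerDr scalerA -exprS addrA.
Qed.


End contractions.

(** The ring map s allows phi to be conjugate linear; for linear phi it is the identity. *)
Lemma qann_map (Z : Type) (K K' : comPzRingType) (V : lmodType K) (V' : lmodType K')
    (s : K -> K') (phi : V -> V') (q : K) (a : Z -> K) w F :
  (forall x y, phi (x + y) = phi x + phi y) -> (forall c x, phi (c *: x) = s c *: phi x) ->
  phi 0 = 0 ->
  phi (qann q a w F) = qann (s q) (fun v => s (a v)) w (fun t => phi (F t)).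
Proof.
move=> hD hZ h0; elim: w F => [//|v w IH] F /=.
by rewrite hD !hZ IH.
Qed.

Section inversion_counting.
Local Open Scope nat_scope.

Lemma inversionsE n (p : 'S_n) : inversions p = \sum_(i < n) \sum_(j < n) ((i < j) && (p j < p i)).
Proof.
rewrite /inversions -sum1_card big_mkcond /= pair_bigA; apply: eq_bigr => -[i j] _ /=.
by rewrite unfold_in /=; case: ifP.
Qed.

Lemma sum_ltn n k : \sum_(m < n) (m < k) = minn n k.
Proof.
elim: n => [|n IH]; first by rewrite big_ord0 min0n.
rewrite big_ord_recr /= IH; case: (ltnP n k) => h; lia.
Qed.

(** The new first position is inverted with exactly the k positions whose values lie below k;
    lifting preserves the other inversions. *)
Lemma inversions_lift n (k : 'I_n.+1) (p : 'S_n) :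
  inversions (lift_perm ord0 k p) = k + inversions p.
Proof.
have hb i j : (bump k i < bump k j) = (i < j) by rewrite !ltnNge leq_bump2.
have lt0 (i : 'I_n) : lift ord0 i = i.+1 :> nat by [].
rewrite !inversionsE big_ord_recl; congr (_ + _).
  rewrite big_ord_recl ltnn /= add0n.
  transitivity (\sum_(j < n) (p j < k)).
    apply: eq_bigr => j _; rewrite lift_perm_lift lift_perm_id /= /bump.
    by congr nat_of_bool; apply/idP/idP; case: leqP; lia.
  rewrite -(reindex_inj (h := p) (F := fun m : 'I_n => nat_of_bool (m < k)) (P := xpredT) (@perm_inj _ p)).
  by rewrite sum_ltn; have := ltn_ord k; lia.
apply: eq_bigr => i _; rewrite big_ord_recl /= add0n.
by apply: eq_bigr => j _; rewrite !lift_perm_lift /= hb /bump /= !add1n ltnS.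
Qed.
End inversion_counting.

Section fock.
Variables (R : realType) (H : realHilbertType R) (q : R).
Local Notation Hc := (complexification H).
Local Notation C := R[i].
Implicit Types (h : Hc) (s t : seq Hc).

Lemma cinner_sym h h' : cinner h h' = (cinner h' h)^*%R.
Proof.
have sy (x y : H) : inner x y = inner y x by rewrite (hermC (@inner _ _ H)) expr0 mul1r.
rewrite /cinner; apply/eqP; rewrite eq_complex /=; apply/andP; split; apply/eqP.
  by rewrite (sy h.1) (sy h.2).
by rewrite (sy h.2) (sy h.1) opprB.
Qed.

Lemma cinner_ge0 h : exists2 r : R, 0 <= r & cinner h h = r%:C.
Proof.
exists (`|h.1| ^+ 2 + `|h.2| ^+ 2); first by rewrite addr_ge0 ?sqr_ge0.
have sy (x y : H) : inner x y = inner y x by rewrite (hermC (@inner _ _ H)) expr0 mul1r.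
by rewrite /cinner -!inner_norm (sy h.2) subrr.
Qed.

Lemma cinner_real (f g : H) : cinner (real_vec f) (real_vec g) = (inner f g)%:C.
Proof.
by rewrite /cinner /real_vec /= linear0l addr0 linear0r linear0l subrr.
Qed.

Lemma nth_rem (T : Type) (x0 : T) (k : nat) (t : seq T) (j : nat) : (k < size t)%N ->
  nth x0 (take k t ++ drop k.+1 t) j = nth x0 t (bump k j).
Proof.
move=> kt; rewrite nth_cat size_take kt /bump; case: ltnP => h.
  by rewrite nth_take// leqNgt h.
by rewrite nth_drop; congr nth; lia.
Qed.

(** The permutations are sorted by the image k of the first position: [lift_perm] parametrizes them,
    and its k additional inversions are the weight with which the k-th letter of t is
    annihilated. *)
Lemma qinner_cons h s t : qinner q (h :: s) t = qann (V := C^o) q%:C (cinner h) t (qinner q s).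
Proof.
rewrite (qannE _ 0) /qinner /=.
have [st|st] := eqVneq (size s).+1 (size t); last first.
  rewrite big1// => k _; rewrite size_cat size_take size_drop ltn_ord.
  case: eqP => [e|_]; last by rewrite scaler0.
  by case/eqP: st; have := ltn_ord k; lia.
set n := size s in st *.
pose f (kp : 'I_n.+1 * 'S_n) := lift_perm ord0 kp.1 kp.2.
have fbij : bijective f.
  apply: inj_card_bij; last by rewrite card_prod card_ord !card_Sn factS.
  move=> [k p] [k' p'] /= e.
  have ek : k = k' by have := congr1 (fun P : 'S_n.+1 => P ord0) e; rewrite !lift_perm_id.
  rewrite -ek in e *; congr (_, _); apply/permP => i.
  by have := congr1 (fun P : 'S_n.+1 => P (lift ord0 i)) e; rewrite !lift_perm_lift => /lift_inj.
rewrite (reindex f) /=; last exact/onW_bij.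
rewrite -(pair_bigA _ (fun k p => (q ^+ inversions (f (k, p)))%:C * \prod_(i < n.+1) cinner (h :: s)`_i t`_(f (k, p) i))) /=.
rewrite -st; apply: eq_bigr => k _.
have kt : (k < size t)%N by rewrite -st.
rewrite size_cat size_take size_drop kt -st.
have -> : (n == k + (n.+1 - k.+1))%N by have := ltn_ord k; lia.
rewrite scaler_sumr; apply: eq_bigr => p _.
rewrite /f /= inversions_lift exprD RCM big_ord_recl lift_perm_id /=.
rewrite RCX -[RHS]/(_ * (_ * _)) -!mulrA; congr (_ * _); rewrite mulrCA; congr (_ * (_ * _)).
by apply: eq_bigr => i _; rewrite lift_perm_lift nth_rem.
Qed.

Variable F : qFock H q.
Local Notation te := (tens F).

Lemma qinner_sym s t : qinner q s t = (qinner q t s)^*%R.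
Proof. by rewrite -!(tens_inner F) inner_sym. Qed.

Lemma conjM_scale (c x : C) : ((c *: (x : C^o) : C^o) : C)^*%R = (c^*%R) *: ((x^*%R) : C^o).
Proof. exact: conjM. Qed.

Lemma qinner_consr h s t :
  qinner q t (h :: s) = qann (V := C^o) q%:C (fun v => cinner v h) t (fun u => qinner q u s).
Proof.
rewrite qinner_sym qinner_cons.
rewrite (@qann_map _ _ _ C^o C^o (fun c : C => c^*%R) (fun c : C => c^*%R)); first last.
- by rewrite conjC0.
- exact: conjM_scale.
- exact: conjD.
rewrite conj_RC; have -> : (fun v => (cinner h v)^*%R) = (fun v => cinner v h).
  by apply/funext => v; rewrite -cinner_sym.
by apply: eq_qann => u _; rewrite -qinner_sym.
Qed.

Definition ann_word h t := qann q%:C (fun v => cinner v h) t te.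

Lemma inner_ann_word h t x : inner (ann_word h t) x = qann (V := C^o) q%:C (fun v => cinner v h) t (fun u => inner (te u) x).
Proof.
apply: (@qann_map _ _ _ _ C^o id (fun y => inner y x)).
- by move=> u v; rewrite innerDl.
- by move=> c u; rewrite innerZl.
- exact: inner0l.
Qed.

Lemma ann_wordP h s t : inner (ann_word h t) (te s) = inner (te t) (te (h :: s)).
Proof.
rewrite inner_ann_word tens_inner qinner_consr; apply: eq_qann => u _.
exact: tens_inner.
Qed.

(** The q-commutation relation a a^* = <h, h> + q a^* a, at the level of words. *)
Lemma inner_cons h s t : inner (te (h :: s)) (te (h :: t)) =
  cinner h h * inner (te s) (te t) + q%:C * inner (ann_word h s) (ann_word h t).
Proof.
rewrite tens_inner qinner_cons /= -(tens_inner F); congr (_ + _ * _).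
rewrite [RHS]inner_sym inner_ann_word.
rewrite (@qann_map _ _ _ C^o C^o (fun c : C => c^*%R) (fun c : C => c^*%R)); first last.
- by rewrite conjC0.
- exact: conjM_scale.
- exact: conjD.
rewrite conj_RC; have -> : (fun v => (cinner v h)^*%R) = cinner h.
  by apply/funext => v; rewrite -cinner_sym.
apply: eq_qann => u _; by rewrite -inner_sym ann_wordP tens_inner.
Qed.

Lemma qann_span (a : Hc -> C) (w pre : seq Hc) : exists c : seq (C * seq Hc),
  qann q%:C a w (fun t => te (pre ++ t)) = lcomb te c /\
  (forall p, p \in c -> (size p.2 < size pre + size w)%N).
Proof.
elim: w pre => [|v w IH] pre; first by exists [::]; rewrite lcomb_nil.
have [c [cE cs]] := IH (rcons pre v).
exists ((a v, pre ++ w) :: cscale q%:C c); split.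
  rewrite /lcomb big_cons -/(lcomb _ _) lcomb_scale -cE /=; congr (_ + _ *: _).
  by apply: eq_qann => t _; rewrite cat_rcons.
move=> p; rewrite inE => /orP[/eqP ->|/mapP[p' /cs h ->]] /=; first by rewrite size_cat; lia.
by apply: leq_trans h _; rewrite size_rcons addSnnS.
Qed.

(** The strict drop in length drives the induction in [cvec_le]. *)
Lemma ann_span h (c : seq (C * seq Hc)) n : (forall p, p \in c -> (size p.2 <= n)%N) ->
  exists c', lcomb (ann_word h) c = lcomb te c' /\ forall p, p \in c' -> (size p.2 < n)%N.
Proof.
elim: c => [|[b w] c IH] hc; first by exists [::]; rewrite !lcomb_nil.
have [|c1 [e1 s1]] := IH; first by move=> p pc; apply: hc; rewrite inE pc orbT.
have [c2 [e2 s2]] := qann_span (fun v => cinner v h) w [::].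
exists (cscale b c2 ++ c1); split.
  by rewrite lcomb_cat lcomb_scale -e1 /lcomb big_cons /= -/(lcomb te c2) -e2.
have hw : (size w <= n)%N by apply: (hc (b, w)); rewrite inE eqxx.
move=> p; rewrite mem_cat => /orP[/mapP[p' /s2 h' ->]|/s1//] /=; exact: leq_trans h' hw.
Qed.

Definition cvec h := lcomb (fun w => te (h :: w)).

Lemma inner_lcomb (W : Type) (V : complexHilbertType R) (v v' : W -> V) c c' :
  inner (lcomb v c) (lcomb v' c') =
  \sum_(p <- c) \sum_(p' <- c') p.1 * (p'.1)^*%R * inner (v p.2) (v' p'.2).
Proof.
rewrite /lcomb inner_suml; apply: eq_bigr => p _; rewrite inner_sumr; apply: eq_bigr => p' _.
by rewrite innerZl innerZr mulrA.
Qed.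

Lemma ann_adj h c c' : inner (lcomb (ann_word h) c) (lcomb te c') = inner (lcomb te c) (cvec h c').
Proof.
rewrite !inner_lcomb; apply: eq_bigr => p _; apply: eq_bigr => p' _.
by rewrite ann_wordP.
Qed.

Lemma cvec_sqr h (r : R) c : cinner h h = r%:C ->
  nrm (cvec h c) ^+ 2 = r * nrm (lcomb te c) ^+ 2 + q * nrm (lcomb (ann_word h) c) ^+ 2.
Proof.
move=> hr; apply: (@complexI R); rewrite -inner_nrm RCD (RCM r) (RCM q) -!inner_nrm !inner_lcomb.
rewrite -hr !mulr_sumr -big_split; apply: eq_bigr => p _ /=.
rewrite !mulr_sumr -big_split; apply: eq_bigr => p' _ /=.
by rewrite inner_cons; ring.
Qed.

Hypothesis hq : -1 < q < 1.

Lemma q_norm_lt1 : 0 < 1 - `|q|.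
Proof. by have /andP[h1 h2] := hq; rewrite subr_gt0 ltr_norml h1. Qed.

(** Induction on the length. If a c denotes the annihilated combination, |a c|^2 is the inner
    product of c with the creation applied to a c, which is shorter; the induction hypothesis gives
    |a c|^2 <= M |c|^2. The q-commutation relation then closes the induction because r + |q| M =
    M. *)
Lemma cvec_le h (r : R) c : 0 <= r -> cinner h h = r%:C ->
  nrm (cvec h c) ^+ 2 <= r / (1 - `|q|) * nrm (lcomb te c) ^+ 2.
Proof.
move=> r0 hr; set M := r / _; have p0 := q_norm_lt1.
have M0 : 0 <= M by rewrite divr_ge0// ltW.
have ME : r + `|q| * M = M.
  have e : M * (1 - `|q|) = r by rewrite /M divfK// lt0r_neq0.
  by rewrite -{1}e mulrBr mulr1 [`|q| * M]mulrC subrK.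
have [n hn] : exists n, forall p, p \in c -> (size p.2 <= n)%N.
  exists (\max_(p <- c) size p.2) => p pc; exact: (leq_bigmax_seq _ pc).
elim/ltn_ind: n c hn => n IH c hn; rewrite (cvec_sqr _ hr).
have [c' [e sz]] := ann_span h hn.
have h1 : nrm (cvec h c') ^+ 2 <= M * nrm (lcomb te c') ^+ 2.
  case: n IH hn sz => [|n] IH hn sz; last by apply: (IH n (ltnSn n)) => p /sz.
  have -> : c' = [::] by case: c' sz {e} => // p c' /(_ p); rewrite inE eqxx ltn0 => /(_ erefl).
  by rewrite /cvec !lcomb_nil !nrm0 expr0n mulr0.
have h2 : nrm (lcomb (ann_word h) c) ^+ 2 <= nrm (lcomb te c) * nrm (cvec h c').
  rewrite -Cre_inner_nrm {2}e ann_adj; apply: (le_trans (ler_norm _)).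
  by apply: (le_trans (Cre_le_nrm _)); exact: inner_le.
have h3 : nrm (lcomb (ann_word h) c) ^+ 2 <= M * nrm (lcomb te c) ^+ 2.
  rewrite -e in h1; move: h1 h2 (nrm_ge0 (lcomb (ann_word h) c)) (nrm_ge0 (lcomb te c)) (nrm_ge0 (cvec h c')).
  move: (nrm _) (nrm _) (nrm _) => z x y h1 h2 x0 z0 y0.
  have [->|xn0] := eqVneq x 0; first by rewrite expr0n/= mulr_ge0 ?sqr_ge0.
  have xp : 0 < x ^+ 2 by rewrite exprn_gt0// lt_def xn0.
  have h4 : (x ^+ 2) ^+ 2 <= z ^+ 2 * y ^+ 2.
    by rewrite -exprMn ler_pXn2r ?nnegrE ?sqr_ge0 ?mulr_ge0.
  have h5 : z ^+ 2 * y ^+ 2 <= z ^+ 2 * (M * x ^+ 2) by apply: ler_wpM2l; [exact: sqr_ge0|].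
  rewrite -(ler_pM2l xp) -expr2; apply: (le_trans h4); apply: (le_trans h5).
  by rewrite [leLHS](_ : _ = x ^+ 2 * (M * z ^+ 2))//; ring.
rewrite -[in leRHS]ME mulrDl -mulrA; apply: lerD; first exact: lexx.
apply: (@le_trans _ _ (`|q| * nrm (lcomb (ann_word h) c) ^+ 2)).
  by apply: ler_wpM2r; [exact: sqr_ge0|exact: ler_norm].
by apply: ler_wpM2l.
Qed.

Lemma tens_total : total_family te.
Proof.
move=> x e e0.
have ec : 0 < e%:C :> R[i] by rewrite ltcR.
have [||y [/interior_subset hy [n [c [s yE]]]]] := @tens_dense _ _ _ F (ball x e%:C)°.
- by exists x; exact: nbhsx_ballx.
- exact: open_interior.
exists [seq (c i, s i) | i <- enum 'I_n]; move: hy; rewrite -ball_normE /= nrmE ltcR.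
by rewrite yE /lcomb big_map big_enum.
Qed.

Lemma ex_creation h : exists T : bounded_op F, (forall s, T (te s) = te (h :: s)).
Proof.
have [r r0 hr] := cinner_ge0 h.
have [||T [hT _]] := @total_op _ _ _ _ tens_total (fun s => te (h :: s)) (Num.sqrt (r / (1 - `|q|))).
- exact: sqrtr_ge0.
- move=> c; rewrite -(@ler_pXn2r _ 2) ?nnegrE ?mulr_ge0 ?sqrtr_ge0 ?nrm_ge0//.
  rewrite exprMn sqr_sqrtr; first exact: cvec_le.
  by rewrite divr_ge0// ltW// q_norm_lt1.
by exists T.
Qed.

Lemma creationE h s : creation F h (te s) = te (h :: s).
Proof.
rewrite /creation; have [T hT] := ex_creation h.
by have := getPex (P := [set T : bounded_op F | forall s, T (te s) = te (h :: s)]) (ex_intro _ T hT); apply.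
Qed.

Lemma annihilationE h s : annihilation F h (te s) = ann_word h s.
Proof.
apply: (total_extl tens_total) => t; rewrite /annihilation ann_wordP.
by rewrite -adjr creationE.
Qed.

End fock.

Lemma RCN (R : realType) (x : R) : (- x)%:C = - x%:C.
Proof. by rewrite -[- x]sub0r RCB sub0r. Qed.

Section wick_words.
Variables (R : realType) (q : R).

Section qann_more.
Variables (Z : Type).
Implicit Types (w : seq Z).

Lemma qann_mapl (Z' : Type) (V : lmodType R) (g : Z' -> Z) (a : Z -> R) (w : seq Z') (F : seq Z -> V) :
  qann q a (map g w) F = qann q (fun z => a (g z)) w (fun t => F (map g t)).
Proof. by elim: w F => [//|v w IH] F /=; rewrite IH. Qed.

(** The terms of [qann] as explicit data, over which the Wick recursion can run. *)
Fixpoint qterms (a : Z -> R) w : seq (R * seq Z) :=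
  if w is v :: w' then (a v, w') :: [seq (q * p.1, v :: p.2) | p <- qterms a w'] else [::].

Lemma qann_terms (V : lmodType R) a w (F : seq Z -> V) :
  qann q a w F = \sum_(p <- qterms a w) p.1 *: F p.2.
Proof.
elim: w F => [|v w IH] F /=; first by rewrite big_nil.
rewrite big_cons big_map IH scaler_sumr; congr (_ + _).
by apply: eq_bigr => p _; rewrite scalerA.
Qed.

Lemma qterms_size a w i : (i < size (qterms a w))%N ->
  size (nth (0, [::]) (qterms a w) i).2 = (size w).-1.
Proof.
elim: w i => [//|v w IH] [|i] //=; rewrite ltnS size_map => h.
by rewrite (nth_map (0, [::]))//= IH//; case: w h {IH}.
Qed.

End qann_more.

Lemma qann_swap (Z Z' : Type) (V : lmodType R) (a : Z -> R) (b : Z' -> R) (w : seq Z) (w' : seq Z') (F : seq Z -> seq Z' -> V) :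
  qann q a w (fun t => qann q b w' (F t)) = qann q b w' (fun t' => qann q a w (F^~ t')).
Proof.
rewrite [LHS]qann_terms [RHS]qann_terms; under eq_bigr do rewrite qann_terms scaler_sumr.
rewrite exchange_big; apply: eq_bigr => p' _; rewrite qann_terms scaler_sumr.
by apply: eq_bigr => p _; rewrite !scalerA mulrC.
Qed.


Definition rcomb (Z : Type) (V : lmodType R) (F : seq Z -> V) (c : seq (R * seq Z)) : V :=
  \sum_(p <- c) p.1 *: F p.2.

Section moments.
Variables (Z : Type) (ip : Z -> Z -> R).
Hypothesis ip_sym : forall x y, ip x y = ip y x.
Implicit Types (w us : seq Z).

(** The inner product of the word w with a product of Gaussians us applied to the vacuum
    ([mom_fock]), computed by letting the Gaussians act one after the other on w. Kept
    combinatorial, it also applies to letters that are coefficient vectors on sites, or that carry a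
    tag. *)
Fixpoint mom w us : R :=
  if us is u :: us' then mom (u :: w) us' + qann (V := R^o) q (fun v => ip v u) w (fun t => mom t us')
  else (nilp w)%:R.

(* The formal polynomial that creates the word w out of the vacuum. *)
Fixpoint wick_fuel n w : seq (R * seq Z) :=
  if n is n'.+1 then
    if w is f :: w' then
      [seq (p.1, f :: p.2) | p <- wick_fuel n' w'] ++
      flatten [seq [seq (- p.1 * p'.1, p'.2) | p' <- wick_fuel n' p.2] | p <- qterms (fun v => ip v f) w']
    else [:: (1, [::])]
  else [:: (1, [::])].

Definition wick w := wick_fuel (size w) w.

Lemma wick_fuelE n w : (size w <= n)%N -> wick_fuel n w = wick w.
Proof.
rewrite /wick; have [m hm] := ubnP (size w); elim: m n w hm => [//|m IH] [|n] [|f w] //=.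
rewrite !ltnS => hm hn; rewrite (IH n)//; congr (_ ++ flatten _).
apply: (@eq_from_nth _ [::]); rewrite ?size_map// => i hi.
have hz : size (nth (0, [::]) (qterms (fun v => ip v f) w) i).2 = (size w).-1 by exact: qterms_size.
rewrite !(nth_map (0, [::]))//; congr map.
by rewrite (IH n) ?(IH (size w))// hz; case: (w) hm hn => //= *; lia.
Qed.

Lemma rcomb_wick (V : lmodType R) (F : seq Z -> V) f w :
  rcomb F (wick (f :: w)) = rcomb (fun t => F (f :: t)) (wick w) -
    qann q (fun v => ip v f) w (fun t => rcomb F (wick t)).
Proof.
rewrite /rcomb {1}/wick /= big_cat big_map; congr (_ + _).
rewrite big_flatten big_map qann_terms -sumrN /=.
rewrite !(big_nth (0, [::])) !big_mkord; apply: eq_bigr => i _.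
rewrite big_map wick_fuelE ?qterms_size ?leq_pred//.
by rewrite -scaleNr scaler_sumr; apply: eq_bigr => p _; rewrite scalerA.
Qed.

Lemma mom_wickl w us : rcomb (V := R^o) (fun u => mom [::] (rev u ++ us)) (wick w) = mom w us.
Proof.
have [m hm] := ubnP (size w); elim: m w us hm => [//|m IH] [|f w] us /=.
  by rewrite /rcomb big_seq1 /= => _; exact: mul1r.
rewrite ltnS => hm; rewrite rcomb_wick.
have -> : qann (V := R^o) q (fun v => ip v f) w (fun t => rcomb (fun u => mom [::] (rev u ++ us)) (wick t)) =
   qann (V := R^o) q (fun v => ip v f) w (fun t => mom t us).
  by apply: eq_qann => t ht; apply: IH; rewrite ht; case: (w) hm => //= *; lia.
rewrite -[X in X - _](_ : mom w (f :: us) = _); first by rewrite /= addrK.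
rewrite -IH//; apply: eq_bigr => p _; by rewrite rev_cons cat_rcons.
Qed.

(** The q-inner product of words for an arbitrary scalar pairing. Two alphabets are allowed, so that
    the words on the two sides can be tagged differently. *)
Fixpoint qform (Z' : Type) (ip' : Z -> Z' -> R) w (w' : seq Z') : R :=
  if w' is f :: w'' then qann (V := R^o) q (fun v => ip' v f) w (fun t => qform ip' t w'')
  else (nilp w)%:R.

Lemma qform_consl f w w' : qform ip (f :: w) w' =
  qann (V := R^o) q (fun v => ip v f) w' (fun t => qform ip w t).
Proof.
elim: w' w => [//|g w' IH] w /=; rewrite ip_sym; congr (_ + _ *: _).
under [in RHS]eq_fun do idtac.
transitivity (qann (V := R^o) q (fun v => ip v g) w (fun t => qann (V := R^o) q (fun v => ip v f) w' (fun t' => qform ip t t'))).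
  by apply: eq_qann => t _; exact: IH.
exact: qann_swap.
Qed.

Lemma mom_wickr w w' : rcomb (V := R^o) (mom w) (wick w') = qform ip w w'.
Proof.
have [m hm] := ubnP (size w'); elim: m w w' hm => [//|m IH] w [|f w'] /=.
  by rewrite /rcomb big_seq1 /= => _; exact: mul1r.
rewrite ltnS => hm; rewrite rcomb_wick.
have -> : qann (V := R^o) q (fun v => ip v f) w' (fun t => rcomb (mom w) (wick t)) = qform ip (f :: w) w'.
  rewrite qform_consl; apply: eq_qann => t ht; apply: IH; rewrite ht.
  by case: (w') hm => //= *; lia.
rewrite /rcomb /=; under eq_bigr do rewrite scalerDr.
rewrite big_split /= -/(rcomb (V := R^o) (mom (f :: w)) (wick w')) IH// addrAC subrr add0r.
rewrite -qann_sum; apply: eq_qann => t _; exact: IH.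
Qed.

(** Valid for every symmetric pairing. Applied to tagged letters whose mutual pairing is scaled by
    r, it shows with [qform_scale] that rotating a Wick word of length n costs the factor r^n. *)
Lemma mom_wick2 w w' : rcomb (V := R^o) (fun u =>
    rcomb (V := R^o) (fun u' => mom [::] (rev u ++ u')) (wick w')) (wick w) = qform ip w w'.
Proof.
rewrite /rcomb -mom_wickr /rcomb; under eq_bigr do rewrite scaler_sumr.
rewrite exchange_big; apply: eq_bigr => p' _ /=.
rewrite -mom_wickl /rcomb scaler_sumr; apply: eq_bigr => p _; exact: mulrCA.
Qed.

End moments.

Lemma qform_map (Z1 Z2 Z1' Z2' : Type) (g : Z1 -> Z1') (g' : Z2 -> Z2') (ip : Z1' -> Z2' -> R) w w' :
  qform ip (map g w) (map g' w') = qform (fun x y => ip (g x) (g' y)) w w'.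
Proof.
elim: w' w => [|f w' IH] w /=; first by case: w.
by rewrite qann_mapl; apply: eq_qann => t _; rewrite IH.
Qed.

Lemma qform_scale (Z Z' : Type) (ip : Z -> Z' -> R) (c : R) w w' :
  qform (fun x y => c * ip x y) w w' = c ^+ size w * qform ip w w'.
Proof.
elim: w' w => [|f w' IH] w /=.
  by case: w => [|? ?]; rewrite ?expr0 ?mul1r//= mulr0.
case: w => [|v w]; first by rewrite /= mulr0.
transitivity (c ^+ (size w).+1 *: qann (V := R^o) q (ip^~ f) (v :: w) (fun t => qform ip t w')); last by [].
have -> : qann (V := R^o) q (fun x => c * ip x f) (v :: w) (fun t => qform (fun x y => c * ip x y) t w')
   = qann (V := R^o) q (fun x => c * ip x f) (v :: w) (fun t => c ^+ size w *: (qform ip t w' : R^o) + 0).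
  by apply: eq_qann => t /= ht; rewrite IH ht addr0.
rewrite qannP qann0 addr0 exprSr -scalerA; congr (_ *: _).
move: (v :: w) => u; elim: u (fun t => qform ip t w') => [|x u IHu] G /=; first by rewrite scaler0.
by rewrite IHu scalerDr !scalerA [q * c]mulrC.
Qed.

Lemma mom_map (Z Z' : Type) (g : Z -> Z') (ip : Z' -> Z' -> R) w us :
  mom ip (map g w) (map g us) = mom (fun x y => ip (g x) (g y)) w us.
Proof.
elim: us w => [|u us IH] w /=; first by case: w.
by rewrite -IH qann_mapl; congr (_ + _); apply: eq_qann => t _; rewrite IH.
Qed.

Lemma qterms_map (Z Z' : Type) (g : Z -> Z') (a : Z' -> R) w :
  qterms a (map g w) = [seq (p.1, map g p.2) | p <- qterms (fun x => a (g x)) w].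
Proof. by elim: w => [//|v w IH] /=; rewrite IH -!map_comp. Qed.

Lemma wick_map (Z Z' : Type) (g : Z -> Z') (ip : Z' -> Z' -> R) w :
  wick ip (map g w) = [seq (p.1, map g p.2) | p <- wick (fun x y => ip (g x) (g y)) w].
Proof.
rewrite /wick size_map; move: (size w) => n; elim: n w => [//|n IH] [|f w] //=.
rewrite map_cat IH -!map_comp; congr (_ ++ _).
rewrite map_flatten qterms_map -!map_comp; congr flatten; apply: eq_map => p /=.
by rewrite IH -!map_comp.
Qed.

End wick_words.

Section gaussian_words.
Variables (R : realType) (H : complexHilbertType R) (Z : Type).

Definition wprod (s : Z -> bounded_op H) (w : seq Z) : bounded_op H :=
  foldr (fun z T => s z * T) 1 w.

Lemma wprod_cat s w w' : wprod s (w ++ w') = wprod s w * wprod s w'.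
Proof. by elim: w => [|z w IH] /=; rewrite ?mul1r// IH mulrA. Qed.

Lemma star_wprod s w : (forall z, star (s z) = s z) -> star (wprod s w) = wprod s (rev w).
Proof.
move=> hs; elim: w => [|z w IH]; first exact: star1.
by rewrite /= star_opM IH hs rev_cons -cats1 wprod_cat /= mulr1.
Qed.

End gaussian_words.

Section real_words.
Variables (R : realType) (H : realHilbertType R) (q : R) (F : qFock H q).
Hypothesis hq : -1 < q < 1.
Local Notation C := R[i].
Implicit Types (w us : seq H).

Definition rtens w : F := tens F (map (@real_vec R H) w).
Definition vacuum : F := rtens [::].

Lemma gaussian_sa f : star (gaussian F f) = gaussian F f.
Proof. by rewrite /gaussian starD /annihilation starK addrC. Qed.

Lemma qann_real (a : H -> R) w (G : seq H -> F) : qann q%:C (fun v => (a v)%:C) w G =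
  \sum_(p <- qterms q a w) p.1%:C *: G p.2.
Proof.
elim: w G => [|v w IH] G /=; first by rewrite big_nil.
rewrite big_cons big_map IH scaler_sumr; congr (_ + _).
by apply: eq_bigr => p _; rewrite scalerA -RCM.
Qed.

Lemma qann_mapC (Z Z' : Type) (V : lmodType C) (g : Z' -> Z) (a : Z -> C) (w : seq Z') (G : seq Z -> V) :
  qann q%:C a (map g w) G = qann q%:C (fun z => a (g z)) w (fun t => G (map g t)).
Proof. by elim: w G => [//|v w IH] G /=; rewrite IH. Qed.

Lemma gaussianE f w : gaussian F f (rtens w) =
  rtens (f :: w) + qann q%:C (fun v => (inner v f)%:C) w rtens.
Proof.
rewrite /gaussian opDE creationE// annihilationE// /ann_word qann_mapC; congr (_ + _).
by congr qann; apply/funext => v; rewrite cinner_real.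
Qed.

Lemma rtens_nil w : inner (rtens w) vacuum = (nilp w)%:R.
Proof.
rewrite /vacuum /rtens tens_inner; case: w => [|f w]; last by rewrite qinner_cons.
rewrite /qinner /= (eq_bigr (fun=> 1)); last first.
  by move=> p _; rewrite inversionsE !big_ord0 expr0 mul1r.
by rewrite sumr_const card_Sn.
Qed.

Lemma mom_fock w us :
  inner (rtens w) (wprod (gaussian F) us vacuum) = (mom q (fun x y => inner x y) w us)%:C.
Proof.
elim: us w => [|u us IH] w.
  have -> : wprod (gaussian F) [::] vacuum = vacuum by [].
  by rewrite rtens_nil /=; case: nilp.
rewrite [wprod _ _]/= [mom _ _ _ _]/=.
rewrite opME adjr gaussian_sa gaussianE innerDl IH RCD; congr (_ + _).
rewrite qann_real inner_suml qann_terms RC_sum; apply: eq_bigr => p _.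
by rewrite innerZl IH -RCM.
Qed.

Lemma mom_fock0 w us : inner (wprod (gaussian F) us vacuum) (wprod (gaussian F) w vacuum) =
  (mom q (fun x y => inner x y) [::] (rev us ++ w))%:C.
Proof.
by rewrite -mom_fock wprod_cat opME -(star_wprod _ gaussian_sa) -adjl.
Qed.

Lemma wick_fock w : \sum_(p <- wick q (fun x y => inner x y) w) p.1%:C *: wprod (gaussian F) p.2 vacuum = rtens w.
Proof.
have [m hm] := ubnP (size w); elim: m w hm => [//|m IH] [|f w] /=.
  by rewrite big_seq1 scale1r op1E.
rewrite ltnS => hm.
have e : gaussian F f (rtens w) = \sum_(p <- wick q (fun x y => inner x y) w)
    p.1%:C *: wprod (gaussian F) (f :: p.2) vacuum.
  by rewrite -IH// opv_sum; apply: eq_bigr => p _; rewrite opvZ.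
transitivity (gaussian F f (rtens w) - qann q%:C (fun v => (inner v f)%:C) w rtens); last first.
  by rewrite gaussianE addrK.
rewrite e {1}/wick [wick_fuel _ _ _ _]/= big_cat big_map; congr (_ + _).
rewrite big_flatten big_map qann_real -sumrN /=.
rewrite !(big_nth (0, [::])) !big_mkord; apply: eq_bigr => i _.
rewrite big_map wick_fuelE ?qterms_size ?leq_pred//.
rewrite -IH; last by rewrite qterms_size//; case: (w) hm => //= *; lia.
rewrite -scaleNr scaler_sumr; apply: eq_bigr => p _.
by rewrite scalerA; congr (_ *: _); rewrite /= mulNr RCN RCM mulNr.
Qed.

Lemma tens_split (s1 s2 : seq (complexification H)) (h : complexification H) :
  tens F (s1 ++ h :: s2) = tens F (s1 ++ real_vec h.1 :: s2) + 'i *: tens F (s1 ++ real_vec h.2 :: s2).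
Proof.
apply: (total_extl (@tens_total _ _ _ F)) => t; rewrite innerDl innerZl !tens_inner.
elim: s1 t => [|g s1 IH] t /=; last first.
  rewrite !qinner_cons.
  have -> : qann (V := C^o) q%:C (cinner g) t (qinner q (s1 ++ h :: s2)) =
     qann (V := C^o) q%:C (cinner g) t (fun u => 'i *: (qinner q (s1 ++ real_vec h.2 :: s2) u : C^o) + qinner q (s1 ++ real_vec h.1 :: s2) u).
    by apply: eq_qann => u _; rewrite IH addrC.
  by rewrite qannP addrC.
rewrite !qinner_cons; move: (qinner q s2) => G.
elim: t G => [|v t IH] G /=; first by rewrite mulr0 addr0.
rewrite IH; have -> : cinner h v = cinner (real_vec h.1) v + 'i * cinner (real_vec h.2) v.
  rewrite /cinner /real_vec /= !linear0l !addr0 !sub0r.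
  apply/eqP; rewrite eq_complex /=; apply/andP; split; apply/eqP; ring.
by rewrite -![_ *: _]/(_ * _); ring.
Qed.

Lemma rtens_total : total_family rtens.
Proof.
have sp (s : seq (complexification H)) w : exists c, tens F (map (@real_vec R H) w ++ s) = lcomb rtens c.
  elim: s w => [|h s IH] w; first by exists [:: (1, w)]; rewrite cats0 lcomb1.
  have [c1 e1] := IH (rcons w h.1); have [c2 e2] := IH (rcons w h.2).
  exists (c1 ++ cscale 'i c2); rewrite tens_split lcomb_cat lcomb_scale -e1 -e2.
  by rewrite !map_rcons !cat_rcons.
move=> x e e0; have [c hc] := @tens_total _ _ _ F x e e0.
have [c' e'] : exists c', lcomb (tens F) c = lcomb rtens c'.
  elim: {hc} c => [|[a s] c [c' IH]]; first by exists [::]; rewrite !lcomb_nil.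
  have [c1 e1] := sp s [::]; exists (cscale a c1 ++ c').
  by rewrite lcomb_cat lcomb_scale -e1 -IH /lcomb big_cons.
by exists c'; rewrite -e'.
Qed.

Lemma gword_total : total_family (fun us => wprod (gaussian F) us vacuum).
Proof.
move=> x e e0; have [c hc] := rtens_total x e0.
have [c' e'] : exists c', lcomb rtens c = lcomb (fun us => wprod (gaussian F) us vacuum) c'.
  elim: {hc} c => [|[a w] c [c' IH]]; first by exists [::]; rewrite !lcomb_nil.
  exists (cscale a [seq (p.1%:C, p.2) | p <- wick q (fun x y => inner x y) w] ++ c').
  rewrite lcomb_cat lcomb_scale -IH /lcomb big_cons /= big_map; congr (_ *: _ + _).
  by rewrite -wick_fock.
by exists c'; rewrite -e'.
Qed.

End real_words.

(** * The Haagerup-Bozejko inequality *)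

Section gram_schmidt.
Variables (R : realType) (V : complexHilbertType R) (W : Type) (v : W -> V).
Local Notation C := R[i].
Local Notation vec := (lcomb v).

Lemma lcomb_flatten (I : Type) (r : seq I) (c : I -> C) (E : I -> seq (C * W)) :
  vec (flatten [seq cscale (c i) (E i) | i <- r]) = \sum_(i <- r) c i *: vec (E i).
Proof.
elim: r => [|i r IH]; first by rewrite big_nil lcomb_nil.
by rewrite /= lcomb_cat lcomb_scale IH big_cons.
Qed.

Lemma gram_schmidt (ws : seq W) : exists d (E : 'I_d -> seq (C * W)),
  (forall i j, inner (vec (E i)) (vec (E j)) = (i == j)%:R) /\
  (forall n w0, (n < size ws)%N -> v (nth w0 ws n) =
     \sum_i inner (v (nth w0 ws n)) (vec (E i)) *: vec (E i)).
Proof.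
elim: ws => [|w ws [d [E [ON sp]]]]; first by exists 0%N, (fun=> [::]); split=> // -[].
pose c0 := \sum_i inner (v w) (vec (E i)) *: vec (E i); pose g := v w - c0.
have orth j : inner g (vec (E j)) = 0.
  rewrite /g innerBl inner_suml (bigD1 j)//= big1 ?addr0.
    by rewrite innerZl ON eqxx mulr1 subrr.
  by move=> i ij; rewrite innerZl ON (negPf ij) mulr0.
have [g0|g0] := eqVneq g 0.
  exists d, E; split=> // -[|n] w0 //=; last exact: sp.
  by move=> _; apply/eqP; rewrite -subr_eq0 -/c0 -/g g0.
have ng : nrm g != 0 by apply: contra g0 => /eqP/nrm_eq0 ->.
pose a : C := ((nrm g)^-1)%:C.
pose e := cscale a ((1, w) :: flatten [seq cscale (- inner (v w) (vec (E i))) (E i) | i <- enum 'I_d]).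
have eE : vec e = a *: g.
  rewrite lcomb_scale /lcomb big_cons /= -/(lcomb v _) lcomb_flatten scale1r /g /c0; congr (_ *: (_ + _)).
  by rewrite big_enum -sumrN; apply: eq_bigr => i _; rewrite scaleNr.
pose E' (i : 'I_d.+1) := if unlift ord0 i is Some j then E j else e.
have E'0 : E' ord0 = e by rewrite /E' unlift_none.
have E'S j : E' (lift ord0 j) = E j by rewrite /E' liftK.
have ee : inner (vec e) (vec e) = 1.
  rewrite eE innerZl innerZr inner_nrm /a conj_RC -!RCM; congr (_ %:C); field.
  exact: ng.
have oe j : inner (vec e) (vec (E j)) = 0 by rewrite eE innerZl orth mulr0.
exists d.+1, E'; split=> [i j|].
  case: (unliftP ord0 i) => [i'|] ->; case: (unliftP ord0 j) => [j'|] ->; rewrite ?E'0 ?E'S.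
  - by rewrite ON (inj_eq lift_inj).
  - by rewrite inner_sym oe conjC0.
  - by rewrite oe.
  - by rewrite ee eqxx.
move=> [|n] w0 /=; rewrite ?ltnS => hn; rewrite big_ord_recl E'0; under eq_bigr do rewrite E'S.
  have -> : inner (v w) (vec e) *: vec e = g.
    have -> : inner (v w) (vec e) = (nrm g)%:C.
      have -> : v w = g + c0 by rewrite subrK.
      have hg : inner c0 g = 0.
        by rewrite /c0 inner_suml big1// => i _; rewrite innerZl [inner _ g]inner_sym orth conjC0 mulr0.
      rewrite innerDl eE !innerZr hg mulr0 addr0 inner_nrm /a conj_RC -RCM; congr (_ %:C).
      field; exact: ng.
    by rewrite eE scalerA /a -RCM mulfV// scale1r.
  by rewrite -/c0 /g subrK.
have -> : inner (v (nth w0 ws n)) (vec e) = 0.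
  rewrite (sp n w0 hn) inner_suml big1// => i _.
  by rewrite innerZl [inner _ (vec e)]inner_sym oe conjC0 mulr0.
by rewrite scale0r add0r -sp.
Qed.

End gram_schmidt.

Section shuffles.
Variables (R : realType) (q : R) (Z : Type).
Local Notation C := R[i].
Implicit Types (w : seq Z).

(* All splittings of a word into two complementary subwords, weighted by q to the
   number of inversions. *)
Fixpoint shl w : seq (R * (seq Z * seq Z)) :=
  if w is g :: w' then
    [seq (s.1, (g :: s.2.1, s.2.2)) | s <- shl w'] ++
    [seq (q ^+ size s.2.1 * s.1, (s.2.1, g :: s.2.2)) | s <- shl w']
  else [:: (1, ([::], [::]))].

Definition shs (V : lmodType C) (f : seq Z -> seq Z -> V) w : V :=
  \sum_(s <- shl w) s.1%:C *: f s.2.1 s.2.2.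

Lemma shs_cons (V : lmodType C) (f : seq Z -> seq Z -> V) g w : shs f (g :: w) =
  shs (fun u1 u2 => f (g :: u1) u2) w + shs (fun u1 u2 => (q ^+ size u1)%:C *: f u1 (g :: u2)) w.
Proof.
rewrite /shs /= big_cat !big_map; congr (_ + _).
by apply: eq_bigr => s _ /=; rewrite RCM scalerA mulrC.
Qed.

Lemma eq_shs (V : lmodType C) (f f' : seq Z -> seq Z -> V) w : (forall u v, f u v = f' u v) -> shs f w = shs f' w.
Proof. by move=> h; apply: eq_bigr => s _; rewrite h. Qed.

Lemma shsP (V : lmodType C) (f f' : seq Z -> seq Z -> V) (c : C) w :
  shs (fun u v => c *: f u v + f' u v) w = c *: shs f w + shs f' w.
Proof.
rewrite /shs scaler_sumr -big_split; apply: eq_bigr => s _.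
by rewrite scalerDr !scalerA mulrC.
Qed.

(** Letters of the right part that precede the removed letter make up the difference between its
    position in w and its position in the left part; they are precisely its inversions in the
    splitting. *)
Lemma shs_qann (V : lmodType C) (a : Z -> C) (f : seq Z -> seq Z -> V) w :
  shs (fun u1 u2 => qann q%:C a u1 (fun t => f t u2)) w = qann q%:C a w (shs f).
Proof.
elim: w f => [|g w IH] f; first by rewrite /shs big_seq1 /= scaler0.
rewrite shs_cons /= shsP.
have -> : qann q%:C a w (fun t => shs f (g :: t)) =
   qann q%:C a w (fun t => (1 : C) *: shs (fun u1 u2 => f (g :: u1) u2) t
      + shs (fun u1 u2 => (q ^+ size u1)%:C *: f u1 (g :: u2)) t).
  by apply: eq_qann => t _; rewrite scale1r shs_cons.
rewrite qannP scale1r scalerDr addrA; congr (_ + _).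
  by congr (_ + _); rewrite -IH /shs scaler_sumr; apply: eq_bigr => s _; rewrite !scalerA mulrC.
rewrite -IH /shs scaler_sumr; apply: eq_bigr => s _; rewrite [RHS]scalerA [q%:C * _]mulrC -[RHS]scalerA; congr (_ *: _).
move: s.2.1 s.2.2 => u1 u2; case: u1 => [|u u1]; first by rewrite /= !scaler0.
have -> : qann q%:C a (u :: u1) (fun t => (q ^+ size t)%:C *: f t (g :: u2)) =
   qann q%:C a (u :: u1) (fun t => (q ^+ size u1)%:C *: f t (g :: u2) + 0).
  by apply: eq_qann => t /= ->; rewrite addr0.
by rewrite qannP qann0 addr0 scalerA -RCM -exprS.
Qed.

Lemma shs_nil (V : lmodType C) (f : seq Z -> V) w :
  shs (fun u1 u2 => (nilp u1)%:R *: f u2) w = f w.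
Proof.
elim: w f => [|g w IH] f; first by rewrite /shs big_seq1 /= !scale1r.
rewrite shs_cons -[RHS](IH (fun t => f (g :: t))) -[RHS]add0r; congr (_ + _).
  by rewrite /shs big1// => s _; rewrite /= scale0r scaler0.
by apply: eq_shs => u v; case: u => [|? ?] /=; rewrite ?expr0 ?scale1r// !scale0r scaler0.
Qed.

Definition shj j w := [seq s <- shl w | size s.2.1 == j].

Lemma shj_l1_rec j g w : \sum_(s <- shj j.+1 (g :: w)) `|s.1| =
  \sum_(s <- shj j w) `|s.1| + `|q| ^+ j.+1 * \sum_(s <- shj j.+1 w) `|s.1|.
Proof.
rewrite /shj /= filter_cat big_cat !big_filter !big_map /=; congr (_ + _).
rewrite mulr_sumr; apply: eq_bigr => s /eqP ->.
by rewrite normrM normrX.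
Qed.

Lemma shj_l1_0 w : \sum_(s <- shj 0 w) `|s.1| = 1.
Proof.
elim: w => [|g w IH]; first by rewrite /shj /= big_seq1 normr1.
rewrite -[RHS]IH /shj /= filter_cat big_cat !big_filter !big_map /= big_pred0 ?add0r//.
by apply: eq_bigr => s /eqP ->; rewrite expr0 mul1r.
Qed.

(** The product of the (1 - |q|^i)^-1 for i from 1 to j, an inverse q-Pochhammer symbol. It bounds
    q-binomial coefficients independently of the length of the word. *)
Fixpoint qpoch j : R := if j is j'.+1 then qpoch j' / (1 - `|q| ^+ j) else 1.

Hypothesis hq : `|q| < 1.

Lemma qpoch_den j : 0 < 1 - `|q| ^+ j.+1.
Proof. by rewrite subr_gt0 exprn_ilt1. Qed.

Lemma qpoch_gt0 j : 0 < qpoch j.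
Proof. by elim: j => [|j IH] //=; rewrite divr_gt0// qpoch_den. Qed.

Lemma qpoch_ndS j : qpoch j <= qpoch j.+1.
Proof.
rewrite /= ler_pdivlMr ?qpoch_den// ler_piMr ?(ltW (qpoch_gt0 j))//.
Qed.

Lemma qpoch_nd j k : (j <= k)%N -> qpoch j <= qpoch k.
Proof.
elim: k => [|k IH]; first by rewrite leqn0 => /eqP ->.
by rewrite leq_eqVlt => /orP[/eqP <-//|]; rewrite ltnS => /IH h; apply: (le_trans h); exact: qpoch_ndS.
Qed.

(** Double induction: the sums satisfy S_(j+1)(g w) = S_j(w) + |q|^(j+1) S_(j+1)(w), and [qpoch] is
    the stationary solution of this recursion. *)
Lemma shj_l1 j w : \sum_(s <- shj j w) `|s.1| <= qpoch j.
Proof.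
elim: j w => [|j IHj] w; first by rewrite shj_l1_0.
elim: w => [|g w IH]; first by rewrite /shj /= big_nil; exact/ltW/(qpoch_gt0 j.+1).
rewrite shj_l1_rec; have e : qpoch j = qpoch j.+1 * (1 - `|q| ^+ j.+1).
  by rewrite [qpoch j.+1]/= divfK// lt0r_neq0// qpoch_den.
have h : `|q| ^+ j.+1 * \sum_(s <- shj j.+1 w) `|s.1| <= `|q| ^+ j.+1 * qpoch j.+1.
  by apply: ler_wpM2l => //; exact: exprn_ge0.
apply: (le_trans (lerD (IHj w) h)); rewrite e; move: (qpoch j.+1) => p.
by rewrite mulrBr mulr1 [p * _]mulrC subrK.
Qed.

(** The factors tend to 1, hence are at most rho beyond some N; the earlier ones go into the
    constant. *)
Lemma qpoch_subexp (rho : R) : 1 < rho -> exists2 c, 0 < c & forall j, qpoch j <= c * rho ^+ j.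
Proof.
move=> r1; have r0 : 0 < rho by exact: lt_trans r1.
have [N hN] : exists N, forall j, (N <= j)%N -> (1 - `|q| ^+ j.+1)^-1 <= rho.
  have d0 : 0 < 1 - rho^-1 by rewrite subr_gt0 invf_lt1.
  have : `|q| ^+ n @[n --> \oo] --> 0 by apply: cvg_expr; rewrite normr_id.
  move=> /cvgrPdist_lt/(_ _ d0)[N _ h]; exists N => j Nj.
  have := h j.+1 (leqW Nj) => /=; rewrite sub0r normrN ger0_norm ?exprn_ge0// => h'.
  by rewrite -[leRHS]invrK lef_pV2 ?posrE ?invr_gt0 ?qpoch_den//; lra.
exists (qpoch N); first exact: qpoch_gt0.
have up j : 1 <= rho ^+ j by rewrite exprn_ege1// ltW.
elim=> [|j IH]; first by rewrite expr0 mulr1; exact: qpoch_nd.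
have [jN|Nj] := ltnP j N.
  apply: (le_trans (qpoch_nd jN)); rewrite ler_peMr//; exact/ltW/qpoch_gt0.
rewrite [qpoch j.+1]/= [rho ^+ _]exprSr mulrA; apply: ler_pM => //; last exact: hN.
- exact/ltW/qpoch_gt0.
- by rewrite invr_ge0; exact/ltW/qpoch_den.
Qed.

End shuffles.

Lemma bernoulli_le (R : realFieldType) (y : R) m : 1 <= y -> 1 + m%:R * (y - 1) <= y ^+ m.
Proof.
move=> y1; elim: m => [|m IH]; first by rewrite mul0r addr0 expr0.
rewrite exprS -natr1; apply: (@le_trans _ _ (y * (1 + m%:R * (y - 1)))); last first.
  by apply: ler_wpM2l => //; exact: le_trans y1.
rewrite -subr_ge0 (_ : _ - _ = m%:R * (y - 1) ^+ 2); last by ring.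
by rewrite mulr_ge0 ?sqr_ge0.
Qed.

Section concatenation.
Variables (R : realType) (H : realHilbertType R) (q : R) (F : qFock H q).
Hypothesis hq : -1 < q < 1.
Local Notation C := R[i].
Local Notation rt := (rtens F).
Local Notation ip := (fun x y : H => inner x y).
Implicit Types (u v w t : seq H) (x y : seq (C * (seq H * seq H))).

Let hq1 : `|q| < 1. Proof. by have := q_norm_lt1 hq; rewrite subr_gt0. Qed.

Lemma qann_RC (a : H -> R) w (G : seq H -> C) (G' : seq H -> R) : (forall t, G t = (G' t)%:C) ->
  qann (V := C^o) q%:C (fun z => (a z)%:C) w G = (qann (V := R^o) q a w G')%:C.
Proof.
elim: w G G' => [|g w IH] G G' h //=.
by rewrite (IH _ (fun t => G' (g :: t)))// h RCD !RCM.
Qed.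

Lemma rt_inner w w' : inner (rt w) (rt w') = (qform q ip w w')%:C.
Proof.
elim: w' w => [|f w' IH] w; first by rewrite rtens_nil /=; case: nilp.
rewrite /rtens tens_inner /= (qinner_consr F) qann_mapC.
have -> : (fun z : H => cinner (real_vec z) (real_vec f)) = fun z => (inner z f)%:C.
  by apply/funext => z; rewrite cinner_real.
by apply: qann_RC => t; rewrite -(tens_inner F) -IH.
Qed.

Lemma inner_symR (f g : H) : inner f g = inner g f.
Proof. by rewrite (hermC (@inner _ _ H)) expr0 mul1r. Qed.

Lemma qform_sym u v : qform q ip u v = qform q ip v u.
Proof. by apply: complexI; rewrite -!rt_inner inner_sym rt_inner conj_RC. Qed.

Lemma qform_size u v : size u != size v -> qform q ip u v = 0.
Proof.
elim: v u => [|g v IH] [|f u] //= h.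
have e t : size t = (size (f :: u)).-1 -> qform q ip t v = 0 by move=> ht; apply: IH; rewrite ht.
have e1 := @eq_qann H R R^o q (fun z => inner z g) (f :: u) (fun t => qform q ip t v) (fun=> 0) e.
by apply: (etrans e1); exact: (@qann0 H R R^o q).
Qed.

(** Recursion from the last letter instead of the first. It yields the invariance under reversal of
    both words, which converts estimates for creators into estimates for annihilators. *)
Lemma qform_rcons u f v : qform q ip (rcons u f) v =
  qann (V := R^o) q (fun z => inner z f) (rev v) (fun t => qform q ip u (rev t)).
Proof.
elim: v u => [|g v IH] u; first by case: u.
rewrite rev_cons -!cats1 qann_cat [LHS]/= qann_cat /= !scaler0 !addr0 !cats0 revK; congr (_ + _).
  transitivity (qann (V := R^o) q (fun z => inner z g) u (fun t => qann (V := R^o) q (fun z => inner z f) (rev v)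
      (fun s => qform q ip t (rev s)))).
    by apply: eq_qann => t _; rewrite cats1 IH.
  rewrite qann_swap; apply: eq_qann => t _; by rewrite cats1 rev_rcons.
rewrite size_rev [inner f g]inner_symR.
have [e|e] := eqVneq (size u) (size v); first by rewrite e.
by rewrite qform_size// !scaler0.
Qed.

Lemma qform_rev u v : qform q ip (rev u) (rev v) = qform q ip u v.
Proof.
elim: u v => [|f u IH] v; first by rewrite qform_sym [RHS]qform_sym /nilp; case: v => [//|g v]; rewrite rev_cons; case: (rev v).
rewrite rev_cons qform_rcons revK qform_consl; last exact: inner_symR.
by apply: eq_qann => t _; exact: IH.
Qed.

(** The weighted splitting is the adjoint of concatenation. Induction on u: by [shs_qann],
    annihilating a letter of w is the same as annihilating it in the left part of each splitting. *)
Lemma concat_inner u v w : inner (rt (u ++ v)) (rt w) =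
  shs q (V := C^o) (fun w1 w2 => inner (rt u) (rt w1) * inner (rt v) (rt w2)) w.
Proof.
elim: u w => [|f u IH] w /=.
  rewrite -[LHS](shs_nil q (V := C^o) (fun w2 => inner (rt v) (rt w2))); apply: eq_shs => w1 w2.
  rewrite [inner _ (rt w1)]inner_sym rtens_nil; case: nilp; rewrite ?conjC1 ?conjC0//.
have cons (g : H) (s t : seq H) : inner (rt (g :: s)) (rt t) =
    qann (V := C^o) q%:C (fun z => (inner z g)%:C) t (fun t' => inner (rt s) (rt t')).
  rewrite /rtens tens_inner /= qinner_cons qann_mapC.
  have -> : (fun z : H => cinner (real_vec g) (real_vec z)) = fun z => (inner z g)%:C.
    by apply/funext => z; rewrite cinner_real inner_symR.
  by apply: eq_qann => t' _; rewrite tens_inner.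
rewrite cons.
have -> : qann (V := C^o) q%:C (fun z => (inner z f)%:C) w (fun t' => inner (rt (u ++ v)) (rt t')) =
  qann (V := C^o) q%:C (fun z => (inner z f)%:C) w
    (shs q (V := C^o) (fun w1 w2 => inner (rt u) (rt w1) * inner (rt v) (rt w2))).
  by apply: eq_qann => t _; exact: IH.
rewrite -shs_qann; apply: eq_shs => w1 w2; rewrite cons mulrC.
move: (inner (rt v) (rt w2)) => z.
have -> : (fun t => inner (rt u) (rt t) * z) = (fun t => z *: (inner (rt u) (rt t) : C^o) + 0).
  by apply/funext => t; rewrite addr0 mulrC.
by rewrite qannP qann0 addr0.
Qed.

Lemma concat_inner_j u v w : inner (rt (u ++ v)) (rt w) =
  \sum_(s <- shj q (size u) w) s.1%:C * (inner (rt u) (rt s.2.1) * inner (rt v) (rt s.2.2)).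
Proof.
rewrite concat_inner /shs /shj big_filter [RHS]big_mkcond; apply: eq_bigr => s _.
case: ifP => // h; rewrite rt_inner qform_size ?mul0r ?scaler0//.
by rewrite eq_sym h.
Qed.

(* A list x of weighted pairs of words stands for an element of the algebraic tensor
   square: form2 is the tensor inner product, cat_vec the concatenation. *)
Definition cat_vec x : F := lcomb (fun p => rt (p.1 ++ p.2)) x.
Definition form2 x y : C := \sum_(p <- x) \sum_(p' <- y)
  p.1 * (p'.1)^*%R * (inner (rt p.2.1) (rt p'.2.1) * inner (rt p.2.2) (rt p'.2.2)).
(** Concatenation followed by its adjoint, restricted to left parts of a fixed size: by
    [form2_shuffle] it represents the positive operator whose norm is wanted. *)
Definition shuffle_map x := flatten [seq
  [seq (p.1 * s.1%:C, s.2) | s <- shj q (size p.2.1) (p.2.1 ++ p.2.2)] | p <- x].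
Definition left_size j x := all (fun p => size p.2.1 == j) x.

Lemma left_sizeP j x p : left_size j x -> p \in x -> size p.2.1 = j.
Proof. by move=> /allP h /h /eqP. Qed.

Lemma shuffle_left j x : left_size j x -> left_size j (shuffle_map x).
Proof.
move=> hx; apply/allP => p /flatten_mapP[p' p'x /mapP[s]]; rewrite mem_filter => /andP[/eqP h _] ->.
by rewrite /= h (left_sizeP hx p'x).
Qed.

Lemma form2_shuffle j x y : left_size j x -> left_size j y ->
  form2 x (shuffle_map y) = inner (cat_vec x) (cat_vec y).
Proof.
move=> hx hy; rewrite inner_lcomb /form2 /shuffle_map.
rewrite big_seq_cond [RHS]big_seq_cond; apply: eq_bigr => p; rewrite andbT => px.
rewrite big_flatten big_map big_seq_cond [RHS]big_seq_cond; apply: eq_bigr => p'; rewrite andbT => py.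
rewrite big_map concat_inner_j (left_sizeP hx px) (left_sizeP hy py) mulr_sumr.
by apply: eq_bigr => s _ /=; rewrite conjM conj_RC; ring.
Qed.

Lemma form2_sym x y : form2 x y = (form2 y x)^*%R.
Proof.
rewrite /form2 conj_sum exchange_big; apply: eq_bigr => p _; rewrite conj_sum; apply: eq_bigr => p' _.
rewrite !conjM cjK -!inner_sym; ring.
Qed.

Lemma form2_shuffle_sym j x y : left_size j x -> left_size j y ->
  form2 (shuffle_map x) y = form2 x (shuffle_map y).
Proof.
move=> hx hy; rewrite form2_sym (form2_shuffle hy hx) (form2_shuffle hx hy).
by rewrite -inner_sym.
Qed.

(** Coordinates in an orthonormal family produced by Gram-Schmidt: the Gram matrix of a finite list
    of words becomes a finite sum of products. *)
Lemma gram_factor (ws : seq (seq H)) : exists d (kap : 'I_d -> seq H -> C),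
  forall u u', u \in ws -> u' \in ws ->
    inner (rt u) (rt u') = \sum_a kap a u * (kap a u')^*%R.
Proof.
have [d [E [_ sp]]] := gram_schmidt rt ws.
exists d, (fun a u => inner (rt u) (lcomb rt (E a))) => u u' _ hu'.
have hw : rt u' = \sum_i inner (rt u') (lcomb rt (E i)) *: lcomb rt (E i).
  by rewrite -{1 2}(nth_index [::] hu') -sp// index_mem.
rewrite {1}hw inner_sumr; apply: eq_bigr => a _; by rewrite innerZr mulrC.
Qed.

(** The coordinates of the left words place any finite part of the tensor square in a finite sum of
    copies of F; positivity and Cauchy-Schwarz for [form2] are read off there. *)
Lemma form2_rep (ws : seq (seq H)) : exists d (Phi : seq (C * (seq H * seq H)) -> l2 'I_d F),
  forall x y, (forall p, p \in x -> p.2.1 \in ws) -> (forall p, p \in y -> p.2.1 \in ws) ->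
    form2 x y = inner (Phi x) (Phi y).
Proof.
have [d [kap hk]] := gram_factor ws.
exists d, (fun x => fin_vec (fun a => \sum_(p <- x) (p.1 * kap a p.2.1) *: rt p.2.2)).
move=> x y hx hy; rewrite inner_l2.
under eq_bigr do rewrite !fin_vecE inner_suml.
rewrite exchange_big /form2 big_seq_cond [RHS]big_seq_cond; apply: eq_bigr => p; rewrite andbT => px.
under [RHS]eq_bigr do rewrite inner_sumr.
rewrite exchange_big big_seq_cond [RHS]big_seq_cond; apply: eq_bigr => p'; rewrite andbT => py.
under [RHS]eq_bigr do rewrite innerZl innerZr conjM.
rewrite (hk _ _ (hx _ px) (hy _ py)) mulr_suml mulr_sumr; apply: eq_bigr => a _; ring.
Qed.

Lemma form2_ge0 x : 0 <= Cre (form2 x x).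
Proof.
have [d [Phi hPhi]] := form2_rep [seq p.2.1 | p <- x].
by rewrite hPhi ?Cre_inner_nrm ?sqr_ge0// => p px; apply: map_f.
Qed.

Lemma form2_CS x y : nrm (form2 x y) ^+ 2 <= Cre (form2 x x) * Cre (form2 y y).
Proof.
have [d [Phi hPhi]] := form2_rep ([seq p.2.1 | p <- x] ++ [seq p.2.1 | p <- y]).
have hx p : p \in x -> p.2.1 \in [seq p.2.1 | p <- x] ++ [seq p.2.1 | p <- y].
  by move=> px; rewrite mem_cat; apply/orP; left; apply/mapP; exists p.
have hy p : p \in y -> p.2.1 \in [seq p.2.1 | p <- x] ++ [seq p.2.1 | p <- y].
  by move=> py; rewrite mem_cat; apply/orP; right; apply/mapP; exists p.
rewrite !hPhi// !Cre_inner_nrm -exprMn.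
by rewrite ler_pXn2r ?nnegrE ?nrm_ge0 ?mulr_ge0 ?nrm_ge0//; exact: inner_le.
Qed.

Let l1 x : R := \sum_(p <- x) nrm p.1.

Let shuffle_l1 j x : left_size j x -> l1 (shuffle_map x) <= qpoch q j * l1 x.
Proof.
move=> hx; rewrite /l1 /shuffle_map big_flatten big_map mulr_sumr.
rewrite big_seq_cond [leRHS]big_seq_cond; apply: ler_sum => p; rewrite andbT => px.
rewrite big_map /=; under eq_bigr do rewrite nrmM nrmC.
rewrite -mulr_sumr mulrC (left_sizeP hx px); apply: ler_wpM2r; first exact: nrm_ge0.
exact: shj_l1.
Qed.

(** Shuffling only permutes the letters of p.1 p.2, so these bounds survive every iteration. They
    compare [form2] with the l1 norm of the coefficients. *)
Let bounded_words (k : R) n x := forall p, p \in x ->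
  (size p.2.1 + size p.2.2 <= n)%N /\ forall f, f \in p.2.1 ++ p.2.2 -> nrm (creation F (real_vec f)) <= k.

Lemma shl_perm w s : s \in shl q w -> perm_eq (s.2.1 ++ s.2.2) w.
Proof.
elim: w s => [|g w IH] s /=; first by rewrite inE => /eqP ->.
rewrite mem_cat => /orP[/mapP[s' /IH h ->]|/mapP[s' /IH h ->]] /=; first by rewrite perm_cons.
by rewrite -cat1s perm_catCA /= perm_cons.
Qed.

Let bounded_shuffle k n x : bounded_words k n x -> bounded_words k n (shuffle_map x).
Proof.
move=> hx p /flatten_mapP[p' /hx[h1 h2] /mapP[s]]; rewrite mem_filter => /andP[_ /shl_perm sp] -> /=.
split; first by rewrite -size_cat (perm_size sp) size_cat.
by move=> f; rewrite (perm_mem sp); exact: h2.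
Qed.

Lemma rt_le (k : R) w : 0 <= k -> (forall f, f \in w -> nrm (creation F (real_vec f)) <= k) -> nrm (rt w) <= k ^+ size w.
Proof.
move=> k0; elim: w => [|f w IH] h.
  rewrite expr0 -(@expr_le1 _ 2) ?nrm_ge0// -Cre_inner_nrm rtens_nil /=; exact: lexx.
rewrite exprS /rtens /= -creationE//; apply: (le_trans (op_le _ _)).
apply: ler_pM; rewrite ?nrm_ge0//; first by apply: h; rewrite inE eqxx.
by apply: IH => g gw; apply: h; rewrite inE gw orbT.
Qed.

Let form2_bound (k : R) n x y : 1 <= k -> bounded_words k n x -> bounded_words k n y ->
  nrm (form2 x y) <= (k ^+ n) ^+ 2 * (l1 x * l1 y).
Proof.
move=> k1 hx hy; have k0 : 0 <= k by exact: le_trans k1.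
have hz z p : bounded_words k n z -> p \in z -> nrm (rt p.2.1) * nrm (rt p.2.2) <= k ^+ n.
  move=> hz /hz[h1 h2]; apply: (le_trans _ (ler_weXn2l k1 h1)); rewrite exprD; apply: ler_pM; rewrite ?nrm_ge0//.
    by apply: rt_le => // f hf; apply: h2; rewrite mem_cat hf.
  by apply: rt_le => // f hf; apply: h2; rewrite mem_cat hf orbT.
apply: (le_trans (nrm_sum _ _ _)); rewrite /l1 mulr_suml mulr_sumr.
rewrite big_seq_cond [leRHS]big_seq_cond; apply: ler_sum => p; rewrite andbT => px.
apply: (le_trans (nrm_sum _ _ _)); rewrite mulr_sumr mulr_sumr.
rewrite big_seq_cond [leRHS]big_seq_cond; apply: ler_sum => p'; rewrite andbT => py.
rewrite !nrmM nrm_conj mulrC; apply: ler_pM; rewrite ?mulr_ge0 ?nrm_ge0//.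
have h1 := hz _ _ hx px; have h2 := hz _ _ hy py.
apply: (@le_trans _ _ (nrm (rt p.2.1) * nrm (rt p'.2.1) * (nrm (rt p.2.2) * nrm (rt p'.2.2)))).
  by apply: ler_pM; rewrite ?nrm_ge0//; exact: inner_le.
rewrite mulrACA expr2; apply: ler_pM => //; by rewrite mulr_ge0 ?nrm_ge0.
Qed.

(* The shuffle map is symmetric for form2 and bounded by qpoch j in a weighted l1 norm,
   so its spectral radius bounds it for form2. *)
Lemma concat_le j x : left_size j x ->
  nrm (cat_vec x) ^+ 2 <= qpoch q j * Cre (form2 x x).
Proof.
move=> hx; set P := qpoch q j; have P0 : 0 < P by exact: qpoch_gt0.
pose k : R := 1 + \sum_(p <- x) \sum_(f <- p.2.1 ++ p.2.2) nrm (creation F (real_vec f)).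
have k1 : 1 <= k by rewrite lerDl sumr_ge0// => p _; rewrite sumr_ge0// => f _; exact: nrm_ge0.
pose n := (\sum_(p <- x) (size p.2.1 + size p.2.2))%N.
have bx : bounded_words k n x.
  move=> p px; split; first by rewrite /n (big_rem p px) leq_addr.
  move=> f fp; rewrite /k (big_rem p px) (big_rem f fp) /= -!addrA [1 + _]addrC -!addrA lerDl.
  rewrite !addr_ge0// ?sumr_ge0// => *; rewrite ?nrm_ge0// sumr_ge0// => *; exact: nrm_ge0.
pose X m := iter m shuffle_map x.
have lX m : left_size j (X m) by elim: m => [//|m IH]; exact: shuffle_left.
have bX m : bounded_words k n (X m) by elim: m => [//|m IH]; exact: bounded_shuffle.
have l1X m : l1 (X m) <= P ^+ m * l1 x.
  elim: m => [|m IH]; first by rewrite expr0 mul1r.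
  apply: (le_trans (shuffle_l1 (lX m))); rewrite exprS -mulrA; apply: ler_wpM2l => //; exact: ltW.
have shift a b : form2 (X a) (X b) = form2 x (X (a + b)%N).
  elim: a b => [//|a IH] b; rewrite addSnnS -IH.
  exact: (form2_shuffle_sym (lX a) (lX b)).
set A := Cre (form2 x x); have A0 : 0 <= A by exact: form2_ge0.
pose t m := Cre (form2 x (X (2 ^ m)%N)).
have t0 : t 0%N = nrm (cat_vec x) ^+ 2.
  by rewrite /t expn0 /X /= (form2_shuffle hx hx) Cre_inner_nrm.
have tge m : 0 <= t m.
  case: m => [|m]; first by rewrite t0 sqr_ge0.
  by rewrite /t expnS mul2n -addnn -shift form2_ge0.
(* Cauchy-Schwarz for [form2], after which the symmetry of the shuffle map moves all iterations to
   one side and doubles the exponent. *)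
have tS m : t m ^+ 2 <= A * t m.+1.
  apply: le_trans (_ : nrm (form2 x (X (2 ^ m)%N)) ^+ 2 <= _).
    by rewrite ler_pXn2r ?nnegrE ?nrm_ge0 ?tge//; exact: le_trans (ler_norm _) (Cre_le_nrm _).
  by apply: (le_trans (form2_CS _ _)); rewrite shift addnn -mul2n -expnS.
rewrite -t0.
pose K := (k ^+ n) ^+ 2 * (l1 x * l1 x).
have tK m : t m <= K * P ^+ (2 ^ m).
  apply: le_trans (ler_norm _) _; apply: le_trans (Cre_le_nrm _) _.
  apply: (le_trans (form2_bound k1 bx (bX _))); rewrite /K -[leRHS]mulrA; apply: ler_wpM2l.
    by rewrite sqr_ge0.
  have l0 z : 0 <= l1 z by rewrite /l1 sumr_ge0// => p _; exact: nrm_ge0.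
  by rewrite -[leRHS]mulrA; apply: ler_wpM2l => //; rewrite mulrC; exact: l1X.
have [A00|An0] := eqVneq A 0.
  by have := tS 0%N; rewrite A00 mul0r mulr0 => h; have := tge 0%N; nra.
have Ap : 0 < A by rewrite lt_def An0.
rewrite leNgt; apply/negP => hlt.
(* If the claim fails then y > 1, and doubling gives t m >= A (y P)^(2^m), which outgrows the bound
   of [tK]. *)
pose y := t 0%N / (P * A).
have y1 : 1 < y by rewrite ltr_pdivlMr ?mulr_gt0// mul1r.
have hy m : A * (y * P) ^+ (2 ^ m) <= t m.
  elim: m => [|m IH].
    rewrite expn0 expr1 (_ : A * (y * P) = t 0%N)// /y; field.
    by rewrite An0 lt0r_neq0.
  rewrite -(ler_pM2l Ap); apply: le_trans (tS m); rewrite expnS mul2n -addnn exprD.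
  have -> z : A * (A * (z * z)) = (A * z) ^+ 2 by ring.
  rewrite ler_pXn2r ?nnegrE ?tge//.
  have y0 : 0 <= y by apply: ltW; exact: lt_trans ltr01 y1.
  apply: mulr_ge0 => //; apply/exprn_ge0/mulr_ge0 => //; exact: ltW.
have bd m : A * y ^+ (2 ^ m) <= K.
  have Pm : 0 < P ^+ (2 ^ m) by exact: exprn_gt0.
  by rewrite -(ler_pM2r Pm) -mulrA -exprMn; exact: le_trans (hy m) (tK m).
have dv m := @bernoulli_le R y m (ltW y1).
have [m hm] : exists m : nat, K / A < 1 + m%:R * (y - 1).
  exists (Num.bound ((K / A) / (y - 1))).
  have l0 : 0 <= l1 x by apply: sumr_ge0 => p _; exact: nrm_ge0.
  have K0 : 0 <= K by apply: mulr_ge0; [exact: sqr_ge0|exact: mulr_ge0].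
  have yp : 0 < y - 1 by rewrite subr_gt0.
  have := archi_boundP (divr_ge0 (divr_ge0 K0 A0) (ltW yp)); rewrite ltr_pdivrMr// => h.
  by apply: (lt_trans h); rewrite ltrDr.
have := bd m; have h2 : y ^+ m <= y ^+ (2 ^ m).
  by apply: ler_weXn2l; [exact: ltW|exact/ltnW/ltn_expl].
rewrite leNgt => /negP; apply; rewrite mulrC -ltr_pdivrMr//.
exact: lt_le_trans (lt_le_trans hm (dv m)) h2.
Qed.

End concatenation.

Section total_operators.
Variables (R : realType) (V : complexHilbertType R) (W : Type) (v : W -> V).
Hypothesis tv : total_family v.

Lemma op_ext_total (S T : bounded_op V) : (forall w, S (v w) = T (v w)) -> S = T.
Proof.
move=> h; rewrite -[S]starK -[T]starK; congr star; apply: bopE => z.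
by apply: (total_extr tv) => w; rewrite -!adjl h.
Qed.

Lemma op_nrm_total (T : bounded_op V) (M : R) : 0 <= M ->
  (forall c, nrm (T (lcomb v c)) <= M * nrm (lcomb v c)) -> nrm T <= M.
Proof.
move=> M0 h; have [|T' [hT nT]] := @total_op _ _ _ _ tv (fun w => T (v w)) M M0.
  by move=> c; rewrite (_ : lcomb _ c = T (lcomb v c))// /lcomb opv_sum; apply: eq_bigr => p _; rewrite opvZ.
by rewrite -(op_ext_total hT).
Qed.

End total_operators.

Section contraction_words.
Variables (R : realType) (H : realHilbertType R) (q : R) (F : qFock H q).
Hypothesis hq : -1 < q < 1.
Local Notation C := R[i].
Local Notation rt := (rtens F).
Local Notation ip := (fun x y : H => inner x y).
Local Notation qpoch := (qpoch q).
Implicit Types (u v w t : seq H) (x y : seq (C * (seq H * seq H))) (c : seq (C * seq H)).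

Let hq1 : `|q| < 1. Proof. by have := q_norm_lt1 hq; rewrite subr_gt0. Qed.

Definition cre w : bounded_op F := wprod (fun f => creation F (real_vec f)) w.
Definition ann w : bounded_op F := wprod (fun f => annihilation F (real_vec f)) w.

Lemma creS f w : cre (f :: w) = creation F (real_vec f) * cre w. Proof. by []. Qed.
Lemma annS f w : ann (f :: w) = annihilation F (real_vec f) * ann w. Proof. by []. Qed.

Lemma creE w w' : cre w (rt w') = rt (w ++ w').
Proof. by elim: w => [|f w IH]; [exact: op1E|rewrite creS opME IH /rtens /= creationE]. Qed.

Lemma star_cre w : star (cre w) = ann (rev w).
Proof.
elim: w => [|f w IH]; first exact: star1.
by rewrite creS star_opM IH rev_cons -cats1 /ann wprod_cat /= mulr1.
Qed.

Lemma annE f w : annihilation F (real_vec f) (rt w) = qann q%:C (fun z : H => (inner z f)%:C) w rt.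
Proof.
rewrite /rtens annihilationE// /ann_word qann_mapC.
by congr qann; apply/funext => v; rewrite cinner_real.
Qed.

Lemma ann_creation f g : annihilation F (real_vec f) * creation F (real_vec g) =
  q%:C *: (creation F (real_vec g) * annihilation F (real_vec f)) + (inner g f)%:C *: (1 : bounded_op F).
Proof.
apply: (op_ext_total (@rtens_total _ _ _ F)) => w; rewrite opDE !opZE !opME op1E annE.
rewrite (creE [:: g] w : creation F (real_vec g) (rt w) = _) annE /= addrC; congr (_ *: _ + _).
rewrite (qann_map (s := id) (V' := F) (phi := fun z => creation F (real_vec g) z)) ?opv0//.
- by congr qann; apply/funext => t; rewrite (creE [:: g] t).
- by move=> z z'; rewrite opvD.
- by move=> a z; rewrite opvZ.
Qed.

Lemma ann_cre f w : annihilation F (real_vec f) * cre w =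
  (q ^+ size w)%:C *: (cre w * annihilation F (real_vec f)) +
  qann q%:C (fun z : H => (inner z f)%:C) w cre.
Proof.
elim: w => [|g w IH]; first by rewrite /= addr0 scale1r mulr1 mul1r.
rewrite [cre (g :: w)]/= mulrA ann_creation mulrDl opZl -mulrA IH mulrDr opZr scalerDr scalerA -RCM -exprS.
rewrite opZl mul1r /= -!mulrA -addrA; congr (_ + _); rewrite addrC; congr (_ + _ *: _).
rewrite (qann_map (s := id) (V' := bounded_op F) (phi := fun T => creation F (real_vec g) * T)) ?mulr0//.
- by move=> S T; rewrite mulrDr.
- by move=> a T; rewrite opZr.
Qed.

(** The Wick operator in normal order. It sends the vacuum to w and obeys the same recursion under
    Gaussians as the words do. *)
Definition wickop w : bounded_op F := shs q (fun u v => cre u * ann v) w.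

Lemma gaussian_wickop f w : gaussian F f * wickop w =
  wickop (f :: w) + qann q%:C (fun z : H => (inner z f)%:C) w wickop.
Proof.
rewrite {2}/wickop shs_cons -shs_qann.
have shD (f1 f2 : seq H -> seq H -> bounded_op F) : shs q f1 w + shs q f2 w = shs q (fun u v => f1 u v + f2 u v) w.
  by rewrite -[shs q f1 w]scale1r -shsP; apply: eq_shs => u v; rewrite scale1r.
rewrite !shD /wickop /shs mulr_sumr; apply: eq_bigr => s _; rewrite opZr; congr (_ *: _).
move: s.2.1 s.2.2 => u v; rewrite /gaussian mulrDl -addrA; congr (_ + _); first by rewrite mulrA.
rewrite mulrA ann_cre mulrDl opZl -!mulrA; congr (_ + _).
rewrite (qann_map (s := id) (V := bounded_op F) (V' := bounded_op F) (phi := fun T : bounded_op F => T * ann v)) ?mul0r//.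
- by move=> S T; rewrite mulrDl.
- by move=> a T; rewrite opZl.
Qed.

Lemma ann_vacuum w : ann w (rt [::]) = (nilp w)%:R *: rt [::].
Proof.
elim: w => [|f w IH]; first by rewrite scale1r op1E.
rewrite annS opME IH opvZ annE /= scale0r; exact: scaler0.
Qed.

Lemma shs_nilr (V : lmodType C) (f : seq H -> V) w :
  shs q (fun u1 u2 => (nilp u2)%:R *: f u1) w = f w.
Proof.
elim: w f => [|g w IH] f; first by rewrite /shs big_seq1 /= !scale1r.
rewrite shs_cons IH -[RHS]addr0; congr (_ + _).
by rewrite /shs big1// => s _; rewrite /= scale0r !scaler0.
Qed.

Lemma wickop_vacuum w : wickop w (rt [::]) = rt w.
Proof.
rewrite -[RHS](shs_nilr rt w) /wickop /shs op_sumE; apply: eq_bigr => s _.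
by rewrite opZE opME ann_vacuum opvZ creE cats0.
Qed.

Lemma qann_ind (V : lmodType C) (P : V -> Prop) (a : H -> C) w (G : seq H -> V) :
  P 0 -> (forall (b : C) z z', P z -> P z' -> P (b *: z + z')) ->
  (forall t, size t = (size w).-1 -> P (G t)) -> P (qann q%:C a w G).
Proof.
move=> P0 PD; elim: w G => [//|v w IH] G h /=; apply: (PD); first exact: h.
rewrite -[_ *: _]addr0; apply: PD => //.
case: w h IH => [//|v' w] h IH; apply: IH => t ht; apply: h; by rewrite /= ht.
Qed.

(** The algebra generated by the Gaussians is not assumed to contain 1, which is the Wick operator
    of the empty word, so Wick operators are only shown to multiply it into itself. *)
Definition multiplier (A : set (bounded_op F)) : set (bounded_op F) :=
  [set T | forall a, A a -> A (a * T) /\ A (T * a)].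

Lemma wickop_multiplier A w : subalg A -> (forall f, A (gaussian F f)) -> multiplier A (wickop w).
Proof.
move=> hA hG; have [m hm] := ubnP (size w); elim: m w hm => [//|m IH] [|f w] /=.
  by rewrite /wickop /shs big_seq1 /= !mulr1 scale1r => _ a Aa; rewrite mulr1 mul1r.
rewrite ltnS => hm a Aa.
have -> : wickop (f :: w) = gaussian F f * wickop w - qann q%:C (fun z : H => (inner z f)%:C) w wickop.
  by rewrite gaussian_wickop addrK.
have [_ hD hM _ _] := hA; have [h1 h2] := IH w hm a Aa.
suff [h3 h4] : A (a * qann q%:C (fun z : H => (inner z f)%:C) w wickop) /\
               A (qann q%:C (fun z : H => (inner z f)%:C) w wickop * a).
  rewrite mulrBr mulrBl; split; apply: subalgB => //; last by rewrite -mulrA; exact: hM.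
  by rewrite mulrA; have [] := IH w hm (a * gaussian F f) (hM _ _ Aa (hG f)).
apply: (@qann_ind _ (fun T => A (a * T) /\ A (T * a))).
- by rewrite mulr0 mul0r; have [] := hA.
- by move=> b z z' [k1 k2] [k3 k4]; rewrite mulrDr mulrDl opZr opZl; split; exact: hD.
- by move=> t ht; apply: IH => //; rewrite ht; case: (w) hm => //= *; lia.
Qed.

Lemma lcomb_map (W W' : Type) (V : lmodType C) (vv : W' -> V) (g : C * W -> C * W') (cc : seq (C * W)) :
  lcomb vv (map g cc) = \sum_(p <- cc) (g p).1 *: vv (g p).2.
Proof. by rewrite /lcomb big_map. Qed.

Lemma ann_comb w c : exists c', ann w (lcomb rt c) = lcomb rt c'.
Proof.
elim: w => [|f w [c' IH]]; first by exists c.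
exists (flatten [seq cscale p.1 [seq (r.1%:C, r.2) | r <- qterms q (fun z : H => inner z f) p.2] | p <- c']).
rewrite lcomb_flatten annS opME IH /lcomb opv_sum; apply: eq_bigr => p _.
by rewrite opvZ annE qann_real big_map.
Qed.

(** Applied to a combination z, the operator concatenates c with z. The pair is an elementary
    tensor, whose [form2] is the product of the two squared norms, and [concat_le] applies. *)
Lemma cre_row_le j c : (forall p, p \in c -> size p.2 = j) ->
  nrm (lcomb cre c) ^+ 2 <= qpoch j * nrm (lcomb rt c) ^+ 2.
Proof.
move=> hc; have P0 : 0 < qpoch j by exact: qpoch_gt0.
have K0 : 0 <= qpoch j * nrm (lcomb rt c) ^+ 2 by rewrite mulr_ge0 ?sqr_ge0 ?ltW.
rewrite -[leRHS]sqr_sqrtr// ler_pXn2r ?nnegrE ?sqrtr_ge0 ?nrm_ge0//.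
apply: (op_nrm_total (@rtens_total _ _ _ F)) => [|z]; first exact: sqrtr_ge0.
pose x := flatten [seq [seq (p.1 * p'.1, (p.2, p'.2)) | p' <- z] | p <- c].
have e : lcomb cre c (lcomb rt z) = cat_vec F x.
  rewrite /cat_vec {1 3}/lcomb op_sumE big_flatten big_map; apply: eq_bigr => p _.
  rewrite opZE /lcomb opv_sum scaler_sumr big_map; apply: eq_bigr => p' _ /=.
  by rewrite opvZ scalerA creE.
have hx : left_size j x.
  by apply/allP => p /flatten_mapP[p' /hc h /mapP[r _ ->]] /=; rewrite h.
have := concat_le F hq hx; rewrite -e.
have -> : Cre (form2 F x x) = nrm (lcomb rt c) ^+ 2 * nrm (lcomb rt z) ^+ 2.
  apply: (@complexI R); rewrite RCM -!inner_nrm !inner_lcomb.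
  have -> : (Cre (form2 F x x))%:C = form2 F x x.
    have h : form2 F x x = (\sum_(p <- c) \sum_(p' <- c) p.1 * (p'.1)^*%R * inner (rt p.2) (rt p'.2)) *
      (\sum_(p <- z) \sum_(p' <- z) p.1 * (p'.1)^*%R * inner (rt p.2) (rt p'.2)).
      rewrite /form2 big_flatten big_map mulr_suml; apply: eq_bigr => p _.
      under eq_bigr do rewrite big_flatten big_map.
      rewrite big_map exchange_big mulr_suml; apply: eq_bigr => p' _.
      rewrite mulr_sumr; apply: eq_bigr => r _.
      rewrite big_map mulr_sumr; apply: eq_bigr => r' _ /=; rewrite !conjM; ring.
    by rewrite h -!inner_lcomb !inner_nrm -RCM.
  rewrite /form2 big_flatten big_map mulr_suml; apply: eq_bigr => p _.
  under eq_bigr do rewrite big_flatten big_map.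
  rewrite big_map exchange_big mulr_suml; apply: eq_bigr => p' _.
  rewrite mulr_sumr; apply: eq_bigr => r _.
  rewrite big_map mulr_sumr; apply: eq_bigr => r' _ /=; rewrite !conjM; ring.
rewrite mulrA => h; rewrite -(@ler_pXn2r _ 2)// ?nnegrE ?mulr_ge0 ?sqrtr_ge0 ?nrm_ge0//.
by rewrite exprMn sqr_sqrtr.
Qed.

(** The adjoint is a combination of creators along reversed words, and reversal preserves the norm
    by [qform_rev]. *)
Lemma ann_row_le j c : (forall p, p \in c -> size p.2 = j) ->
  nrm (lcomb ann c) ^+ 2 <= qpoch j * nrm (lcomb rt c) ^+ 2.
Proof.
move=> hc; pose c' := [seq ((p.1)^*%R, rev p.2) | p <- c].
have hc' p : p \in c' -> size p.2 = j by move=> /mapP[p' /hc h ->]; rewrite size_rev.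
have e1 : star (lcomb ann c) = lcomb cre c'.
  rewrite lcomb_map /lcomb star_sum; apply: eq_bigr => p _ /=.
  by rewrite star_opZ -[cre (rev p.2)]starK star_cre revK.
have e2 : nrm (lcomb rt c') ^+ 2 = nrm (lcomb rt c) ^+ 2.
  apply: (@complexI R); rewrite -!inner_nrm !inner_lcomb big_map [RHS]exchange_big.
  apply: eq_bigr => p _; rewrite big_map; apply: eq_bigr => p' _ /=.
  by rewrite cjK mulrC [in LHS]mulrC !rt_inner qform_rev// [in RHS]qform_sym// [(p.1)^*%R * _]mulrC mulrC.
by rewrite -nrm_star e1 -e2; exact: cre_row_le.
Qed.

Definition pairop x : bounded_op F := lcomb (fun p => cre p.1 * ann p.2) x.

(** On a vector, annihilate first and then concatenate: [concat_le] bounds the second operation by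
    [form2], and the Gram coordinates of the left words split this form into finitely many rows of
    annihilators, each bounded by [ann_row_le]. *)
Lemma pairop_le j l x : left_size j x -> (forall p, p \in x -> size p.2.2 = l) ->
  nrm (pairop x) ^+ 2 <= qpoch j * (qpoch l * Cre (form2 F x x)).
Proof.
move=> hx hl; have P0 k : 0 <= qpoch k by apply/ltW/qpoch_gt0.
have f0 : 0 <= Cre (form2 F x x) by exact: form2_ge0.
have K0 : 0 <= qpoch j * (qpoch l * Cre (form2 F x x)) by rewrite !mulr_ge0.
rewrite -[leRHS]sqr_sqrtr// ler_pXn2r ?nnegrE ?sqrtr_ge0 ?nrm_ge0//.
apply: (op_nrm_total (@rtens_total _ _ _ F)) => [|z]; first exact: sqrtr_ge0.
rewrite -(@ler_pXn2r _ 2)// ?nnegrE ?mulr_ge0 ?sqrtr_ge0 ?nrm_ge0//.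
rewrite exprMn sqr_sqrtr//; set ze := lcomb rt z.
have [zz hz] := boolp.choice (fun v => ann_comb v z).
pose X := flatten [seq [seq (p.1 * p'.1, (p.2.1, p'.2)) | p' <- zz p.2.2] | p <- x].
have e : pairop x ze = cat_vec F X.
  rewrite /pairop /cat_vec {1 2}/lcomb op_sumE big_flatten big_map; apply: eq_bigr => p _.
  rewrite opZE opME hz /lcomb opv_sum scaler_sumr big_map; apply: eq_bigr => p' _ /=.
  by rewrite opvZ scalerA creE.
have hX : left_size j X.
  by apply/allP => p /flatten_mapP[p' /(allP hx) h /mapP[r _ ->]].
rewrite e; apply: (le_trans (concat_le F hq hX)); rewrite -mulrA; apply: ler_wpM2l => //.
have [d [kap hk]] := gram_factor F [seq p.2.1 | p <- x].
have hk' p p' : p \in x -> p' \in x -> inner (rt p.2.1) (rt p'.2.1) = \sum_a kap a p.2.1 * (kap a p'.2.1)^*%R.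
  by move=> hp hp'; apply: hk; apply: (map_f (fun p => p.2.1)).
pose ya a := [seq (p.1 * kap a p.2.1, p.2.2) | p <- x].
have fX : form2 F X X = (\sum_a nrm (lcomb ann (ya a) ze) ^+ 2)%:C.
  have -> : form2 F X X = \sum_(p <- x) \sum_(p' <- x) p.1 * (p'.1)^*%R *
     (inner (rt p.2.1) (rt p'.2.1) * inner (ann p.2.2 ze) (ann p'.2.2 ze)).
    rewrite /form2 big_flatten big_map; apply: eq_bigr => p _.
    under eq_bigr do rewrite big_flatten big_map.
    rewrite big_map exchange_big; apply: eq_bigr => p' _.
    rewrite /ze !hz inner_lcomb !mulr_sumr; apply: eq_bigr => r _.
    rewrite big_map !mulr_sumr; apply: eq_bigr => r' _ /=; rewrite !conjM; ring.
  rewrite RC_sum; under [RHS]eq_bigr do rewrite -inner_nrm /ya lcomb_map op_sumE inner_suml.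
  rewrite [RHS]exchange_big big_seq_cond [RHS]big_seq_cond; apply: eq_bigr => p; rewrite andbT => px.
  under [RHS]eq_bigr do rewrite inner_sumr.
  rewrite exchange_big big_seq_cond [RHS]big_seq_cond; apply: eq_bigr => p'; rewrite andbT => px'.
  rewrite (hk' _ _ px px') mulr_suml mulr_sumr; apply: eq_bigr => a _ /=.
  rewrite -[RHS]/(inner ((p.1 * kap a p.2.1) *: (ann p.2.2 ze)) ((p'.1 * kap a p'.2.1) *: (ann p'.2.2 ze))).
  by rewrite innerZl innerZr conjM; ring.
have fx : form2 F x x = (\sum_a nrm (lcomb rt (ya a)) ^+ 2)%:C.
  rewrite RC_sum; under [RHS]eq_bigr do rewrite -inner_nrm inner_lcomb big_map.
  rewrite exchange_big /form2 big_seq_cond [RHS]big_seq_cond; apply: eq_bigr => p; rewrite andbT => px.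
  under [RHS]eq_bigr do rewrite big_map.
  rewrite exchange_big big_seq_cond [RHS]big_seq_cond; apply: eq_bigr => p'; rewrite andbT => px'.
  rewrite (hk' _ _ px px') mulr_suml mulr_sumr; apply: eq_bigr => a _ /=.
  by rewrite conjM; ring.
rewrite fX fx /= mulr_sumr mulr_suml; apply: ler_sum => a _.
apply: (@le_trans _ _ ((nrm (lcomb ann (ya a)) * nrm ze) ^+ 2)).
  by rewrite ler_pXn2r ?nnegrE ?mulr_ge0 ?nrm_ge0//; exact: op_le.
rewrite exprMn; apply: ler_wpM2r; first exact: sqr_ge0.
by apply: ann_row_le => p /mapP[p' /hl h ->].
Qed.

(** The adjoint of concatenation on words with left part of size k ([form2_delta]): the degree (k, n
    - k) part of the coproduct. *)
Definition delta k c := flatten [seq [seq (p.1 * s.1%:C, s.2) | s <- shj q k p.2] | p <- c].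

Lemma delta_left k c : left_size k (delta k c).
Proof.
apply/allP => p /flatten_mapP[p' _ /mapP[s]]; rewrite mem_filter => /andP[h _] -> /=; exact: h.
Qed.

Lemma delta_right n k c p : (forall p, p \in c -> size p.2 = n) -> p \in delta k c -> size p.2.2 = (n - k)%N.
Proof.
move=> hc /flatten_mapP[p' /hc h /mapP[s]]; rewrite mem_filter => /andP[/eqP h1 /shl_perm/perm_size h2] -> /=.
by move: h2; rewrite size_cat h1 h => <-; rewrite addKn.
Qed.

Lemma form2_delta k c x : left_size k x -> form2 F x (delta k c) = inner (cat_vec F x) (lcomb rt c).
Proof.
move=> hx; rewrite /cat_vec /lcomb inner_suml /form2 big_seq_cond [RHS]big_seq_cond; apply: eq_bigr => p; rewrite andbT => px.
rewrite innerZl inner_sumr mulr_sumr big_flatten big_map; apply: eq_bigr => p' _.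
rewrite innerZr big_map concat_inner_j// (left_sizeP hx px) !mulr_sumr.
by apply: eq_bigr => s _ /=; rewrite conjM conj_RC; ring.
Qed.

(** An operator and its adjoint have the same norm: the form is at most the norm of the
    concatenation of [delta k c] times the norm of c, and [concat_le] bounds the former by the form
    itself. *)
Lemma delta_le k c : Cre (form2 F (delta k c) (delta k c)) <= qpoch k * nrm (lcomb rt c) ^+ 2.
Proof.
set f := Cre _; have f0 : 0 <= f by exact: form2_ge0.
have P0 : 0 < qpoch k by exact: qpoch_gt0.
have h1 : f <= nrm (cat_vec F (delta k c)) * nrm (lcomb rt c).
  by rewrite /f form2_delta ?delta_left//; exact: (le_trans (ler_norm _) (le_trans (Cre_le_nrm _) (inner_le _ _))).
have h2 : nrm (cat_vec F (delta k c)) ^+ 2 <= qpoch k * f by exact: concat_le (delta_left k c).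
have h3 : f ^+ 2 <= qpoch k * f * nrm (lcomb rt c) ^+ 2.
  apply: (@le_trans _ _ ((nrm (cat_vec F (delta k c)) * nrm (lcomb rt c)) ^+ 2)).
    by rewrite ler_pXn2r ?nnegrE ?mulr_ge0 ?nrm_ge0.
  by rewrite exprMn; apply: ler_wpM2r => //; exact: sqr_ge0.
have [->|fn0] := eqVneq f 0; first by rewrite mulr_ge0 ?sqr_ge0 ?ltW.
have fp : 0 < f by rewrite lt_def fn0.
by rewrite -(ler_pM2l fp) -expr2 (le_trans h3)// mulrAC mulrC.
Qed.

(** The n + 1 summands correspond to the number k of creators. Each squared norm carries three
    factors at most [qpoch n]; the resulting power 3/2 is rounded up to 2. *)
Lemma wickop_le n c : (forall p, p \in c -> size p.2 = n) ->
  nrm (lcomb wickop c) <= n.+1%:R * (qpoch n ^+ 2 * nrm (lcomb rt c)).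
Proof.
move=> hc; have P0 k : 0 <= qpoch k by apply/ltW/qpoch_gt0.
have P1 : 1 <= qpoch n by rewrite -[1]/(qpoch 0); exact: qpoch_nd.
have -> : lcomb wickop c = \sum_(k < n.+1) pairop (delta k c).
  rewrite /lcomb; under [RHS]eq_bigr do rewrite /pairop /lcomb /delta big_flatten big_map.
  rewrite exchange_big big_seq_cond [RHS]big_seq_cond; apply: eq_bigr => p; rewrite andbT => pc.
  under [RHS]eq_bigr do rewrite big_map /shj big_filter big_mkcond.
  rewrite exchange_big /wickop /shs scaler_sumr big_seq_cond [RHS]big_seq_cond; apply: eq_bigr => s; rewrite andbT => sc.
  have hs : (size s.2.1 < n.+1)%N.
    by rewrite ltnS -(hc _ pc) -(perm_size (shl_perm sc)) size_cat leq_addr.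
  rewrite (bigD1 (Ordinal hs))//= eqxx big1 ?addr0 ?scalerA// => i ii; case: eqP => // e.
  by case/eqP: ii; apply: val_inj.
apply: (le_trans (nrm_sum _ _ _)).
have -> z : n.+1%:R * z = \sum_(k < n.+1) z by rewrite sumr_const card_ord mulr_natl.
apply: ler_sum => k _.
have N0 : 0 <= nrm (lcomb rt c) by exact: nrm_ge0.
rewrite -(@ler_pXn2r _ 2)// ?nnegrE ?mulr_ge0 ?sqr_ge0 ?nrm_ge0//.
apply: (le_trans (pairop_le (delta_left k c) (fun p => delta_right (p := p) hc))).
have kn : (k <= n)%N by rewrite -ltnS.
have h1 : qpoch k <= qpoch n by exact: qpoch_nd.
have h2 : qpoch (n - k) <= qpoch n by apply: qpoch_nd => //; exact: leq_subr.
apply: (@le_trans _ _ (qpoch n * (qpoch n * (qpoch n * nrm (lcomb rt c) ^+ 2)))).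
  apply: ler_pM => //; first by rewrite mulr_ge0 ?form2_ge0.
  apply: ler_pM => //; first by rewrite form2_ge0.
  apply: (le_trans (delta_le k c)); apply: ler_wpM2r => //; exact: sqr_ge0.
move: (P0 n) N0 P1; move: (qpoch n) (nrm _) => a b a0 b0 a1.
rewrite (_ : (a ^+ 2 * b) ^+ 2 = a * (a * (a * b ^+ 2)) * a); last by ring.
by apply: ler_peMr => //; rewrite !mulr_ge0 ?sqr_ge0.
Qed.

(** The second quantisation of r on formal combinations. *)
Definition damp (r : R) c := [seq ((r ^+ size p.2)%:C * p.1, p.2) | p <- c].

Lemma geometric_sum_le (r : R) N : 0 <= r < 1 -> \sum_(n < N) r ^+ n <= (1 - r)^-1.
Proof.
move=> /andP[r0 r1]; have p : 0 < 1 - r by rewrite subr_gt0.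
rewrite -(ler_pM2l p) mulfV ?gt_eqF// -opprB mulNr -subrX1 opprB.
by rewrite lerBlDr lerDl exprn_ge0.
Qed.

Lemma graded_le n c : nrm (lcomb rt [seq p <- c | size p.2 == n]) <= nrm (lcomb rt c).
Proof.
set c' := [seq p <- c | _]; have h : inner (lcomb rt c') (lcomb rt c') = inner (lcomb rt c') (lcomb rt c).
  rewrite !inner_lcomb big_seq_cond [RHS]big_seq_cond; apply: eq_bigr => p; rewrite andbT.
  rewrite mem_filter => /andP[/eqP hp _]; rewrite big_filter big_mkcond; apply: eq_bigr => p' _.
  by case: ifP => // /negbT e; rewrite rt_inner// qform_size ?mulr0// hp eq_sym.
have [->|n0] := eqVneq (nrm (lcomb rt c')) 0; first exact: nrm_ge0.
have np : 0 < nrm (lcomb rt c') by rewrite lt_def n0 nrm_ge0.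
rewrite -(ler_pM2l np) -expr2 -Cre_inner_nrm h; exact: (le_trans (ler_norm _) (le_trans (Cre_le_nrm _) (inner_le _ _))).
Qed.

Theorem wickop_damp_le (r : R) : 0 < r < 1 -> exists2 K, 0 <= K &
  forall c, nrm (lcomb wickop (damp r c)) <= K * nrm (lcomb rt c).
Proof.
(* One power of la = 1 + t absorbs n + 1 and two absorb the square of [qpoch n]. With r = 1 - 7 t
   the ratio mu = r la^3 expands to 1 minus positive terms, so the series over n converges. *)
move=> /andP[r0 r1]; pose t := (1 - r) / 7.
have t0 : 0 < t by rewrite divr_gt0// subr_gt0.
pose la := 1 + t; have la1 : 1 < la by rewrite ltrDl.
pose mu := r * la ^+ 3.
have mu1 : mu < 1.
  have -> : mu = 1 - (4 * t + 18 * t ^+ 2 + 20 * t ^+ 3 + 7 * t ^+ 4).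
    by rewrite /mu /la (_ : r = 1 - 7 * t); [ring|rewrite /t; field].
  rewrite ltrBlDr ltrDl; move: (t) t0 => s s0.
  have := exprn_gt0 2 s0; have := exprn_gt0 3 s0; have := exprn_gt0 4 s0; lra.
have mu0 : 0 <= mu by rewrite mulr_ge0 ?exprn_ge0 ?ltW// (lt_trans ltr01).
have [k k0 hk] := qpoch_subexp hq1 la1.
have hn n : n.+1%:R <= (1 + t^-1) * la ^+ n.
  have := bernoulli_le n (ltW la1); rewrite [la - 1]addrC addKr => h.
  have h2 : n%:R <= t^-1 * la ^+ n.
    rewrite mulrC ler_pdivlMr//; apply: le_trans h; by rewrite lerDr.
  rewrite -natr1 addrC mulrDl mul1r lerD//; exact/exprn_ege1/ltW.
pose A := (1 + t^-1) * k ^+ 2.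
have A0 : 0 <= A by rewrite mulr_ge0 ?sqr_ge0 ?addr_ge0// invr_ge0 ltW.
have hb n : r ^+ n * (n.+1%:R * qpoch n ^+ 2) <= A * mu ^+ n.
  have -> : A * mu ^+ n = r ^+ n * ((1 + t^-1) * la ^+ n * (k * la ^+ n) ^+ 2).
    by rewrite /A /mu exprMn -exprM mulnC exprM; ring.
  apply: ler_wpM2l; first by rewrite exprn_ge0// ltW.
  apply: ler_pM => //; first exact: sqr_ge0.
  have Pn : 0 <= qpoch n by apply/ltW/qpoch_gt0.
  by rewrite ler_pXn2r ?nnegrE//; apply: le_trans (hk n).
exists (A / (1 - mu)) => [|c]; first by rewrite divr_ge0// subr_ge0 ltW.
pose N := (\sum_(p <- c) (size p.2).+1)%N.
have -> : lcomb wickop (damp r c) =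
    \sum_(n < N) (r ^+ n)%:C *: lcomb wickop [seq p <- c | size p.2 == n].
  rewrite lcomb_map /lcomb; under [RHS]eq_bigr do rewrite big_filter big_mkcond scaler_sumr.
  rewrite exchange_big big_seq_cond [RHS]big_seq_cond; apply: eq_bigr => p; rewrite andbT => pc.
  have hp : (size p.2 < N)%N by rewrite /N (big_rem p pc) leq_addr.
  rewrite (bigD1 (Ordinal hp))//= eqxx big1 ?addr0 ?scalerA// => i ii; case: eqP => e; last by rewrite scaler0.
  by case/eqP: ii; apply: val_inj.
apply: (le_trans (nrm_sum _ _ _)).
apply: (@le_trans _ _ (\sum_(n < N) A * mu ^+ n * nrm (lcomb rt c))); last first.
  rewrite -mulr_suml -mulr_sumr; apply: ler_wpM2r; first exact: nrm_ge0.
  by apply: ler_wpM2l => //; apply: geometric_sum_le; rewrite mu0.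
apply: ler_sum => n _; rewrite nrmZ nrmC ger0_norm; last by rewrite exprn_ge0// ltW.
apply: (@le_trans _ _ (r ^+ n * (n.+1%:R * (qpoch n ^+ 2 * nrm (lcomb rt c))))).
  apply: ler_wpM2l; first by rewrite exprn_ge0// ltW.
  apply: (le_trans (@wickop_le n _ _)); first by move=> p; rewrite mem_filter => /andP[/eqP].
  apply: ler_wpM2l => //; apply: ler_wpM2l; [exact: sqr_ge0|exact: graded_le].
have -> a b d e : a * (b * (d * e)) = (a * (b * d)) * e :> R by ring.
by apply: ler_wpM2r; [exact: nrm_ge0|exact: hb].
Qed.

End contraction_words.

(** Multilinearity in one letter, whose position is arbitrary so that the induction can push
    Gaussians in front of it. It serves to expand a coefficient vector over the sites. *)
Lemma mom_lin (R : realType) (q : R) (Z : Type) (I : finType) (ip : Z -> Z -> R) (a : Z) (c : I -> R) (b : I -> Z) :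
  (forall v, ip a v = \sum_i c i * ip (b i) v) -> forall us w1 w2,
  mom q ip (w1 ++ a :: w2) us = \sum_i c i * mom q ip (w1 ++ b i :: w2) us.
Proof.
move=> h; elim=> [|u us IH] w1 w2.
  by rewrite big1 => [|i _]; [case: w1|case: w1 => *; exact: mulr0].
rewrite [LHS]/= (IH (u :: w1)); under [RHS]eq_bigr do rewrite /= mulrDr; rewrite big_split; congr (_ + _).
under [RHS]eq_bigr do rewrite qann_cat /= mulrDr; rewrite qann_cat /= big_split; congr (_ + _).
  rewrite -qann_sum; by apply: eq_qann => t _; exact: IH.
have -> : qann (V := R^o) q (ip^~ u) w2 (fun t => mom q ip (w1 ++ a :: t) us) =
    \sum_i c i * qann (V := R^o) q (ip^~ u) w2 (fun t => mom q ip (w1 ++ b i :: t) us).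
  by rewrite -[RHS]qann_sum; apply: eq_qann => t _; exact: IH.
rewrite h -![_ *: _]/(_ * _) mulr_suml mulr_sumr -big_split mulr_sumr; apply: eq_bigr => i _ /=.
by rewrite -![_ *: _]/(_ * _); ring.
Qed.

(** * Spin models *)

Section spin_moments.
Variables (R : realType) (q : R).
Local Notation C := R[i].

(* A pair (w, S): a choice of sign for each pair of sites, and the set of excited sites. *)
Definition spin_index : choiceType := ((nat * nat -> bool) * (nat -> bool))%type.

Definition flip (x : nat) (S : nat -> bool) : nat -> bool := fun y => S y (+) (y == x).
Definition site_pair (x y : nat) := if (x < y)%N then (x, y) else (y, x).
Definition eps (w : nat * nat -> bool) (x y : nat) : R := (-1) ^+ (w (site_pair x y)).
(** A Jordan-Wigner sign, collected by passing x over the excited sites below it. It makes the spins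
    at x and y commute or anticommute according to [eps w x y]. *)
Definition sig (w : nat * nat -> bool) (x : nat) (S : nat -> bool) : R :=
  \prod_(y < x) (if S y then eps w x y else 1).

Lemma flipK x S : flip x (flip x S) = S.
Proof. by apply/funext => y; rewrite /flip -addbA addbb addbF. Qed.

Lemma flipC x y S : flip x (flip y S) = flip y (flip x S).
Proof. by apply/funext => z; rewrite /flip addbAC. Qed.

Lemma site_pairC x y : site_pair x y = site_pair y x.
Proof. by rewrite /site_pair; case: ltngtP => // ->. Qed.

Lemma site_pair_inj x : injective (site_pair x).
Proof.
move=> y z; rewrite /site_pair; case: ltnP => h1; case: ltnP => h2 e; move: (congr1 fst e) (congr1 snd e) => /=; lia.
Qed.

Lemma epsC w x y : eps w x y = eps w y x.
Proof. by rewrite /eps site_pairC. Qed.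

Lemma eps2 w x y : eps w x y * eps w x y = 1.
Proof. by rewrite /eps -expr2 sqrr_sign. Qed.

Lemma norm_eps w x y : `|eps w x y| = 1.
Proof. exact: normr_sign. Qed.

Lemma sig2 w x S : sig w x S * sig w x S = 1.
Proof.
by rewrite -big_split big1// => y _ /=; case: ifP => _; rewrite ?eps2 ?mul1r.
Qed.

Lemma sig_flip w x y S : sig w x (flip y S) = (if (y < x)%N then eps w x y else 1) * sig w x S.
Proof.
rewrite /sig; case: ltnP => h; last first.
  rewrite mul1r; apply: eq_bigr => z _; rewrite /flip.
  by have -> : (z == y :> nat) = false; [apply/negbTE; have := ltn_ord z; lia|rewrite addbF].
rewrite (bigD1 (Ordinal h))//= [in RHS](bigD1 (Ordinal h))//= mulrA; congr (_ * _).
  by rewrite /flip eqxx addbT; case: (S y); rewrite /= ?eps2 ?mulr1.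
apply: eq_bigr => z zy; rewrite /flip.
by have -> : (z == y :> nat) = false; [apply/negbTE; apply: contra zy => /eqP e; apply/eqP/val_inj|rewrite addbF].
Qed.

Definition basis (j : spin_index) : l2 spin_index (cplx R) := single j ((1 : C) : cplx R).

Lemma ex_spin : exists lam : nat -> bounded_op (l2 spin_index (cplx R)),
  (forall x (w : nat * nat -> bool) S, lam x (basis (w, S)) = (sig w x S)%:C *: basis (w, flip x S)) /\
  (forall x, star (lam x) = lam x).
Proof.
pose s x (j : spin_index) : spin_index := (j.1, flip x j.2).
have sK x : involutive (s x) by move=> [w S]; rewrite /s /= flipK.
pose a x (j : spin_index) : C := (sig j.1 x j.2)%:C.
have as' x j : a x (s x j) = a x j by rewrite /a /= sig_flip ltnn mul1r.
have a1 x j : nrm (a x j) <= 1.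
  by rewrite /a nrmC -(@expr_le1 _ 2)// real_normK ?num_real// expr2 sig2.
pose lam x := wperm (a1 x) (sK x).
exists lam; split=> [x w S|x]; last first.
  apply: star_wperm => f j; rewrite /lam wpermE as' /a conj_RC; reflexivity.
apply: l2E => j; rewrite wpermE singleE.
rewrite -[RHS]/((sig w x S)%:C * (if j == (w, flip x S) then 1 else 0 : C)).
have -> : (s x j == (w, S)) = (j == (w, flip x S)).
  by rewrite (can2_eq (sK x) (sK x)).
by case: eqP => [->|_]; rewrite ?mulr0// /a /= sig_flip ltnn mul1r.
Qed.

Section one_model.
Variables (V : complexHilbertType R) (e : spin_index -> V) (lam : nat -> bounded_op V).
Hypothesis ONe : forall j j', inner (e j) (e j') = (j == j')%:R.
Hypothesis lamE : forall x (w : nat * nat -> bool) S, lam x (e (w, S)) = (sig w x S)%:C *: e (w, flip x S).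
Hypothesis lam_sa : forall x, star (lam x) = lam x.

Lemma spin_comm x y w S : x != y ->
  lam x (lam y (e (w, S))) = (eps w x y)%:C *: lam y (lam x (e (w, S))).
Proof.
move=> xy; rewrite !lamE !opvZ !lamE !scalerA -!RCM flipC; congr (_ %:C *: _).
rewrite !sig_flip [eps w y x]epsC; move: xy; case: (ltngtP x y) => [h|h|->]; rewrite ?eqxx// => _.
  rewrite [RHS](_ : _ = (eps w x y * eps w x y) * (sig w x S * sig w y S)); last by ring.
  by rewrite eps2; ring.
by ring.
Qed.

Definition spin_word ys : bounded_op V := wprod lam ys.

Lemma spin_wordE ys w S : exists c : R,
  spin_word ys (e (w, S)) = c%:C *: e (w, foldr flip S ys).
Proof.
elim: ys => [|y ys [c IH]]; first by exists 1; rewrite scale1r.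
by exists (c * sig w y (foldr flip S ys)); rewrite -[spin_word (y :: ys) _]/(lam y (spin_word ys _)) IH opvZ lamE scalerA RCM.
Qed.

(** The site x has to be absent from ys: [eps w x x] is an arbitrary sign, whereas a spin commutes
    with itself. *)
Lemma spin_pull x ys w S : x \notin ys -> lam x (spin_word ys (e (w, S))) =
  (\prod_(y <- ys) eps w x y)%:C *: spin_word ys (lam x (e (w, S))).
Proof.
elim: ys => [|y ys IH]; first by rewrite big_nil scale1r.
rewrite inE negb_or => /andP[xy /IH h]; rewrite big_cons RCM -scalerA.
rewrite -[spin_word (y :: ys) _]/(lam y (spin_word ys _)).
rewrite -[spin_word (y :: ys) (lam x _)]/(lam y (spin_word ys _)) -opvZ -h.
have [c ->] := spin_wordE ys w S.
by rewrite !opvZ spin_comm// !scalerA mulrC.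
Qed.

Lemma spin_cancel x ys1 ys2 w S : x \notin ys1 -> lam x (spin_word (ys1 ++ x :: ys2) (e (w, S))) =
  (\prod_(y <- ys1) eps w x y)%:C *: spin_word (ys1 ++ ys2) (e (w, S)).
Proof.
move=> h; have -> : spin_word (ys1 ++ ys2) = spin_word ys1 * spin_word ys2 by exact: wprod_cat.
have -> : spin_word (ys1 ++ x :: ys2) = spin_word ys1 * (lam x * spin_word ys2) by exact: wprod_cat.
rewrite !opME.
have [c ->] := spin_wordE ys2 w S.
rewrite !opvZ lamE !opvZ spin_pull// lamE !opvZ !scalerA -!RCM sig_flip ltnn mul1r flipK.
congr (_ %:C *: _); have := sig2 w x (foldr flip S ys2); move: (sig _ _ _) => a ha.
rewrite (_ : _ * _ = (a * a) * (c * \prod_(y <- ys1) eps w x y)); last by ring.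
by rewrite ha mul1r mulrC.
Qed.

Lemma spin_word_vac ys w S : uniq ys -> inner (spin_word ys (e (w, S))) (e (w, S)) = (nilp ys)%:R.
Proof.
case: ys => [_|y ys hu]; first by rewrite op1E ONe eqxx.
have [c ->] := spin_wordE (y :: ys) w S; rewrite innerZl ONe.
have fE zs z : foldr flip S zs z = S z (+) odd (count_mem z zs).
  elim: zs => [|z' zs IH]; first by rewrite addbF.
  by rewrite /= /flip IH oddD eq_sym -addbA; congr (_ (+) _); case: (z' == z); rewrite /= addbC.
case: eqP => [[h]|_]; last exact: mulr0.
have := congr1 (fun f => f y) h; rewrite -[flip _ _]/(foldr flip S (y :: ys)) fE /= eqxx.
move/andP: hu => [/count_memPn -> _] /=; by case: (S y).
Qed.

End one_model.

Definition del N (x : 'I_N) (ys : seq 'I_N) := rem x ys.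
Definition pre N (x : 'I_N) (ys : seq 'I_N) := take (index x ys) ys.

Section sites.
Variable N : nat.
Implicit Types (x y : 'I_N) (ys zs : seq 'I_N) (u : 'I_N -> R) (us : seq ('I_N -> R)).

Lemma pre_del x ys : x \in ys -> uniq ys -> exists ys1 ys2,
  [/\ ys = ys1 ++ x :: ys2, pre x ys = ys1, del x ys = ys1 ++ ys2 & x \notin ys1].
Proof.
move=> xy hu; pose k := index x ys; exists (take k ys), (drop k.+1 ys).
have e : ys = take k ys ++ x :: drop k.+1 ys.
  by rewrite -{1}(cat_take_drop k ys) (drop_nth x) ?index_mem// nth_index.
have nx : x \notin take k ys.
  by apply/negP => h; move: hu; rewrite e cat_uniq => /and3P[_ /hasPn/(_ x)]; rewrite inE eqxx h => /(_ isT).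
split=> //; rewrite /del {1}e; elim: (take k ys) nx => [|z s IH] /=; first by rewrite eqxx.
by rewrite inE negb_or eq_sym => /andP[/negPf -> /IH ->].
Qed.

(** The counterpart of [mom] for fixed signs ([spin_nom]). A new site either meets its own earlier
    occurrence, reached by commuting over the sites before it, and cancels, or is put in front; the
    list ys thus never repeats a site. *)
Fixpoint nom w us ys : R :=
  if us is u :: us' then
    \sum_x u x * (if x \in ys then \prod_(y <- pre x ys) eps w x y * nom w us' (del x ys)
                  else nom w us' (x :: ys))
  else (nilp ys)%:R.

Definition spin_gauss (V : complexHilbertType R) (lam : nat -> bounded_op V) u : bounded_op V :=
  \sum_x (u x)%:C *: lam x.

Lemma nom_cons w u us ys : nom w (u :: us) ys =
  \sum_x u x * (if x \in ys then \prod_(y <- pre x ys) eps w x y * nom w us (del x ys)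
    else nom w us (x :: ys)).
Proof. by []. Qed.

Lemma spin_nom (V : complexHilbertType R) (e : spin_index -> V) (lam : nat -> bounded_op V) w S us ys :
  (forall j j', inner (e j) (e j') = (j == j')%:R) ->
  (forall (x : nat) (w : nat * nat -> bool) S, lam x (e (w, S)) = (sig w x S)%:C *: e (w, flip x S)) ->
  (forall x : nat, star (lam x) = lam x) -> uniq ys ->
  inner (spin_word lam (map val ys) (e (w, S))) (wprod (spin_gauss lam) us (e (w, S))) = (nom w us ys)%:C.
Proof.
move=> ON lE lsa; elim: us ys => [|u us IH] ys hu.
  rewrite -[wprod _ _ _]/(e (w, S)) (spin_word_vac ON lE) ?(map_inj_uniq val_inj)//.
  by case: ys hu => [|//]; rewrite ?RC_nat.
rewrite -[wprod _ (u :: us) _]/(spin_gauss lam u (wprod (spin_gauss lam) us (e (w, S)))).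
move E : (wprod _ us _) => W; rewrite /spin_gauss op_sumE inner_sumr nom_cons RC_sum; apply: eq_bigr => x _.
rewrite opZE innerZr conj_RC RCM adjr lsa; congr (_ * _); rewrite -E.
case: ifP => xy; last by rewrite -IH//= xy hu.
have [ys1 [ys2 [e1 -> -> nx]]] := pre_del xy hu.
rewrite {1}e1 map_cat map_cons (spin_cancel lE); last by rewrite mem_map//; exact: val_inj.
rewrite innerZl RCM big_map -map_cat IH//.
by apply: subseq_uniq hu; rewrite e1; apply: cat_subseq; [exact: subseq_refl|exact: subseq_cons].
Qed.

Definition dotp u u' : R := \sum_x u x * u' x.
Definition delta_site x : 'I_N -> R := fun y => (y == x)%:R.
Definition mq us ys := mom q dotp (map delta_site ys) us.

Lemma dotp_delta x u : dotp (delta_site x) u = u x.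
Proof.
rewrite /dotp (bigD1 x)//= /delta_site eqxx mul1r big1 ?addr0// => y /negPf ->; exact: mul0r.
Qed.

Lemma qann_uniq (a : 'I_N -> R) (G : seq 'I_N -> R) ys : uniq ys -> qann (V := R^o) q a ys G =
  \sum_(x | x \in ys) a x * (q ^+ size (pre x ys) * G (del x ys)).
Proof.
elim: ys G => [|y ys IH] G /=; first by rewrite big_pred0.
move=> /andP[yn hu]; rewrite (bigD1 y) ?inE ?eqxx//= /pre /del /= eqxx expr0 mul1r; congr (_ + _).
rewrite IH// scaler_sumr; apply: eq_big => x.
  by rewrite inE; case: eqP => [->|]; rewrite ?(negPf yn) ?andbF ?andbT.
move=> xy; have /negPf nyx : y != x by apply: contra yn => /eqP ->.
by rewrite nyx /= exprS; rewrite -[_ *: _]/(_ * _); rewrite /pre /del; ring.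
Qed.

Lemma mq_cons u us ys : uniq ys -> mq (u :: us) ys = \sum_x u x * mq us (x :: ys) +
  \sum_(x | x \in ys) u x * (q ^+ size (pre x ys) * mq us (del x ys)).
Proof.
move=> hu; rewrite /mq /=; congr (_ + _).
  rewrite (@mom_lin _ q _ _ dotp u u delta_site _ us [::])// => v.
  by apply: eq_bigr => x _; rewrite dotp_delta.
rewrite qann_mapl -[RHS](qann_uniq u (fun t => mom q dotp (map delta_site t) us) hu).
by congr qann; apply/funext => y; exact: dotp_delta.
Qed.


Lemma sum_mem_le ys : \sum_x (x \in ys)%:R <= (size ys)%:R :> R.
Proof.
rewrite -natr_sum ler_nat; apply: leq_trans (card_size ys).
by rewrite -sum1_card [leqRHS]big_mkcond; apply: leq_sum => x _; case: ifP.
Qed.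

Hypothesis hq : -1 < q < 1.

Section estimates.
Variables (g : 'I_N -> R) (B : R).
Hypotheses (g0 : forall x, 0 <= g x) (gB : \sum_x g x ^+ 2 <= B).
Local Notation PG ys := (\prod_(y <- ys) g y).
Definition dominated us := forall u, List.In u us -> forall x, `|u x| <= g x.

(** Here n letters remain, m sites are occupied and z have been cancelled. The terms of [Cc] stand
    for a fresh site, a cancellation, and a coincidence with an occupied or cancelled site, the last
    estimated crudely by [Kc]. *)
Fixpoint Kc (n m : nat) : R := if n is n'.+1 then B * Kc n' m.+1 + m%:R * Kc n' m.-1 else 1.
Fixpoint Cc (n m z : nat) : R := if n is n'.+1 then
  B * Cc n' m.+1 z + m%:R * Cc n' m.-1 z.+1 + (m + z)%:R * (2 * Kc n' m.+1) else 0.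

Let B0 : 0 <= B. Proof. by apply: le_trans gB; apply: sumr_ge0 => x _; exact: sqr_ge0. Qed.

Lemma Kc_ge0 n m : 0 <= Kc n m.
Proof. by elim: n m => [|n IH] m //=; rewrite addr_ge0// mulr_ge0. Qed.

Lemma Cc_ge0 n m z : 0 <= Cc n m z.
Proof.
elim: n m z => [|n IH] m z //=; rewrite !addr_ge0// mulr_ge0//; rewrite mulr_ge0//; exact: Kc_ge0.
Qed.

Let PG0 ys : 0 <= PG ys. Proof. by apply: prodr_ge0 => x _. Qed.
Let q1 : `|q| <= 1. Proof. by apply: ltW; have := q_norm_lt1 hq; rewrite subr_gt0. Qed.

Let PG_del x ys : x \in ys -> PG ys = g x * PG (del x ys).
Proof. by move=> h; rewrite (big_rem x h). Qed.

Lemma sum_site_le (T : 'I_N -> R) (c1 c2 : R) ys : 0 <= c1 -> 0 <= c2 ->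
  (forall x, `|T x| <= g x ^+ 2 * c1 + (x \in ys)%:R * c2) ->
  `|\sum_x T x| <= B * c1 + (size ys)%:R * c2.
Proof.
move=> c10 c20 h; apply: (le_trans (ler_norm_sum _ _ _)).
apply: (le_trans (ler_sum _ (fun x _ => h x))); rewrite big_split /= -!mulr_suml.
by apply: lerD; apply: ler_wpM2r => //; exact: sum_mem_le.
Qed.

Lemma nom_le w us ys : dominated us -> uniq ys -> `|nom w us ys| <= Kc (size us) (size ys) * PG ys.
Proof.
elim: us ys => [|u us IH] ys hd hu.
  by rewrite /= mul1r; case: ys hu => [|y ys] _; rewrite ?normr0// normr1 big_nil.
have hdu x : `|u x| <= g x by apply: hd; left.
have hd' : dominated us by move=> v hv; apply: hd; right.
rewrite nom_cons [size (u :: us)]/= [Kc _ _]/= mulrDl -!mulrA.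
apply: sum_site_le; rewrite ?mulr_ge0 ?Kc_ge0// => x.
rewrite normrM; case: ifP => xy; last first.
  rewrite mul0r addr0; have := IH (x :: ys) hd'; rewrite /= xy => /(_ hu) h.
  rewrite big_cons in h; rewrite expr2 -mulrA; apply: ler_pM => //.
  by rewrite mulrCA.
rewrite mul1r; apply: ler_wpDl; first by rewrite mulr_ge0 ?sqr_ge0 ?mulr_ge0 ?Kc_ge0.
rewrite normrM normr_prod big1 ?mul1r; last by move=> y _; exact: norm_eps.
have := IH (del x ys) hd' (rem_uniq _ hu); rewrite size_rem// => h.
by rewrite (PG_del xy) mulrCA; apply: ler_pM.
Qed.

Lemma qann_le (a : 'I_N -> R) ys (G : seq 'I_N -> R) M : 0 <= M -> (forall x, `|a x| <= g x) ->
  (forall t, size t = (size ys).-1 -> `|G t| <= M * PG t) ->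
  `|qann (V := R^o) q a ys G| <= (size ys)%:R * (M * PG ys).
Proof.
move=> M0 ha; elim: ys G M M0 => [|y ys IH] G M M0 h; first by rewrite /= normr0 mul0r.
have -> : (size (y :: ys))%:R = 1 + (size ys)%:R :> R by rewrite -natr1 addrC.
rewrite mulrDl mul1r; apply: (le_trans (ler_normD _ _)); apply: lerD.
  rewrite big_cons normrM mulrCA; apply: ler_pM => //; exact: h.
rewrite normrM -[leRHS]mul1r; apply: ler_pM => //.
case: ys h IH => [|y' ys] h IH; first by rewrite /= normr0 mul0r.
rewrite [PG (y :: _)]big_cons [M * _]mulrA; apply: (IH (fun t => G (y :: t)) (M * g y)) => [|t ht]; first exact: mulr_ge0.
by have := h (y :: t); rewrite /= ht => /(_ erefl); rewrite big_cons mulrA.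
Qed.

Lemma mq_expand u us ys : mq (u :: us) ys = \sum_x u x * mq us (x :: ys) +
  qann (V := R^o) q u ys (mq us).
Proof.
rewrite /mq /=; congr (_ + _).
  rewrite (@mom_lin _ q _ _ dotp u u delta_site _ us [::])// => v.
  by apply: eq_bigr => x _; rewrite dotp_delta.
by rewrite qann_mapl; congr qann; apply/funext => y; exact: dotp_delta.
Qed.

Lemma mq_le us ys : dominated us -> `|mq us ys| <= Kc (size us) (size ys) * PG ys.
Proof.
elim: us ys => [|u us IH] ys hd.
  by rewrite /mq /= mul1r; case: ys => [|y ys]; rewrite ?normr0// normr1 big_nil.
have hdu x : `|u x| <= g x by apply: hd; left.
have hd' : dominated us by move=> v hv; apply: hd; right.
rewrite mq_expand [size (u :: us)]/= [Kc _ _]/= mulrDl -!mulrA.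
apply: (le_trans (ler_normD _ _)); apply: lerD; last first.
  apply: qann_le => // [|t ht]; first exact: Kc_ge0.
  by rewrite -ht; exact: IH.
have := @sum_site_le (fun x => u x * mq us (x :: ys)) (Kc (size us) (size ys).+1 * PG ys) 0 [::].
rewrite mulr0 addr0; apply=> //; first by rewrite mulr_ge0 ?Kc_ge0.
move=> x; rewrite addr0 normrM expr2 -mulrA; apply: ler_pM => //.
by have := IH (x :: ys) hd'; rewrite big_cons mulrCA.
Qed.

End estimates.

Definition site_order x y : 'I_N * 'I_N := if (x < y)%N then (x, y) else (y, x).
(** Pairs outside the N sites get the value false, that is the sign 1. *)
Definition signs_of (w : {ffun 'I_N * 'I_N -> bool}) : nat * nat -> bool :=
  fun p => [exists r : 'I_N * 'I_N, [&& val r.1 == p.1, val r.2 == p.2 & w r]].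

Lemma signs_ofE w x y : signs_of w (val x, val y) = w (x, y).
Proof.
apply/existsP/idP => [[[x' y']] /and3P[/eqP/= h /eqP/= h' hw]|hw]; last by exists (x, y); rewrite !eqxx.
by rewrite -(val_inj h) -(val_inj h').
Qed.

Lemma eps_signs w x y : eps (signs_of w) x y = (-1) ^+ w (site_order x y).
Proof. by rewrite /eps /site_pair /site_order; case: ifP => _; rewrite signs_ofE. Qed.

Lemma site_order_inj x : injective (site_order x).
Proof.
move=> y z h; apply: val_inj; apply: (@site_pair_inj x).
have e t : site_pair x (val t) = (val (site_order x t).1, val (site_order x t).2).
  by rewrite /site_pair /site_order; case: ifP.
by rewrite !e h.
Qed.

(** The value true stands for the sign -1, so the signs are independent of mean q. *)
Definition sign_weight (w : {ffun 'I_N * 'I_N -> bool}) : R :=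
  \prod_p (if w p then (1 - q) / 2 else (1 + q) / 2).
Definition chi (D : seq ('I_N * 'I_N)) (w : {ffun 'I_N * 'I_N -> bool}) : R :=
  \prod_(p <- D) (-1) ^+ w p.
Definition expect (f : {ffun 'I_N * 'I_N -> bool} -> R) : R := \sum_w sign_weight w * f w.

Lemma sign_weight_ge0 w : 0 <= sign_weight w.
Proof. apply: prodr_ge0 => p _; case: ifP => _; move/andP: hq => [h1 h2]; lra. Qed.

Lemma expect_chi D : uniq D -> expect (chi D) = q ^+ size D.
Proof.
move=> hD; rewrite -(card_uniqP hD) -prodr_const big_mkcond /=.
transitivity (\prod_p \sum_b (if b then (1 - q) / 2 else (1 + q) / 2) * (if p \in D then (-1) ^+ (b : bool) else 1)).
  rewrite bigA_distr_bigA; apply: eq_bigr => w _; rewrite big_split; congr (_ * _).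
  by rewrite /chi big_uniq// big_mkcond.
by apply: eq_bigr => p _; rewrite big_bool /=; case: ifP => _; field.
Qed.

Lemma sum_sign_weight : \sum_w sign_weight w = 1.
Proof.
rewrite -[RHS](expect_chi (D := [::]))//; apply: eq_bigr => w _.
by rewrite /chi big_nil mulr1.
Qed.

Lemma expect_le D (f : {ffun 'I_N * 'I_N -> bool} -> R) M : (forall w, `|f w| <= M) ->
  `|expect (fun w => chi D w * f w)| <= M.
Proof.
move=> h; apply: (le_trans (ler_norm_sum _ _ _)); rewrite -[M]mul1r -sum_sign_weight mulr_suml.
apply: ler_sum => w _; rewrite normrM ger0_norm ?sign_weight_ge0//; apply: ler_wpM2l; first exact: sign_weight_ge0.
rewrite normrM /chi normr_prod big1 ?mul1r// => p _; exact: normr_sign.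
Qed.

(** Induction on us. [chi D] collects the signs extracted so far and zs the cancelled sites; every
    pair in D touches zs, so the signs still to come are new and independent unless a site of zs
    returns. The exact recursion [mq_cons] differs from that of [nom] only when a site coincides
    with one of ys or zs, and each such term carries g x ^ 2 <= dl ^ 2. *)
Lemma expect_nom (g : 'I_N -> R) (dl B : R) us ys D zs : (forall x, 0 <= g x) -> (forall x, g x <= dl) ->
  \sum_x g x ^+ 2 <= B -> dominated g us -> uniq ys -> uniq D ->
  (forall p, p \in D -> (p.1 \in zs) || (p.2 \in zs)) -> (forall z, z \in zs -> z \notin ys) ->
  `|expect (fun w => chi D w * nom (signs_of w) us ys) - q ^+ size D * mq us ys| <=
    Cc B (size us) (size ys) (size zs) * (dl ^+ 2 * \prod_(y <- ys) g y).
Proof.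
move=> g0 gd gB; elim: us ys D zs => [|u us IH] ys D zs hd hu hD hDz hzy.
  have -> : expect (fun w => chi D w * nom (signs_of w) [::] ys) = q ^+ size D * (nilp ys)%:R.
    by rewrite -expect_chi// /expect mulr_suml; apply: eq_bigr => w _; rewrite mulrA.
  by rewrite /mq /= mul0r; case: (ys) => [|? ?]; rewrite subrr normr0.
have PG0 s : 0 <= \prod_(y <- s) g y by apply: prodr_ge0.
have B0 : 0 <= B by apply: le_trans gB; apply: sumr_ge0 => x _; exact: sqr_ge0.
have hdu x : `|u x| <= g x by apply: hd; left.
have hd' : dominated g us by move=> v hv; apply: hd; right.
have q1 : `|q| ^+ size D <= 1 by rewrite exprn_ile1//; apply: ltW; have := q_norm_lt1 hq; rewrite subr_gt0.
set K := Kc B (size us) (size ys).+1; set PG := \prod_(y <- ys) g y.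
have K0 : 0 <= K by exact: (Kc_ge0 gB).
have d20 : 0 <= dl ^+ 2 by exact: sqr_ge0.
pose br x w := if x \in ys then \prod_(y <- pre x ys) eps (signs_of w) x y * nom (signs_of w) us (del x ys)
    else nom (signs_of w) us (x :: ys).
pose A x := q ^+ size D * mq us (x :: ys).
pose A' x := q ^+ size D * (q ^+ size (pre x ys) * mq us (del x ys)).
pose T x := u x * (expect (fun w => chi D w * br x w) - A x - (if x \in ys then A' x else 0)).
have -> : expect (fun w => chi D w * nom (signs_of w) (u :: us) ys) - q ^+ size D * mq (u :: us) ys = \sum_x T x.
  rewrite mq_cons// mulrDr opprD addrA !mulr_sumr -!sumrN [X in _ + X]big_mkcond /=.
  have -> : expect (fun w => chi D w * nom (signs_of w) (u :: us) ys) =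
      \sum_x u x * expect (fun w => chi D w * br x w).
    rewrite /expect; under eq_bigr do rewrite nom_cons !mulr_sumr.
    rewrite exchange_big; apply: eq_bigr => x _; rewrite mulr_sumr; apply: eq_bigr => w _ /=.
    rewrite /br; move: (if _ then _ else _) => z; ring.
  rewrite -!big_split; apply: eq_bigr => x _; rewrite /T /A /A'; case: ifP => _ /=; ring.
have Ax x : `|u x * A x| <= K * (g x * g x * PG).
  rewrite /A normrM mulrCA -mulrA; apply: ler_pM => //.
  have h := mq_le g0 gB (x :: ys) hd'; rewrite big_cons in h.
  rewrite normrM normrX -[leRHS]mul1r; apply: ler_pM => //; rewrite ?exprn_ge0//.
  by rewrite mulrCA.
have gg x : g x * g x * PG <= dl ^+ 2 * PG.
  by apply: ler_wpM2r; [exact: PG0|rewrite [leRHS]expr2; exact: ler_pM].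
pose c1 := Cc B (size us) (size ys).+1 (size zs) * (dl ^+ 2 * PG).
pose c2 := Cc B (size us) (size ys).-1 (size zs).+1 * (dl ^+ 2 * PG).
pose c3 := 2 * K * (dl ^+ 2 * PG).
have dP : 0 <= dl ^+ 2 * PG by apply: mulr_ge0; [exact: d20|exact: PG0].
have c10 : 0 <= c1 by apply: mulr_ge0 => //; exact: (Cc_ge0 gB).
have c20 : 0 <= c2 by apply: mulr_ge0 => //; exact: (Cc_ge0 gB).
have c30 : 0 <= c3 by apply: mulr_ge0 => //; exact: mulr_ge0.
have hT x : `|T x| <= g x ^+ 2 * c1 + (x \in ys)%:R * c2 + (x \in ys ++ zs)%:R * c3.
  have gc : 0 <= g x ^+ 2 * c1 by rewrite mulr_ge0 ?sqr_ge0.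
  rewrite /T mem_cat; case: ifP => xy.
    (* An occupied site: [mq_cons] has both the creation term A x and the cancellation A' x, whereas
       the spin model only cancels. A x is therefore pure error, and the rest is compared by
       induction with the extracted signs added to D. *)
    rewrite /= !mul1r (_ : _ - A x - A' x = - A x + (expect (fun w => chi D w * br x w) - A' x)); last by ring.
    rewrite mulrDr mulrN; apply: (le_trans (ler_normD _ _)); rewrite normrN addrC; apply: lerD; last first.
      apply: (le_trans (Ax x)); apply: (@le_trans _ _ (K * (dl ^+ 2 * PG))); first exact: ler_wpM2l.
      by rewrite /c3 -mulrA; apply: ler_peMl; [exact: mulr_ge0|rewrite ler1n].
    apply: ler_wpDl => //.
    have [ys1 [ys2 [e1 e2 e3 nx]]] := pre_del xy hu.
    pose D' := D ++ map (site_order x) (pre x ys).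
    have -> : expect (fun w => chi D w * br x w) = expect (fun w => chi D' w * nom (signs_of w) us (del x ys)).
      apply: eq_bigr => w _; rewrite /br xy /chi /D' big_cat big_map -!mulrA; congr (_ * (_ * (_ * _))).
      by apply: eq_bigr => y _; rewrite eps_signs.
    have -> : A' x = q ^+ size D' * mq us (del x ys) by rewrite /A' /D' size_cat size_map exprD mulrA.
    have ud : uniq (del x ys) by exact: rem_uniq.
    have up y : y \in pre x ys -> y \in ys by move=> /mem_take.
    have := IH (del x ys) D' (x :: zs) hd' ud.
    have h1 : uniq D'.
      rewrite cat_uniq hD map_inj_uniq ?take_uniq//; last exact: site_order_inj.
      rewrite andbT; apply/hasPn => p /mapP[y yp ->]; apply/negP => /hDz.
      by rewrite /site_order; case: ifP => _ /= /orP[] /hzy; rewrite ?xy ?(up y yp).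
    have h2 p : p \in D' -> (p.1 \in x :: zs) || (p.2 \in x :: zs).
      rewrite mem_cat !inE => /orP[/hDz/orP[]->|/mapP[y _ ->]]; rewrite ?orbT//.
      by rewrite /site_order; case: ifP => _ /=; rewrite eqxx ?orbT.
    have h3 z : z \in x :: zs -> z \notin del x ys.
      rewrite inE /del mem_rem_uniq// inE negb_and negbK => /orP[->//|/hzy ->]; exact: orbT.
    move=> /(_ h1 h2 h3); rewrite size_rem// normrM => h.
    rewrite /c2 /PG (big_rem x xy) /= -/(del x ys).
    rewrite (_ : _ * (dl ^+ 2 * _) = g x * (Cc B (size us) (size ys).-1 (size zs).+1 * (dl ^+ 2 * \prod_(y <- del x ys) g y))); last by ring.
    exact: ler_pM.
  rewrite subr0 mul0r addr0 [false || _]/=; case xz: (x \in zs); last first.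
    rewrite mul0r addr0 normrM; have := IH (x :: ys) D zs hd'; rewrite /= xy => /(_ hu hD hDz).
    have h3 z : z \in zs -> z \notin x :: ys.
      by move=> hz; rewrite inE negb_or hzy// andbT; apply: contraFN xz => /eqP e; rewrite -e.
    move=> /(_ h3); rewrite big_cons /br xy => h.
    rewrite (_ : g x ^+ 2 * c1 = g x * (Cc B (size us) (size ys).+1 (size zs) * (dl ^+ 2 * (g x * PG)))); last by rewrite /c1; ring.
    exact: ler_pM.
  (* A cancelled site has come back: its signs may already occur in D, so the two terms are
     estimated separately. *)
  rewrite mul1r; apply: ler_wpDl => //; rewrite mulrBr.
  apply: (le_trans (ler_normB _ _)).
  have hA := le_trans (Ax x) (ler_wpM2l K0 (gg x)).
  rewrite /c3 (_ : 2 * K * _ = K * (dl ^+ 2 * PG) + K * (dl ^+ 2 * PG)); last by ring.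
  apply: lerD => //; apply: le_trans (ler_wpM2l K0 (gg x)).
  rewrite normrM mulrCA -mulrA; apply: ler_pM => //.
  apply: expect_le => w; rewrite /br xy; have := nom_le g0 gB (signs_of w) hd' (ys := x :: ys).
  by rewrite /= xy big_cons mulrCA; apply.
apply: (le_trans (ler_norm_sum _ _ _)); apply: (le_trans (ler_sum _ (fun x _ => hT x))).
rewrite !big_split /= -!mulr_suml.
rewrite (_ : (_ + _ + _) * (dl ^+ 2 * _) = B * c1 + (size ys)%:R * c2 + (size ys + size zs)%:R * c3); last by rewrite /c1 /c2 /c3 -/K; ring.
apply: lerD; last by rewrite -size_cat; apply: ler_wpM2r => //; exact: sum_mem_le.
by apply: lerD; apply: ler_wpM2r => //; exact: sum_mem_le.
Qed.

End sites.

Hypothesis hq : -1 < q < 1.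

(** A central limit theorem with a rate. K depends only on the number of letters and on b, so one
    estimate serves all models, initial configurations and letters at once. *)
Theorem spin_moment m (b : R) : 0 <= b -> exists2 K, 0 <= K &
  forall (V : complexHilbertType R) (e : spin_index -> V) (lam : nat -> bounded_op V)
    N (us : seq ('I_N -> R)) (dl : R) (S : nat -> bool),
  (forall j j', inner (e j) (e j') = (j == j')%:R) ->
  (forall (x : nat) (w : nat * nat -> bool) S, lam x (e (w, S)) = (sig w x S)%:C *: e (w, flip x S)) ->
  (forall x : nat, star (lam x) = lam x) -> size us = m ->
  (forall u, List.In u us -> \sum_x u x ^+ 2 <= b /\ forall x, `|u x| <= dl) ->
  nrm (\sum_(w : {ffun 'I_N * 'I_N -> bool}) (sign_weight w)%:C * inner (e (signs_of w, S)) (wprod (spin_gauss lam) us (e (signs_of w, S)))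
       - (mom q (@dotp N) [::] us)%:C) <= K * dl ^+ 2.
Proof.
move=> b0; pose B := m%:R * b; exists (Cc B m 0 0 * m%:R).
  rewrite mulr_ge0//; have B0 : 0 <= B by rewrite mulr_ge0.
  by apply: (@Cc_ge0 0 (fun=> 0)); rewrite ?big_ord0.
move=> V e lam N us dl S ON lE lsa hm hus.
(* The root of the sum of the squares is a single weight that dominates every letter and is still
   square-summable, with bound m b. *)
pose sq x := \sum_(u <- us) u x ^+ 2; pose g x := Num.sqrt (sq x).
have sq0 x : 0 <= sq x by apply: sumr_ge0 => u _; exact: sqr_ge0.
have g2 x : g x ^+ 2 = sq x by rewrite sqr_sqrtr.
have sumin (f : ('I_N -> R) -> R) c : (forall u, List.In u us -> f u <= c) -> \sum_(u <- us) f u <= m%:R * c.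
  rewrite -hm; clear; elim: us => [|u us IH] h; first by rewrite big_nil mul0r.
  rewrite big_cons /= -natr1 addrC mulrDl mul1r; apply: lerD; last by apply: h; left.
  by apply: IH => v hv; apply: h; right.
have dom : dominated g us.
  move=> u hu x; rewrite -(@ler_pXn2r _ 2)// ?nnegrE ?sqrtr_ge0// g2 real_normK ?num_real// /sq.
  elim: (us) hu => [//|v s IH] [->|/IH h]; rewrite big_cons.
    by rewrite lerDl; apply: sumr_ge0 => *; exact: sqr_ge0.
  by apply: ler_wpDl => //; exact: sqr_ge0.
have gd x : g x <= Num.sqrt (m%:R * dl ^+ 2).
  apply: ler_wsqrtr; apply: sumin => u /hus[_ /(_ x) h].
  by rewrite -real_normK ?num_real// ler_pXn2r ?nnegrE// (le_trans _ h).
have gB : \sum_x g x ^+ 2 <= B.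
  under eq_bigr do rewrite g2 /sq; rewrite exchange_big; apply: sumin => u /hus[h _]; exact: h.
have h := @expect_nom N hq g _ B us [::] [::] [::] (fun x => sqrtr_ge0 _) gd gB dom erefl erefl
  (fun p (hp : p \in [::]) => False_ind _ (notF hp)) (fun z (hz : z \in [::]) => False_ind _ (notF hz)).
have {}h : `|expect (fun w : {ffun 'I_N * 'I_N -> bool} => chi [::] w * nom (signs_of w) us [::]) - mq us [::]| <= Cc B m 0 0 * m%:R * dl ^+ 2.
  move: h; have -> : q ^+ size ([::] : seq ('I_N * 'I_N)) = 1 by [].
  have p0 : 0 <= m%:R * dl ^+ 2 by apply: mulr_ge0 => //; exact: sqr_ge0.
  by rewrite mul1r big_nil mulr1 (sqr_sqrtr p0) mulrA hm.
have -> : \sum_(w : {ffun 'I_N * 'I_N -> bool}) (sign_weight w)%:C * inner (e (signs_of w, S)) (wprod (spin_gauss lam) us (e (signs_of w, S)))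
   = (expect (fun w : {ffun 'I_N * 'I_N -> bool} => chi [::] w * nom (signs_of w) us [::]))%:C.
  rewrite /expect RC_sum; apply: eq_bigr => w _; rewrite /chi big_nil mul1r RCM -(@spin_nom _ V e lam _ S)//.
rewrite -RCB nrmC; apply: h => //.
Qed.

End spin_moments.

Section constant_diagonal.
Variables (R : realType) (I : choiceType) (V : complexHilbertType R).
Implicit Types (x y : bounded_op V) (f : l2 I V).

Lemma l2DE f (g : l2 I V) i : (f + g) i = f i + g i. Proof. by []. Qed.
Lemma l2ZE (a : R[i]) f i : (a *: f) i = a *: f i. Proof. by []. Qed.

Definition cdiag x : bounded_op (l2 I V) :=
  projT1 (cid (ex_diag (nrm_ge0 x) (fun i : I => lexx (nrm x)))).

Lemma cdiagE x f i : cdiag x f i = x (f i).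
Proof. by rewrite /cdiag; case: cid => /= T [-> _]. Qed.

Lemma nrm_cdiag x : nrm (cdiag x) <= nrm x.
Proof. by rewrite /cdiag; case: cid => /= T []. Qed.

Lemma cdiagP (a : R[i]) x y : cdiag (a *: x + y) = a *: cdiag x + cdiag y.
Proof.
apply: bopE => f; apply: l2E => i; by rewrite cdiagE !opDE !opZE l2DE l2ZE !cdiagE.
Qed.

Lemma cdiagM x y : cdiag (x * y) = cdiag x * cdiag y.
Proof. by apply: bopE => f; apply: l2E => i; rewrite opME !cdiagE. Qed.

Lemma cdiag1 : cdiag 1 = 1.
Proof. by apply: bopE => f; apply: l2E => i; rewrite cdiagE. Qed.

Lemma cdiagZ (a : R[i]) x : cdiag (a *: x) = a *: cdiag x.
Proof.
by apply: bopE => f; apply: l2E => i; rewrite cdiagE !opZE l2ZE cdiagE.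
Qed.

Lemma cdiag0 : cdiag 0 = 0.
Proof. by rewrite -(scale0r (0 : bounded_op V)) cdiagZ scale0r. Qed.

Lemma cdiagB x y : cdiag (x - y) = cdiag x - cdiag y.
Proof. by rewrite -scaleN1r addrC cdiagP scaleN1r addrC. Qed.

Lemma cdiag_sum (J : Type) (r : seq J) (x : J -> bounded_op V) :
  cdiag (\sum_(j <- r) x j) = \sum_(j <- r) cdiag (x j).
Proof.
elim: r => [|j r IH]; last by rewrite !big_cons -IH -[x j]scale1r cdiagP !scale1r.
by rewrite !big_nil -(scale0r (0 : bounded_op V)) cdiagZ scale0r.
Qed.

Lemma cdiag_single x i (y : V) : cdiag x (single i y) = single i (x y).
Proof. by apply: l2E => j; rewrite cdiagE !singleE; case: eqP => _; rewrite ?opv0. Qed.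

Lemma inner_cdiag_single (x y : bounded_op V) i (u v : V) :
  inner (cdiag x (single i u)) (cdiag y (single i v)) = inner u ((star x * y) v).
Proof. by rewrite !cdiag_single inner_single singleE eqxx adjl opME. Qed.

End constant_diagonal.
Arguments cdiag {R} I {V} x.

(** Regrouping the N families as one family of vectors in the N-fold sum of V turns the double sum
    into the diagonal action of [amp X]. *)
Lemma cdiag_cc (R : realType) (I : finType) (V : complexHilbertType R) N
    (X : 'M[bounded_op V]_N) (f g : 'I_N -> l2 I V) :
  nrm (\sum_a \sum_b inner (cdiag I (X a b) (f b)) (g a)) <=
    nrm (amp X) * Num.sqrt (\sum_b nrm (f b) ^+ 2) * Num.sqrt (\sum_a nrm (g a) ^+ 2).
Proof.
pose hat (f : 'I_N -> l2 I V) : l2 I (l2 'I_N V) := fin_vec (fun i => fin_vec (fun a => f a i)).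
have nh (h : 'I_N -> l2 I V) : nrm (hat h) = Num.sqrt (\sum_b nrm (h b) ^+ 2).
  rewrite -[LHS]ger0_norm ?nrm_ge0// -sqrtr_sqr; congr Num.sqrt.
  rewrite nrm_l2 (eq_bigr (fun i => \sum_b nrm (h b i) ^+ 2)); last first.
    by move=> i _; rewrite /hat fin_vecE nrm_l2; apply: eq_bigr => b _; rewrite fin_vecE.
  by rewrite exchange_big; apply: eq_bigr => b _; rewrite nrm_l2.
rewrite -!nh; have -> : \sum_a \sum_b inner (cdiag I (X a b) (f b)) (g a) =
    inner (cdiag I (amp X) (hat f)) (hat g).
  rewrite inner_l2; under [RHS]eq_bigr do rewrite cdiagE /hat !fin_vecE amp_inner.
  rewrite [RHS]exchange_big; apply: eq_bigr => a _; rewrite [RHS]exchange_big; apply: eq_bigr => b _.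
  by rewrite inner_l2; apply: eq_bigr => i _; rewrite cdiagE !fin_vecE.
apply: (le_trans (inner_le _ _)); apply: ler_wpM2r; first exact: nrm_ge0.
apply: (le_trans (op_le _ _)); apply: ler_wpM2r; [exact: nrm_ge0|exact: nrm_cdiag].
Qed.

Section spins_trace.
Variables (R : realType) (N : nat).
Implicit Types (t : {ffun 'I_N -> bool}) (x : 'I_N).

Definition spins_of t : nat -> bool := fun y => [exists x : 'I_N, (val x == y) && t x].
Definition fflip x t : {ffun 'I_N -> bool} := [ffun y => t y (+) (y == x)].

Lemma flip_spins x t : flip (val x) (spins_of t) = spins_of (fflip x t).
Proof.
apply/funext => y; rewrite /flip /spins_of.
have ex (P : pred 'I_N) : [exists z, (val z == y) && P z] = if insub y is Some z then P z else false.
  case: insubP => [z _ zy|yN].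
    apply/existsP/idP => [[z' /andP[/eqP h hP]]|hP]; last by exists z; rewrite zy eqxx.
    by rewrite (_ : z = z')//; apply: val_inj; rewrite zy.
  apply/existsP => -[z /andP[/eqP h _]]; by rewrite -h ltn_ord in yN.
rewrite !ex; case: insubP => [z _ zy|yN]; first by rewrite ffunE -zy (inj_eq val_inj).
by rewrite /=; apply/eqP => h; rewrite h ltn_ord in yN.
Qed.

Lemma fflipK x : involutive (fflip x).
Proof. by move=> t; apply/ffunP => y; rewrite !ffunE -addbA addbb addbF. Qed.

(** Y is an arbitrary bounded operator, so the sum over configurations is a hypertrace for the
    spins. The reason is that flipping the site x permutes the configurations and leaves the sign of
    x unchanged. *)
Lemma spin_trace (V : complexHilbertType R) (e : spin_index -> V) (lam : nat -> bounded_op V) w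
    (Y : bounded_op V) x :
  (forall (x : nat) (w : nat * nat -> bool) S, lam x (e (w, S)) = (sig R w x S)%:C *: e (w, flip x S)) ->
  \sum_t inner (Y (lam x (e (w, spins_of t)))) (e (w, spins_of t)) =
  \sum_t inner (Y (e (w, spins_of t))) (lam x (e (w, spins_of t))).
Proof.
move=> lE; rewrite [LHS](reindex_inj (inv_inj (fflipK x))); apply: eq_bigr => t _.
rewrite !lE -flip_spins opvZ innerZl innerZr conj_RC flipK sig_flip ltnn mul1r.
by [].
Qed.

Lemma spin_gauss_trace (V : complexHilbertType R) (e : spin_index -> V) (lam : nat -> bounded_op V) w
    (Y : bounded_op V) (u : 'I_N -> R) :
  (forall (x : nat) (w : nat * nat -> bool) S, lam x (e (w, S)) = (sig R w x S)%:C *: e (w, flip x S)) ->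
  \sum_t inner (Y (spin_gauss lam u (e (w, spins_of t)))) (e (w, spins_of t)) =
  \sum_t inner (Y (e (w, spins_of t))) (spin_gauss lam u (e (w, spins_of t))).
Proof.
move=> lE; under eq_bigr do rewrite op_sumE opv_sum inner_suml.
under [RHS]eq_bigr do rewrite op_sumE inner_sumr.
rewrite exchange_big [RHS]exchange_big; apply: eq_bigr => y _.
under eq_bigr do rewrite opZE opvZ innerZl.
under [RHS]eq_bigr do rewrite opZE innerZr conj_RC.
by rewrite -!mulr_sumr spin_trace.
Qed.

End spins_trace.

Lemma sum_pair (V : nmodType) (I J : finType) (f : I * J -> V) :
  \sum_p f p = \sum_i \sum_j f (i, j).
Proof. by rewrite pair_bigA; apply: eq_bigr => -[]. Qed.

Lemma star_inner (R : realType) (V : complexHilbertType R) (A B : bounded_op V) u v :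
  inner ((star A * B) u) v = inner (B u) (A v).
Proof. by rewrite opME adjl starK. Qed.

Lemma inner_weight (R : realType) (V : complexHilbertType R) (T : bounded_op V) (r : R) u v : 0 <= r ->
  inner (T ((Num.sqrt r)%:C *: u)) ((Num.sqrt r)%:C *: v) = r%:C * inner (T u) v.
Proof.
by move=> r0; rewrite opvZ innerZl innerZr conj_RC mulrA -RCM -expr2 sqr_sqrtr.
Qed.

Lemma inner_weights (R : realType) (I : finType) (V : complexHilbertType R) (T : bounded_op V)
    (f g : l2 I V) (r : I -> R) (u v : I -> V) :
  (forall i, f i = (Num.sqrt (r i))%:C *: u i) -> (forall i, g i = (Num.sqrt (r i))%:C *: v i) ->
  (forall i, 0 <= r i) -> inner (cdiag I T f) g = \sum_i (r i)%:C * inner (T (u i)) (v i).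
Proof.
move=> hf hg r0; rewrite inner_l2; apply: eq_bigr => i _; rewrite cdiagE hf hg.
exact: inner_weight.
Qed.

Lemma qann_ext (Z : Type) (K : comPzRingType) (V : lmodType K) (q : K) (a : pred Z) (f f' : Z -> K) w (G G' : seq Z -> V) :
  (forall v, a v -> f v = f' v) -> all a w -> (forall t, all a t -> G t = G' t) ->
  qann q f w G = qann q f' w G'.
Proof.
move=> hf; elim: w G G' => [//|v w IH] G G' /= /andP[av aw] hG.
rewrite hf// hG// (IH _ (fun t => G' (v :: t)))// => t at'; apply: hG; by rewrite /= av.
Qed.

Lemma mom_ext (R : realType) (q : R) (Z : Type) (a : pred Z) (ip ip' : Z -> Z -> R) w us :
  (forall x y, a x -> a y -> ip x y = ip' x y) -> all a w -> all a us -> mom q ip w us = mom q ip' w us.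
Proof.
move=> h; elim: us w => [//|u us IH] w aw /= /andP[au aus]; congr (_ + _).
  by apply: IH => //=; rewrite au.
by apply: (@qann_ext _ _ _ q a) => // [v av|t at']; [exact: h|exact: IH].
Qed.

Lemma mom_map0 (R : realType) (q : R) (Z Z' : Type) (g : Z -> Z') (ip : Z' -> Z' -> R) us :
  mom q ip [::] (map g us) = mom q (fun x y => ip (g x) (g y)) [::] us.
Proof. exact: (mom_map q g ip [::] us). Qed.

Lemma In_map (A : eqType) (B : Type) (f : A -> B) (s : seq A) u :
  List.In u (map f s) -> exists2 p, p \in s & u = f p.
Proof.
elim: s => [//|p s IH] [<-|/IH[p' ps ->]]; first by exists p; rewrite ?inE ?eqxx.
by exists p'; rewrite // inE ps orbT.
Qed.

Lemma wprod_map (R : realType) (V : complexHilbertType R) (Z Z' : Type) (s : Z' -> bounded_op V) (g : Z -> Z') w :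
  wprod s (map g w) = wprod (fun z => s (g z)) w.
Proof. by elim: w => [//|z w IH] /=; rewrite IH. Qed.

Section model.
Variables (R : realType) (H : realHilbertType R) (q : R) (F : qFock H q).
Hypothesis hq : -1 < q < 1.
Local Notation C := R[i].
Local Notation index := (seq H * nat)%type.
Local Notation V := (l2 spin_index (cplx R)).
Local Notation K := (l2 index V).
Local Notation letter := (H * (nat -> R))%type.

(** Coordinates are needed only for finite lists. They come from the Gram factorization of
    one-letter words in F; its complex coordinates are split into real and imaginary parts, as the
    inner products of H are real. *)
Lemma ex_coord (fs : seq H) : exists dc : {d & 'I_d -> H -> R}, forall f g,
  f \in fs -> g \in fs -> inner f g = \sum_a projT2 dc a f * projT2 dc a g.
Proof.
have [d [kap hk]] := gram_factor F [seq [:: f] | f <- fs].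
pose co (p : 'I_d * bool) f := if p.2 then Cre (kap p.1 [:: f]) else Cim (kap p.1 [:: f]).
exists (existT (fun d => 'I_d -> H -> R) #|{: 'I_d * bool}| (fun a => co (enum_val a))) => f g hf hg /=.
rewrite (reindex enum_rank) /=; last exact: onW_bij (enum_rank_bij _).
under eq_bigr do rewrite enum_rankK.
rewrite -(pair_bigA _ (fun a b => co (a, b) f * co (a, b) g)) /=.
have := hk [:: f] [:: g] (map_f _ hf) (map_f _ hg); rewrite rt_inner// => h.
have qf : qform q (fun x y : H => inner x y) [:: f] [:: g] = inner f g by rewrite /= scaler0 addr0; exact: mulr1.
rewrite qf in h; rewrite -[LHS]/(Cre (inner f g)%:C) h Cre_sum; apply: eq_bigr => a _.
rewrite big_bool /co /=; case: (kap a [:: f]) => x y; case: (kap a [:: g]) => z t.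
by rewrite /Cre /Cim /=; ring.
Qed.

Definition coord fs : {d & 'I_d -> H -> R} := projT1 (cid (ex_coord fs)).

Lemma coordE fs f g : f \in fs -> g \in fs ->
  inner f g = \sum_a projT2 (coord fs) a f * projT2 (coord fs) a g.
Proof. by rewrite /coord; case: cid => /= dc h; exact: h. Qed.

Implicit Types (i : index) (z : letter) (w : seq H).
Local Notation site i := ('I_(projT1 (coord i.1)) * 'I_i.2.+2 * 'I_i.2.+1)%type.

Definition sites i := #|{: site i}|.
(** A site has three indices: a coordinate of the vector, one of n + 2 directions (the original one
    and n + 1 fresh ones for the rotations), and one of n + 1 repetitions. Dividing by the square
    root of n + 1 keeps the inner products while making all coefficients small. *)
Definition lett i z : 'I_(sites i) -> R := fun x => let p : site i := enum_val x in
  projT2 (coord i.1) p.1.1 z.1 * z.2 p.1.2 / Num.sqrt i.2.+1%:R.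
Arguments lett : clear implicits.
Definition gam n (g g' : nat -> R) : R := \sum_(k < n.+2) g k * g' k.

Lemma sqrt_sites n : Num.sqrt (n.+1%:R : R) * Num.sqrt n.+1%:R = n.+1%:R.
Proof. by rewrite -expr2 sqr_sqrtr. Qed.

Lemma dotp_lett i z z' : z.1 \in i.1 -> z'.1 \in i.1 ->
  dotp (lett i z) (lett i z') = inner z.1 z'.1 * gam i.2 z.2 z'.2.
Proof.
move=> hz hz'; rewrite /dotp /lett (reindex enum_rank) /=; last exact: onW_bij (enum_rank_bij _).
under eq_bigr do rewrite enum_rankK.
rewrite (coordE hz hz') mulr_suml.
set n := i.2; set co := projT2 (coord i.1); set sn := Num.sqrt _.
transitivity (\sum_a \sum_(k < n.+2) \sum_(j < n.+1) (co a z.1 * co a z'.1 * (z.2 k * z'.2 k)) / n.+1%:R).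
  rewrite (pair_bigA _ (fun a (k : 'I_n.+2) => \sum_(j < n.+1) (co a z.1 * co a z'.1 * (z.2 k * z'.2 k)) / n.+1%:R)).
  rewrite (pair_bigA _ (fun (ak : 'I_(projT1 (coord i.1)) * 'I_n.+2) (j : 'I_n.+1) =>
    (co ak.1 z.1 * co ak.1 z'.1 * (z.2 ak.2 * z'.2 ak.2)) / n.+1%:R)).
  apply: eq_bigr => -[[a k] j] _ /=; rewrite -sqrt_sites invfM -/sn; ring.
apply: eq_bigr => a _; rewrite /gam mulr_sumr; apply: eq_bigr => k _.
by rewrite sumr_const card_ord -[LHS]mulr_natr divfK.
Qed.

Lemma lett_le i z (b : R) x : z.1 \in i.1 -> inner z.1 z.1 <= b -> gam i.2 z.2 z.2 <= 1 ->
  `|lett i z x| <= Num.sqrt (b / i.2.+1%:R).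
Proof.
move=> hz hb hg; rewrite /lett; move: (enum_val x : site i) => [[a k] j] /=.
have i0 : 0 <= inner z.1 z.1.
  by rewrite (coordE hz hz); apply: sumr_ge0 => a' _; rewrite -expr2 sqr_ge0.
have b0 : 0 <= b by exact: le_trans hb.
rewrite -(@ler_pXn2r _ 2)// ?nnegrE ?sqrtr_ge0// sqr_sqrtr ?divr_ge0// real_normK ?num_real//.
rewrite expr_div_n sqr_sqrtr// ler_pM2r ?invr_gt0// exprMn -[b]mulr1; apply: ler_pM; rewrite ?sqr_ge0//.
  apply: le_trans hb; rewrite (coordE hz hz) (bigD1 a)//= -expr2 lerDl.
  by apply: sumr_ge0 => a' _; rewrite -expr2 sqr_ge0.
apply: le_trans hg; rewrite /gam (bigD1 k)//= -expr2 lerDl.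
by apply: sumr_ge0 => a' _; rewrite -expr2 sqr_ge0.
Qed.

Local Notation sample i := ({ffun 'I_(sites i) * 'I_(sites i) -> bool} * {ffun 'I_(sites i) -> bool})%type.

Definition spin : nat -> bounded_op V := projT1 (cid (@ex_spin R)).

Lemma spinE x (w : nat * nat -> bool) S : spin x (basis R (w, S)) = (sig R w x S)%:C *: basis R (w, flip x S).
Proof. by rewrite /spin; case: cid => /= lam []. Qed.

Lemma spin_sa x : star (spin x) = spin x.
Proof. by rewrite /spin; case: cid => /= lam []. Qed.

Lemma basis_inner j j' : inner (basis R j) (basis R j') = (j == j')%:R.
Proof.
rewrite /basis inner_single singleE; case: eqP => _; last exact: inner0r.
by rewrite cplx_innerE conjC1 mulr1.
Qed.

Definition letter_op i z : bounded_op V := spin_gauss spin (lett i z).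

Lemma letter_op_sa i z : star (letter_op i z) = letter_op i z.
Proof.
rewrite /letter_op /spin_gauss star_sum; apply: eq_bigr => x _.
by rewrite star_opZ spin_sa conj_RC.
Qed.

Definition wt i (s : sample i) : R := sign_weight q s.1 / (2 ^+ sites i).
Definition bvec i (s : sample i) : K := single i (basis R (signs_of s.1, spins_of s.2)).
Arguments wt : clear implicits.
Arguments bvec : clear implicits.
Definition famw i (ks : 'I_i.2.+1 * sample i) : R := wt i ks.2 / i.2.+1%:R.
Arguments famw : clear implicits.
(** The square roots of the weights are put into the vector, so that averaging over the summand k,
    the signs and the configurations is a vector state of the amplified B(K). The operator Y may
    depend on k. *)
Definition fam i (Y : nat -> bounded_op V) : l2 ('I_i.2.+1 * sample i)%type K :=
  fin_vec (fun ks => (Num.sqrt (famw i ks))%:C *: cdiag index (Y ks.1) (bvec i ks.2)).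

Lemma famw_ge0 i (ks : 'I_i.2.+1 * sample i) : 0 <= famw i ks.
Proof. by rewrite /famw /wt !divr_ge0 ?exprn_ge0// sign_weight_ge0. Qed.

Lemma famE i Y ks : fam i Y ks = (Num.sqrt (famw i ks))%:C *: cdiag index (Y ks.1) (bvec i ks.2).
Proof. exact: fin_vecE. Qed.

Arguments fam : clear implicits.
Opaque fam.

Lemma fam_inner i (x : bounded_op K) Y Y' : inner (cdiag _ x (fam i Y)) (fam i Y') =
  \sum_ks (famw i ks)%:C * inner (x (cdiag index (Y ks.1) (bvec i ks.2))) (cdiag index (Y' ks.1) (bvec i ks.2)).
Proof.
exact: (inner_weights x (famE Y) (famE Y') (@famw_ge0 i)).
Qed.
Arguments fam_inner : clear implicits.

Lemma fam_sum i (f : 'I_i.2.+1 -> sample i -> C) :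
  \sum_ks (famw i ks)%:C * f ks.1 ks.2 =
  \sum_k \sum_e (sign_weight q e / 2 ^+ sites i / i.2.+1%:R)%:C * \sum_t f k (e, t).
Proof.
rewrite sum_pair; apply: eq_bigr => k _; rewrite sum_pair; apply: eq_bigr => e _.
by rewrite mulr_sumr.
Qed.

Lemma fam_inner3 i (x : bounded_op K) Y Y' : inner (cdiag _ x (fam i Y)) (fam i Y') =
  \sum_(k < i.2.+1) \sum_(e : {ffun 'I_(sites i) * 'I_(sites i) -> bool})
    (sign_weight q e / 2 ^+ sites i / i.2.+1%:R)%:C *
    \sum_t inner (x (cdiag index (Y k) (bvec i (e, t)))) (cdiag index (Y' k) (bvec i (e, t))).
Proof.
exact: (etrans (fam_inner i x Y Y')
  (fam_sum (fun k s => inner (x (cdiag index (Y k) (bvec i s))) (cdiag index (Y' k) (bvec i s))))).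
Qed.
Arguments fam_inner3 : clear implicits.

(** The hypertrace property survives averaging, also for a letter that varies with k. This is where
    x may be any operator on K. *)
Lemma fam_trace i (x : bounded_op K) Y Y' (z : nat -> letter) :
  inner (cdiag _ x (fam i (fun k => Y k * letter_op i (z k)))) (fam i Y') =
  inner (cdiag _ x (fam i Y)) (fam i (fun k => Y' k * letter_op i (z k))).
Proof.
apply: (etrans (fam_inner3 i x _ Y')); apply: (etrans _ (esym (fam_inner3 i x Y _))).
apply: eq_bigr => k _; apply: eq_bigr => e _.
set wgt : C := _%:C; apply: (f_equal (fun u => wgt * u)); move: wgt => _.
pose T := star (cdiag index (Y' k)) * (x * cdiag index (Y k)).
have hl : cdiag index (letter_op i (z k)) = spin_gauss (fun y => cdiag index (spin y)) (lett i (z k)).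
  by rewrite /letter_op /spin_gauss cdiag_sum; apply: eq_bigr => y _; rewrite cdiagZ.
transitivity (\sum_t inner (T (cdiag index (letter_op i (z k)) (bvec i (e, t)))) (bvec i (e, t))).
  by apply: eq_bigr => t _; rewrite cdiagM opME; exact: (esym (star_inner _ _ _ _)).
transitivity (\sum_t inner (T (bvec i (e, t))) (cdiag index (letter_op i (z k)) (bvec i (e, t)))); last first.
  by apply: eq_bigr => t _; rewrite cdiagM opME; exact: (star_inner _ _ _ _).
have lE y' (w' : nat * nat -> bool) S : cdiag index (spin y') (single i (basis R (w', S))) =
    (sig R w' y' S)%:C *: single i (basis R (w', flip y' S)).
  by rewrite cdiag_single spinE singleZ.
have h := @spin_gauss_trace R (sites i) K (fun j => single i (basis R j)) (fun y => cdiag index (spin y))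
  (signs_of e) T (lett i (z k)) lE.
by rewrite hl; exact: h.
Qed.

(** A tag tells on which side of the inner product a letter stands; rho is the correlation between
    the rotations used on the two sides. The left word appears reversed in [tagged] because its
    operator is moved over as an adjoint. *)
Definition tag_ip (rho : R) (p p' : bool * H) : R := inner p.2 p'.2 * (if p.1 == p'.1 then 1 else rho).
Definition tagged w w' : seq (bool * H) := rev (map (pair false) w) ++ map (pair true) w'.
Definition letters (g : nat -> R) w : seq letter := map (fun f => (f, g)) w.
Definition gword i g w : bounded_op V := wprod (letter_op i) (letters g w).

Lemma star_gword i g w : star (gword i g w) = gword i g (rev w).
Proof. by rewrite /gword star_wprod => [|z]; [rewrite /letters map_rev|exact: letter_op_sa]. Qed.

(** The rate 1/(n+1) is the square of the coefficient bound [lett_le] inserted in [spin_moment]. The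
    constant depends on the words alone, neither on the model nor on the rotations. *)
Lemma word_moment w w' : exists2 k0, 0 <= k0 & forall i (rho : R) (g g' : nat -> nat -> R),
  {subset w <= i.1} -> {subset w' <= i.1} ->
  (forall k : 'I_i.2.+1, [/\ gam i.2 (g k) (g k) = 1, gam i.2 (g' k) (g' k) = 1 & gam i.2 (g k) (g' k) = rho]) ->
  nrm (inner (fam i (fun k => gword i (g k) w)) (fam i (fun k => gword i (g' k) w')) -
    (mom q (tag_ip rho) [::] (tagged w w'))%:C) <= k0 / i.2.+1%:R.
Proof.
have fld (a m : R) : a != 0 -> m != 0 -> m * (a * (a^-1 / m)) = 1.
  by move=> a0 m0; field; rewrite a0 m0.
pose b : R := \sum_(f <- w ++ w') inner f f.
have ff (f : H) : 0 <= inner f f.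
  by have := @coordE [:: f] f f; rewrite inE eqxx => ->//; apply: sumr_ge0 => a _; rewrite -expr2 sqr_ge0.
have b0 : 0 <= b by apply: sumr_ge0 => f _.
have fb f : f \in w ++ w' -> inner f f <= b.
  by move=> h; rewrite /b (big_rem f h) /= lerDl sumr_ge0.
have [k1 k10 hk] := spin_moment hq (size w + size w') b0.
exists (k1 * b) => [|i rho g g' hw hw' hg]; first exact: mulr_ge0.
set n1 : R := i.2.+1%:R; have n10 : 0 < n1 by [].
pose mu := mom q (tag_ip rho) [::] (tagged w w').
pose zs (k : 'I_i.2.+1) : seq letter := rev (letters (g k) w) ++ letters (g' k) w'.
pose tg (k : 'I_i.2.+1) (p : bool * H) : letter := (p.2, if p.1 then g' k else g k).
have zsE k : zs k = map (tg k) (tagged w w').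
  by rewrite /zs /tagged map_cat map_rev -!map_comp.
have tin p : p \in tagged w w' -> p.2 \in i.1 /\ p.2 \in w ++ w'.
  rewrite !mem_cat mem_rev => /orP[/mapP[f fw ->]|/mapP[f fw ->]] /=; rewrite fw ?orbT; split=> //; [exact: hw|exact: hw'].
pose N := sites i.
have key (k : 'I_i.2.+1) (t : {ffun 'I_N -> bool}) :
  nrm (\sum_(e : {ffun 'I_N * 'I_N -> bool}) (sign_weight q e)%:C *
     inner (basis R (signs_of e, spins_of t)) (wprod (letter_op i) (zs k) (basis R (signs_of e, spins_of t))) - mu%:C) <= k1 * (b / n1).
  have h2 : (Num.sqrt (b / n1)) ^+ 2 = b / n1 by rewrite sqr_sqrtr// divr_ge0// ltW.
  have := hk V (basis R) spin N (map (lett i) (zs k)) (Num.sqrt (b / n1)) (spins_of t) basis_inner spinE spin_sa.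
  rewrite h2 wprod_map size_map zsE size_map /tagged size_cat size_rev !size_map -/(tagged w w') => /(_ erefl).
  have ha : all (fun p => p \in tagged w w') (tagged w w') by exact/allP.
  rewrite -map_comp mom_map0 (@mom_ext R q _ (fun p => p \in tagged w w') _ (tag_ip rho))//; last first.
    move=> p p' /tin[hp _] /tin[hp' _] /=; rewrite dotp_lett// /tag_ip; congr (_ * _).
    have [h1 h3 h4] := hg k; rewrite /tg /=; case: (p.1) (p'.1) => [] [] //=; rewrite -h4 /gam.
    by apply: eq_bigr => a _; exact: mulrC.
  apply=> u hu; have [p hp ->] := In_map hu; have [pi pw] := tin p hp; have [h1 h3 _] := hg k.
  have hg1 : gam i.2 (tg k p).2 (tg k p).2 = 1 by rewrite /tg /=; case: p.1.
  split=> [|x]; last by apply: lett_le; rewrite ?hg1//; exact: fb.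
  rewrite (eq_bigr (fun x => lett i (tg k p) x * lett i (tg k p) x)); last by move=> x _; rewrite expr2.
  by rewrite -/(dotp _ _) dotp_lett// hg1 mulr1; exact: fb.
pose G (k : 'I_i.2.+1) (e : {ffun 'I_N * 'I_N -> bool}) (t : {ffun 'I_N -> bool}) : C :=
  inner (basis R (signs_of e, spins_of t)) (wprod (letter_op i) (zs k) (basis R (signs_of e, spins_of t))).
have GE (k : 'I_i.2.+1) e t : inner (cdiag index (gword i (g k) w) (bvec i (e, t))) (cdiag index (gword i (g' k) w') (bvec i (e, t))) = G k e t.
  have eW : star (gword i (g k) w) * gword i (g' k) w' = wprod (letter_op i) (zs k).
    by rewrite star_gword /zs wprod_cat /gword /letters map_rev.
  exact: (etrans (inner_cdiag_single _ _ _ _ _) (f_equal (fun T : bounded_op V =>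
    inner (basis R (signs_of e, spins_of t)) (T (basis R (signs_of e, spins_of t)))) eW)).
have := fam_inner3 i 1 (fun k => gword i (g k) w) (fun k => gword i (g' k) w').
rewrite cdiag1 op1E => ->.
have c2 : (#|{ffun 'I_N -> bool}|%:R : R) = 2 ^+ N by rewrite card_ffun card_bool card_ord natrX.
have p2 : 0 < 2 ^+ N :> R by exact: exprn_gt0.
pose al : R := (2 ^+ N)^-1 / n1.
have al0 : 0 <= al by rewrite divr_ge0 ?invr_ge0 ?ltW.
have sal (V' : lmodType R) (z : V') : \sum_(k < i.2.+1) \sum_(t : {ffun 'I_N -> bool}) al *: z = z.
  rewrite (eq_bigr (fun=> (2 ^+ N * al) *: z)); last first.
    by move=> k _; rewrite sumr_const -scaler_nat scalerA c2.
  by rewrite sumr_const card_ord -scaler_nat scalerA /al -/n1 fld ?scale1r// lt0r_neq0.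
set X := (X in X - _).
have -> : X = \sum_(k < i.2.+1) \sum_(t : {ffun 'I_N -> bool}) al%:C *
      \sum_(e : {ffun 'I_N * 'I_N -> bool}) (sign_weight q e)%:C * G k e t.
  apply: eq_bigr => k _; under [RHS]eq_bigr do rewrite mulr_sumr.
  rewrite [RHS]exchange_big; apply: eq_bigr => e _; rewrite mulr_sumr; apply: eq_bigr => t _.
  have h1 : sign_weight q e / 2 ^+ sites i / i.2.+1%:R = al * sign_weight q e by rewrite /al; ring.
  rewrite h1 RCM -mulrA; apply: (f_equal (fun u => al%:C * ((sign_weight q e)%:C * u))); exact: GE.
have -> : mu%:C = \sum_(k < i.2.+1) \sum_(t : {ffun 'I_N -> bool}) al%:C * mu%:C.
  rewrite -[in LHS](sal _ (mu : R^o)) RC_sum; apply: eq_bigr => k _; rewrite RC_sum.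
  by apply: eq_bigr => t _; rewrite -RCM.
rewrite -sumrB -[leRHS](sal _ (k1 * b / n1 : R^o)).
apply: (le_trans (nrm_sum _ _ _)); apply: ler_sum => k _.
rewrite -sumrB; apply: (le_trans (nrm_sum _ _ _)); apply: ler_sum => t _.
by rewrite -mulrBr nrmM nrmC ger0_norm//; apply: ler_wpM2l => //; rewrite -mulrA; exact: key.
Qed.

End model.

(** * Limits along an ultrafilter and compressions *)

Section asymptotics.
Variables (R : realType) (T : Type) (U : set_system T).
Context {UU : UltraFilter U}.
Variables (K Fk : complexHilbertType R) (J : T -> finType).
Variables (W : Type) (gv : W -> Fk) (vv : forall t, W -> l2 (J t) K).
Hypothesis tgv : total_family gv.
Hypothesis hvv : forall w w', ucvg U (fun t => inner (vv t w) (vv t w')) (inner (gv w) (gv w')).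
Local Notation C := R[i].
Local Notation fam := (forall t, l2 (J t) K).
Local Notation vec := (fun c : seq (C * W) => (fun t => lcomb (vv t) c)).
Implicit Types (c : seq (C * W)) (xi : fam) (eta : Fk) (x y : bounded_op K) (a : bounded_op Fk) (d e : R).
Local Notation amp1 x := (fun xi : fam => (fun t => cdiag (J t) x (xi t))).

Let PU : ProperFilter U. Proof. exact: ultra_proper. Qed.

Lemma vec_inner c c' : ucvg U (fun t => inner (lcomb (vv t) c) (lcomb (vv t) c')) (inner (lcomb gv c) (lcomb gv c')).
Proof.
rewrite inner_lcomb; have -> : (fun t => inner (lcomb (vv t) c) (lcomb (vv t) c')) =
   (fun t => \sum_(p <- c) \sum_(p' <- c') p.1 * (p'.1)^*%R * inner (vv t p.2) (vv t p'.2)).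
  by apply/funext => t; rewrite inner_lcomb.
apply: ucvg_sum => p; apply: ucvg_sum => p'.
by apply: ucvgM => //; exact: ucvg_cst.
Qed.

Lemma vec_nrm2 c : ucvg U (fun t => (nrm (lcomb (vv t) c) ^+ 2)%:C) (nrm (lcomb gv c) ^+ 2)%:C.
Proof.
rewrite -inner_nrm; have -> : (fun t => (nrm (lcomb (vv t) c) ^+ 2)%:C) =
  (fun t => inner (lcomb (vv t) c) (lcomb (vv t) c)) by apply/funext => t; rewrite -inner_nrm.
exact: vec_inner.
Qed.

Lemma vec_lt c d : nrm (lcomb gv c) < d -> U [set t | nrm (lcomb (vv t) c) < d].
Proof.
move=> h; have d0 : 0 < d by apply: le_lt_trans h; exact: nrm_ge0.
have e0 : 0 < d ^+ 2 - nrm (lcomb gv c) ^+ 2.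
  by rewrite subr_gt0 ltr_pXn2r ?nnegrE ?nrm_ge0// ltW.
apply: filterS (vec_nrm2 c e0) => t /=; rewrite -RCB nrmC => hh.
rewrite -(@ltr_pXn2r _ 2)// ?nnegrE ?nrm_ge0 ?(ltW d0)//.
have := le_lt_trans (ler_norm _) hh; by rewrite ltrD2r.
Qed.

(** Convergence of vectors that live in different spaces. By [hvv] the test vectors span a copy of
    Fk in the ultraproduct of Hilbert spaces; this says that the class of xi is the image of eta in
    that copy. *)
Definition tends xi eta := forall d, 0 < d -> exists c,
  nrm (lcomb gv c - eta) < d /\ U [set t | nrm (xi t - lcomb (vv t) c) < d].

Lemma tends_vec c : tends (vec c) (lcomb gv c).
Proof.
move=> d d0; exists c; rewrite subrr nrm0; split=> //.
by apply: filterS filterT => t _ /=; rewrite subrr nrm0.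
Qed.

Lemma tends_near xi eta : (forall d, 0 < d -> exists xi' eta', [/\ tends xi' eta', nrm (eta' - eta) < d &
  U [set t | nrm (xi t - xi' t) < d]]) -> tends xi eta.
Proof.
move=> h d d0; have d2 : 0 < d / 2 by rewrite divr_gt0.
have [xi' [eta' [h1 h2 h3]]] := h _ d2; have [c [h4 h5]] := h1 _ d2.
exists c; rewrite [d]splitr; split.
  by apply: (le_lt_trans (nrm_dist _ eta' _)); exact: ltrD.
apply: filterS (filterI h3 h5) => t /= [h6 h7].
by apply: (le_lt_trans (nrm_dist _ (xi' t) _)); exact: ltrD.
Qed.

Lemma tendsP (b : C) xi xi' eta eta' : tends xi eta -> tends xi' eta' ->
  tends (fun t => b *: xi t + xi' t) (b *: eta + eta').
Proof.
move=> h h' d d0; have b0 : 0 < nrm b + 1 by rewrite ltr_wpDl// nrm_ge0.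
have d1 : 0 < d / (nrm b + 1) by rewrite divr_gt0.
have [c [h1 h2]] := h _ d1; have [c' [h1' h2']] := h' _ d1.
have key (V : normedModType C) (x y z u : V) : nrm (x - y) < d / (nrm b + 1) -> nrm (z - u) < d / (nrm b + 1) ->
    nrm (b *: x + z - (b *: y + u)) < d.
  move=> k1 k2; rewrite opprD addrACA -scalerBr; apply: (le_lt_trans (nrmD _ _)).
  have -> : d = nrm b * (d / (nrm b + 1)) + d / (nrm b + 1).
    by rewrite -[X in _ + X]mul1r -mulrDl mulrC divfK// lt0r_neq0.
  apply: ler_ltD => //; rewrite nrmZ; apply: ler_wpM2l; [exact: nrm_ge0|exact: ltW].
exists (cscale b c ++ c'); split; first by rewrite lcomb_cat lcomb_scale; exact: key.
by apply: filterS (filterI h2 h2') => t /= [k1 k2]; rewrite lcomb_cat lcomb_scale; exact: key.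
Qed.

Lemma tends_lt xi eta d : tends xi eta -> nrm eta < d -> U [set t | nrm (xi t) < d].
Proof.
move=> h hd; pose e := (d - nrm eta) / 2.
have e0 : 0 < e by rewrite divr_gt0// subr_gt0.
have [c [h1 h2]] := h _ e0.
have h3 : nrm (lcomb gv c) < nrm eta + e.
  by apply: (le_lt_trans (nrm_sub_le _ eta)); rewrite ltrD2l.
apply: filterS (filterI h2 (vec_lt h3)) => t /= [k1 k2].
apply: (le_lt_trans (nrm_sub_le _ (lcomb (vv t) c))).
have -> : d = nrm eta + e + e by rewrite /e; field.
exact: ltrD.
Qed.

Lemma tends0P xi : tends xi 0 <-> forall d, 0 < d -> U [set t | nrm (xi t) < d].
Proof.
split=> [h d d0|h d d0]; first by apply: tends_lt h _; rewrite nrm0.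
exists [::]; rewrite !lcomb_nil subrr nrm0; split=> //.
by apply: filterS (h d d0) => t /=; rewrite lcomb_nil subr0.
Qed.

Lemma tends_small xi eta : tends xi eta -> (forall d, 0 < d -> U [set t | nrm (xi t) < d]) -> eta = 0.
Proof.
move=> h h0; apply: nrm_eq0; apply/eqP; rewrite eq_le nrm_ge0 andbT leNgt; apply/negP => p.
pose d := nrm eta / 3; have d0 : 0 < d by rewrite divr_gt0.
have [c [h1 h2]] := h _ d0.
have h3 : 2 * d < nrm (lcomb gv c).
  have := nrm_sub_le eta (lcomb gv c); rewrite nrmB => h4.
  have e : nrm eta = 3 * d by rewrite /d; field.
  by move: h1 h4; rewrite e; move: (nrm _) (nrm _) => u v; lra.
have e0 : 0 < nrm (lcomb gv c) ^+ 2 - (2 * d) ^+ 2.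
  by rewrite subr_gt0 ltr_pXn2r ?nnegrE ?nrm_ge0// mulr_ge0// ltW.
have [t [[/= k1 k2] k3]] := filter_ex (filterI (filterI h2 (h0 _ d0)) (vec_nrm2 c e0)).
move: k3 => /=; rewrite -RCB nrmC distrC => k3.
have := le_lt_trans (ler_norm _) k3; rewrite ltrD2l ltrN2 => k4.
have k5 : nrm (lcomb (vv t) c) < 2 * d.
  apply: (le_lt_trans (nrm_sub_le _ (xi t))); rewrite mulrDl !mul1r.
  by rewrite nrmB in k1; exact: ltrD k2 k1.
have k6 : nrm (lcomb (vv t) c) ^+ 2 < (2 * d) ^+ 2.
  by rewrite ltr_pXn2r ?nnegrE ?nrm_ge0//; apply: mulr_ge0 => //; exact: ltW.
by move: (lt_trans k4 k6); rewrite ltxx.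
Qed.

Lemma tends_uniq xi eta eta' : tends xi eta -> tends xi eta' -> eta = eta'.
Proof.
move=> h h'; have := tendsP (-1) h' h; rewrite !scaleN1r addrC => k.
apply/eqP; rewrite -subr_eq0; apply/eqP; apply: (tends_small k) => d d0.
by apply: filterS filterT => t _ /=; rewrite scaleN1r addNr nrm0.
Qed.

Lemma tends_inner xi xi' eta eta' : tends xi eta -> tends xi' eta' ->
  ucvg U (fun t => inner (xi t) (xi' t)) (inner eta eta').
Proof.
move=> h h' e e0; pose S := nrm eta + nrm eta' + 5.
have S1 : nrm eta + 1 + (nrm eta' + 2) <= S by rewrite /S; lra.
have S2 : nrm eta + (nrm eta' + 2) <= S by rewrite /S; lra.
have e3 : e / 4 + (e / 4 + e / 4) < e by lra.
have S0 : 0 < S by rewrite ltr_wpDl ?addr_ge0 ?nrm_ge0.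
pose d := Num.min 1 (e / (4 * S)).
have d0 : 0 < d by rewrite lt_min ltr01 divr_gt0// mulr_gt0.
have d1 : d <= 1 by rewrite ge_min lexx.
have dS : d * S <= e / 4.
  rewrite -ler_pdivlMr//; rewrite /d ge_min; apply/orP; right.
  by rewrite -[leRHS]mulrA -invfM lexx.
have [c [h1 h2]] := h _ d0; have [c' [h1' h2']] := h' _ d0.
have hx : U [set t | nrm (xi t) < nrm eta + 1] by apply: tends_lt h _; rewrite ltrDl.
have hv : U [set t | nrm (lcomb (vv t) c') < nrm eta' + 2].
  apply: vec_lt; apply: (le_lt_trans (nrm_sub_le _ eta')); rewrite ltrD2l.
  by apply: lt_le_trans h1' (le_trans d1 _); rewrite ler1n.
have e4 : 0 < e / 4 by rewrite divr_gt0.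
apply: filterS (filterI (filterI h2 h2') (filterI (filterI hx hv) (vec_inner c c' e4))) => t /=.
move=> [[k1 k2] [[k3 k4] k5]].
have est (V : complexHilbertType R) (x y z u : V) (p r : R) : nrm (x - z) <= d -> nrm (y - u) <= d -> nrm x <= p -> nrm u <= r ->
    p + r <= S -> nrm (inner x y - inner z u) <= e / 4.
  move=> m1 m2 m3 m4 m5.
  have -> : inner x y - inner z u = inner x (y - u) + inner (x - z) u by rewrite innerBr innerBl; ring.
  apply: le_trans dS; apply: (le_trans (nrmD _ _)).
  apply: (@le_trans _ _ (p * d + d * r)); last first.
    by rewrite [p * d]mulrC -mulrDr; apply: ler_wpM2l => //; exact: ltW.
  apply: lerD; apply: (le_trans (inner_le _ _)); apply: ler_pM; rewrite ?nrm_ge0//.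
have m1 : nrm (inner (xi t) (xi' t) - inner (lcomb (vv t) c) (lcomb (vv t) c')) <= e / 4.
  exact: (est _ _ _ _ _ (nrm eta + 1) (nrm eta' + 2) (ltW k1) (ltW k2) (ltW k3) (ltW k4) S1).
have m2 : nrm (inner eta eta' - inner (lcomb gv c) (lcomb gv c')) <= e / 4.
  apply: (est _ _ _ _ _ (nrm eta) (nrm eta' + 2) _ _ (lexx _) _ S2); [by rewrite nrmB ltW|by rewrite nrmB ltW|].
  apply: (le_trans (nrm_sub_le _ eta')); rewrite lerD2l; apply: le_trans (ltW h1') (le_trans d1 _).
  by rewrite ler1n.
apply: (le_lt_trans (nrm_dist _ (inner (lcomb (vv t) c) (lcomb (vv t) c')) _)).
apply: (@le_lt_trans _ _ (e / 4 + (e / 4 + e / 4))); last exact: e3.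
apply: lerD => //; apply: (le_trans (nrm_dist _ (inner (lcomb gv c) (lcomb gv c')) _)).
by apply: lerD; [exact: ltW|rewrite nrmB].
Qed.

Lemma tends_nrm2 xi eta : tends xi eta -> ucvg U (fun t => (nrm (xi t) ^+ 2)%:C) (nrm eta ^+ 2)%:C.
Proof.
move=> t; rewrite -inner_nrm; have -> : (fun t => (nrm (xi t) ^+ 2)%:C) = (fun t => inner (xi t) (xi t)).
  by apply/funext => s; rewrite -inner_nrm.
exact: tends_inner.
Qed.

Variable A : set (bounded_op Fk).
Hypothesis hA : subalg A.

(** Asking this of x and of its adjoint makes the copy of Fk reducing for x, on which x acts as a.
    Sums, products and adjoints then follow, and a is unique. *)
Definition rel x a := forall xi eta, tends xi eta ->
  tends (amp1 x xi) (a eta) /\ tends (amp1 (star x) xi) (star a eta).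

Lemma rel_uniq x a a' : rel x a -> rel x a' -> a = a'.
Proof.
move=> h h'; apply: (op_ext_total tgv) => w.
have t := tends_vec [:: (1, w)]; rewrite lcomb1 in t.
by apply: tends_uniq; [exact: (h _ _ t).1|exact: (h' _ _ t).1].
Qed.

Lemma rel_star x a : rel x a -> rel (star x) (star a).
Proof. by move=> h xi eta t; have [h1 h2] := h _ _ t; rewrite !starK. Qed.

Lemma relP (b : C) x y a a' : rel x a -> rel y a' -> rel (b *: x + y) (b *: a + a').
Proof.
move=> h h' xi eta t; have [h1 h2] := h _ _ t; have [h3 h4] := h' _ _ t.
split.
  have := tendsP b h1 h3; rewrite (_ : (fun t => _) = (amp1 (b *: x + y) xi))//.
  by apply: functional_extensionality_dep => s; rewrite cdiagP.
have := tendsP (b^*)%R h2 h4; rewrite starD star_opZ starD star_opZ.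
rewrite (_ : (fun t => _) = (amp1 (b^*%R *: star x + star y) xi))//.
by apply: functional_extensionality_dep => s; rewrite cdiagP.
Qed.

Lemma relM x y a a' : rel x a -> rel y a' -> rel (x * y) (a * a').
Proof.
move=> h h' xi eta t; have [h1 h2] := h _ _ t; have [h3 h4] := h' _ _ t.
rewrite !star_opM; split.
  have := (h _ _ h3).1; rewrite (_ : (fun t => _) = (amp1 (x * y) xi))//.
  by apply: functional_extensionality_dep => s; rewrite cdiagM.
have := (h' _ _ h2).2; rewrite (_ : (fun t => _) = (amp1 (star y * star x) xi))//.
by apply: functional_extensionality_dep => s; rewrite cdiagM.
Qed.

Lemma rel_nrm x a : rel x a -> nrm a <= nrm x.
Proof.
move=> h; apply: (op_nrm_total tgv) => [|c]; first exact: nrm_ge0.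
have n0 z : 0 <= nrm (lcomb gv z) by exact: nrm_ge0.
rewrite -(@ler_pXn2r _ 2)// ?nnegrE ?mulr_ge0 ?nrm_ge0// -subr_le0 exprMn.
have [h1 _] := h _ _ (tends_vec c).
apply: (@ucvg_real_le _ _ U _ (fun t => nrm (cdiag (J t) x (lcomb (vv t) c)) ^+ 2 - nrm x ^+ 2 * nrm (lcomb (vv t) c) ^+ 2)).
  have -> : (fun t => (nrm (cdiag (J t) x (lcomb (vv t) c)) ^+ 2 - nrm x ^+ 2 * nrm (lcomb (vv t) c) ^+ 2)%:C) =
    (fun t => (nrm (cdiag (J t) x (lcomb (vv t) c)) ^+ 2)%:C - (nrm x ^+ 2)%:C * (nrm (lcomb (vv t) c) ^+ 2)%:C).
    by apply/funext => t; rewrite RCB (RCM (nrm x ^+ 2)).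
  rewrite RCB (RCM (nrm x ^+ 2)); apply: ucvgB; first exact: tends_nrm2 h1.
  by apply: ucvgM; [exact: ucvg_cst|exact: vec_nrm2].
apply: filterS filterT => t _ /=; rewrite subr_le0 -exprMn ler_pXn2r ?nnegrE ?mulr_ge0 ?nrm_ge0//.
apply: (le_trans (op_le _ _)); apply: ler_wpM2r; [exact: nrm_ge0|exact: nrm_cdiag].
Qed.

Lemma rel_near x a : (forall e, 0 < e -> exists y b, [/\ rel y b, nrm (x - y) < e & nrm (a - b) < e]) -> rel x a.
Proof.
have half x' a' : (forall e, 0 < e -> exists y b, [/\ rel y b, nrm (x' - y) < e & nrm (a' - b) < e]) ->
    forall xi eta, tends xi eta -> tends (amp1 x' xi) (a' eta).
  move=> h xi eta t; apply: tends_near => d d0.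
  have p0 : 0 < nrm eta + 1 by rewrite ltr_wpDl// nrm_ge0.
  have e0 : 0 < d / (nrm eta + 1) by rewrite divr_gt0.
  have [y [b [r h1 h2]]] := h _ e0; exists (amp1 y xi), (b eta); split; first exact: (r _ _ t).1.
    rewrite -opBE; apply: (le_lt_trans (op_le _ _)); rewrite nrmB.
    apply: (@le_lt_trans _ _ (d / (nrm eta + 1) * nrm eta)); first by apply: ler_wpM2r; [exact: nrm_ge0|exact: ltW].
    by rewrite -mulrA gtr_pMr// mulrC ltr_pdivrMr// mul1r ltrDl.
  have hn : nrm eta < nrm eta + 1 by rewrite ltrDl.
  apply: filterS (tends_lt t hn) => s /= k.
  have -> : cdiag (J s) x' (xi s) - cdiag (J s) y (xi s) = cdiag (J s) (x' - y) (xi s).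
    by rewrite cdiagB.
  apply: (le_lt_trans (op_le _ _)).
  have -> : d = d / (nrm eta + 1) * (nrm eta + 1) by rewrite divfK// lt0r_neq0.
  apply: ltr_pM; [exact: nrm_ge0|exact: nrm_ge0|apply: le_lt_trans h1; exact: nrm_cdiag|exact: k].
move=> h xi eta t; split; first exact: half.
apply: half t => e e0; have [y [b [r h1 h2]]] := h _ e0.
by exists (star y), (star b); split; [exact: rel_star|rewrite -starB nrm_star..].
Qed.

Definition model_set : set (bounded_op K) := [set x | exists2 a, A a & rel x a].
Definition model_map x : bounded_op Fk := xget 0 [set a | A a /\ rel x a].

Lemma model_mapP x : model_set x -> A (model_map x) /\ rel x (model_map x).
Proof. by move=> [a Aa r]; exact: (xgetPex 0 (ex_intro (fun a => A a /\ rel x a) a (conj Aa r))). Qed.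

Lemma model_mapE x a : A a -> rel x a -> model_map x = a.
Proof.
move=> Aa r; have [_ r'] := model_mapP (ex_intro2 _ _ a Aa r); exact: rel_uniq r' r.
Qed.

Lemma rel0 : rel 0 0.
Proof.
have h xi eta : tends xi eta -> tends (amp1 0 xi) ((0 : bounded_op Fk) eta).
  move=> t; rewrite op0E; apply/tends0P => d d0.
  by apply: filterS filterT => s _ /=; rewrite cdiag0 op0E nrm0.
by move=> xi eta t; rewrite !star0; split; exact: h.
Qed.

(** For closedness, [rel_nrm] makes the map to A contractive, so the images of a norm-convergent
    sequence converge in A, and [rel_near] identifies their limit. *)
Lemma model_subalg : subalg model_set.
Proof.
have [A0 AD AM AS Ac] := hA; split.
- by exists 0; [exact: A0|exact: rel0].
- by move=> b x y [a Aa r] [a' Aa' r']; exists (b *: a + a'); [exact: AD|exact: relP].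
- by move=> x y [a Aa r] [a' Aa' r']; exists (a * a'); [exact: AM|exact: relM].
- by move=> x [a Aa r]; exists (star a); [exact: AS|exact: rel_star].
move=> x h; have pos n : 0 < n.+1%:R^-1 :> R by [].
have [y hy] := boolp.choice (fun n => let: ex_intro2 y h1 h2 := h _ (pos n) in ex_intro (fun y => model_set y /\ nrm (x - y) < n.+1%:R^-1) y (conj h1 h2)).
have hp n := model_mapP (hy n).1.
have [n m nm|e e0|l hl] := @op_cauchy_bound _ _ (fun n => model_map (y n)) (fun n => 2 / n.+1%:R).
- have r : rel (y m - y n) (model_map (y m) - model_map (y n)).
    have := relP (-1) (hp n).2 (hp m).2; by rewrite !scaleN1r ![- _ + _]addrC.
  apply: (le_trans (rel_nrm r)); apply: (le_trans (nrm_dist _ x _)).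
  have -> : 2 / n.+1%:R = n.+1%:R^-1 + n.+1%:R^-1 :> R by rewrite mulrDl mul1r.
  rewrite nrmB; apply: lerD; last exact/ltW/(hy n).2.
  apply: (le_trans (ltW (hy m).2)); by rewrite lef_pV2 ?posrE// ler_nat ltnS.
- have e2 : 0 < e / 2 by rewrite divr_gt0.
  have [n0 hn0] := @invS_small R 2 (e / 2) (ler0n _ 2) e2.
  by exists n0 => n /hn0 k; apply: (le_lt_trans k); rewrite ltr_pdivrMr// ltr_pMr// ltr1n.
have small e : 0 < e -> exists n, 2 / n.+1%:R < e.
  move=> e0; have e2 : 0 < e / 2 by rewrite divr_gt0.
  have [n0 hn0] := @invS_small R 2 (e / 2) (ler0n _ 2) e2; exists n0.
  by apply: (le_lt_trans (hn0 n0 (leqnn _))); rewrite ltr_pdivrMr// ltr_pMr// ltr1n.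
exists l.
  apply: Ac => e /small[n hn]; exists (model_map (y n)); first exact: (hp n).1.
  exact: le_lt_trans (hl n) hn.
apply: rel_near => e /small[n hn]; exists (y n), (model_map (y n)); split; first exact: (hp n).2.
  apply: lt_le_trans (hy n).2 _; apply: le_trans (ltW hn).
  by rewrite ler_peMl// ler1n.
exact: le_lt_trans (hl n) hn.
Qed.

Lemma model_hom : star_hom model_set model_map.
Proof.
have [A0 AD AM AS Ac] := hA; split.
- move=> b x y /model_mapP[a1 r1] /model_mapP[a2 r2]; apply: model_mapE; [exact: AD|exact: relP].
- move=> x y /model_mapP[a1 r1] /model_mapP[a2 r2]; apply: model_mapE; [exact: AM|exact: relM].
- move=> x /model_mapP[a1 r1]; apply: model_mapE; [exact: AS|exact: rel_star].
Qed.

(** The factor e' turns every convergent family into one that vanishes in norm, and a bounded x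
    keeps it so, whether or not x itself has a limit. The adjoint is treated in the same way with
    [star e] in place of e'. *)
Lemma model_hereditary (e e' : bounded_op K) x : model_set e -> model_map e = 0 -> model_set e' -> model_map e' = 0 ->
  model_set (e * x * e') /\ model_map (e * x * e') = 0.
Proof.
move=> /model_mapP[_ r] pe /model_mapP[_ r'] pe'; rewrite pe in r; rewrite pe' in r'.
have half y y' z : rel y 0 -> rel y' 0 -> forall xi eta, tends xi eta -> tends (amp1 (y * z * y') xi) ((0 : bounded_op Fk) eta).
  move=> h h' xi eta t; have := (h' _ _ t).1; rewrite op0E => /tends0P k.
  have k2 : tends (amp1 (z * y') xi) 0.
    apply/tends0P => d d0; have p0 : 0 < nrm z + 1 by rewrite ltr_wpDl// nrm_ge0.
    have e0 : 0 < d / (nrm z + 1) by rewrite divr_gt0.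
    apply: filterS (k _ e0) => s /= ks; rewrite cdiagM opME; apply: (le_lt_trans (op_le _ _)).
    apply: (@le_lt_trans _ _ ((nrm z + 1) * nrm (cdiag (J s) y' (xi s)))).
      apply: ler_wpM2r; first exact: nrm_ge0.
      by apply: (@le_trans _ _ (nrm z)); [exact: nrm_cdiag|rewrite lerDl].
    by rewrite mulrC -ltr_pdivlMr.
  have := (h _ _ k2).1; rewrite !op0E (_ : (fun t => _) = (amp1 (y * z * y') xi))//.
  by apply: functional_extensionality_dep => s; rewrite -mulrA [in RHS]cdiagM.
have rr : rel (e * x * e') 0.
  move=> xi eta t; split; first exact: half t.
  by rewrite !star_opM star0 mulrA; apply: half t; rewrite -star0; exact: rel_star.
have A0 : A 0 by case: hA.
by split; [exists 0; [exact: A0|exact: rr]|exact: model_mapE].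
Qed.

(** Made for x = S / (1 + S^2/t) with S a spin sum: x is known only on the combinations [S c], which
    have a word form although their operators are unbounded over the models. As B is right
    invertible, such combinations approximate every vector. *)
Lemma lift_half x (B Bi Wd : bounded_op Fk) (S L : seq (C * W) -> seq (C * W)) :
  (forall c t, cdiag (J t) x (lcomb (vv t) (S c)) = lcomb (vv t) (L c)) ->
  (forall c, lcomb gv (S c) = B (lcomb gv c)) -> (forall c, lcomb gv (L c) = Wd (lcomb gv c)) ->
  B * Bi = 1 -> forall xi eta, tends xi eta -> tends (amp1 x xi) ((Wd * Bi) eta).
Proof.
move=> hx hB hW BB xi eta t; apply: tends_near => d d0.
pose M := nrm x + nrm B + nrm Wd + 1.
have M0 : 0 < M by rewrite ltr_wpDl// !addr_ge0 ?nrm_ge0.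
have hM1 : nrm x + 1 <= M by rewrite /M lerD2r -addrA lerDl addr_ge0 ?nrm_ge0.
have hM2 : nrm B + 1 <= M by rewrite /M lerD2r [nrm x + _]addrC -addrA lerDl addr_ge0 ?nrm_ge0.
have hM3 : nrm Wd + 1 <= M by rewrite /M lerD2r [leRHS]addrC lerDl addr_ge0 ?nrm_ge0.
pose de := d / (M * M).
have de0 : 0 < de by rewrite divr_gt0// mulr_gt0.
have [c hc] := tgv (Bi eta) de0; rewrite nrmB in hc.
have mulM (z r : R) : 0 <= r -> z + 1 <= M -> z * r <= M * r.
  by move=> r0 zM; apply: ler_wpM2r => //; apply: le_trans zM; rewrite lerDl.
have dM : M * (M * de) = d by rewrite mulrA /de mulrC divfK// lt0r_neq0// mulr_gt0.
have M1 : 1 <= M by apply: le_trans hM1; rewrite lerDr nrm_ge0.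
have Mz0 : nrm (0 : Fk) = 0 by exact: nrm0.
exists (fun s => lcomb (vv s) (L c)), (lcomb gv (L c)); split; first exact: tends_vec.
  rewrite hW opME -opvB; apply: (le_lt_trans (op_le _ _)).
  apply: (@le_lt_trans _ _ (M * nrm (lcomb gv c - Bi eta))); first by apply: mulM => //; exact: nrm_ge0.
  apply: (@lt_le_trans _ _ (M * de)); first by rewrite ltr_pM2l.
  by rewrite -[leRHS]dM ler_peMl// mulr_ge0// ltW.
have k1 : nrm (lcomb gv (S c) - eta) < M * de.
  have -> : eta = B (Bi eta) by rewrite -opME BB.
  rewrite hB -opvB; apply: (le_lt_trans (op_le _ _)).
  apply: (@le_lt_trans _ _ (M * nrm (lcomb gv c - Bi eta))); first by apply: mulM => //; exact: nrm_ge0.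
  by rewrite ltr_pM2l.
have t2 := tendsP (-1) (tends_vec (S c)) t; rewrite scaleN1r in t2.
have k2 : nrm (- lcomb gv (S c) + eta) < M * de by rewrite addrC nrmB.
apply: filterS (tends_lt t2 k2) => s /= k3.
rewrite -hx -opvB; apply: (le_lt_trans (op_le _ _)).
apply: (@le_lt_trans _ _ (M * nrm (xi s - lcomb (vv s) (S c)))).
  apply: ler_wpM2r; [exact: nrm_ge0|]; apply: (@le_trans _ _ (nrm x)); first exact: nrm_cdiag.
  by apply: le_trans hM1; rewrite lerDl.
by rewrite -dM ltr_pM2l//; move: k3; rewrite scaleN1r addrC.
Qed.

End asymptotics.

Lemma nrm_sandwich (R : realType) (V : complexHilbertType R) (a b c : bounded_op V) (M : R) :
  nrm a <= 1 -> nrm b <= M -> nrm c <= 1 -> nrm (a * b * c) <= M.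
Proof.
move=> ha hb hc; have n0 (x : bounded_op V) : 0 <= nrm x by exact: nrm_ge0.
apply: (le_trans (nrm_opM _ _)); rewrite -[leRHS]mulr1; apply: ler_pM => //.
apply: (le_trans (nrm_opM _ _)); rewrite -[leRHS]mul1r; exact: ler_pM.
Qed.

Section forms.
Variables (R : realType) (V : complexHilbertType R) (W : Type) (v : W -> V).
Hypothesis tv : total_family v.
Local Notation C := R[i].

Lemma op_form_total (S : bounded_op V) (M : R) : 0 <= M ->
  (forall c c', nrm (inner (S (lcomb v c)) (lcomb v c')) <= M * nrm (lcomb v c) * nrm (lcomb v c')) -> nrm S <= M.
Proof.
move=> M0 h; have [|S' [hS nS]] := @total_form_op _ _ _ _ tv (fun w w' => inner (S (v w)) (v w')) M M0.
  move=> c c'; apply: le_trans (h c c'); rewrite le_eqVlt; apply/orP; left; apply/eqP; congr nrm.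
  rewrite /lcomb opv_sum inner_suml; apply: eq_bigr => p _; rewrite opvZ innerZl inner_sumr mulr_sumr.
  by apply: eq_bigr => p' _; rewrite innerZr mulrA.
suff -> : S = S' by [].
apply: (op_ext_total tv) => w; apply: (total_extl tv) => w'; exact: esym (hS w w').
Qed.

Lemma single_total N : total_family (fun aw : 'I_N * W => single aw.1 (v aw.2)).
Proof.
move=> f e e0; have d0 : 0 < e / N.+1%:R by rewrite divr_gt0.
have [c hc] := boolp.choice (fun a => tv (f a) d0).
exists (flatten [seq [seq (p.1, (a, p.2)) | p <- c a] | a <- enum 'I_N]).
have -> : lcomb (fun aw : 'I_N * W => single aw.1 (v aw.2)) (flatten [seq [seq (p.1, (a, p.2)) | p <- c a] | a <- enum 'I_N])
   = \sum_a single a (lcomb v (c a)).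
  rewrite /lcomb big_flatten big_map big_enum; apply: eq_bigr => a _; rewrite big_map /=.
  elim: (c a) => [|p s IH]; first by rewrite !big_nil single0.
  by rewrite !big_cons singleD singleZ IH.
rewrite [f in f - _]l2_single_sum -sumrB; apply: (le_lt_trans (nrm_sum _ _ _)).
apply: (@le_lt_trans _ _ (\sum_(a < N) e / N.+1%:R)).
  apply: ler_sum => a _; have -> : single a (f a) - single a (lcomb v (c a)) = single a (f a - lcomb v (c a)).
    by rewrite singleD -[- lcomb v _]scaleN1r singleZ scaleN1r.
  by rewrite nrm_single; exact/ltW.
rewrite sumr_const card_ord -[ltLHS]mulr_natr mulrAC -mulrA gtr_pMr//.
by rewrite ltr_pdivrMr// mul1r ltr_nat.
Qed.

Lemma lcomb_single N (c : seq (C * ('I_N * W))) :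
  lcomb (fun aw : 'I_N * W => single aw.1 (v aw.2)) c =
  fin_vec (fun a => lcomb v [seq (p.1, p.2.2) | p <- [seq p <- c | p.2.1 == a]]).
Proof.
apply: l2E => a; rewrite fin_vecE lcomb_map big_filter big_mkcond /=.
elim: c => [|p c IH]; first by rewrite lcomb_nil big_nil.
rewrite /lcomb !big_cons -/(lcomb _ c) l2DE l2ZE IH singleE eq_sym; case: eqP => // _.
by rewrite scaler0.
Qed.

End forms.

Section compression.
Variables (R : realType) (T : Type) (U : set_system T).
Context {UU : UltraFilter U}.
Variables (K Fk : complexHilbertType R) (J : T -> finType).
Variables (W : Type) (gv : W -> Fk) (vv : forall t, W -> l2 (J t) K).
Hypothesis tgv : total_family gv.
Hypothesis hvv : forall w w', ucvg U (fun t => inner (vv t w) (vv t w')) (inner (gv w) (gv w')).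
Local Notation C := R[i].
Implicit Types (c : seq (C * W)) (x y : bounded_op K).

Let PU : ProperFilter U. Proof. exact: ultra_proper. Qed.

Definition cform x w w' : C := ulim U (fun t => inner (cdiag (J t) x (vv t w)) (vv t w')).

Lemma cform_ucvg x w w' : ucvg U (fun t => inner (cdiag (J t) x (vv t w)) (vv t w')) (cform x w w').
Proof.
have b w0 : U [set t | nrm (vv t w0) < nrm (gv w0) + 1].
  have := @vec_lt R T U UU K Fk J W gv vv hvv [:: (1, w0)] (nrm (gv w0) + 1).
  by rewrite lcomb1 ltrDl => /(_ ltr01); apply: filterS => t /=; rewrite lcomb1.
apply: (ulimP (M := nrm x * (nrm (gv w) + 1) * (nrm (gv w') + 1))).
apply: filterS (filterI (b w) (b w')) => t /= [h h'].
apply: (le_trans (inner_le _ _)); apply: ler_pM; rewrite ?nrm_ge0//; last exact: ltW.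
apply: (le_trans (op_le _ _)); apply: ler_pM; rewrite ?nrm_ge0//; last exact: ltW.
exact: nrm_cdiag.
Qed.

Lemma inner_cdiag_lcomb x c c' t : inner (cdiag (J t) x (lcomb (vv t) c)) (lcomb (vv t) c') =
  \sum_(p <- c) \sum_(p' <- c') p.1 * (p'.1)^*%R * inner (cdiag (J t) x (vv t p.2)) (vv t p'.2).
Proof.
rewrite /lcomb opv_sum inner_suml; apply: eq_bigr => p _; rewrite opvZ innerZl inner_sumr mulr_sumr.
by apply: eq_bigr => p' _; rewrite innerZr mulrA.
Qed.

Definition cform2 x c c' : C := \sum_(p <- c) \sum_(p' <- c') p.1 * (p'.1)^*%R * cform x p.2 p'.2.

Lemma cform2_ucvg x c c' : ucvg U (fun t => inner (cdiag (J t) x (lcomb (vv t) c)) (lcomb (vv t) c')) (cform2 x c c').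
Proof.
have -> : (fun t => inner (cdiag (J t) x (lcomb (vv t) c)) (lcomb (vv t) c')) = (fun t =>
  \sum_(p <- c) \sum_(p' <- c') p.1 * (p'.1)^*%R * inner (cdiag (J t) x (vv t p.2)) (vv t p'.2)).
  by apply/funext => t; exact: inner_cdiag_lcomb.
apply: ucvg_sum => p; apply: ucvg_sum => p'.
by apply: ucvgM; [exact: ucvg_cst|exact: cform_ucvg].
Qed.

Lemma cform2_cc N (X : 'M[bounded_op K]_N) (c c' : 'I_N -> seq (C * W)) :
  nrm (\sum_a \sum_b cform2 (X a b) (c b) (c' a)) <=
  nrm (amp X) * nrm (fin_vec (fun b => lcomb gv (c b))) * nrm (fin_vec (fun a => lcomb gv (c' a))).
Proof.
pose f t := \sum_a \sum_b inner (cdiag (J t) (X a b) (lcomb (vv t) (c b))) (lcomb (vv t) (c' a)).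
have hf : ucvg U f (\sum_a \sum_b cform2 (X a b) (c b) (c' a)).
  by apply: ucvg_sum => a; apply: ucvg_sum => b; exact: cform2_ucvg.
set l := \sum_a _ in hf *.
have hf2 : ucvg U (fun t => (nrm (f t) ^+ 2)%:C) (nrm l ^+ 2)%:C.
  rewrite -nrm_sqrE; have -> : (fun t => (nrm (f t) ^+ 2)%:C) = (fun t => f t * ((f t)^*)%R).
    by apply/funext => t; rewrite nrm_sqrE.
  by apply: ucvgM => //; exact: ucvg_conj.
pose S (cc : 'I_N -> seq (C * W)) t := \sum_b nrm (lcomb (vv t) (cc b)) ^+ 2.
have hS cc : ucvg U (fun t => (S cc t)%:C) (nrm (fin_vec (fun b => lcomb gv (cc b))) ^+ 2)%:C.
  rewrite nrm_l2 RC_sum (eq_bigr (fun b => (nrm (lcomb gv (cc b)) ^+ 2)%:C)); last by move=> b _; rewrite fin_vecE.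
  have -> : (fun t => (S cc t)%:C) = (fun t => \sum_b (nrm (lcomb (vv t) (cc b)) ^+ 2)%:C).
    by apply/funext => t; rewrite RC_sum.
  apply: ucvg_sum => b; exact: (vec_nrm2 hvv).
have S0 cc t : 0 <= S cc t by apply: sumr_ge0 => b _; exact: sqr_ge0.
rewrite -(@ler_pXn2r _ 2)// ?nnegrE ?mulr_ge0 ?nrm_ge0// !exprMn -subr_le0.
set M := nrm (amp X).
apply: (@ucvg_real_le _ _ U _ (fun t => nrm (f t) ^+ 2 - M ^+ 2 * S c t * S c' t)).
  have -> : (fun t => (nrm (f t) ^+ 2 - M ^+ 2 * S c t * S c' t)%:C) =
    (fun t => (nrm (f t) ^+ 2)%:C - (M ^+ 2)%:C * (S c t)%:C * (S c' t)%:C).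
    by apply/funext => t; rewrite RCB (RCM (M ^+ 2 * S c t)) (RCM (M ^+ 2)).
  rewrite RCB (RCM (M ^+ 2 * _)) (RCM (M ^+ 2)).
  apply: ucvgB => //; apply: ucvgM; last exact: hS.
  by apply: ucvgM; [exact: ucvg_cst|exact: hS].
apply: filterS filterT => t _ /=; rewrite subr_le0.
have := cdiag_cc X (fun b => lcomb (vv t) (c b)) (fun a => lcomb (vv t) (c' a)).
rewrite -/(f t) -/(S c t) -/(S c' t) -/M => h.
have sqs (m u v : R) : 0 <= u -> 0 <= v -> m ^+ 2 * u * v = (m * Num.sqrt u * Num.sqrt v) ^+ 2.
  by move=> u0 v0; rewrite !exprMn !sqr_sqrtr.
have -> : M ^+ 2 * S c t * S c' t = (M * Num.sqrt (S c t) * Num.sqrt (S c' t)) ^+ 2.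
  exact: sqs.
by rewrite ler_pXn2r ?nnegrE ?mulr_ge0 ?sqrtr_ge0 ?nrm_ge0.
Qed.

Lemma ex_compression x : exists S : bounded_op Fk, (forall w w', inner (S (gv w)) (gv w') = cform x w w') /\ nrm S <= nrm x.
Proof.
apply: (total_form_op tgv); first exact: nrm_ge0.
move=> c c'; have := @cform2_cc 1 (const_mx x) (fun=> c) (fun=> c').
have nf (z : Fk) : nrm (fin_vec (fun=> z) : l2 'I_1 Fk) = nrm z.
  apply/eqP; rewrite -(@eqrXn2 _ 2) ?nrm_ge0// nrm_l2; apply/eqP.
  by rewrite big_ord1 fin_vecE.
rewrite !big_ord1 mxE !nf => h; apply: (le_trans h).
apply: ler_wpM2r; first exact: nrm_ge0.
apply: ler_wpM2r; first exact: nrm_ge0.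
apply: (le_trans (@amp_le _ _ _ _ (nrm x) _)); last by rewrite mul1r.
by move=> a b; rewrite mxE.
Qed.

(** The amplifications of x act on the ultraproduct, and this is their compression to the copy of
    Fk. In contrast with [rel], it exists for every x. *)
Definition compression x : bounded_op Fk := projT1 (cid (ex_compression x)).

Lemma compressionE x w w' : inner (compression x (gv w)) (gv w') = cform x w w'.
Proof. by rewrite /compression; case: cid => /= S [-> _]. Qed.

Lemma compression_le x : nrm (compression x) <= nrm x.
Proof. by rewrite /compression; case: cid => /= S []. Qed.

Lemma compression2E x c c' : inner (compression x (lcomb gv c)) (lcomb gv c') = cform2 x c c'.
Proof.
rewrite /lcomb opv_sum inner_suml; apply: eq_bigr => p _; rewrite opvZ innerZl inner_sumr mulr_sumr.
by apply: eq_bigr => p' _; rewrite innerZr mulrA compressionE.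
Qed.

Lemma compressionP (a : C) x y : compression (a *: x + y) = a *: compression x + compression y.
Proof.
apply: (op_ext_total tgv) => w; apply: (total_extl tgv) => w'.
rewrite opDE opZE innerDl innerZl !compressionE.
apply: (ucvg_uniq (U := U) (cform_ucvg _ _ _)).
have -> : (fun t => inner (cdiag (J t) (a *: x + y) (vv t w)) (vv t w')) =
  (fun t => a * inner (cdiag (J t) x (vv t w)) (vv t w') + inner (cdiag (J t) y (vv t w)) (vv t w')).
  by apply/funext => t; rewrite cdiagP opDE opZE innerDl innerZl.
apply: ucvgD; last exact: cform_ucvg.
by apply: ucvgM; [exact: ucvg_cst|exact: cform_ucvg].
Qed.

Lemma compression_cc N (X : 'M[bounded_op K]_N) (u : bounded_op Fk) : nrm u <= 1 ->
  nrm (amp (map_mx (fun x => u * compression x * u) X)) <= nrm (amp X).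
Proof.
move=> u1; have h : nrm (amp (map_mx compression X)) <= nrm (amp X).
  apply: (op_form_total (single_total tgv (N := N))) => [|c c']; first exact: nrm_ge0.
  rewrite !lcomb_single amp_inner; apply: le_trans (cform2_cc _ _ _).
  rewrite le_eqVlt; apply/orP; left; apply/eqP; congr nrm; apply: eq_bigr => a _; apply: eq_bigr => b _.
  by rewrite mxE !fin_vecE compression2E.
have -> : amp (map_mx (fun x => u * compression x * u) X) = cdiag _ u * amp (map_mx compression X) * cdiag _ u.
  apply: bopE => f; apply: l2E => a; rewrite !opME cdiagE !ampE opv_sum; apply: eq_bigr => b _.
  by rewrite !mxE !opME cdiagE.
have c1 : nrm (cdiag 'I_N u) <= 1 by apply: le_trans u1; exact: nrm_cdiag.
exact: nrm_sandwich.
Qed.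

End compression.

Lemma l2_linE (R : realType) (I : choiceType) (V : complexHilbertType R) (a : R[i]) (f g h : l2 I V) :
  (forall i, h i = a *: f i + g i) -> h = a *: f + g.
Proof. by move=> e; apply: l2E => i; rewrite e. Qed.

Section families.
Variables (R : realType) (H : realHilbertType R) (q : R) (F : qFock H q).
Hypothesis hq : -1 < q < 1.
Local Notation C := R[i].
Local Notation index := (seq H * nat)%type.
Local Notation V := (l2 spin_index (cplx R)).
Local Notation K := (l2 index V).
Local Notation ip := (fun x y : H => inner x y).
Implicit Types (i : index) (w : seq H) (g : nat -> nat -> R).

Definition gw w : F := wprod (gaussian F) w (vacuum F).
Definition vw g i w := fam F i (fun k => gword F i (g k) w).

Lemma famP i (a : C) Y Y' : fam F i (fun k => a *: Y k + Y' k) = a *: fam F i Y + fam F i Y'.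
Proof.
apply: l2_linE => ks.
have e := f_equal2 (fun u v : K => a *: u + v) (famE Y ks) (famE Y' ks).
apply: (etrans (famE _ ks)); apply: (etrans _ (esym e)).
by rewrite cdiagP opDE opZE scalerDr !scalerA mulrC.
Qed.

Lemma eq_fam i (Y Y' : nat -> bounded_op V) : (forall k : 'I_i.2.+1, Y k = Y' k) -> fam F i Y = fam F i Y'.
Proof. move=> h; apply: l2E => ks; apply: (etrans (famE Y ks)); apply: (etrans _ (esym (famE Y' ks))).
by rewrite h. Qed.

Lemma fam_lcomb i (W : Type) (Y : W -> nat -> bounded_op V) (c : seq (C * W)) :
  lcomb (fun u => fam F i (Y u)) c = fam F i (fun k => lcomb (Y^~ k) c).
Proof.
elim: c => [|p c IH].
  have e : fam F i (fun=> -1 *: 0 + 0) = 0 by rewrite (famP i (-1) (fun=> 0) (fun=> 0)) scaleN1r addNr.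
  rewrite lcomb_nil; apply: (etrans (esym e)).
  by apply: eq_fam => k; rewrite lcomb_nil scaleN1r addNr.
have cons (V' : lmodType C) (f : W -> V') : lcomb f (p :: c) = p.1 *: f p.2 + lcomb f c by rewrite /lcomb big_cons.
rewrite cons IH -famP; apply: eq_fam => k; by rewrite cons.
Qed.

Lemma fam_diag (x : bounded_op K) (S : index -> bounded_op V) i Y : (forall f j, x f j = S j (f j)) ->
  cdiag _ x (fam F i Y) = fam F i (fun k => S i * Y k).
Proof.
move=> hx; have xs (u : V) : x (single i u) = single i (S i u).
  by apply: l2E => j; rewrite hx !singleE; case: eqP => [->//|_]; exact: opv0.
apply: l2E => ks; apply: (etrans (cdiagE x (fam F i Y) ks)).
apply: (etrans (f_equal x (famE Y ks))); apply: (etrans _ (esym (famE _ ks))).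
have e b : x (cdiag index (Y ks.1) (single i b)) = cdiag index (S i * Y ks.1) (single i b).
  apply: (etrans (f_equal x (cdiag_single _ _ _))); apply: (etrans (xs _)).
  apply: (etrans _ (esym (cdiag_single (S i * Y ks.1) i b))).
  by rewrite opME.
by rewrite opvZ; exact: (f_equal (fun z : K => _ *: z) (e _)).
Qed.

(** The restriction k <= n reflects the fresh direction k + 1 of the k-th rotation, which must be
    among the n + 2 directions available. *)
Definition unit_coeffs g := forall n k, (k <= n)%N -> gam n (g k) (g k) = 1.

Lemma mom_tagged1 w w' : mom q (@tag_ip R H 1) [::] (tagged w w') = mom q ip [::] (rev w ++ w').
Proof.
have -> : rev w ++ w' = map snd (tagged w w').
  by rewrite /tagged map_cat map_rev -!map_comp !map_id.
rewrite mom_map0; congr mom; apply/funext => p; apply/funext => p'.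
by rewrite /tag_ip; case: ifP => _; rewrite mulr1.
Qed.

Lemma approx_ucvg (V' : normedZmodType C) (f : index -> V') l (s0 : seq H) (k0 : R) : 0 <= k0 ->
  (forall i, {subset s0 <= i.1} -> nrm (f i - l) <= k0 / i.2.+1%:R) -> ucvg (@approx_ultra H) f l.
Proof.
move=> k00 h e e0; have e2 : 0 < e / 2 by rewrite divr_gt0.
have [n0 hn] := invS_small k00 e2.
apply: (@approx_tail _ _ s0 n0) => s n hs /hn hn' /=.
apply: (le_lt_trans (h (s, n) hs)); apply: (le_lt_trans hn').
by rewrite ltr_pdivrMr// ltr_pMr// ltr1n.
Qed.

Lemma vw_moment g w w' : unit_coeffs g ->
  ucvg (@approx_ultra H) (fun i => inner (vw g i w) (vw g i w')) (inner (gw w) (gw w')).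
Proof.
move=> hg; have [k0 k00 hk] := word_moment F hq w w'.
apply: (@approx_ucvg _ _ _ (w ++ w') k0) => // i hs.
rewrite mom_fock0// -mom_tagged1; apply: hk.
- by move=> f fw; apply: hs; rewrite mem_cat fw.
- by move=> f fw; apply: hs; rewrite mem_cat fw orbT.
by move=> k; rewrite !hg// -ltnS.
Qed.

Definition cwick w : seq (C * seq H) := [seq (p.1%:C, p.2) | p <- wick q ip w].

Lemma lcomb_cwick w : lcomb gw (cwick w) = rtens F w.
Proof. by rewrite /lcomb big_map -(wick_fock F hq). Qed.

Lemma mom_cwick (rho : R) w :
  \sum_(p <- wick q ip w) \sum_(p' <- wick q ip w) p.1 * p'.1 * mom q (@tag_ip R H rho) [::] (tagged p.2 p'.2)
  = rho ^+ size w * qform q ip w w.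
Proof.
have ts (x y : bool * H) : tag_ip rho x y = tag_ip rho y x by rewrite /tag_ip eq_sym inner_symR.
have tw (b : bool) : wick q (tag_ip rho) (map (pair b) w) = [seq (p.1, map (pair b) p.2) | p <- wick q ip w].
  rewrite wick_map; congr map; congr wick; apply/funext => x; apply/funext => y.
  by rewrite /tag_ip eqxx mulr1.
have := mom_wick2 q ts (map (pair false) w) (map (pair true) w).
rewrite /rcomb !tw big_map => h; rewrite -[RHS](_ : qform q (tag_ip rho) (map (pair false) w) (map (pair true) w) = _).
  rewrite -h; apply: eq_bigr => p _; rewrite big_map scaler_sumr; apply: eq_bigr => p' _ /=.
  by rewrite -mulrA.
rewrite qform_map -qform_scale; congr qform; apply/funext => x; apply/funext => y.
by rewrite /tag_ip /= mulrC.
Qed.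

Lemma wick_moment w : exists2 k0, 0 <= k0 & forall i (rho : R) g g', {subset w <= i.1} ->
  (forall k : 'I_i.2.+1, [/\ gam i.2 (g k) (g k) = 1, gam i.2 (g' k) (g' k) = 1 & gam i.2 (g k) (g' k) = rho]) ->
  nrm (inner (lcomb (vw g i) (cwick w)) (lcomb (vw g' i) (cwick w)) - (rho ^+ size w * qform q ip w w)%:C)
    <= k0 / i.2.+1%:R.
Proof.
have [k hk] : exists k : seq H -> seq H -> R, forall u u', 0 <= k u u' /\ forall i (rho : R) g g',
  {subset u <= i.1} -> {subset u' <= i.1} ->
  (forall k : 'I_i.2.+1, [/\ gam i.2 (g k) (g k) = 1, gam i.2 (g' k) (g' k) = 1 & gam i.2 (g k) (g' k) = rho]) ->
  nrm (inner (vw g i u) (vw g' i u') - (mom q (tag_ip rho) [::] (tagged u u'))%:C) <= k u u' / i.2.+1%:R.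
  have h u u' : exists k, 0 <= k /\ forall i (rho : R) g g',
    {subset u <= i.1} -> {subset u' <= i.1} ->
    (forall k : 'I_i.2.+1, [/\ gam i.2 (g k) (g k) = 1, gam i.2 (g' k) (g' k) = 1 & gam i.2 (g k) (g' k) = rho]) ->
    nrm (inner (vw g i u) (vw g' i u') - (mom q (tag_ip rho) [::] (tagged u u'))%:C) <= k / i.2.+1%:R.
    by have [k0 k00 hk] := word_moment F hq u u'; exists k0; split.
  have h2 u : exists ku : seq H -> R, forall u', 0 <= ku u' /\ forall i (rho : R) g g',
    {subset u <= i.1} -> {subset u' <= i.1} ->
    (forall k : 'I_i.2.+1, [/\ gam i.2 (g k) (g k) = 1, gam i.2 (g' k) (g' k) = 1 & gam i.2 (g k) (g' k) = rho]) ->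
    nrm (inner (vw g i u) (vw g' i u') - (mom q (tag_ip rho) [::] (tagged u u'))%:C) <= ku u' / i.2.+1%:R.
    by have [k hk] := boolp.choice (h u); exists k.
  by have [k hk] := boolp.choice h2; exists k.
have wsub u p : p \in wick q ip u -> {subset p.2 <= u}.
  rewrite /wick; move: (size u) => n; elim: n u p => [|n IH] u p /=; first by rewrite inE => /eqP ->.
  case: u => [|f u]; first by rewrite inE => /eqP ->.
  rewrite mem_cat => /orP[/mapP[p' /IH h ->]|/flatten_mapP[r rq /mapP[p' /IH h ->]]] y /=.
    by rewrite !inE => /orP[->//|/h ->]; rewrite orbT.
  move=> /h yr; rewrite inE; apply/orP; right; move: rq yr; clear.
  elim: u r => [//|v u IH] r /=; rewrite inE => /orP[/eqP ->/= yu|/mapP[r' /IH h ->]] /=.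
    by rewrite inE yu orbT.
  by rewrite !inE => /orP[->//|/h ->]; rewrite orbT.
exists (\sum_(p <- wick q ip w) \sum_(p' <- wick q ip w) `|p.1| * `|p'.1| * k p.2 p'.2).
  by apply: sumr_ge0 => p _; apply: sumr_ge0 => p' _; rewrite !mulr_ge0//; exact: (hk _ _).1.
move=> i rho g g' hw hg; rewrite -mom_cwick inner_lcomb RC_sum /cwick big_map -sumrB.
rewrite mulr_suml; apply: (le_trans (nrm_sum _ _ _)).
rewrite big_seq_cond [leRHS]big_seq_cond; apply: ler_sum => p; rewrite andbT => hp.
rewrite big_map RC_sum -sumrB mulr_suml; apply: (le_trans (nrm_sum _ _ _)).
rewrite big_seq_cond [leRHS]big_seq_cond; apply: ler_sum => p'; rewrite andbT => hp'.
change (nrm (p.1%:C * ((p'.1)%:C)^*%R * inner (vw g i p.2) (vw g' i p'.2) -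
  (p.1 * p'.1 * mom q (tag_ip rho) [::] (tagged p.2 p'.2))%:C) <= `|p.1| * `|p'.1| * k p.2 p'.2 / i.2.+1%:R).
rewrite conj_RC (RCM (p.1 * p'.1)) (RCM p.1) -mulrBr nrmM nrmM !nrmC -[leRHS]mulrA; apply: ler_wpM2l; first exact: mulr_ge0.
by apply: (hk _ _).2 => //; [move=> f /(wsub _ _ hp)/hw|move=> f /(wsub _ _ hp')/hw].
Qed.

End families.

(** * Rotations of the test vectors *)

Section right_shift.
Variables (R : realType) (H : realHilbertType R) (q : R) (F : qFock H q).
Hypothesis hq : -1 < q < 1.
Local Notation C := R[i].
Local Notation index := (seq H * nat)%type.
Local Notation V := (l2 spin_index (cplx R)).
Local Notation K := (l2 index V).
Local Notation rt := (rtens F).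
Local Notation gw := (gw F).
Local Notation vw := (vw F).
Implicit Types (S T : bounded_op F) (w t : seq H) (c : seq (C * seq H)) (g : nat -> nat -> R).

Lemma gw_cons f w : gw (f :: w) = gaussian F f (gw w).
Proof. by []. Qed.

Lemma gw_total : total_family gw.
Proof. exact: gword_total hq. Qed.

(* Right multiplication by a Gaussian acts on Fock space by moving the last
   letter of a word; commuting with it characterises the operators that are
   determined by their vacuum vector. *)
Definition rshift T := forall w w' f, inner (T (gw (rcons w f))) (gw w') = inner (T (gw w)) (gw (rcons w' f)).

Lemma rshift_ext S T : rshift S -> rshift T -> S (vacuum F) = T (vacuum F) -> S = T.
Proof.
move=> hS hT e; apply: (op_ext_total gw_total); elim/last_ind => [//|w f IH].
by apply: (total_extl gw_total) => w'; rewrite hS hT IH.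
Qed.

Lemma rshiftP (a : C) S T : rshift S -> rshift T -> rshift (a *: S + T).
Proof. by move=> hS hT w w' f; rewrite !opDE !opZE !innerDl !innerZl hS hT. Qed.

Lemma rshift0 : rshift 0.
Proof. by move=> w w' f; rewrite !op0E !inner0l. Qed.

Lemma rshift_gaussian f T : rshift T -> rshift (gaussian F f * T).
Proof.
move=> hT w w' h; rewrite !opME !(adjl (gaussian F f)) gaussian_sa -!gw_cons.
exact: hT w (f :: w') h.
Qed.

Lemma rshift_closed : opclosed rshift.
Proof.
move=> T h w w' f; apply/eqP; rewrite -subr_eq0; apply/eqP; apply: nrm_small => e e0.
pose M := nrm (gw (rcons w f)) * nrm (gw w') + nrm (gw w) * nrm (gw (rcons w' f)) + 1.
have M0 : 0 < M by rewrite ltr_wpDl// addr_ge0// mulr_ge0 ?nrm_ge0.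
have [S hS hn] := h (e / M) (divr_gt0 e0 M0).
have -> : inner (T (gw (rcons w f))) (gw w') - inner (T (gw w)) (gw (rcons w' f)) =
    inner ((T - S) (gw (rcons w f))) (gw w') - inner ((T - S) (gw w)) (gw (rcons w' f)).
  by rewrite !opBE !innerBl hS; ring.
have est x y : nrm (inner ((T - S) x) y) <= e / M * (nrm x * nrm y).
  apply: (le_trans (inner_le _ _)); rewrite mulrA; apply: ler_wpM2r; first exact: nrm_ge0.
  by apply: (le_trans (op_le _ _)); apply: ler_wpM2r; [exact: nrm_ge0|exact: ltW].
apply: (le_trans (nrmBD _ _)); apply: (le_trans (lerD (est _ _) (est _ _))).
rewrite -mulrDr -[leRHS](divfK (lt0r_neq0 M0)); apply: ler_wpM2l; first by rewrite divr_ge0 ?ltW.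
by rewrite /M lerDl.
Qed.

Section compressed.
Variable g : nat -> nat -> R.
Hypothesis hg : unit_coeffs g.

Definition phi (x : bounded_op K) : bounded_op F := compression gw_total (fun w w' => vw_moment F hq w w' hg) x.

Lemma vw_rcons i w f :
  vw g i (rcons w f) = fam F i (fun k => gword F i (g k) w * letter_op F i (f, g k)).
Proof.
congr (fam F i _); apply/funext => k.
by rewrite /gword /letters map_rcons -cats1 wprod_cat /= mulr1.
Qed.

Lemma phiE x w w' : inner (phi x (gw w)) (gw w') =
  ulim (@approx_ultra H) (fun i => inner (cdiag _ x (vw g i w)) (vw g i w')).
Proof. exact: compressionE. Qed.

Lemma rshift_phi x : rshift (phi x).
Proof.
move=> w w' f; apply: (etrans (phiE x _ _)); apply: (etrans _ (esym (phiE x _ _))).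
apply: (f_equal (ulim (@approx_ultra H))); apply/funext => i.
rewrite !vw_rcons; exact: (fam_trace F hq i x _ _ (fun k => (f, g k))).
Qed.

Lemma phi1 : phi 1 = 1.
Proof.
apply: (op_ext_total gw_total) => w; apply: (total_extl gw_total) => w'.
apply: (etrans (phiE 1 _ _)); apply: ulim_eq.
have -> : (fun i => inner (cdiag _ (1 : bounded_op K) (vw g i w)) (vw g i w')) = (fun i => inner (vw g i w) (vw g i w')).
  by apply/funext => i; rewrite cdiag1.
exact: vw_moment.
Qed.


End compressed.

(** This is the traciality of the vacuum state, inherited from the models because the compression of
    1 is 1. *)
Lemma rshift1 : rshift 1.
Proof.
have hg : unit_coeffs (fun (_ k : nat) => (k == 0)%:R : R).
  move=> n k _; rewrite /gam big_ord_recl /= mulr1 big1 ?addr0// => j _.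
  by rewrite mul0r.
by rewrite -(phi1 hg); exact: rshift_phi.
Qed.

Lemma rshift_wickop w : rshift (wickop F w).
Proof.
have [n] := ubnP (size w); elim: n w => // n IH [|f w] /= hw.
  rewrite (_ : wickop F [::] = 1); first exact: rshift1.
  by rewrite /wickop /shs /= big_seq1 /= scale1r mulr1.
have -> : wickop F (f :: w) = gaussian F f * wickop F w - qann q%:C (fun z : H => (inner z f)%:C) w (wickop F).
  by rewrite gaussian_wickop// addrK.
rewrite addrC -scaleN1r; apply: rshiftP; last by apply: rshift_gaussian; exact: IH.
apply: qann_ind => [|b z z'|t ht]; [exact: rshift0|exact: rshiftP|apply: IH].
by rewrite ht; apply: leq_ltn_trans (leq_pred _) _; rewrite -ltnS.
Qed.

Lemma rshift_lcomb c : rshift (lcomb (wickop F) c).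
Proof.
elim: c => [|p c IH]; first by rewrite lcomb_nil; exact: rshift0.
by rewrite /lcomb big_cons; apply: rshiftP; [exact: rshift_wickop|exact: IH].
Qed.

End right_shift.

(** A law of large numbers. As the A l have mutual correlation s^2 and correlation s with B, the
    vectors A l - s B are nearly orthogonal, with squares at most Q, and their mean has square of
    order Q/(n+1). Each of their inner products involves four of the given ones, whence 4 e. *)
Lemma nrm_average (R : realType) (W : complexHilbertType R) n (A : 'I_n.+1 -> W) (B : W) (Q s e : R) :
  `|s| <= 1 -> 0 <= Q ->
  (forall l l', nrm (inner (A l) (A l') - ((if l == l' then 1 else s ^+ 2) * Q)%:C) <= e) ->
  (forall l, nrm (inner (A l) B - (s * Q)%:C) <= e) -> nrm (inner B B - Q%:C) <= e ->
  nrm (\sum_l (n.+1%:R^-1)%:C *: A l - s%:C *: B) ^+ 2 <= Q / n.+1%:R + 4 * e.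
Proof.
move=> s1 Q0 hA hB hBB; have e0 : 0 <= e by apply: le_trans hBB; exact: nrm_ge0.
have n0 : n.+1%:R != 0 :> R by [].
pose D l := A l - s%:C *: B; pose r := n.+1%:R^-1 : R.
have r0 : 0 <= r by rewrite invr_ge0.
have -> : \sum_l r%:C *: A l - s%:C *: B = \sum_l r%:C *: D l.
  rewrite /D; under [RHS]eq_bigr do rewrite scalerBr; rewrite sumrB sumr_const card_ord.
  rewrite -scaler_nat scalerA; congr (_ - _); rewrite (_ : _ * _ = 1) ?scale1r//.
  by rewrite -(rmorph_nat (real_complex R)) -RCM /r mulfV.
have hD l l' : nrm (inner (D l) (D l') - ((l == l')%:R * ((1 - s ^+ 2) * Q))%:C) <= 4 * e.
  have -> : inner (D l) (D l') - ((l == l')%:R * ((1 - s ^+ 2) * Q))%:C =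
     (inner (A l) (A l') - ((if l == l' then 1 else s ^+ 2) * Q)%:C)
     - s%:C * (inner (A l) B - (s * Q)%:C) - s%:C * (inner B (A l') - (s * Q)%:C)
     + (s ^+ 2)%:C * (inner B B - Q%:C).
    rewrite /D innerBl !innerBr !innerZl !innerZr conj_RC.
    have -> : ((if l == l' then 1 else s ^+ 2) * Q = (l == l')%:R * ((1 - s ^+ 2) * Q) + s ^+ 2 * Q).
      by case: (l == l'); rewrite ?mul1r ?mul0r; ring.
    rewrite (RCD (_ * (_ * Q))) (RCM (s ^+ 2)) (RCM s) RCX; ring.
  have hB' : nrm (inner B (A l') - (s * Q)%:C) <= e.
    by rewrite inner_sym -(conj_RC (s * Q)) -conjB nrm_conj.
  have sm (x : R[i]) : nrm x <= e -> nrm (s%:C * x) <= e.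
    move=> h; rewrite nrmM nrmC; apply: le_trans h; rewrite ler_piMl ?nrm_ge0//.
  have sm2 (x : R[i]) : nrm x <= e -> nrm ((s ^+ 2)%:C * x) <= e.
    by move=> h; rewrite expr2 RCM -mulrA; apply/sm/sm.
  have -> : 4 * e = e + e + e + e by ring.
  apply: (le_trans (nrmD _ _)); apply: lerD; last exact: sm2.
  apply: (le_trans (nrmBD _ _)); apply: lerD; last exact: sm.
  by apply: (le_trans (nrmBD _ _)); apply: lerD; [exact: hA|exact: sm].
rewrite -Cre_inner_nrm inner_suml Cre_sum.
have -> : Q / n.+1%:R + 4 * e = \sum_(l < n.+1) (r * r) * (Q + n.+1%:R * (4 * e)).
  rewrite sumr_const card_ord -mulr_natl /r; field.
  by apply/eqP => h; move/eqP: n0; apply; rewrite -natr1 addrC.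
apply: ler_sum => l _; rewrite inner_sumr Cre_sum.
have -> : r * r * (Q + n.+1%:R * (4 * e)) = \sum_(l' < n.+1) (r * r * ((l == l')%:R * Q + 4 * e)).
  rewrite -mulr_sumr big_split /= sumr_const card_ord -[(4 * e) *+ _]mulr_natl; congr (_ * (_ + _)).
  by rewrite (bigD1 l)//= eqxx mul1r big1 ?addr0// => j jl; rewrite eq_sym (negbTE jl) mul0r.
apply: ler_sum => l' _; rewrite innerZl innerZr conj_RC !CreZ mulrA.
apply: ler_wpM2l; first exact: mulr_ge0.
set d := (l == l')%:R * Q; have d0 : 0 <= (l == l')%:R * (s ^+ 2 * Q) by apply: mulr_ge0; [exact: ler0n|apply: mulr_ge0 => //; exact: sqr_ge0].
have h := le_trans (ler_norm _) (le_trans (Cre_le_nrm _) (hD l l')).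
rewrite CreB in h; apply: (@le_trans _ _ ((l == l')%:R * ((1 - s ^+ 2) * Q) + 4 * e)).
  by rewrite -lerBlDl.
by rewrite lerD2r /d mulrBl mul1r mulrBr lerBlDr lerDl.
Qed.

Lemma mean_const (R : realType) n (z : R[i]) : z = (n.+1%:R^-1)%:C * \sum_(k < n.+1) z.
Proof. by rewrite sumr_const card_ord -[z *+ _]mulr_natl mulrA -(rmorph_nat (real_complex R)) -RCM mulVf ?mul1r. Qed.

Lemma nrm_le_sqr (R : realType) (W : complexHilbertType R) (u : W) (M : R) :
  0 <= M -> nrm (inner u u) <= M -> nrm u <= M + 1.
Proof.
move=> M0 h; have M1 : 0 <= M + 1 by rewrite addr_ge0.
have sq : M <= (M + 1) ^+ 2 by rewrite sqrrD expr1n mulr1 mulr2n; nra.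
rewrite -(@ler_pXn2r _ 2) ?nnegrE ?nrm_ge0//; apply: le_trans sq.
by rewrite -Cre_inner_nrm; apply: (le_trans (ler_norm _)); apply: (le_trans (Cre_le_nrm _)).
Qed.

Section rotation.
Variables (R : realType) (H : realHilbertType R) (q : R) (F : qFock H q).
Hypothesis hq : -1 < q < 1.
Local Notation C := R[i].
Local Notation index := (seq H * nat)%type.
Local Notation V := (l2 spin_index (cplx R)).
Local Notation K := (l2 index V).
Local Notation rt := (rtens F).
Local Notation gw := (gw F).
Local Notation vw := (vw F).
Implicit Types (S T : bounded_op F) (w t : seq H) (c : seq (C * seq H)) (g : nat -> nat -> R) (i : index) (x : bounded_op K).

(* Each letter of the k-th summand is rotated by the angle arccos r towards a
   k-th fresh direction, so that different summands have correlation r ^+ 2. *)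
Definition rot (r : R) (k j : nat) : R := if j == 0%N then r else (j == k.+1)%:R * Num.sqrt (1 - r ^+ 2).
Definition unrot (k j : nat) : R := (j == 0%N)%:R.

Lemma gam_unrot n : gam n (unrot 0) (unrot 0) = 1 :> R.
Proof. by rewrite /gam big_ord_recl /= mulr1 big1 ?addr0// => j _; rewrite mul0r. Qed.

Lemma gam_rot0 (r : R) n k : gam n (rot r k) (unrot 0) = r.
Proof. by rewrite /gam big_ord_recl /= mulr1 big1 ?addr0// => j _; rewrite mulr0. Qed.

Lemma gam_rot (r : R) n k l : 0 <= r <= 1 -> (k <= n)%N -> (l <= n)%N ->
  gam n (rot r k) (rot r l) = if k == l then 1 else r ^+ 2.
Proof.
move=> /andP[r0 r1] kn ln; have s0 : 0 <= 1 - r ^+ 2 by rewrite subr_ge0 exprn_ile1.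
rewrite /gam big_ord_recl /= /rot /=.
rewrite (bigD1 (Ordinal (kn : (k < n.+1)%N)))//= eqxx mul1r big1 ?addr0.
  case: (eqVneq k l) => [->|kl]; last by rewrite eqSS (negbTE kl) mul0r mulr0 addr0 expr2.
  by rewrite eqxx mul1r -expr2 -(expr2 (Num.sqrt _)) sqr_sqrtr// addrC subrK.
move=> j jk; rewrite eqSS (_ : (val j == k) = false) ?mul0r//.
by apply/negbTE; apply: contra jk => /eqP e; apply/eqP/val_inj.
Qed.

Lemma unit_unrot : unit_coeffs unrot.
Proof. by move=> n k _; exact: gam_unrot. Qed.

Lemma unit_rot (r : R) : 0 <= r <= 1 -> unit_coeffs (rot r).
Proof. by move=> hr n k kn; rewrite gam_rot// eqxx. Qed.

(** The left vector is the same for every k, so the average over the summands can be carried out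
    inside the right vector. *)
Lemma fam_average i x (Y0 : bounded_op V) (Y : nat -> bounded_op V) :
  inner (cdiag _ x (fam F i (fun=> Y0))) (fam F i Y) =
  inner (cdiag _ x (fam F i (fun=> Y0))) (\sum_(l < i.2.+1) (i.2.+1%:R^-1)%:C *: fam F i (fun=> Y l)).
Proof.
rewrite inner_sumr; apply: (etrans (fam_inner3 F hq i x (fun=> Y0) Y)); apply: eq_bigr => l _.
rewrite innerZr conj_RC; apply: (etrans _ (esym (f_equal (fun z => _ * z) (fam_inner3 F hq i x (fun=> Y0) (fun=> Y l))))).
exact: mean_const.
Qed.

Lemma phi_ucvg g (hg : unit_coeffs g) x c : ucvg (@approx_ultra H)
  (fun i => inner (cdiag _ x (fam F i (fun=> 1))) (lcomb (vw g i) c))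
  (inner (phi F hq hg x (vacuum F)) (lcomb gw c)).
Proof.
have h := cform2_ucvg (UU := @approx_ultraP H) (fun w w' => vw_moment F hq w w' hg) x [:: (1, [::])] c.
have e := compression2E (UU := @approx_ultraP H) (gw_total hq) (fun w w' => vw_moment F hq w w' hg) x [:: (1, [::])] c.
have eV : vacuum F = lcomb gw [:: (1, [::])] by rewrite lcomb1.
rewrite eV; apply: (@eq_rect _ _ (fun l => ucvg _ _ l) _ _ (esym e)).
have ef : (fun i => inner (cdiag _ x (fam F i (fun=> 1))) (lcomb (vw g i) c)) =
  (fun i => inner (cdiag _ x (lcomb (vw g i) [:: (1, [::])])) (lcomb (vw g i) c)).
  by apply/funext => i; rewrite lcomb1.
by rewrite ef.
Qed.

Lemma lcomb_vw_average g i x w c :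
  inner (cdiag _ x (fam F i (fun=> 1))) (lcomb (vw g i) c) =
  inner (cdiag _ x (fam F i (fun=> 1))) (\sum_(l < i.2.+1) (i.2.+1%:R^-1)%:C *: lcomb (vw (fun=> g l) i) c).
Proof.
have e g' : lcomb (vw g' i) c = fam F i (fun k => lcomb (gword F i (g' k)) c) by exact: fam_lcomb.
apply: (etrans (f_equal (inner _) (e g))).
apply: (etrans (fam_average i x 1 (fun k => lcomb (gword F i (g k)) c))).
apply: (f_equal (inner _)).
apply: eq_bigr => l _.
apply: (f_equal (fun z => _ *: z)).
exact: (esym (e _)).
Qed.

Lemma qform_ge0 w : 0 <= qform q (fun x y : H => inner x y) w w.
Proof.
have := sqr_ge0 (nrm (rt w)); rewrite -Cre_inner_nrm rt_inner//.
Qed.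

(** The vacuum vector carries no letters and is not rotated, so x only sees the mean over k of the
    rotated Wick words. By [nrm_average] this mean approaches r^n times the unrotated Wick word in
    norm, and any bounded x respects that. *)
Lemma phi_rot (r : R) (hr : 0 <= r <= 1) x w :
  inner (phi F hq (unit_rot hr) x (vacuum F)) (rt w) =
  (r ^+ size w)%:C * inner (phi F hq unit_unrot x (vacuum F)) (rt w).
Proof.
have [r0 r1] := andP hr; pose Q := qform q (fun x y : H => inner x y) w w.
have Q0 : 0 <= Q by exact: qform_ge0.
have [k0 k00 hk] := wick_moment F hq w; pose cw := cwick q w.
have [k1 k10 hk1] := word_moment F hq [::] [::].
pose v i := fam F i (fun=> 1); pose s := r ^+ size w.
have s1 : `|s| <= 1 by rewrite ger0_norm ?exprn_ge0// exprn_ile1.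
have h1 := phi_ucvg (unit_rot hr) x cw; have h0 := phi_ucvg unit_unrot x cw.
rewrite -(lcomb_cwick F hq w) -/cw -/s.
pose D i := \sum_(l < i.2.+1) (i.2.+1%:R^-1)%:C *: lcomb (vw (fun=> rot r l) i) cw - s%:C *: lcomb (vw unrot i) cw.
have hD i : {subset w <= i.1} -> nrm (D i) ^+ 2 <= (Q + 4 * k0) / i.2.+1%:R.
  move=> hw; have sw : (r ^+ 2) ^+ size w = s ^+ 2 by rewrite -!exprM mulnC.
  have g1 l : (l <= i.2)%N -> gam i.2 (rot r l) (rot r l) = 1 by move=> hl; rewrite gam_rot// eqxx.
  have a1 (l l' : 'I_i.2.+1) (k : 'I_i.2.+1) : [/\ gam i.2 (rot r l) (rot r l) = 1, gam i.2 (rot r l') (rot r l') = 1 &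
      gam i.2 (rot r l) (rot r l') = if l == l' then 1 else r ^+ 2].
    have hl := ltn_ord l; have hl' := ltn_ord l'; rewrite ltnS in hl; rewrite ltnS in hl'.
    by rewrite (g1 _ hl) (g1 _ hl') gam_rot.
  have a2 (l : 'I_i.2.+1) (k : 'I_i.2.+1) : [/\ gam i.2 (rot r l) (rot r l) = 1, gam i.2 (unrot 0) (unrot 0) = 1 :> R &
      gam i.2 (rot r l) (unrot 0) = r].
    have hl := ltn_ord l; rewrite ltnS in hl.
    by rewrite (g1 _ hl) gam_unrot gam_rot0.
  have a3 (k : 'I_i.2.+1) : [/\ gam i.2 (unrot 0) (unrot 0) = 1 :> R, gam i.2 (unrot 0) (unrot 0) = 1 :> R &
      gam i.2 (unrot 0) (unrot 0) = 1 :> R] by rewrite gam_unrot.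
  have b1 (l l' : 'I_i.2.+1) : nrm (inner (lcomb (vw (fun=> rot r l) i) cw) (lcomb (vw (fun=> rot r l') i) cw) -
      ((if l == l' then 1 else s ^+ 2) * Q)%:C) <= k0 / i.2.+1%:R.
    have -> : (if l == l' then 1 else s ^+ 2) * Q = (if l == l' then 1 else r ^+ 2) ^+ size w * Q.
      by case: (l == l'); rewrite ?expr1n ?sw.
    exact: (hk i _ (fun=> rot r l) (fun=> rot r l') hw (a1 l l')).
  have b2 (l : 'I_i.2.+1) := hk i _ (fun=> rot r l) unrot hw (a2 l).
  have b3 : nrm (inner (lcomb (vw unrot i) cw) (lcomb (vw unrot i) cw) - Q%:C) <= k0 / i.2.+1%:R.
    rewrite -[Q]mul1r -[X in X * Q](expr1n _ (size w)); exact: (hk i _ unrot unrot hw a3).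
  rewrite mulrDl -[4 * k0 / _]mulrA.
  exact: (nrm_average s1 Q0 b1 b2 b3).
have hu : exists2 M, 0 <= M & forall i, nrm (inner (v i) (v i)) <= M.
  exists (k1 + nrm (mom q (@tag_ip R H 1) [::] (tagged [::] [::]))%:C) => [|i]; first by rewrite addr_ge0 ?nrm_ge0.
  apply: (le_trans (nrm_sub_le _ (mom q (@tag_ip R H 1) [::] (tagged [::] [::]))%:C)).
  rewrite addrC lerD2r; apply: (@le_trans _ _ (k1 / i.2.+1%:R)).
    apply: (hk1 i 1 unrot unrot); [by []|by []|by move=> k; rewrite gam_unrot].
  by rewrite ler_pdivrMr// ler_peMr// ler1n.
have hv : exists2 M, 0 < M & forall i, nrm (v i) <= M.
  have [M M0 hM] := hu; have M1 : 0 < M + 1 by rewrite ltr_wpDl.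
  exists (M + 1) => // i; apply: nrm_le_sqr => //; exact: hM.
have [M M0 hM] := hv.
pose f i := inner (cdiag _ x (v i)) (D i).
have fE i : f i = inner (cdiag _ x (v i)) (lcomb (vw (rot r) i) cw) - s%:C * inner (cdiag _ x (v i)) (lcomb (vw unrot i) cw).
  rewrite /f /D innerBr innerZr conj_RC; apply: (f_equal (fun z => z - _)).
  exact: (esym (lcomb_vw_average _ _ _ w _)).
have f0 : ucvg (@approx_ultra H) f 0.
  move=> e e0; pose N := nrm x * M + 1.
  have N0 : 0 < N by rewrite ltr_wpDl// mulr_ge0 ?nrm_ge0 ?ltW.
  have e1 : 0 < (e / N) ^+ 2 / 2 by rewrite divr_gt0// exprn_gt0// divr_gt0.
  have B0 : 0 <= Q + 4 * k0 by rewrite addr_ge0// mulr_ge0.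
  have [n0 hn] := invS_small B0 e1.
  apply: (@approx_tail _ _ w n0) => a n hs hn' /=; rewrite subr0.
  have k2 : nrm (D (a, n)) < e / N.
    rewrite -(@ltr_pXn2r _ 2) ?nnegrE ?nrm_ge0 ?divr_ge0 ?ltW//.
    apply: (le_lt_trans (hD (a, n) hs)); apply: (le_lt_trans (hn _ hn')).
    by rewrite ltr_pdivrMr// ltr_pMr ?ltr1n// exprn_gt0// divr_gt0.
  apply: (le_lt_trans (inner_le _ _)).
  apply: (@le_lt_trans _ _ (N * nrm (D (a, n)))).
    apply: ler_wpM2r; first exact: nrm_ge0.
    apply: (le_trans (op_le _ _)); apply: (@le_trans _ _ (nrm x * M)); last by rewrite lerDl.
    by apply: ler_pM; [exact: nrm_ge0|exact: nrm_ge0|exact: nrm_cdiag|exact: hM].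
  by rewrite mulrC -ltr_pdivlMr.
have ef : f = (fun i => inner (cdiag _ x (v i)) (lcomb (vw (rot r) i) cw) - s%:C * inner (cdiag _ x (v i)) (lcomb (vw unrot i) cw)).
  exact/funext.
have h3 : ucvg (@approx_ultra H) f (inner (phi F hq (unit_rot hr) x (vacuum F)) (lcomb gw cw) -
    s%:C * inner (phi F hq unit_unrot x (vacuum F)) (lcomb gw cw)).
  by rewrite ef; apply: ucvgB; [exact: h1|apply: ucvgMl; exact: h0].
apply/eqP; rewrite -subr_eq0; apply/eqP; exact: ucvg_uniq h3 f0.
Qed.

End rotation.

(** * Lifts of the Gaussians and approximation *)

Section generated_subalgebras.
Variables (R : realType) (V : complexHilbertType R).
Implicit Types (X B : set (bounded_op V)).

Definition gen X : set (bounded_op V) := smallest (@cstar_subalgebra R (bounded_op V)) X.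

Lemma gen_min X B : subalg B -> X `<=` B -> gen X `<=` B.
Proof. by move=> hB XB a; apply; split=> //; apply/cstar_subalgebraP. Qed.

Lemma sub_gen X : X `<=` gen X.
Proof. by move=> a Xa B [_]; exact. Qed.

Lemma gen_subalg X : subalg (gen X).
Proof.
split.
- by move=> B [/cstar_subalgebraP[h _ _ _ _]].
- move=> a x y hx hy B hB; have [/cstar_subalgebraP[_ h _ _ _] _] := hB; apply: h; [exact: hx|exact: hy].
- move=> x y hx hy B hB; have [/cstar_subalgebraP[_ _ h _ _] _] := hB; apply: h; [exact: hx|exact: hy].
- move=> x hx B hB; have [/cstar_subalgebraP[_ _ _ h _] _] := hB; apply: h; exact: hx.
move=> x hx B hB; have [/cstar_subalgebraP[_ _ _ _ h] _] := hB; apply: h => e /hx[y hy n].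
by exists y => //; exact: hy.
Qed.

End generated_subalgebras.

Section image_closure.
Variables (R : realType) (V V' : complexHilbertType R).
Variables (D : set (bounded_op V)) (p : bounded_op V -> bounded_op V').
Hypotheses (hD : subalg D) (hp : star_hom D p).

(** This reduces the density of the image of p to approximating the generators. *)
Lemma image_closure_subalg :
  subalg [set a | forall e : R, 0 < e -> exists2 x, D x & nrm (p x - a) < e].
Proof.
have [D0 DD DM DS _] := hD; have [pP pM pS] := hp; split.
- by move=> e e0; exists 0 => //; rewrite (star_hom0 hD hp) subrr nrm0.
- move=> b a a' ha ha' e e0; have b0 : 0 < nrm b + 1 by rewrite ltr_wpDl// nrm_ge0.
  have [x Dx hx] := ha (e / (nrm b + 1)) (divr_gt0 e0 b0).
  have [y Dy hy] := ha' (e / (nrm b + 1)) (divr_gt0 e0 b0).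
  exists (b *: x + y); first exact: DD.
  rewrite pP// opprD addrACA -scalerBr; apply: (le_lt_trans (nrmD _ _)).
  have -> : e = nrm b * (e / (nrm b + 1)) + e / (nrm b + 1).
    by rewrite -[X in _ + X]mul1r -mulrDl mulrC divfK// lt0r_neq0.
  by apply: ler_ltD => //; rewrite nrmZ; apply: ler_wpM2l; [exact: nrm_ge0|exact: ltW].
- move=> a a' ha ha' e e0; pose M := nrm a + nrm a' + 1.
  have M0 : 0 < M by rewrite ltr_wpDl// addr_ge0 ?nrm_ge0.
  pose d := Num.min 1 (e / (2 * M)).
  have d0 : 0 < d by rewrite lt_min ltr01 divr_gt0// mulr_gt0.
  have dM : 2 * (d * M) <= e.
    by rewrite mulrCA -ler_pdivlMr ?mulr_gt0// /d ge_min lexx orbT.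
  have d1 : d <= 1 by rewrite /d ge_min lexx.
  have [x Dx hx] := ha d d0; have [y Dy hy] := ha' d d0.
  exists (x * y); first exact: DM.
  have -> : p (x * y) - a * a' = (p x - a) * p y + a * (p y - a') by rewrite pM// mulrBl mulrBr addrA subrK.
  have ny : nrm (p y) <= M.
    apply: (le_trans (nrm_sub_le _ a')); rewrite /M addrC [nrm a + _]addrC -addrA [leRHS]addrC.
    rewrite lerD2r; apply: (le_trans (ltW hy)); apply: (le_trans d1); by rewrite lerDr nrm_ge0.
  apply: (le_lt_trans (nrmD _ _)); apply: lt_le_trans dM; rewrite mulr_natl mulr2n.
  apply: ltr_leD.
    apply: (le_lt_trans (nrm_opM _ _)); apply: (@le_lt_trans _ _ (nrm (p x - a) * M)).
      by apply: ler_wpM2l => //; exact: nrm_ge0.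
    by rewrite ltr_pM2r.
  apply: (le_trans (nrm_opM _ _)); rewrite mulrC; apply: ler_pM; rewrite ?nrm_ge0// ?ltW//.
  by rewrite /M -addrA ltrDl ltr_wpDl ?nrm_ge0.
- move=> a ha e e0; have [x Dx hx] := ha e e0; exists (star x); first exact: DS.
  by rewrite pS// -starB nrm_star.
move=> a ha e e0; have e2 : 0 < e / 2 by rewrite divr_gt0.
have [b hb nb] := ha _ e2; have [x Dx hx] := hb _ e2; exists x => //.
rewrite [e]splitr; apply: (le_lt_trans (nrm_dist _ b _)); apply: ltrD; first exact: hx.
rewrite nrmB; exact: nb.
Qed.

End image_closure.

Section wick_operators.
Variables (R : realType) (H : realHilbertType R) (q : R) (F : qFock H q).
Hypothesis hq : -1 < q < 1.
Local Notation C := R[i].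
Local Notation rt := (rtens F).
Local Notation gw := (gw F).
Implicit Types (S T : bounded_op F) (w t : seq H) (c : seq (C * seq H)).

Lemma lcomb_wickop_vacuum c : lcomb (wickop F) c (vacuum F) = lcomb rt c.
Proof.
rewrite /lcomb op_sumE; apply: eq_bigr => p _; rewrite opZE; congr (_ *: _).
exact: wickop_vacuum.
Qed.

Lemma inner_damp r c w : inner (lcomb rt (damp r c)) (rt w) = (r ^+ size w)%:C * inner (lcomb rt c) (rt w).
Proof.
rewrite lcomb_map /lcomb !inner_suml mulr_sumr; apply: eq_bigr => p _ /=.
rewrite !innerZl -mulrA; have [->//|e] := eqVneq (size p.2) (size w).
by rewrite rt_inner// qform_size// !mulr0.
Qed.

Lemma damp_sub r c c' : damp r (c ++ cscale (-1) c') = damp r c ++ cscale (-1) (damp r c').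
Proof. by rewrite /damp map_cat /cscale -!map_comp; congr (_ ++ _); apply: eq_map => p /=; rewrite mulrCA. Qed.

Lemma lcomb_sub (V : lmodType C) (v : seq H -> V) c c' :
  lcomb v (c ++ cscale (-1) c') = lcomb v c - lcomb v c'.
Proof. by rewrite lcomb_cat lcomb_scale scaleN1r. Qed.

Variable A : set (bounded_op F).
Hypothesis hA : subalg A.
Hypothesis GA : forall f, A (gaussian F f).

Lemma multiplier_closed : opclosed (multiplier A).
Proof.
have [_ _ _ _ Ac] := hA; move=> T h a Aa.
have a0 : 0 < nrm a + 1 by rewrite ltr_wpDl// nrm_ge0.
have key e : 0 < e -> exists S, [/\ multiplier A S, nrm (a * T - a * S) < e & nrm (T * a - S * a) < e].
  move=> e0; have [S mS hS] := h (e / (nrm a + 1)) (divr_gt0 e0 a0); exists S.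
  have k : nrm (T - S) * nrm a < e.
    apply: (@le_lt_trans _ _ (e / (nrm a + 1) * nrm a)).
      by apply: ler_wpM2r; [exact: nrm_ge0|exact: ltW].
    by rewrite -mulrA gtr_pMr// mulrC ltr_pdivrMr// mul1r ltrDl.
  split=> //; first by rewrite -mulrBr; apply: (le_lt_trans (nrm_opM _ _)); rewrite mulrC.
  by rewrite -mulrBl; apply: (le_lt_trans (nrm_opM _ _)).
split; apply: Ac => e /key[S [mS h1 h2]].
  by exists (a * S) => //; have [] := mS _ Aa.
by exists (S * a) => //; have [] := mS _ Aa.
Qed.

Lemma lcomb_multiplier c : multiplier A (lcomb (wickop F) c).
Proof.
move=> a Aa; have [A0 AD _ _ _] := hA; elim: c => [|p c [h1 h2]]; first by rewrite lcomb_nil mulr0 mul0r.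
have [k1 k2] := wickop_multiplier hq p.2 hA GA Aa.
have -> : lcomb (wickop F) (p :: c) = p.1 *: wickop F p.2 + lcomb (wickop F) c by rewrite /lcomb big_cons.
by rewrite mulrDr mulrDl opZl opZr; split; exact: AD.
Qed.

(** Approximate xi by combinations of words and damp them. By [wickop_damp_le] the corresponding
    Wick operators converge in norm, to some L that is a multiplier. T and L are both compatible
    with right shifts and have the same vacuum vector, hence are equal. *)
Lemma rshift_multiplier (r : R) T (xi : F) : 0 < r < 1 -> rshift T ->
  (forall w, inner (T (vacuum F)) (rt w) = (r ^+ size w)%:C * inner xi (rt w)) -> multiplier A T.
Proof.
move=> hr hT hxi; have [k k0 hk] := wickop_damp_le F hq hr.
have pos n : 0 < n.+1%:R^-1 :> R by [].
have [c hc] := boolp.choice (fun n => @rtens_total _ _ _ F xi _ (pos n)).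
pose S n := lcomb (wickop F) (damp r (c n)).
have hS n m : nrm (S m - S n) <= k * nrm (lcomb rt (c m) - lcomb rt (c n)).
  by rewrite /S -!lcomb_sub -damp_sub; exact: hk.
have [n m nm|e e0|L hL] := @op_cauchy_bound _ _ S (fun n => k * 2 / n.+1%:R).
- apply: (le_trans (hS _ _)); rewrite -mulrA; apply: ler_wpM2l => //.
  apply: (le_trans (nrm_dist _ xi _)).
  have -> : 2 / n.+1%:R = n.+1%:R^-1 + n.+1%:R^-1 :> R by rewrite mulrDl mul1r.
  apply: lerD; last exact/ltW/hc.
  by rewrite nrmB; apply: (le_trans (ltW (hc m))); rewrite lef_pV2 ?posrE// ler_nat ltnS.
- have e2 : 0 < e / 2 by rewrite divr_gt0.
  have k2 : 0 <= k * 2 by rewrite mulr_ge0.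
  have [n0 hn0] := invS_small k2 e2.
  by exists n0 => n /hn0 h; apply: (le_lt_trans h); rewrite ltr_pdivrMr// ltr_pMr// ltr1n.
have app e : 0 < e -> exists n, nrm (L - S n) < e /\ nrm (xi - lcomb rt (c n)) < e.
  move=> e0; have e2 : 0 < e / 2 by rewrite divr_gt0.
  have k2 : 0 <= k * 2 + 1 by rewrite addr_ge0// mulr_ge0.
  have [n0 hn0] := invS_small k2 e2.
  have hh := hn0 _ (leqnn n0).
  have ee : (k * 2 + 1) / n0.+1%:R < e by apply: (le_lt_trans hh); rewrite ltr_pdivrMr// ltr_pMr// ltr1n.
  exists n0; split.
    apply: (le_lt_trans (hL n0)); apply: le_lt_trans ee; by rewrite ler_pM2r ?invr_gt0// lerDl.
  apply: (lt_le_trans (hc n0)); apply: le_trans (ltW ee); rewrite -[leLHS]mul1r ler_pM2r ?invr_gt0//.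
  by rewrite lerDr mulr_ge0.
have -> : T = L.
  apply: (rshift_ext hq) => //.
    by apply: rshift_closed => e /app[n [h _]]; exists (S n) => //; exact: rshift_lcomb.
  apply: (total_extl (@rtens_total _ _ _ F)) => w; apply/eqP; rewrite -subr_eq0; apply/eqP; apply: nrm_small => e e0.
  pose M := (nrm (vacuum F) + 1) * nrm (rt w) + 1.
  have rw0 : 0 <= nrm (rt w) by exact: nrm_ge0.
  have v0 : 0 <= nrm (vacuum F) by exact: nrm_ge0.
  have M0 : 0 < M by rewrite ltr_wpDl// mulr_ge0// addr_ge0.
  have [n [h1 h2]] := app (e / M) (divr_gt0 e0 M0).
  have -> : inner (T (vacuum F)) (rt w) - inner (L (vacuum F)) (rt w) =
     (r ^+ size w)%:C * inner (xi - lcomb rt (c n)) (rt w) - inner ((L - S n) (vacuum F)) (rt w).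
    rewrite hxi opBE !innerBl lcomb_wickop_vacuum inner_damp; ring.
  have [r0 r1] := andP hr.
  apply: (le_trans (nrmBD _ _)).
  have s1 : `|r ^+ size w| <= 1 by rewrite ger0_norm; [apply: exprn_ile1; exact: ltW|apply: exprn_ge0; exact: ltW].
  have b1 : nrm ((r ^+ size w)%:C * inner (xi - lcomb rt (c n)) (rt w)) <= e / M * nrm (rt w).
    rewrite nrmM nrmC; apply: (@le_trans _ _ (1 * (nrm (xi - lcomb rt (c n)) * nrm (rt w)))).
      by apply: ler_pM; [exact: normr_ge0|exact: nrm_ge0|exact: s1|exact: inner_le].
    by rewrite mul1r; apply: ler_wpM2r => //; exact: ltW.
  have b2 : nrm (inner ((L - S n) (vacuum F)) (rt w)) <= e / M * nrm (vacuum F) * nrm (rt w).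
    apply: (le_trans (inner_le _ _)); apply: ler_wpM2r => //.
    by apply: (le_trans (op_le _ _)); apply: ler_wpM2r => //; exact: ltW.
  apply: (le_trans (lerD b1 b2)).
  have -> : e / M * nrm (rt w) + e / M * nrm (vacuum F) * nrm (rt w) = e / M * ((nrm (vacuum F) + 1) * nrm (rt w)) by ring.
  rewrite -[leRHS](divfK (lt0r_neq0 M0)); apply: ler_wpM2l; first by rewrite divr_ge0 ?ltW.
  by rewrite /M lerDl.
apply: multiplier_closed => e /app[n [h _]]; exists (S n) => //; exact: lcomb_multiplier.
Qed.

End wick_operators.

Section wick_density.
Variables (R : realType) (H : realHilbertType R) (q : R) (F : qFock H q).
Hypothesis hq : -1 < q < 1.
Local Notation C := R[i].
Local Notation wspan := [set T | exists c : seq (C * seq H), T = lcomb (wickop F) c].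
Local Notation wdense := [set T | forall e : R, 0 < e -> exists c : seq (C * seq H), nrm (T - lcomb (wickop F) c) < e].
Implicit Types (T : bounded_op F) (f : H) (w : seq H) (c : seq (C * seq H)).

Let wspanP (b : C) S T : wspan S -> wspan T -> wspan (b *: S + T).
Proof. by move=> [c ->] [c' ->]; exists (cscale b c ++ c'); rewrite lcomb_cat lcomb_scale. Qed.

Let wspan_gaussian f c : wspan (gaussian F f * lcomb (wickop F) c).
Proof.
elim: c => [|p c IH]; first by exists [::]; rewrite lcomb_nil mulr0.
have -> : lcomb (wickop F) (p :: c) = p.1 *: wickop F p.2 + lcomb (wickop F) c by rewrite /lcomb big_cons.
rewrite mulrDr opZr gaussian_wickop//; apply: wspanP => //.
have w1 w : wspan (wickop F w) by exists [:: (1, w)]; rewrite lcomb1.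
rewrite addrC -[X in X + _]scale1r; apply: wspanP; last exact: w1.
apply: qann_ind => [|b z z' hz hz'|t _]; [by exists [::]; rewrite lcomb_nil|exact: wspanP|exact: w1].
Qed.

Let wdenseP (b : C) S T : wdense S -> wdense T -> wdense (b *: S + T).
Proof.
move=> hS hT e e0; have b0 : 0 < nrm b + 1 by rewrite ltr_wpDl// nrm_ge0.
have [c hc] := hS (e / (nrm b + 1)) (divr_gt0 e0 b0).
have [c' hc'] := hT (e / (nrm b + 1)) (divr_gt0 e0 b0).
exists (cscale b c ++ c'); rewrite lcomb_cat lcomb_scale opprD addrACA -scalerBr.
apply: (le_lt_trans (nrmD _ _)).
have -> : e = nrm b * (e / (nrm b + 1)) + e / (nrm b + 1).
  by rewrite -[X in _ + X]mul1r -mulrDl mulrC divfK// lt0r_neq0.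
by apply: ler_ltD => //; rewrite nrmZ; apply: ler_wpM2l; [exact: nrm_ge0|exact: ltW].
Qed.

Let wdense_closed : opclosed wdense.
Proof.
move=> T h e e0; have e2 : 0 < e / 2 by rewrite divr_gt0.
have [S hS nS] := h _ e2; have [c hc] := hS _ e2; exists c.
rewrite [e]splitr; apply: (le_lt_trans (nrm_dist _ S _)); exact: ltrD.
Qed.

Let left_mult : set (bounded_op F) :=
  [set a | forall T, wdense T -> wdense (a * T) /\ wdense (star a * T)].

Let left_mult_subalg : subalg left_mult.
Proof.
have w0 : wdense 0 by move=> e e0; exists [::]; rewrite lcomb_nil subrr nrm0.
split.
- by move=> T _; rewrite star0 !mul0r; split.
- move=> b x y hx hy T hT; have [h1 h2] := hx _ hT; have [h3 h4] := hy _ hT.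
  by rewrite starD star_opZ !mulrDl !opZl; split; exact: wdenseP.
- move=> x y hx hy T hT; have [h1 h2] := hx _ hT; have [h3 h4] := hy _ hT.
  rewrite star_opM -!mulrA; split; first exact: (hx _ h3).1.
  exact: (hy _ h2).2.
- by move=> x hx T hT; have [h1 h2] := hx _ hT; rewrite starK.
move=> x h T hT; have T0 : 0 < nrm T + 1 by rewrite ltr_wpDl// nrm_ge0.
have key e : 0 < e -> exists y, [/\ left_mult y, nrm (x * T - y * T) < e & nrm (star x * T - star y * T) < e].
  move=> e0; have [y hy ny] := h (e / (nrm T + 1)) (divr_gt0 e0 T0); exists y.
  have k : nrm (x - y) * nrm T < e.
    apply: (@le_lt_trans _ _ (e / (nrm T + 1) * nrm T)).
      by apply: ler_wpM2r; [exact: nrm_ge0|exact: ltW].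
    by rewrite -mulrA gtr_pMr// mulrC ltr_pdivrMr// mul1r ltrDl.
  split; first exact: hy.
    by rewrite -mulrBl; apply: (le_lt_trans (nrm_opM _ _)).
  by rewrite -mulrBl -starB; apply: (le_lt_trans (nrm_opM _ _)); rewrite nrm_star.
split; apply: wdense_closed => e /key[y [hy h1 h2]].
  by exists (y * T); [exact: (hy _ hT).1|exact: h1].
by exists (star y * T); [exact: (hy _ hT).2|exact: h2].
Qed.

(** A Gaussian maps the span of the Wick operators into itself by left multiplication
    ([gaussian_wickop]), so the operators that, with their adjoints, preserve the closure of this
    span form a closed algebra containing the generators. Apply a to 1. *)
Lemma wickop_dense a : gen ([set 1] `|` range (gaussian F)) a ->
  forall e : R, 0 < e -> exists c, nrm (a - lcomb (wickop F) c) < e.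
Proof.
have w1 : wdense 1.
  move=> e e0; exists [:: (1, [::])]; rewrite lcomb1 (_ : wickop F [::] = 1) ?subrr ?nrm0//.
  by rewrite /wickop /shs /= big_seq1 /= scale1r mulr1.
suff : gen ([set 1] `|` range (gaussian F)) `<=` left_mult.
  by move=> h ha; have [h1 _] := h a ha 1 w1; rewrite mulr1 in h1; exact: h1.
apply: (gen_min left_mult_subalg) => _ [->|[f _ <-]] T hT; first by rewrite star1 mul1r; exact: conj.
rewrite gaussian_sa; suff hG : wdense (gaussian F f * T) by exact: conj.
move=> e e0; have G0 : 0 < nrm (gaussian F f) + 1 by rewrite ltr_wpDl// nrm_ge0.
have [c hc] := hT (e / (nrm (gaussian F f) + 1)) (divr_gt0 e0 G0).
have [c' hc'] := wspan_gaussian f c; exists c'; rewrite -hc' -mulrBr.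
apply: (le_lt_trans (nrm_opM _ _)); apply: (@le_lt_trans _ _ (nrm (gaussian F f) * (e / (nrm (gaussian F f) + 1)))).
  by apply: ler_wpM2l; [exact: nrm_ge0|exact: ltW].
by rewrite mulrC -mulrA gtr_pMr// mulrC ltr_pdivrMr// mul1r ltrDl.
Qed.

(** Adjoining 1 turns multipliers into elements, so that Wick combinations become available as
    elements with lifts. *)
Lemma wickop_gen1 w : gen ([set 1] `|` range (gaussian F)) (wickop F w).
Proof.
have hA := gen_subalg ([set 1] `|` range (gaussian F)).
have GA f : gen ([set 1] `|` range (gaussian F)) (gaussian F f) by apply: sub_gen; right; exists f.
have A1 : gen ([set 1] `|` range (gaussian F)) 1 by apply: sub_gen; left.
by have [] := wickop_multiplier hq w hA GA A1; rewrite mul1r.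
Qed.

End wick_density.

(** The operator S w is S / (1 + S^2/t). Its norm bound does not involve S, so one t serves the spin
    sums of all models, while the error is small for large t when S is a fixed Gaussian. *)
Lemma bounded_inverse (R : realType) (V : complexHilbertType R) (S : bounded_op V) (t : R) : 0 < t -> star S = S ->
  exists w, [/\ (1 + (t^-1)%:C *: (S * S)) * w = 1, w * (1 + (t^-1)%:C *: (S * S)) = 1,
    star (S * w) = S * w, nrm (S * w) <= 1 + t & forall D, subalg D -> D S -> D (S * w)] /\
    nrm (S - S * w) <= t^-1 * nrm S ^+ 3.
Proof.
move=> t0 hS; pose k := (t^-1)%:C *: (S * S).
have pk : psd k by apply: psdZ; [rewrite invr_ge0 ltW|exact: psd_sqr].
have [w [w1 w2 nw sw [Dw cw]]] := ex_inv1p pk; exists w.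
have Sk : S * k = k * S by rewrite /k opZl opZr mulrA.
have wS : w * S = S * w by rewrite (cw _ Sk).
have kw : k * w = 1 - w by apply/eqP; rewrite eq_sym subr_eq addrC -[X in X + _]mul1r -mulrDl w1.
have s1 : star (S * w) = S * w by rewrite star_opM sw hS.
have n1w : nrm (1 - w) <= 2.
  by apply: (le_trans (nrmBD _ _)); rewrite -[2]/(1 + 1); apply: lerD => //; exact: nrm_op1.
split; first split=> //.
(* The square of S w is t k w^2 with k w = 1 - w, of norm at most 2 t <= (1 + t)^2. *)
- have h2 : nrm (S * w) ^+ 2 <= 2 * t.
    rewrite -nrm_starM s1 -mulrA (mulrA w) wS -(mulrA S) mulrA.
    have -> : S * S * (w * w) = t%:C *: ((k * w) * w).
      by rewrite /k !opZl scalerA -RCM mulfV ?scale1r ?mulrA// gt_eqF.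
    rewrite kw nrmZ nrmC (ger0_norm (ltW t0)) [leLHS]mulrC; apply: ler_wpM2r; first exact: ltW.
    apply: (le_trans (nrm_opM _ _)); rewrite -[2]mulr1; apply: ler_pM; rewrite ?nrm_ge0//.
  have p : 0 <= 1 + t by rewrite addr_ge0// ltW.
  rewrite -(@ler_pXn2r _ 2) ?nnegrE ?nrm_ge0//; apply: (le_trans h2).
  by rewrite sqrrD expr1n mul1r mulr_natl -addrA addrCA lerDl addr_ge0// sqr_ge0.
- move=> D hD DS; have DM x y : D x -> D y -> D (x * y) by move=> hx hy; have [_ _ h _ _] := hD; exact: h.
  have -> : S * w = S - S * (1 - w) by rewrite mulrBr mulr1 opprB addrC subrK.
  apply: subalgB => //; apply: (DM) => //; apply: (Dw) => //.
  by rewrite /k; apply: subalgZ => //; exact: DM.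
have -> : S - S * w = S * (k * w) by rewrite kw mulrBr mulr1.
have ti : 0 <= t^-1 by rewrite invr_ge0 ltW.
rewrite /k opZl opZr nrmZ nrmC (ger0_norm ti); apply: ler_wpM2l => //.
rewrite mulrA; apply: (le_trans (nrm_opM _ _)); rewrite -[leRHS]mulr1; apply: ler_pM; rewrite ?nrm_ge0//.
apply: (le_trans (nrm_opM _ _)); rewrite exprS expr2; apply: ler_wpM2l; [exact: nrm_ge0|exact: nrm_opM].
Qed.

Lemma lcomb_mull (R : realType) (V : complexHilbertType R) (W : Type) (f : W -> bounded_op V) (S : bounded_op V) c :
  S * lcomb f c = lcomb (fun w => S * f w) c.
Proof. by rewrite /lcomb mulr_sumr; apply: eq_bigr => p _; rewrite opZr. Qed.

Lemma lcomb_mapr (R : realType) (V : lmodType R[i]) (W : Type) (f : W -> V) (h : W -> W) (a : R[i]) c :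
  lcomb f [seq (a * p.1, h p.2) | p <- c] = a *: lcomb (f \o h) c.
Proof. by rewrite /lcomb big_map scaler_sumr; apply: eq_bigr => p _; rewrite scalerA. Qed.

Section gaussian_model.
Variables (R : realType) (H : realHilbertType R) (q : R) (F : qFock H q).
Hypothesis hq : -1 < q < 1.
Local Notation C := R[i].
Local Notation index := (seq H * nat)%type.
Local Notation V := (l2 spin_index (cplx R)).
Local Notation K := (l2 index V).
Local Notation U := (@approx_ultra H).
Local Notation rt := (rtens F).
Local Notation gw := (gw F).
Local Notation vw := (vw F).
Local Notation vac := (vacuum F).
Implicit Types (S T a : bounded_op F) (w : seq H) (f : H) (c : seq (C * seq H)) (i : index) (x y z : bounded_op K).

Definition lifts x a := rel U gw (vw (@unrot R)) x a.

Let tg : total_family gw. Proof. exact: gw_total. Qed.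
Let hv : forall w w', ucvg U (fun i => inner (vw (@unrot R) i w) (vw (@unrot R) i w')) (inner (gw w) (gw w')).
Proof. by move=> w w'; apply: vw_moment => //; exact: unit_unrot. Qed.

Lemma lift_gaussian f (e : R) : 0 < e -> exists x a, [/\ lifts x a,
  forall D, subalg D -> D (gaussian F f) -> D a & nrm (a - gaussian F f) < e].
Proof.
move=> e0; pose G := gaussian F f; pose n := nrm G ^+ 3.
have n0 : 0 <= n by rewrite exprn_ge0// nrm_ge0.
(* Chosen so that the error t^-1 |G|^3 of [bounded_inverse] stays below e. *)
pose t := (n + 1) / e; have t0 : 0 < t by rewrite divr_gt0// ltr_wpDl.
have te : t^-1 * n < e.
  by rewrite /t invf_div mulrC mulrA ltr_pdivrMr ?ltr_wpDl// mulrC ltr_pM2l// ltrDl.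
have [wi [[b1 b2 b3 b4 b5] b6]] := bounded_inverse t0 (gaussian_sa F f).
pose S i := letter_op F i (f, @unrot R 0).
have [w hw] := boolp.choice (fun i => bounded_inverse t0 (letter_op_sa F i (f, @unrot R 0))).
have t1 : 0 <= 1 + t by rewrite addr_ge0// ltW.
have hT i : nrm (S i * w i) <= 1 + t by have [[_ _ _ h _] _] := hw i.
have [x [hx _]] := ex_diag t1 hT.
have sx : star x = x.
  apply: bopE => u; apply: l2E => i; rewrite (star_diag hx) hx.
  by have [[_ _ -> _ _] _] := hw i.
(* In words, [Sc c] is (1 + S^2/t) c and [Lc c] is S c. Since w inverts 1 + S^2/t, the bounded
   operator S w sends the first to the second in every model. *)
pose Sc c := c ++ [seq ((t^-1)%:C * p.1, f :: f :: p.2) | p <- c].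
pose Lc c := [seq (1 * p.1, f :: p.2) | p <- c].
have k1 c i : cdiag _ x (lcomb (vw (@unrot R) i) (Sc c)) = lcomb (vw (@unrot R) i) (Lc c).
  have fl c' : lcomb (vw (@unrot R) i) c' = fam F i (fun k => lcomb (gword F i (@unrot R k)) c') by exact: fam_lcomb.
  apply: (etrans (f_equal (cdiag _ x) (fl _))); apply: (etrans _ (esym (fl _))).
  apply: (etrans (fam_diag (S := fun i => S i * w i) F i _ hx)); apply: eq_fam => k.
  rewrite lcomb_cat (lcomb_mapr _ (fun u => f :: f :: u)) (lcomb_mapr _ (cons f)) scale1r.
  have -> : gword F i (@unrot R k) \o (fun p => f :: f :: p) = (fun p => S i * S i * gword F i (@unrot R k) p).
    by apply/funext => p; rewrite -mulrA.
  have -> : gword F i (@unrot R k) \o (cons f) = (fun p => S i * gword F i (@unrot R k) p) by apply/funext.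
  rewrite -!lcomb_mull -opZl -[X in _ * (X + _)]mul1r -mulrDl mulrA.
  by have [[_ e2 _ _ _] _] := hw i; rewrite -[S i * w i * _]mulrA e2 mulr1.
have k2 c : lcomb gw (Sc c) = (1 + (t^-1)%:C *: (G * G)) (lcomb gw c).
  rewrite lcomb_cat (lcomb_mapr _ (fun u => f :: f :: u)) opDE op1E opZE opME; congr (_ + _ *: _).
  by rewrite /lcomb !opv_sum; apply: eq_bigr => p _; rewrite !opvZ -!gw_cons.
have k3 c : lcomb gw (Lc c) = G (lcomb gw c).
  rewrite (lcomb_mapr _ (cons f)) scale1r /lcomb opv_sum; apply: eq_bigr => p _; by rewrite opvZ.
have half xi eta := @lift_half _ _ U (@approx_ultraP H) _ _ _ _ _ _ tg hv x _ wi G Sc Lc k1 k2 k3 b1 xi eta.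
exists x, (G * wi); split.
- by move=> xi eta h; rewrite sx b3; split; exact: half.
- by move=> D hD DG; exact: b5.
by rewrite -nrmN opprB; exact: le_lt_trans te.
Qed.

Lemma lifts1 : lifts 1 1.
Proof.
move=> xi eta h; rewrite !star1 op1E.
have -> : (fun i => cdiag _ (1 : bounded_op K) (xi i)) = xi by apply: functional_extensionality_dep => i; rewrite cdiag1.
by split.
Qed.

Section dense_lifts.
Variable X : set (bounded_op F).
Hypothesis hX : forall a (e : R), X a -> 0 < e -> exists x b, [/\ lifts x b, gen X b & nrm (b - a) < e].
Local Notation MS := (model_set U gw (vw (@unrot R)) (gen X)).
Local Notation MP := (model_map U gw (vw (@unrot R)) (gen X)).

Lemma models_subalg : subalg MS. Proof. exact: (model_subalg (UU := approx_ultraP H) tg hv (gen_subalg X)). Qed.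
Lemma models_hom : star_hom MS MP. Proof. exact: (model_hom (UU := approx_ultraP H) tg hv (gen_subalg X)). Qed.

Lemma models_mapE x a : gen X a -> lifts x a -> MP x = a.
Proof. exact: (model_mapE (UU := approx_ultraP H) tg hv). Qed.

Lemma models_dense a (e : R) : gen X a -> 0 < e -> exists2 x, MS x & nrm (MP x - a) < e.
Proof.
move=> ga; move: e; move: a ga; apply: gen_min.
  exact: (image_closure_subalg models_subalg models_hom).
move=> a Xa e e0; have [x [b [l gb n]]] := hX Xa e0; exists x; first by exists b.
by rewrite (models_mapE gb l).
Qed.

Lemma ex_lift a : gen X a -> exists z, lifts z a /\ nrm z <= 2 * nrm a.
Proof.
move=> ga; have pA x : MS x -> gen X (MP x) by move=> /model_mapP[].
have [z [Dz pz nz]] := exact_lift models_subalg models_hom (gen_subalg X) pA models_dense ga.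
exists z; split; last exact: nz.
have [_ l] := model_mapP Dz; rewrite pz in l; exact: l.
Qed.

End dense_lifts.

Local Notation A := (gen (range (gaussian F))).
Local Notation A1 := (gen ([set 1] `|` range (gaussian F))).

Lemma gaussian_liftable a (e : R) : range (gaussian F) a -> 0 < e -> exists x b, [/\ lifts x b, A b & nrm (b - a) < e].
Proof.
move=> [f _ <-] e0; have [x [b [l h n]]] := lift_gaussian f e0; exists x, b; split=> //.
by apply: (h A (gen_subalg _)); apply: sub_gen; exists f.
Qed.

Lemma gaussian_liftable1 a (e : R) : ([set 1] `|` range (gaussian F)) a -> 0 < e ->
  exists x b, [/\ lifts x b, A1 b & nrm (b - a) < e].
Proof.
move=> [->|[f _ <-]] e0.
  by exists 1, 1; split; [exact: lifts1|apply: sub_gen; left|rewrite subrr nrm0].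
have [x [b [l h n]]] := lift_gaussian f e0; exists x, b; split=> //.
by apply: (h A1 (gen_subalg _)); apply: sub_gen; right; exists f.
Qed.

Lemma phi0_vacuum z a : lifts z a -> phi F hq (@unit_unrot R) z vac = a vac.
Proof.
move=> l; apply: (total_extl tg) => w.
have h := phi_ucvg F hq (@unit_unrot R) z [:: (1, w)].
have t := tends_vec (UU := approx_ultraP H) gw (vw (@unrot R)) [:: (1, [::])].
have t' := tends_vec (UU := approx_ultraP H) gw (vw (@unrot R)) [:: (1, w)].
have k := tends_inner (UU := approx_ultraP H) hv (l _ _ t).1 t'.
rewrite !lcomb1 in h k; apply: (ucvg_uniq (FU := approx_ultra_proper H) h).
have ef : (fun i => inner (cdiag _ z (fam F i (fun=> 1))) (lcomb (vw (@unrot R) i) [:: (1, w)])) =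
  (fun i => inner (cdiag _ z (lcomb (vw (@unrot R) i) [:: (1, [::])])) (lcomb (vw (@unrot R) i) [:: (1, w)])).
  apply/funext => i; apply: (f_equal (fun u => inner (cdiag _ z u) (lcomb (vw (@unrot R) i) [:: (1, w)]))).
  exact: (esym (lcomb1 (vw (@unrot R) i) [::])).
rewrite ef; exact: k.
Qed.

End gaussian_model.

Section qwep_of_gaussians.
Variables (R : realType) (H : realHilbertType R) (q : R) (F : qFock H q).
Hypothesis hq : -1 < q < 1.
Local Notation C := R[i].
Local Notation index := (seq H * nat)%type.
Local Notation V := (l2 spin_index (cplx R)).
Local Notation K := (l2 index V).
Local Notation U := (@approx_ultra H).
Local Notation rt := (rtens F).
Local Notation vac := (vacuum F).
Local Notation A := (gen (range (gaussian F))).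
Local Notation A1 := (gen ([set 1] `|` range (gaussian F))).
Implicit Types (S T a : bounded_op F) (w : seq H) (f : H) (c : seq (C * seq H)) (x y z b : bounded_op K).

Definition phir (r : R) (hr : 0 <= r <= 1) x := phi F hq (unit_rot hr) x.

Lemma phirP (r : R) (hr : 0 <= r <= 1) (s : C) x y : phir hr (s *: x + y) = s *: phir hr x + phir hr y.
Proof. exact: compressionP. Qed.

Lemma phirB (r : R) (hr : 0 <= r <= 1) x y : phir hr (x - y) = phir hr x - phir hr y.
Proof. by have := phirP hr (-1) y x; rewrite !scaleN1r ![- _ + _]addrC. Qed.

Lemma phir_vacuum (r : R) (hr : 0 <= r <= 1) x a w : lifts x a ->
  inner (phir hr x vac) (rt w) = (r ^+ size w)%:C * inner (a vac) (rt w).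
Proof. by move=> l; rewrite -(phi0_vacuum hq l); exact: phi_rot. Qed.

Lemma phir_ext (r : R) (hr : 0 <= r <= 1) T x a : lifts x a -> rshift T ->
  (forall w, inner (T vac) (rt w) = (r ^+ size w)%:C * inner (a vac) (rt w)) -> phir hr x = T.
Proof.
move=> l sT hT; apply: (rshift_ext hq _ sT); first exact: rshift_phi.
by apply: (total_extl (@rtens_total _ _ _ F)) => w; rewrite hT; exact: phir_vacuum.
Qed.

Lemma phir_wickop (r : R) (hr : 0 <= r <= 1) x c : lifts x (lcomb (wickop F) c) ->
  phir hr x = lcomb (wickop F) (damp r c).
Proof.
move=> l; apply: (phir_ext hr l); first exact: rshift_lcomb.
by move=> w; rewrite !lcomb_wickop_vacuum//; exact: inner_damp.
Qed.

(** The compression depends on x only through its limit a, so x may be replaced by a lift of norm at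
    most 2 |a|. The norm of x itself is not bounded by a. *)
Lemma nrm_phir (r : R) (hr : 0 <= r <= 1) x a : lifts x a -> A1 a -> nrm (phir hr x) <= 2 * nrm a.
Proof.
move=> l ga; have [z [lz nz]] := ex_lift hq (@gaussian_liftable1 _ _ _ F hq) ga.
have -> : phir hr x = phir hr z.
  apply: (phir_ext hr l); first exact: rshift_phi.
  by move=> w; exact: phir_vacuum.
by apply: le_trans nz; exact: compression_le.
Qed.

Lemma damp_near c (e : R) : 0 < e -> exists2 r0 : R, 0 < r0 < 1 & forall r, r0 <= r < 1 ->
  nrm (lcomb (wickop F) c - lcomb (wickop F) (damp r c)) <= e.
Proof.
move=> e0; pose M := \sum_(p <- c) (size p.2)%:R * (nrm p.1 * nrm (wickop F p.2)).
have M0 : 0 <= M by apply: sumr_ge0 => p _; rewrite !mulr_ge0 ?nrm_ge0.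
have M1 : 0 < M + 1 by rewrite ltr_wpDl.
pose d := Num.min 2^-1 (e / (M + 1)).
have d0 : 0 < d by rewrite lt_min invr_gt0 ltr0n divr_gt0.
have d1 : d < 1 by rewrite gt_min invf_lt1 ?ltr0n// ltr1n.
have dM : d * M <= e.
  apply: (@le_trans _ _ (d * (M + 1))); first by rewrite ler_wpM2l ?lerDl// ltW.
  by rewrite -ler_pdivlMr// ge_min lexx orbT.
exists (1 - d); first by rewrite subr_gt0 d1 gtrBl.
move=> r /andP[r0 r1]; have rd : 1 - r <= d by rewrite lerBlDr addrC -lerBlDr.
have p0 : 0 <= r by apply: le_trans r0; rewrite subr_ge0 ltW.
apply: (le_trans _ dM); apply: (@le_trans _ _ ((1 - r) * M)); last by rewrite ler_wpM2r.
rewrite lcomb_map /lcomb -sumrB mulr_sumr; apply: (le_trans (nrm_sum _ _ _)); apply: ler_sum => p _ /=.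
have ge : 1 - r ^+ size p.2 <= (1 - r) * (size p.2)%:R.
  elim: (size p.2) => [|n IH]; first by rewrite expr0 subrr mulr0.
  rewrite -natr1 mulrDr mulr1 exprS; have rn : r ^+ n <= 1 by rewrite exprn_ile1// ltW.
  have r1' : 0 <= 1 - r by rewrite subr_ge0 ltW.
  have -> : 1 - r * r ^+ n = (1 - r ^+ n) + (1 - r) * r ^+ n by ring.
  by apply: lerD => //; rewrite -[leRHS]mulr1; apply: ler_wpM2l.
have -> : p.1 *: wickop F p.2 - ((r ^+ size p.2)%:C * p.1) *: wickop F p.2 =
    ((1 - r ^+ size p.2)%:C * p.1) *: wickop F p.2 by rewrite -scalerBl RCB mulrBl mul1r.
rewrite nrmZ nrmM nrmC ger0_norm; last first.
  by rewrite subr_ge0 exprn_ile1// ltW.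
rewrite -mulrA [leRHS]mulrA; apply: ler_wpM2r; [by rewrite mulr_ge0 ?nrm_ge0|exact: ge].
Qed.

(** On Wick combinations the compression is explicit damping, which tends to the identity. The
    remainder a - W is controlled uniformly in r by [nrm_phir], whose factor 2 accounts for the
    quarter of e. *)
Lemma phir_near x a (e : R) : lifts x a -> A1 a -> 0 < e -> exists2 r0 : R, 0 < r0 < 1 &
  forall r (hr : 0 <= r <= 1), r0 <= r < 1 -> nrm (a - phir hr x) <= e.
Proof.
move=> l ga e0; pose d := e / 4; have d0 : 0 < d by rewrite divr_gt0.
have [c hc] := wickop_dense hq ga d0; set W := lcomb (wickop F) c in hc.
have gW : A1 W.
  rewrite /W; have [A0 AD _ _ _] := gen_subalg ([set 1] `|` range (gaussian F)).
  elim: (c) => [|p s IH]; first by rewrite lcomb_nil.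
  have -> : lcomb (wickop F) (p :: s) = p.1 *: wickop F p.2 + lcomb (wickop F) s by rewrite /lcomb big_cons.
  by apply: AD => //; exact: wickop_gen1.
have [y [ly _]] := ex_lift hq (@gaussian_liftable1 _ _ _ F hq) gW.
have [r0 hr0 h0] := damp_near c d0; exists r0 => // r hr h.
have lz : lifts (x - y) (a - W).
  have := relP (UU := @approx_ultraP H) (-1) ly l; rewrite !scaleN1r ![- _ + _]addrC; exact.
have gz : A1 (a - W) by apply: (subalgB (gen_subalg _) ga gW).
have -> : a - phir hr x = (a - W) + (W - phir hr y) - phir hr (x - y).
  by rewrite phirB (addrA (a - W)) subrK opprB addrA subrK.
have -> : e = d + d + 2 * d by rewrite /d; field.
apply: (le_trans (nrmBD _ _)); apply: lerD.
  apply: (le_trans (nrmD _ _)); apply: lerD; first exact: ltW.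
  by rewrite (phir_wickop hr ly); exact: h0.
apply: (le_trans (nrm_phir hr lz gz)); apply: ler_wpM2l => //; exact: ltW.
Qed.

Local Notation MS := (model_set U (gw F) (vw F (@unrot R)) A).
Local Notation MP := (model_map U (gw F) (vw F (@unrot R)) A).

Lemma gen_sub1 : A `<=` A1.
Proof. by apply: gen_min; [exact: gen_subalg|move=> a Xa; apply: sub_gen; right]. Qed.

Lemma phir_near_all (bs : seq (bounded_op K)) (e : R) : (forall b, b \in bs -> MS b) -> 0 < e ->
  exists2 r0 : R, 0 < r0 < 1 & forall r (hr : 0 <= r <= 1), r0 <= r < 1 ->
  forall b, b \in bs -> nrm (MP b - phir hr b) <= e.
Proof.
move=> + e0; elim: bs => [|b bs IH] hb; first by exists 2^-1; rewrite ?invr_gt0 ?ltr0n ?invf_lt1 ?ltr1n.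
have hb' b' : b' \in bs -> MS b' by move=> h; apply: hb; rewrite inE h orbT.
have [r1 /andP[r10 r11] h1] := IH hb'.
have [gb lb] := model_mapP (hb b (mem_head _ _)).
have [r2 /andP[r20 r21] h2] := phir_near lb (gen_sub1 gb) e0.
exists (Num.max r1 r2) => [|r hr /andP[hm h]]; first by rewrite lt_max r10 gt_max r11 r21.
move: hm; rewrite ge_max => /andP[k1 k2] b'; rewrite inE => /orP[/eqP ->|bb].
  by apply: h2; rewrite k2.
by apply: h1; rewrite ?k1.
Qed.

Lemma gaussian_approximation (bs : seq (bounded_op K)) (e : R) : (forall b, b \in bs -> MS b) -> 0 < e ->
  exists psi, lift_cc A psi /\ forall b, b \in bs -> nrm (MP b - psi b) <= e.
Proof.
move=> hb e0; have hA := gen_subalg (range (gaussian F)).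
have [_ _ AM AS _] := hA.
(* A quasi-unit absorbs from the left only; the adjoints are listed because a is multiplied by u on
   both sides. *)
pose cs := [seq MP b | b <- bs] ++ [seq star (MP b) | b <- bs].
have hcs a : a \in cs -> A a.
  rewrite mem_cat => /orP[] /mapP[b /hb/model_mapP[gb _] ->] => //; exact: AS.
have e4 : 0 < e / 4 by rewrite divr_gt0.
have e2 : 0 < e / 2 by rewrite divr_gt0.
have [u [Au pu pu1 hu]] := quasi_unit hA e4 hcs.
have nu : nrm u <= 1 by apply: (psd_nrm_le ltr01 pu); rewrite scale1r; exact: pu1.
have [r0 /andP[r00 r01] hr0] := phir_near_all hb e2.
have hr : 0 <= r0 <= 1 by rewrite !ltW.
exists (fun x => u * phir hr x * u); split.
  split.
  - by move=> s x y; rewrite phirP mulrDr mulrDl opZr opZl.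
  - move=> x; have hm : multiplier A (phir hr x).
      have GA f : A (gaussian F f) by apply: sub_gen; exists f.
      have h01 : 0 < r0 < 1 by rewrite r00.
      exact: (rshift_multiplier hq hA GA h01 (rshift_phi F hq (unit_rot hr) x) (phi_rot F hq hr x)).
    apply: (AM _ _ _ Au); exact: (hm _ Au).1.
  by move=> n X; exact: compression_cc.
move=> b hbb; set a := MP b; set T := phir hr b.
(* Two defects of absorption and one of compression, of sizes e/4, e/4 and e/2. *)
have -> : a - u * T * u = (1 - u) * a + u * (a * (1 - u)) + u * (a - T) * u.
  by rewrite !(mulrBr, mulrBl, mul1r, mulr1, mulrA) [a - _ + _]addrA subrK addrA subrK.
have su : star (1 - u) = 1 - u by case: pu1.
have h1 : nrm ((1 - u) * a) <= e / 4.
  by apply: hu; rewrite mem_cat map_f.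
have h2 : nrm (a * (1 - u)) <= e / 4.
  by rewrite -nrm_star star_opM su; apply: hu; rewrite mem_cat; apply/orP; right; apply/mapP; exists b.
have h3 : nrm (a - T) <= e / 2 by apply: hr0; rewrite ?lexx.
have -> : e = e / 4 + e / 4 + e / 2 by field.
apply: (le_trans (nrmD _ _)); apply: lerD; last exact: nrm_sandwich.
apply: (le_trans (nrmD _ _)); apply: lerD => //.
apply: (le_trans (nrm_opM _ _)); apply: le_trans h2; rewrite -[leRHS]mul1r.
by apply: ler_wpM2r => //; exact: nrm_ge0.
Qed.

End qwep_of_gaussians.

Theorem corollary3p4 (R : realType) (H : realHilbertType R) (q : R) (hq : -1 < q < 1)
  (F : qFock H q) : QWEP (q_gaussian_cstar F).
Proof.
have hA := gen_subalg (range (gaussian F)).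
have tv := gw_total (F := F) hq.
have hv w w' := vw_moment F hq w w' (@unit_unrot R).
have hX := @gaussian_liftable _ _ _ F hq.
apply: (qwep_of_lifts (models_subalg hq (range (gaussian F))) hA (models_hom hq (range (gaussian F)))).
- by move=> x /model_mapP[].
- exact: models_dense.
- exact: (model_hereditary (UU := approx_ultraP H) tv hv hA).
- exact: gaussian_approximation.
by [].
Qed.
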